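(* Let $M=\mathbb{S}^1$, $\mathcal{A}=-\Delta=-\partial_{xx}$ and $2<p<\infty$. Suppose that $q\in L^\infty(\mathbb{S}^1\times\mathbb{S}^1)$ is nonnegative and satisfies $\inf_\Omega q>0$ for a subset $\Omega\subset\mathbb{S}^1\times\mathbb{S}^1$ containing a rectangle $[a_1,b_1]\times[a_2,b_2]$ (with $a_1<b_1$, $a_2<b_2$) such that $b_1+b_2-a_1-a_2>2\pi$. Then the equation $$-\partial_{xx}u+\partial_{tt}u=q(x,t)|u|^{p-2}u,\qquad (x,t)\in\mathbb{S}^1\times\mathbb{S}^1,$$ admits a ground state solution on $\mathbb{S}^1\times\mathbb{S}^1$. In particular, this holds if $\inf_\Omega q>0$ for $\Omega=\omega\times\mathbb{S}^1$ or $\Omega=\mathbb{S}^1\times\omega$, where $\omega\subset\mathbb{S}^1$ is an arbitrary nonempty open set.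
   Context: $\mathbb{S}^1=\mathbb{R}/2\pi\mathbb{Z}$; rectangles $[a_1,b_1]\times[a_2,b_2]$ are understood as subsets of $\mathbb{S}^1\times\mathbb{S}^1$ via the quotient map $\mathbb{R}^2\to\mathbb{S}^1\times\mathbb{S}^1$; $\inf_\Omega q$ is the essential infimum; all functions are real-valued and $d(x,t)$ is the product measure on $M\times\mathbb{S}^1$. Let $\nu_0\le\nu_1\le\dots\to+\infty$ be the eigenvalues of $\mathcal{A}$ on $L^2(M)$ (with multiplicity) and $(\zeta_k)_{k\in\mathbb{N}_0}$ an orthonormal basis of $L^2(M)$ with $\mathcal{A}\zeta_k=\nu_k\zeta_k$. Let $e_0=(2\pi)^{-1/2}$, $e_l(t)=\pi^{-1/2}\cos(lt)$, $e_{-l}(t)=\pi^{-1/2}\sin(lt)$ for $l\in\mathbb{N}$, so $(\zeta_k\otimes e_l)_{k\in\mathbb{N}_0,l\in\mathbb{Z}}$ is an orthonormal basis of $H:=L^2(M\times\mathbb{S}^1)$. The operator $L_{\mathcal{A}}=\mathcal{A}+\partial_{tt}$ is the selfadjoint operator in $H$ with $L_{\mathcal{A}}(\zeta_k\otimes e_l)=(\nu_k-l^2)\zeta_k\otimes e_l$. $P^+,P^-,P^0$ are the orthogonal projections in $H$ onto the closed spans of those $\zeta_k\otimes e_l$ with $\nu_k-l^2>0$, $<0$, $=0$ respectively, so $P^0H=\ker(L_{\mathcal{A}})$; $u^\pm=P^\pm u$, $u^0=P^0u$. For $u=\sum a_{kl}\zeta_k\otimes e_l$, $v=\sum b_{kl}\zeta_k\otimes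 e_l$ put $\langle u,v\rangle_\pm=\sum_{\pm(\nu_k-l^2)>0}|\nu_k-l^2|a_{kl}b_{kl}$, $\|u\|_\pm=\langle u,u\rangle_\pm^{1/2}$, $E^\pm=\{u\in P^\pm H:\|u\|_\pm<\infty\}$. Further $E^0=\{u\in\ker(L_{\mathcal{A}}):\int_{M\times\mathbb{S}^1}q|u|^p\,d(x,t)<\infty\}$ and $E=E^-\oplus E^0\oplus E^+$. A weak solution is a function $u\in E$ with $\langle u^+,v^+\rangle_+-\langle u^-,v^-\rangle_-=\int_{M\times\mathbb{S}^1}q|u|^{p-2}uv\,d(x,t)$ for every $v\in E$. The energy is $\Phi(u)=\frac12(\|u^+\|_+^2-\|u^-\|_-^2)-\frac1p\int_{M\times\mathbb{S}^1}q|u|^p\,d(x,t)$, $u\in E$. A ground state solution is a nonzero weak solution which minimizes $\Phi$ among all nonzero weak solutions. *)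

(* Defs.v *)
From HB Require Import structures.
From mathcomp Require Import all_boot all_order all_algebra.
From mathcomp Require Import all_classical all_reals all_analysis.
From mathcomp Require Import ess_sup_inf.

Set Implicit Arguments.
Unset Strict Implicit.
Unset Printing Implicit Defensive.

Import Order.TTheory GRing.Theory Num.Theory.
Import numFieldNormedType.Exports.

Local Open Scope classical_set_scope.
Local Open Scope ring_scope.

(* Functions on S^1 = R/2piZ (resp. S^1 x S^1) are 2pi-periodic functions on R
   (resp. functions on R * R that are 2pi-periodic in each variable), and
   subsets are 2pi-periodic subsets.  All measure-theoretic notions refer to
   Lebesgue measure restricted to the fundamental domain [0, 2pi[ (resp. its
   square).  Elements of L^p are represented by measurable functions, with
   equality almost everywhere. *)

Section Torus.
Context {R : realType}.

Definition circle_invariant {V : Type} (f : R -> V) : Prop :=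
  forall x, f (x + 2 * pi) = f x.

Definition torus_invariant {V : Type} (f : R * R -> V) : Prop :=
  forall x t, f (x + 2 * pi, t) = f (x, t) /\ f (x, t + 2 * pi) = f (x, t).

Definition fundamental_domain : set (measurableTypeR R) :=
  [set` `[0, 2 * pi[%R].

Lemma measurable_fundamental_domain : measurable fundamental_domain.
Proof. exact: measurable_itv. Qed.

Lemma fundamental_domain_lty :
  (lebesgue_measure fundamental_domain < +oo :> \bar R)%E.
Proof.
rewrite /fundamental_domain lebesgue_measure_itv/= -EFinD.
by case: ifP => _; rewrite ltry.
Qed.

Definition circle_measure :
    {finite_measure set (measurableTypeR R) -> \bar R} :=
  mfrestr measurable_fundamental_domain fundamental_domain_lty.

Definition torus_measure :
    {measure set (measurableTypeR R * measurableTypeR R) -> \bar R} :=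
  (circle_measure \x circle_measure)%E.

End Torus.

Section HilbertSpace.
Context {d : measure_display} {T : measurableType d} {R : realType}.
Variable mu : {measure set T -> \bar R}.

Definition inner (u v : T -> R) : R := \int[mu]_z (u z * v z).

(* Membership of u in the closure, in the L^2 norm, of the span of the f i with
   i in S.  Membership of u in L^2 itself is to be required separately. *)
Definition in_closed_span {I : choiceType} (S : set I) (f : I -> T -> R)
    (u : T -> R) : Prop :=
  forall eps : R, 0 < eps -> exists (A : set I) (c : I -> R), fsets S A /\
    ('N[mu]_2%:E[EFin \o (fun z => u z - \sum_(i \in A) c i * f i z)%R]
       < eps%:E)%E.

(* A representative of the orthogonal projection of u onto the closed subspace
   X; representatives agree almost everywhere. *)
Definition orth_proj (X : set (T -> R)) (u : T -> R) : T -> R :=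
  xget (cst 0) [set v | X v /\ forall w, X w -> inner (u \- v) w = 0].

End HilbertSpace.

(* Unconditional sum of a real family, meaningful when it is summable. *)
Definition usum {R : realType} {I : choiceType} (S : set I) (a : I -> R) : R :=
  fine (\esum_(i in S) (a^\+ i)%:E) - fine (\esum_(i in S) (a^\- i)%:E).

Section WaveEquation.
Context {R : realType}.

Local Notation mu1 := (@circle_measure R).
Local Notation mu2 := (@torus_measure R).

Definition L2_circle : set (R -> R) :=
  [set f | circle_invariant f /\ f \in Lfun mu1 2%:E].

Definition L2_torus : set (R * R -> R) :=
  [set u | torus_invariant u /\ u \in Lfun mu2 2%:E].

Definition orthonormal_basis_circle (zeta : nat -> R -> R) : Prop :=
  [/\ forall k, L2_circle (zeta k),
      forall j k, inner mu1 (zeta j) (zeta k) = (j == k)%:R &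
      forall f, L2_circle f -> in_closed_span mu1 setT zeta f].

(* f is an eigenfunction (or 0) of the operator -d^2/dx^2 on S^1; as these are
   smooth, the equation is required in the classical sense. *)
Definition laplace_eigen (nu : R) (f : R -> R) : Prop :=
  [/\ forall x, derivable f x 1,
      forall x, derivable (derive1 f) x 1 &
      forall x, - derive1 (derive1 f) x = nu * f x].

Definition laplace_eigenbasis (nu : nat -> R) (zeta : nat -> R -> R) : Prop :=
  [/\ {homo nu : j k / (j <= k)%N >-> j <= k},
      nu @ \oo --> +oo,
      orthonormal_basis_circle zeta &
      forall k, laplace_eigen (nu k) (zeta k)].

Definition trig_basis (l : int) (t : R) : R :=
  if l == 0 then (Num.sqrt (2 * pi))^-1
  else if 0 < l then (Num.sqrt pi)^-1 * cos (l%:~R * t)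
  else (Num.sqrt pi)^-1 * sin ((- l)%:~R * t).

Section Spectral.
Variables (nu : nat -> R) (zeta : nat -> R -> R).

Definition mode (i : nat * int) (z : R * R) : R :=
  zeta i.1 z.1 * trig_basis i.2 z.2.

Definition lam (i : nat * int) : R := nu i.1 - i.2%:~R ^+ 2.

Definition coef (u : R * R -> R) (i : nat * int) : R := inner mu2 u (mode i).

(* The graph of L_A = A + d^2/dt^2, the selfadjoint operator which is diagonal
   in the basis of modes with eigenvalues lam. *)
Definition LA_graph (u w : R * R -> R) : Prop :=
  [/\ L2_torus u, L2_torus w & forall i, coef w i = lam i * coef u i].

Definition ker_LA : set (R * R -> R) := [set u | LA_graph u (cst 0)].

Definition Ipos : set (nat * int) := [set i | 0 < lam i].
Definition Ineg : set (nat * int) := [set i | lam i < 0].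

(* P^+ H and P^- H are spectral_space Ipos and spectral_space Ineg; likewise for
   the projections, the forms and E^+, E^- below. *)
Definition spectral_space (S : set (nat * int)) : set (R * R -> R) :=
  [set u | L2_torus u /\ in_closed_span mu2 S mode u].

Definition spectral_proj (S : set (nat * int)) (u : R * R -> R) : R * R -> R :=
  orth_proj mu2 (spectral_space S) u.

Definition spectral_form (S : set (nat * int)) (u v : R * R -> R) : R :=
  usum S (fun i => `|lam i| * coef u i * coef v i).

Definition spectral_norm (S : set (nat * int)) (u : R * R -> R) : R :=
  Num.sqrt (spectral_form S u u).

Definition E_spectral (S : set (nat * int)) : set (R * R -> R) :=
  [set u | spectral_space S u /\
           summable S (fun i => (`|lam i| * coef u i * coef u i)%:E)].

Variables (p : R) (q : R * R -> R).

Definition E_zero : set (R * R -> R) :=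
  [set u | ker_LA u /\ (\int[mu2]_z (q z * `|u z| `^ p)%:E < +oo)%E].

Definition E_space : set (R * R -> R) :=
  [set u | exists um u0 up, [/\ E_spectral Ineg um, E_zero u0,
             E_spectral Ipos up & u = um \+ u0 \+ up]].

Definition weak_solution (u : R * R -> R) : Prop :=
  E_space u /\ forall v, E_space v ->
    spectral_form Ipos (spectral_proj Ipos u) (spectral_proj Ipos v)
      - spectral_form Ineg (spectral_proj Ineg u) (spectral_proj Ineg v)
    = \int[mu2]_z (q z * `|u z| `^ (p - 2) * u z * v z).

Definition energy (u : R * R -> R) : R :=
  2^-1 * (spectral_norm Ipos (spectral_proj Ipos u) ^+ 2
          - spectral_norm Ineg (spectral_proj Ineg u) ^+ 2)
  - p^-1 * \int[mu2]_z (q z * `|u z| `^ p).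

Definition nonzero_weak_solution (u : R * R -> R) : Prop :=
  weak_solution u /\ ~ {ae mu2, forall z, u z = 0}.

Definition ground_state (u : R * R -> R) : Prop :=
  nonzero_weak_solution u /\
  forall w, nonzero_weak_solution w -> energy u <= energy w.

End Spectral.

(* The essential infimum of q over Omega, for a 2pi-periodic set Omega: since q
   is replaced by +oo off Omega, points outside Omega impose no constraint. *)
Definition ess_inf_on (Omega : set (R * R)) (q : R * R -> R) : \bar R :=
  ess_inf mu2 (patch (cst +oo%E) Omega (EFin \o q)).

End WaveEquation.

(* Main.v *)
Require Import Defs.
From HB Require Import structures.
From mathcomp Require Import all_boot all_order all_algebra.
From mathcomp Require Import finmap.
From mathcomp Require Import all_classical all_reals all_analysis.
From mathcomp Require Import measurable_realfun ess_sup_inf.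
From mathcomp Require Import zify ring lra.

Set Implicit Arguments.
Unset Strict Implicit.
Unset Printing Implicit Defensive.

Import Order.TTheory GRing.Theory Num.Theory.
Import numFieldNormedType.Exports.

Local Open Scope classical_set_scope.
Local Open Scope ring_scope.

(* Dual variational method.  With r = p / (p - 1) and w = (q^(1/p) |u|)^(p-2) q^(1/p) u, solving the
   equation amounts to finding a critical point of |w|_r^r / r - <K w, w> / 2 on the closed space X
   of those w in L^r for which q^(1/p) w annihilates the kernel of the wave operator; here K is
   q^(1/p) L^-1 q^(1/p).  The form <K w, w> is compact on L^r, because the number of modes whose
   eigenvalue has modulus at most 2^n grows only slightly faster than 2^n.  As r < 2, uniform
   convexity makes it attain its supremum on the unit ball of X, and the supremum is positive,
   as a test function supported in the rectangle shows.  A rescaled maximizer w satisfies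
   |w|^(r-2) w = K w + (annihilator of X), and the annihilator of X is q^(1/p) times the kernel as
   soon as q controls the kernel: the integral of |phi|^p is at most C times that of q |phi|^p.
   This control is where the rectangle enters.  Kernel elements are sums of two waves travelling
   along the characteristic directions (1,1) and (1,-1), and since the half-sides of the rectangle
   add up to more than pi, every characteristic line meets it (and a shifted copy of it) in a set of
   positive length; hence the shift differences of phi are controlled by q, and so is phi.
   Finally the energy of a weak solution is (1/2 - 1/p) |w|_r^r, which the maximizer minimizes
   among the duals of all nonzero weak solutions. *)

(** * Real powers and L^r spaces *)

(** The eigenvalues of the wave operator are unbounded in both directions and 0 has infinite
    multiplicity, so the energy is strongly indefinite and gives no compactness on the kernel
    component; the dual problem inverts the operator off the kernel and turns the kernel into a
    closed linear constraint. The eigenvalues are m^2 - l^2 = (m - l)(m + l) with integers m and l: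
    a nonzero one has modulus at least 1, and the reciprocals of those below 2^j sum to O(j^2), by
    comparison with the square of a harmonic sum. This bounds a dyadic block of modes in the sup
    norm by a multiple of j, and interpolation with L^2 gives geometric decay in L^p for every p >
    2. Weak compactness and the Hahn-Banach theorem are replaced by ultrafilter limits of
    coefficients and by closest points in a uniformly convex space. The basis in [x] is an arbitrary
    eigenbasis, so its elements are first identified as trigonometric combinations by solving the
    differential equation. Limits are constructed pointwise, because periodicity is required
    everywhere and not merely almost everywhere. *)

Section RealPowers.
Context {R : realType}.
Implicit Types a b x y r s : R.

Lemma powRD_neq0 a r s : a != 0 -> a `^ (r + s) = a `^ r * a `^ s.
Proof. by move=> a0; apply: powRD; rewrite a0 implybT. Qed.

Lemma powR_normD r a b : 0 <= r ->
  `|a + b| `^ r <= 2 `^ r * (`|a| `^ r + `|b| `^ r).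
Proof.
move=> r0; wlog ab : a b / `|a| <= `|b|.
  move=> h; have [|/ltW] := leP `|a| `|b|; first exact: h.
  by rewrite addrC [X in _ * X]addrC; exact: h.
apply: (@le_trans _ _ ((2 * `|b|) `^ r)).
  apply: ge0_ler_powR; rewrite ?nnegrE ?mulr_ge0 //.
  by rewrite (le_trans (ler_normD _ _)) //; lra.
by rewrite powRM // ler_wpM2l ?powR_ge0 // lerDr powR_ge0.
Qed.

(** Bounding both factors by the larger of [|a|] and [|b|] stands in for Young's inequality; the
    lost constants are harmless, since the bound only serves to dominate integrands. *)
Lemma powR_young r a b : 1 <= r ->
  `|a| `^ (r - 1) * `|b| <= `|a| `^ r + `|b| `^ r.
Proof.
move=> r1; have r0 : 0 < r by rewrite (lt_le_trans ltr01).
have r10 : 0 <= r - 1 by rewrite subr_ge0.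
have [ab|/ltW ab] := leP `|a| `|b|.
  apply: (@le_trans _ _ (`|b| `^ (r - 1) * `|b|)).
    by rewrite ler_wpM2r //; exact: ge0_ler_powR.
  by rewrite mulrC mulr_powRB1 // lerDr powR_ge0.
apply: (@le_trans _ _ (`|a| `^ (r - 1) * `|a|)); first by rewrite ler_wpM2l ?powR_ge0.
by rewrite mulrC mulr_powRB1 // lerDl powR_ge0.
Qed.

(* The duality map of L^r. *)
Definition jmap r x := `|x| `^ (r - 2) * x.

Lemma jmap0 r : jmap r 0 = 0. Proof. by rewrite /jmap mulr0. Qed.

Lemma norm_jmap r x : 1 < r -> `|jmap r x| = `|x| `^ (r - 1).
Proof.
move=> r1; rewrite /jmap normrM (ger0_norm (powR_ge0 _ _)).
have [->|x0] := eqVneq x 0; first by rewrite normr0 mulr0 powR0 // subr_eq0 gt_eqF.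
have x0' : `|x| != 0 by rewrite normr_eq0.
by rewrite -[X in _ * X]powRr1 // -powRD_neq0 //; congr (_ `^ _); ring.
Qed.

Lemma jmapM r x : 1 < r -> jmap r x * x = `|x| `^ r.
Proof.
move=> r1; rewrite /jmap -mulrA -expr2 -real_normK ?num_real //.
have [->|x0] := eqVneq x 0.
  by rewrite normr0 expr0n /= mulr0 powR0 // gt_eqF // (lt_trans ltr01).
have x0' : `|x| != 0 by rewrite normr_eq0.
by rewrite -powR_mulrn // -powRD_neq0 //; congr (_ `^ _); ring.
Qed.

Lemma jmapZ r c x : 0 < c -> 1 < r -> jmap r (c * x) = c `^ (r - 1) * jmap r x.
Proof.
move=> c0 r1; rewrite /jmap normrM (gtr0_norm c0) powRM ?(ltW c0) //.
have -> : c `^ (r - 1) = c `^ (r - 2) * c.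
  by rewrite -[X in _ = _ * X](powRr1 (ltW c0)) -powRD_neq0 ?gt_eqF //; congr (_ `^ _); ring.
ring.
Qed.

(** Composing gives the exponent [(r - 1) * (p - 2) + (r - 2)], which equals [p * r - (p + r)] and
    vanishes for conjugate exponents. This inverse recovers a solution from its dual variable. *)
Lemma jmapK p r x : 1 < p -> 1 < r -> p^-1 + r^-1 = 1 -> jmap p (jmap r x) = x.
Proof.
move=> p1 r1 pr.
have [->|x0] := eqVneq x 0; first by rewrite !jmap0.
have x0' : `|x| != 0 by rewrite normr_eq0.
rewrite {1}/jmap norm_jmap // /jmap mulrA -powRrM -powRD_neq0 //.
suff -> : (r - 1) * (p - 2) + (r - 2) = 0 by rewrite powRr0 mul1r.
have p0 : p != 0 by rewrite gt_eqF // (lt_trans ltr01).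
have r0 : r != 0 by rewrite gt_eqF // (lt_trans ltr01).
have : p + r = p * r.
  have -> : p + r = p * r * (p^-1 + r^-1) by field; rewrite p0 r0.
  by rewrite pr mulr1.
move=> h; have -> : (r - 1) * (p - 2) + (r - 2) = p * r - (p + r) by ring.
by rewrite h subrr.
Qed.

Lemma measurable_normpowR d (T : measurableType d) r (f : T -> R) :
  measurable_fun setT f -> measurable_fun setT (fun z => `|f z| `^ r).
Proof.
move=> mf; apply: (measurableT_comp (measurable_powR _)).
exact: measurableT_comp.
Qed.

Lemma measurable_jmap d (T : measurableType d) r (f : T -> R) :
  measurable_fun setT f -> measurable_fun setT (fun z => jmap r (f z)).
Proof. by move=> mf; apply: measurable_funM => //; exact: measurable_normpowR. Qed.

(** The tangent line inequality of the convex function [|x|^r], read off from Young's inequality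
    with exponents [r] and [r / (r - 1)]. The first-order conditions below rest on it instead of on
    derivatives of the norm. *)
Lemma jmap_convex r x y : 1 < r ->
  `|x| `^ r + r * (jmap r x * (y - x)) <= `|y| `^ r.
Proof.
move=> r1; rewrite mulrBr jmapM //.
have r0 : 0 < r by rewrite (lt_trans ltr01).
have rn0 : r != 0 by rewrite gt_eqF.
have r10 : 0 < r - 1 by rewrite subr_gt0.
set s := r / (r - 1).
have s0 : 0 < s by rewrite divr_gt0.
have h1 : jmap r x * y <= `|x| `^ (r - 1) * `|y|.
  by rewrite -norm_jmap // -normrM ler_norm.
have := @conjugate_powR R `|y| (`|x| `^ (r - 1)) r s.
rewrite normr_ge0 powR_ge0 r0 s0 => /(_ erefl erefl erefl erefl).
have -> : r^-1 + s^-1 = 1 by rewrite /s; field; rewrite gt_eqF.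
move=> /(_ erefl); rewrite -powRrM.
have -> : (r - 1) * s = r by rewrite /s; field; rewrite gt_eqF.
move=> h2.
have h3 : jmap r x * y <= `|y| `^ r / r + `|x| `^ r / s.
  by rewrite (le_trans h1) // mulrC.
have {}h3 : r * (jmap r x * y) <= r * (`|y| `^ r / r + `|x| `^ r / s) by rewrite ler_wpM2l // ltW.
have e : r * (`|y| `^ r / r + `|x| `^ r / s) = `|y| `^ r + (r - 1) * `|x| `^ r.
  by rewrite /s; field; rewrite rn0 gt_eqF.
rewrite e in h3; rewrite mulrBr; lra.
Qed.

Lemma continuous_normpowR r : 0 < r -> continuous (fun x => `|x| `^ r).
Proof.
move=> r0 x; have [->|x0] := eqVneq x 0; last first.
  apply: (@continuous_comp _ _ _ (@Num.norm R R) (fun a => a `^ r)).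
    exact: norm_continuous.
  apply: differentiable_continuous; apply/derivable1_diffP.
  by apply: derivable_powR; rewrite in_itv/= andbT normr_gt0.
apply/cvgrPdist_le => e e0.
rewrite normr0 powR0 ?gt_eqF //.
have e' : 0 < e `^ r^-1 by rewrite powR_gt0.
apply: filterS (@nbhs0_le R R _ e') => t te.
rewrite sub0r normrN ger0_norm ?powR_ge0 //.
have -> : e = (e `^ r^-1) `^ r by rewrite -powRrM mulVf ?gt_eqF // powRr1 // ltW.
by apply: ge0_ler_powR; [exact: ltW|by rewrite nnegrE|by rewrite nnegrE powR_ge0|].
Qed.

Lemma continuous_jmap r : 1 < r -> continuous (jmap r).
Proof.
move=> r1 x; have [->|x0] := eqVneq x 0; last first.
  rewrite /jmap; apply: cvgM; last exact: cvg_id.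
  apply: (@continuous_comp _ _ _ (@Num.norm R R) (fun a => a `^ (r - 2))).
    exact: norm_continuous.
  apply: differentiable_continuous; apply/derivable1_diffP.
  by apply: derivable_powR; rewrite in_itv/= andbT normr_gt0.
rewrite /continuous_at jmap0; apply/norm_cvg0P.
have -> : (fun z => `|jmap r z|) = (fun z => `|z| `^ (r - 1)).
  by apply/funext => z; rewrite norm_jmap.
have := @continuous_normpowR (r - 1) _ 0; rewrite subr_gt0 => /(_ r1).
by rewrite /continuous_at normr0 powR0 // gt_eqF // subr_gt0.
Qed.

(** Adding the tangent line inequalities at the midpoint, evaluated at [c] and at 1, cancels the
    linear terms; it is enough that the one at 1 is strict. *)
Lemma powR_strict r c : 1 < r -> -1 <= c -> c < 1 ->
  2 * `|(1 + c) / 2| `^ r < 1 + `|c| `^ r.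
Proof.
move=> r1 c1 c2; have r0 : 0 < r by rewrite (lt_trans ltr01).
set x := (1 + c) / 2.
have x0 : 0 <= x by rewrite /x; lra.
have x1 : x < 1 by rewrite /x; lra.
have hc := @jmap_convex r x c r1.
suff h : `|x| `^ r + r * (jmap r x * (1 - x)) < 1.
  have e : c - x = - (1 - x) by rewrite /x; lra.
  by rewrite e mulrN mulrN in hc; lra.
have [x00|x0n] := eqVneq x 0.
  by rewrite x00 jmap0 mul0r mulr0 normr0 powR0 ?gt_eqF // addr0.
have {}x0 : 0 < x by rewrite lt0r x0n x0.
rewrite /jmap (gtr0_norm x0).
(* Bernoulli for [y = 1 / sqrt x], squared, is strict. *)
set y := Num.sqrt x^-1.
have y1 : 1 < y by rewrite -sqrtr1 ltr_sqrt ?invr_gt0 // invf_gt1.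
have y2 : y ^+ 2 = x^-1 by rewrite sqr_sqrtr // invr_ge0 ltW.
have hb := @jmap_convex r 1 y r1.
rewrite /jmap normr1 !powR1 !mul1r (gtr0_norm (lt_trans ltr01 y1)) in hb.
have yr : (y `^ r) ^+ 2 = (x `^ r)^-1.
  rewrite -powR_mulrn ?powR_ge0 // -powRrM mulrC powRrM powR_mulrn ?sqrtr_ge0 // y2.
  by rewrite -(powR_inv1 (ltW x0)) -powRrM mulN1r powRN.
have h1 : 1 + r * (x^-1 - 1) < (x `^ r)^-1.
  rewrite -yr -y2.
  have : (1 + r * (y - 1)) ^+ 2 <= (y `^ r) ^+ 2.
    rewrite ler_sqr // nnegrE ?powR_ge0 //.
    by rewrite addr_ge0 // mulr_ge0 ?ltW // subr_gt0.
  apply: lt_le_trans; rewrite -[ltLHS]addr0 -subr_gt0 addr0.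
  have -> : (1 + r * (y - 1)) ^+ 2 - (1 + r * (y ^+ 2 - 1)) = r * (r - 1) * (y - 1) ^+ 2 by ring.
  by rewrite !mulr_gt0 // ?exprn_gt0 // subr_gt0.
have xr : 0 < x `^ r by rewrite powR_gt0.
have : x `^ r * (1 + r * (x^-1 - 1)) < 1.
  by rewrite -ltr_pdivlMl // mulr1.
apply: le_lt_trans; rewrite [leRHS]mulrDr mulr1 lerD2l.
have -> : x `^ r = x `^ (r - 2) * x * x.
  rewrite -mulrA -expr2 -powR_mulrn ?ltW // -powRD_neq0 //.
  by congr (_ `^ _); ring.
rewrite le_eqVlt; apply/orP; left; apply/eqP; field; exact: x0n.
Qed.

(** By homogeneity it suffices to take [a = 1] and [b = c] with [|c| <= 1]. On [[-1, 1 - eta]] the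
    convexity defect [g] has a positive minimum by compactness and absorbs the left side, which is
    at most [2^r]; for [c] near 1 the left side is itself at most [e]. *)
Lemma powR_unif_convex r e : 1 < r -> 0 < e -> exists2 C, 0 < C & forall a b,
  `|a - b| `^ r <= e * (`|a| `^ r + `|b| `^ r)
    + C * (`|a| `^ r + `|b| `^ r - 2 * `|(a + b) / 2| `^ r).
Proof.
move=> r1 e0; have r0 : 0 < r by rewrite (lt_trans ltr01).
pose g (c : R) : R := 1 + `|c| `^ r - 2 * `|(1 + c) / 2| `^ r.
(* [1 - c < eta] forces [|1 - c|^r <= e]; the bound by 1 keeps the compact interval nonempty. *)
pose eta := Num.min 1 (e `^ r^-1).
have eta0 : 0 < eta by rewrite /eta lt_min ltr01 powR_gt0.
have cg : continuous g.
  move=> c; rewrite /g; apply: cvgB; first apply: cvgD; first exact: cvg_cst.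
    exact: continuous_normpowR.
  apply: cvgM; first exact: cvg_cst.
  have cm : (fun c : R => (1 + c) / 2) @ c --> (1 + c) / 2.
    by apply: cvgM; [apply: cvgD; [exact: cvg_cst|exact: cvg_id]|exact: cvg_cst].
  exact: (continuous_comp cm (@continuous_normpowR r r0 _)).
have eta1 : eta <= 1 by rewrite /eta ge_min lexx.
have [] := @EVT_min R g (-1) (1 - eta).
- by lra.
- exact: continuous_subspaceT.
move=> c0; rewrite in_itv/= => /andP[c01 c02] gmin.
have gc0 : 0 < g c0 by rewrite /g subr_gt0; apply: powR_strict => //; lra.
have C0 : 0 < 2 `^ r / g c0 by rewrite divr_gt0 // powR_gt0.
have g0 (c : R) : -1 <= c -> c <= 1 -> 0 <= g c.
  move=> h1; rewrite le_eqVlt => /orP[/eqP->|h2].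
    have -> : g 1 = 0; last by [].
    rewrite /g; have -> : (1 + 1) / 2 = 1 :> R by lra.
    by rewrite normr1 powR1; lra.
  by rewrite /g subr_ge0 ltW // powR_strict.
exists (2 `^ r / g c0) => // a b.
wlog ab : a b / `|b| <= `|a|.
  move=> h; have [|/ltW] := leP `|b| `|a|; first exact: h.
  move=> /h; rewrite distrC (addrC b) (addrC (`|b| `^ r)); exact.
have [a0|a0] := eqVneq a 0.
  have b0 : b = 0 by apply/eqP; rewrite -normr_le0 (le_trans ab) // a0 normr0.
  by rewrite a0 b0 subrr addr0 mul0r normr0 powR0 ?gt_eqF // !(addr0,mulr0,subr0).
have [c b_] : exists c, b = a * c by exists (b / a); rewrite mulrC divfK.
have c1 : `|c| <= 1 by rewrite b_ normrM ger_pMr ?normr_gt0 // in ab.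
move: c1; rewrite ler_norml => /andP[c1 c2].
have -> : a - b = a * (1 - c) by rewrite b_; ring.
have -> : (a + b) / 2 = a * ((1 + c) / 2) by rewrite b_; ring.
have gE : g c = 1 + `|c| `^ r - 2 * `|(1 + c) / 2| `^ r by [].
move: gE; move: ((1 + c) / 2) => m gE.
rewrite b_ !normrM !powRM //.
rewrite [leRHS](_ : _ = `|a| `^ r * (e * (1 + `|c| `^ r) + 2 `^ r / g c0 * g c)); last first.
  by rewrite gE; ring.
rewrite ler_wpM2l ?powR_ge0 //.
have [h|h] := leP c (1 - eta).
  apply: (@le_trans _ _ (2 `^ r)).
    apply: ge0_ler_powR; rewrite ?nnegrE ?(ltW r0) //.
    by rewrite ger0_norm; lra.
  apply: (@le_trans _ _ (2 `^ r / g c0 * g c)).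
    rewrite -mulrA ler_peMr ?powR_ge0 // mulrC ler_pdivlMr // mul1r gmin //.
    by rewrite in_itv/= c1.
  by rewrite lerDr mulr_ge0 ?ltW // addr_gt0 // lt_neqAle ?powR_ge0 //.
apply: (@le_trans _ _ e).
  have -> : e = (e `^ r^-1) `^ r by rewrite -powRrM mulVf ?gt_eqF // powRr1 // ltW.
  apply: ge0_ler_powR; rewrite ?nnegrE ?powR_ge0 ?(ltW r0) //.
  have : eta <= e `^ r^-1 by rewrite /eta ge_min lexx orbT.
  by move=> ?; rewrite ger0_norm; lra.
apply: (@le_trans _ _ (e * (1 + `|c| `^ r))).
  by rewrite ler_peMr ?(ltW e0) // lerDl powR_ge0.
by rewrite lerDl mulr_ge0 ?(ltW C0) // g0.
Qed.

End RealPowers.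

(** * Integrals of real-valued functions *)

Section Integration.
Context {d} {T : measurableType d} {R : realType}.
Variable mu : {measure set T -> \bar R}.
Implicit Types f g h : T -> R.

Definition intg f : Prop := mu.-integrable setT (EFin \o f).

Lemma intg_measurable f : intg f -> measurable_fun setT f.
Proof. by move=> /measurable_int /measurable_EFinP. Qed.

Lemma intgP f : measurable_fun setT f -> (forall x, 0 <= f x) ->
  intg f <-> (\int[mu]_x (f x)%:E < +oo)%E.
Proof.
move=> mf f0.
have e : (\int[mu]_x `|(f x)%:E|)%E = (\int[mu]_x (f x)%:E)%E.
  by apply: eq_integral => x _; rewrite gee0_abs // lee_fin.
split; first by move=> /integrableP[_]; rewrite e.
by move=> h; apply/integrableP; split; [exact/measurable_EFinP|rewrite e].
Qed.

Lemma intg_EFin f : intg f -> (\int[mu]_x (f x)%:E)%E = (\int[mu]_x f x)%:E.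
Proof. by move=> h; rewrite /Rintegral fineK //; exact: integrable_fin_num. Qed.

Lemma intg_le f g : measurable_fun setT f -> (forall x, `|f x| <= g x) ->
  intg g -> intg f.
Proof.
move=> mf fg; apply: le_integrable => //; first exact/measurable_EFinP.
by move=> x _; rewrite !abse_EFin lee_fin (le_trans (fg x)) // ler_norm.
Qed.

Lemma intgD f g : intg f -> intg g -> intg (fun x => f x + g x).
Proof. by move=> hf hg; apply: eq_integrable (integrableD measurableT hf hg). Qed.

Lemma intgZ c f : intg f -> intg (fun x => c * f x).
Proof. by move=> hf; apply: eq_integrable (integrableZl measurableT c hf). Qed.

Lemma intgN f : intg f -> intg (fun x => - f x).
Proof. by move=> /(intgZ (-1)); under eq_fun do rewrite mulN1r. Qed.

Lemma intgB f g : intg f -> intg g -> intg (fun x => f x - g x).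
Proof. by move=> hf hg; apply: intgD => //; exact: intgN. Qed.

Lemma intg0 : intg (fun=> 0).
Proof. exact: integrable0. Qed.

Lemma intg_sum I (s : seq I) (F : I -> T -> R) :
  (forall i, intg (F i)) -> intg (fun x => \sum_(i <- s) F i x).
Proof.
move=> h; elim: s => [|i s ih].
  by under eq_fun do rewrite big_nil; exact: intg0.
by under eq_fun do rewrite big_cons; exact: intgD.
Qed.

Lemma int_D f g : intg f -> intg g ->
  \int[mu]_x (f x + g x) = \int[mu]_x f x + \int[mu]_x g x.
Proof. by move=> hf hg; rewrite RintegralD. Qed.

Lemma int_B f g : intg f -> intg g ->
  \int[mu]_x (f x - g x) = \int[mu]_x f x - \int[mu]_x g x.
Proof. by move=> hf hg; rewrite RintegralB. Qed.

Lemma int_Z c f : intg f -> \int[mu]_x (c * f x) = c * \int[mu]_x f x.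
Proof. by move=> hf; rewrite RintegralZl. Qed.

Lemma int_N f : intg f -> \int[mu]_x (- f x) = - \int[mu]_x f x.
Proof.
move=> hf; have := int_Z (-1) hf; rewrite mulN1r => <-.
by apply: eq_Rintegral => x _; rewrite mulN1r.
Qed.

Lemma int_0 : \int[mu]_x 0 = 0 :> R.
Proof. by rewrite /Rintegral integral0. Qed.

Lemma int_sum I (s : seq I) (F : I -> T -> R) : (forall i, intg (F i)) ->
  \int[mu]_x (\sum_(i <- s) F i x) = \sum_(i <- s) \int[mu]_x F i x.
Proof.
move=> h; elim: s => [|i s ih].
  by rewrite big_nil -[RHS]int_0; apply: eq_Rintegral => x _; rewrite big_nil.
rewrite big_cons -ih -int_D //; last exact: intg_sum.
by apply: eq_Rintegral => x _; rewrite big_cons.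
Qed.

Lemma int_ge0 f : (forall x, 0 <= f x) -> 0 <= \int[mu]_x f x.
Proof. by move=> h; apply: Rintegral_ge0. Qed.

Lemma int_le f g : intg f -> intg g -> (forall x, f x <= g x) ->
  \int[mu]_x f x <= \int[mu]_x g x.
Proof. by move=> hf hg h; apply: le_Rintegral. Qed.

Lemma int_abs f : intg f -> `|\int[mu]_x f x| <= \int[mu]_x `|f x|.
Proof. exact: le_normr_Rintegral. Qed.

Lemma intg_abs f : intg f -> intg (fun x => `|f x|).
Proof. exact: integrable_norm. Qed.

Lemma int_ae_eq f g : measurable_fun setT f -> measurable_fun setT g ->
  {ae mu, forall x, f x = g x} -> \int[mu]_x f x = \int[mu]_x g x.
Proof.
move=> mf mg fg; rewrite /Rintegral; congr fine.
apply: ae_eq_integral => //; [exact/measurable_EFinP|exact/measurable_EFinP|].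
by apply: filterS fg => x -> _.
Qed.

Lemma intg_ae_eq f g : measurable_fun setT f -> measurable_fun setT g ->
  {ae mu, forall x, f x = g x} -> intg f -> intg g.
Proof.
move=> mf mg fg /integrableP[_ h]; apply/integrableP; split; first exact/measurable_EFinP.
apply: le_lt_trans h; rewrite le_eqVlt; apply/orP; left; apply/eqP; symmetry.
apply: ae_eq_integral => //.
- by apply: measurableT_comp => //; exact/measurable_EFinP.
- by apply: measurableT_comp => //; exact/measurable_EFinP.
by apply: filterS fg => x /= -> _.
Qed.

Lemma int_eq0_ae f : intg f -> (forall x, 0 <= f x) -> \int[mu]_x f x = 0 ->
  {ae mu, forall x, f x = 0}.
Proof.
move=> hf f0 h.
have := (@ae_eq_integral_abs _ _ _ mu setT measurableT (EFin \o f)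
  (measurable_int _ hf)).1.
have -> : (\int[mu]_x `|(EFin \o f) x|)%E = 0%E.
  rewrite -[RHS]/(0%:E) -h -intg_EFin //.
  by apply: eq_integral => x _; rewrite gee0_abs // lee_fin.
by move=> /(_ erefl); apply: filterS => x /(_ I) [].
Qed.

End Integration.

(** * L^r spaces: uniform convexity, first-order conditions, completeness *)

Section LrSpaces.
Context {d} {T : measurableType d} {R : realType}.
Variable mu : {measure set T -> \bar R}.
Implicit Types f g h : T -> R.
Local Notation intg := (intg mu).

Definition Lr r f := measurable_fun setT f /\ intg (fun x => `|f x| `^ r).

(* Locked: unification would otherwise unfold the integrals. *)
Fact nr_key : unit. Proof. exact: tt. Qed.
Definition nr : R -> (T -> R) -> R :=
  locked_with nr_key (fun r f => (\int[mu]_x `|f x| `^ r) `^ r^-1).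

Lemma nrE r f : nr r f = (\int[mu]_x `|f x| `^ r) `^ r^-1.
Proof. by rewrite [nr]unlock. Qed.

Lemma nr_ge0 r f : 0 <= nr r f. Proof. by rewrite nrE powR_ge0. Qed.

Lemma int_pow_ge0 r f : 0 <= \int[mu]_x `|f x| `^ r.
Proof. by apply: int_ge0 => x; exact: powR_ge0. Qed.

Lemma nrK r f : 0 < r -> nr r f `^ r = \int[mu]_x `|f x| `^ r.
Proof. by move=> r0; rewrite nrE -powRrM mulVf ?gt_eqF // powRr1 // int_pow_ge0. Qed.

Lemma Lr_le r f g : 0 <= r -> measurable_fun setT f -> (forall x, `|f x| <= `|g x|) ->
  Lr r g -> Lr r f.
Proof.
move=> r0 mf fg [mg ig]; split => //; apply: intg_le ig; first exact: measurable_normpowR.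
by move=> x; rewrite ger0_norm ?powR_ge0 //; exact: ge0_ler_powR.
Qed.

Lemma LrD r f g : 0 <= r -> Lr r f -> Lr r g -> Lr r (fun x => f x + g x).
Proof.
move=> r0 [mf hf] [mg hg]; split; first exact: measurable_funD.
apply: intg_le (intgZ (2 `^ r) (intgD hf hg)).
  by apply: measurable_normpowR; exact: measurable_funD.
by move=> x; rewrite ger0_norm ?powR_ge0 //; exact: powR_normD.
Qed.

Lemma LrZ r c f : Lr r f -> Lr r (fun x => c * f x).
Proof.
move=> [mf hf]; split; first exact: measurable_funM.
have -> : (fun x => `|c * f x| `^ r) = (fun x => `|c| `^ r * `|f x| `^ r).
  by apply/funext => x; rewrite normrM powRM.
exact: intgZ.
Qed.

Lemma LrN r f : Lr r f -> Lr r (fun x => - f x).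
Proof. by move=> /(LrZ (-1)); under eq_fun do rewrite mulN1r. Qed.

Lemma LrB r f g : 0 <= r -> Lr r f -> Lr r g -> Lr r (fun x => f x - g x).
Proof. by move=> r0 hf hg; apply: LrD => //; exact: LrN. Qed.

Lemma Lr0 r : 0 < r -> Lr r (fun=> 0).
Proof.
move=> r0; split; first exact: measurable_cst.
have -> : (fun x : T => `|0 : R| `^ r) = (fun=> 0); last exact: intg0.
by apply/funext => x; rewrite normr0 powR0 // gt_eqF.
Qed.

Lemma Lr_sum r I (s : seq I) (F : I -> T -> R) : 0 < r ->
  (forall i, Lr r (F i)) -> Lr r (fun x => \sum_(i <- s) F i x).
Proof.
move=> r0 h; elim: s => [|i s ih].
  by under eq_fun do rewrite big_nil; exact: Lr0.
by under eq_fun do rewrite big_cons; apply: LrD => //; exact: ltW.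
Qed.

Lemma Lr_ae_eq r f g : measurable_fun setT g -> {ae mu, forall x, f x = g x} ->
  Lr r f -> Lr r g.
Proof.
move=> mg fg [mf hf]; split => //; apply: intg_ae_eq hf; try exact: measurable_normpowR.
by apply: filterS fg => x ->.
Qed.

Lemma Lr_jmap p r f : 1 < p -> 1 < r -> p^-1 + r^-1 = 1 -> Lr p f ->
  Lr r (fun x => jmap p (f x)).
Proof.
move=> p1 r1 pr [mf hf]; split; first exact: measurable_jmap.
have p0 : p != 0 by rewrite gt_eqF // (lt_trans ltr01).
have r0 : r != 0 by rewrite gt_eqF // (lt_trans ltr01).
have -> : (fun x => `|jmap p (f x)| `^ r) = (fun x => `|f x| `^ p) => //.
apply/funext => x; rewrite norm_jmap // -powRrM; congr (_ `^ _).
have : p + r = p * r * (p^-1 + r^-1) by field; rewrite p0 r0.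
rewrite pr mulr1 => h; rewrite mulrBl mul1r -h; ring.
Qed.

Lemma Lr_mul p r f g : 1 < p -> 1 < r -> p^-1 + r^-1 = 1 -> Lr p f -> Lr r g ->
  intg (fun x => f x * g x).
Proof.
move=> p1 r1 pr [mf hf] [mg hg].
have p0 : 0 < p by rewrite (lt_trans ltr01).
have r0 : 0 < r by rewrite (lt_trans ltr01).
apply: intg_le (intgD hf hg); first exact: measurable_funM.
move=> x; rewrite normrM.
have := @conjugate_powR R `|f x| `|g x| p r.
rewrite !normr_ge0 p0 r0 pr => /(_ erefl erefl erefl erefl erefl) /le_trans; apply.
by apply: lerD; rewrite ler_pdivrMr // ler_peMr ?powR_ge0 // ltW.
Qed.

Lemma Lr_Lnorm r f : 0 < r -> Lr r f -> ('N[mu]_r%:E[EFin \o f] = (nr r f)%:E)%E.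
Proof.
move=> r0 [mf hf].
have -> : (nr r f)%:E = ((\int[mu]_x (`|f x| `^ r)%:E) `^ r^-1)%E.
  by rewrite intg_EFin // poweR_EFin nrE.
by rewrite unlock; congr (_ `^ _)%E; apply: eq_integral => x _; rewrite abse_EFin poweR_EFin.
Qed.

Lemma Lfun_Lr r f : 0 < r -> f \in Lfun mu r%:E <-> Lr r f.
Proof.
move=> r0; split.
  rewrite inE => /andP[]; rewrite !inE /= => mf hf; split => //.
  apply/intgP; first exact: measurable_normpowR.
    by move=> x; exact: powR_ge0.
  move: hf; rewrite /finite_norm => /(poweR_lty r).
  by rewrite powR_Lnorm ?gt_eqF.
move=> [mf hf]; rewrite inE; apply/andP; split; first by rewrite inE.
by rewrite inE /= /finite_norm Lr_Lnorm ?ltry.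
Qed.

Lemma hoelder_nr p r f g : 1 < p -> 1 < r -> p^-1 + r^-1 = 1 -> Lr p f -> Lr r g ->
  `|\int[mu]_x (f x * g x)| <= nr p f * nr r g.
Proof.
move=> p1 r1 pr hf hg.
have p0 : 0 < p by rewrite (lt_trans ltr01).
have r0 : 0 < r by rewrite (lt_trans ltr01).
have hfg := Lr_mul p1 r1 pr hf hg.
apply: le_trans (int_abs hfg) _.
have := hoelder mu hf.1 hg.1 p0 r0 pr.
rewrite (Lr_Lnorm p0 hf) (Lr_Lnorm r0 hg) -EFinM Lnorm1.
have -> : (\int[mu]_x `|(EFin \o (f \* g)%R) x|)%E = (\int[mu]_x `|f x * g x|)%:E.
  by rewrite -intg_EFin //; exact: intg_abs.
by rewrite lee_fin.
Qed.

Lemma nrD r f g : 1 <= r -> Lr r f -> Lr r g ->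
  nr r (fun x => f x + g x) <= nr r f + nr r g.
Proof.
move=> r1 hf hg; have r0 : 0 < r by rewrite (lt_le_trans ltr01).
have := minkowski_EFin mu hf.1 hg.1 r1.
by rewrite (Lr_Lnorm r0 hf) (Lr_Lnorm r0 hg) (Lr_Lnorm r0 (LrD (ltW r0) hf hg)) -EFinD lee_fin.
Qed.

Lemma nrZ r c f : 0 < r -> Lr r f -> nr r (fun x => c * f x) = `|c| * nr r f.
Proof.
move=> r0 [mf hf]; rewrite nrE.
under eq_Rintegral => x _ do rewrite normrM powRM //.
rewrite int_Z // powRM ?powR_ge0 ?int_pow_ge0 //.
by rewrite nrE -powRrM divff ?gt_eqF // powRr1.
Qed.

Lemma nrN r f : nr r (fun x => - f x) = nr r f.
Proof. by rewrite !nrE; under eq_Rintegral => x _ do rewrite normrN. Qed.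

Lemma nrBC r f g : nr r (fun x => f x - g x) = nr r (fun x => g x - f x).
Proof. by rewrite -nrN !nrE; under eq_Rintegral => x _ do rewrite opprB. Qed.

Lemma nrB r f g : 1 <= r -> Lr r f -> Lr r g ->
  nr r (fun x => f x - g x) <= nr r f + nr r g.
Proof. by move=> r1 hf hg; rewrite -[nr r g]nrN; apply: nrD => //; exact: LrN. Qed.

Lemma nr_dist r f g : 1 <= r -> Lr r f -> Lr r g ->
  `|nr r f - nr r g| <= nr r (fun x => f x - g x).
Proof.
move=> r1 hf hg; have r0 : 0 < r by rewrite (lt_le_trans ltr01).
have h f1 g1 : Lr r f1 -> Lr r g1 -> nr r f1 <= nr r (fun x => f1 x - g1 x) + nr r g1.
  move=> hf1 hg1; have e : f1 = (fun x => (f1 x - g1 x) + g1 x) by apply/funext => x; ring.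
  by rewrite {1}e; apply: nrD => //; apply: LrB => //; exact: ltW.
rewrite ler_norml; apply/andP; split.
  by have := h _ _ hg hf; rewrite nrBC; lra.
by have := h _ _ hf hg; lra.
Qed.

Lemma nr_tri r f g h : 1 <= r -> Lr r f -> Lr r g -> Lr r h ->
  nr r (fun x => f x - h x) <= nr r (fun x => f x - g x) + nr r (fun x => g x - h x).
Proof.
move=> r1 hf hg hh; have r0 : 0 <= r by rewrite (le_trans ler01).
have -> : (fun x => f x - h x) = (fun x => (f x - g x) + (g x - h x)).
  by apply/funext => x; ring.
by apply: nrD => //; exact: LrB.
Qed.

Lemma nr_ae_eq r f g : measurable_fun setT f -> measurable_fun setT g ->
  {ae mu, forall x, f x = g x} -> nr r f = nr r g.
Proof.
move=> mf mg fg; rewrite !nrE.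
rewrite (int_ae_eq (measurable_normpowR _ mf) (measurable_normpowR r mg)) //.
by apply: filterS fg => x ->.
Qed.

Lemma nr_eq0 r f : 0 < r -> Lr r f -> nr r f = 0 -> {ae mu, forall x, f x = 0}.
Proof.
move=> r0 [mf hf] h.
have : \int[mu]_x `|f x| `^ r = 0 by rewrite -nrK // h powR0 // gt_eqF.
move=> /int_eq0_ae => /(_ hf (fun x => powR_ge0 _ _)).
by apply: filterS => x /powR_eq0_eq0 /normr0_eq0.
Qed.

Lemma nr_le_int r f c : 0 < r -> 0 <= c -> (nr r f <= c) = (\int[mu]_x `|f x| `^ r <= c `^ r).
Proof.
move=> r0 c0; rewrite -nrK //; apply/idP/idP => h.
  by apply: ge0_ler_powR => //; [exact: ltW|rewrite nnegrE nr_ge0].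
rewrite leNgt; apply/negP => h1; move: h; rewrite leNgt => /negP; apply.
by apply: gt0_ltr_powR => //; rewrite nnegrE ?nr_ge0.
Qed.

(** The additive term with factor [e] makes the pointwise inequality linear in the powers, so it
    integrates directly. For functions of bounded norm whose midpoint loses almost no norm, both
    terms on the right are small. *)
Lemma Lr_unif_convex r e : 1 < r -> 0 < e -> exists2 C, 0 < C &
  forall f g, Lr r f -> Lr r g ->
  \int[mu]_x `|f x - g x| `^ r <=
    e * (\int[mu]_x `|f x| `^ r + \int[mu]_x `|g x| `^ r) +
    C * (\int[mu]_x `|f x| `^ r + \int[mu]_x `|g x| `^ r
         - 2 * \int[mu]_x `|(f x + g x) / 2| `^ r).
Proof.
move=> r1 e0; have r0 : 0 <= r by rewrite (le_trans ler01) // ltW.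
have [C C0 hC] := powR_unif_convex r1 e0; exists C => // f g hf hg.
have [_ h1] := LrB r0 hf hg.
have [_ h2] : Lr r (fun x => (f x + g x) / 2).
  by have := LrZ 2^-1 (LrD r0 hf hg); under eq_fun do rewrite mulrC.
have h3 := intgD hf.2 hg.2.
have h4 := intgB h3 (intgZ 2 h2).
apply: le_trans (int_le h1 (intgD (intgZ e h3) (intgZ C h4)) (fun x => hC (f x) (g x))) _.
rewrite (int_D (intgZ e h3) (intgZ C h4)) !int_Z // int_B //; last exact: intgZ.
by rewrite int_Z // int_D //; [exact: hf.2|exact: hg.2].
Qed.

(** Continuity of the derivative of the p-th power integral along [h], by dominated convergence;
    since [|s n| <= 1], one dominating function [G] serves all [n]. *)
Lemma cvg_Lr_jmap p r f h (s : nat -> R) : 1 < p -> 1 < r -> p^-1 + r^-1 = 1 ->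
  Lr p f -> Lr p h -> s @ \oo --> 0 -> (forall n, `|s n| <= 1) ->
  (fun n => \int[mu]_x (jmap p (f x + s n * h x) * h x)) @ \oo
    --> \int[mu]_x (jmap p (f x) * h x).
Proof.
move=> p1 r1 pr hf hh s0 s1.
have p0 : 0 <= p by rewrite (le_trans ler01) // ltW.
have mu_ n : measurable_fun setT (fun x => f x + s n * h x).
  by apply: measurable_funD; [exact: hf.1|apply: measurable_funM => //; exact: hh.1].
have m1 n : measurable_fun setT (fun x => jmap p (f x + s n * h x) * h x).
  by apply: measurable_funM; [exact: measurable_jmap|exact: hh.1].
have m2 : measurable_fun setT (fun x => jmap p (f x) * h x).
  by apply: measurable_funM; [apply: measurable_jmap; exact: hf.1|exact: hh.1].
pose G x := (2 `^ p * (`|f x| `^ p + `|h x| `^ p) + `|h x| `^ p).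
have iG : intg G by apply: intgD hh.2; apply: intgZ; exact: (intgD hf.2 hh.2).
have bnd n x : `|jmap p (f x + s n * h x) * h x| <= G x.
  rewrite normrM norm_jmap //; apply: le_trans (powR_young _ _ (ltW p1)) _.
  rewrite lerD2r; apply: le_trans (powR_normD _ _ p0) _.
  rewrite ler_wpM2l ?powR_ge0 // lerD2l; apply: ge0_ler_powR => //.
  by rewrite normrM ler_piMl.
have i1 n : intg (fun x => jmap p (f x + s n * h x) * h x) by exact: intg_le iG.
have bnd0 x : `|jmap p (f x) * h x| <= G x.
  rewrite normrM norm_jmap //; apply: le_trans (powR_young _ _ (ltW p1)) _.
  rewrite lerD2r; apply: (@le_trans _ _ (`|f x| `^ p + `|h x| `^ p)).
    by rewrite lerDl powR_ge0.
  rewrite ler_peMl ?addr_ge0 ?powR_ge0 // -[leLHS](powRr0 2); apply: ler_powR => //.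
  by rewrite ler1n.
have i2 : intg (fun x => jmap p (f x) * h x) by exact: intg_le iG.
have := @dominated_cvg _ _ _ mu setT measurableT
  (fun n x => (jmap p (f x + s n * h x) * h x)%:E) (fun x => (jmap p (f x) * h x)%:E)
  (EFin \o G).
have H1 n : measurable_fun setT (fun x => (jmap p (f x + s n * h x) * h x)%:E).
  exact/measurable_EFinP.
have H2 x : setT x -> (jmap p (f x + s n * h x) * h x)%:E @[n --> \oo]
    --> (jmap p (f x) * h x)%:E.
  move=> _; apply: cvg_EFin; first exact: nearW.
  apply: cvgM; last exact: cvg_cst.
  have H : f x + s n * h x @[n --> \oo] --> f x + 0 * h x.
    by apply: cvgD; [exact: cvg_cst|apply: cvgM => //; exact: cvg_cst].
  rewrite mul0r addr0 in H.
  exact: (@cvg_comp _ _ _ _ (jmap p) _ _ _ H (@continuous_jmap R p p1 (f x))).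
move=> /(_ H1 H2 (fun x _ => erefl) iG) H.
have {}H : (\int[mu]_x (jmap p (f x + s n * h x) * h x)%:E)%E @[n --> \oo] -->
   (\int[mu]_x (jmap p (f x) * h x)%:E)%E.
  by apply: H => n x _; rewrite abse_EFin lee_fin.
rewrite intg_EFin // in H.
have -> : (fun n => \int[mu]_x (jmap p (f x + s n * h x) * h x)) =
    fine \o (fun n => \int[mu]_x (jmap p (f x + s n * h x) * h x)%:E)%E by [].
exact: fine_cvg H.
Qed.

Lemma cvg_seq_ge0 (v : nat -> R) (l : R) : v @ \oo --> l -> (forall n, 0 <= v n) -> 0 <= l.
Proof.
move=> vl v0; rewrite -(cvg_lim _ vl) //; apply: limr_ge; first by apply/cvg_ex; exists l.
exact: nearW.
Qed.

(* First-order condition at a minimiser of the norm along a line. *)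
Lemma Lr_minimizer_jmap p r f h : 1 < p -> 1 < r -> p^-1 + r^-1 = 1 ->
  Lr p f -> Lr p h ->
  (forall s, \int[mu]_x `|f x| `^ p <= \int[mu]_x `|f x + s * h x| `^ p) ->
  \int[mu]_x (jmap p (f x) * h x) = 0.
Proof.
move=> p1 r1 pr hf hh hmin.
have p0 : 0 < p by rewrite (lt_trans ltr01).
have key h' : Lr p h' ->
    (forall s, \int[mu]_x `|f x| `^ p <= \int[mu]_x `|f x + s * h' x| `^ p) ->
    0 <= \int[mu]_x (jmap p (f x) * h' x).
  move=> hh' hm.
  have s0 : (fun n => n.+1%:R^-1 : R) @ \oo --> 0 by exact: cvg_harmonic.
  have sgt n : 0 < n.+1%:R^-1 :> R by rewrite invr_gt0.
  have s1 n : `|n.+1%:R^-1 : R| <= 1.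
    by rewrite ger0_norm ?invr_ge0 // invf_le1 // ler1n.
  have H := cvg_Lr_jmap p1 r1 pr hf hh' s0 s1.
  apply: (cvg_seq_ge0 H) => n.
  set t := n.+1%:R^-1 in H *.
  have hfs : Lr p (fun x => f x + t * h' x) by apply: LrD (ltW p0) hf (LrZ t hh').
  have ijh : intg (fun x => jmap p (f x + t * h' x) * h' x).
    by apply: Lr_mul r1 p1 _ (Lr_jmap p1 r1 pr hfs) hh'; rewrite addrC.
  have iA := intgD hfs.2 (intgZ (- (p * t)) ijh).
  (* The tangent line at the perturbed point, evaluated at [f]: together with minimality of [f] it
     gives the pairing at the perturbed point a sign, which survives the limit [t -> 0]. *)
  have hA : forall x, `|f x + t * h' x| `^ p + - (p * t) * (jmap p (f x + t * h' x) * h' x)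
      <= `|f x| `^ p.
    move=> x; have := @jmap_convex R p (f x + t * h' x) (f x) p1.
    apply: le_trans; rewrite le_eqVlt; apply/orP; left; apply/eqP; ring.
  have := int_le iA hf.2 hA; rewrite int_D ?int_Z //; [|exact: hfs.2|exact: intgZ].
  have := hm t.
  move: (\int[mu]_x `|f x| `^ p) (\int[mu]_x `|f x + t * h' x| `^ p)
    (\int[mu]_x (jmap p (f x + t * h' x) * h' x)) => a b c h1 h2.
  have : 0 <= (p * t) * c by lra.
  by rewrite pmulr_rge0 // mulr_gt0 //; exact: sgt.
apply/eqP; rewrite eq_le key // andbT.
have := key _ (LrN hh).
have -> : \int[mu]_x (jmap p (f x) * - h x) = - \int[mu]_x (jmap p (f x) * h x).
  rewrite -int_N; first by apply: eq_Rintegral => x _; rewrite mulrN.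
  by apply: Lr_mul r1 p1 _ (Lr_jmap p1 r1 pr hf) hh; rewrite addrC.
rewrite oppr_ge0; apply => s; have := hmin (- s).
by under [X in _ <= X -> _]eq_Rintegral => x _ do rewrite mulNr -mulrN.
Qed.

Lemma limn_einf_le (u : nat -> \bar R) (e : \bar R) :
  (\forall n \near \oo, (u n <= e)%E) -> (limn_einf u <= e)%E.
Proof.
move=> [N _ hN]; rewrite limn_einf_lim.
apply: lime_le; first exact: is_cvg_einfs.
apply: nearW => n; apply: (@le_trans _ _ (u (maxn n N))); last by apply: hN => /=; exact: leq_maxr.
by apply: ereal_inf_lbound; exists (maxn n N) => //=; exact: leq_maxl.
Qed.

Lemma geometric_cvg_seq (v : nat -> R) (C : R) :
  (forall n, `|v n.+1 - v n| <= C * 2^-1 ^+ n) -> cvgn v.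
Proof.
move=> h.
have C0 : 0 <= C by have := h 0%N; rewrite expr0 mulr1; exact: le_trans.
have -> : v = (fun n => v 0%N + series (telescope v) n).
  by apply/funext => n; rewrite -eq_sum_telescope.
apply: is_cvgD; first exact: is_cvg_cst.
apply: normed_cvg; apply: (@series_le_cvg _ _ (geometric C 2^-1)) => //.
- by move=> n /=; exact: normr_ge0.
- by move=> n /=; rewrite mulr_ge0 // exprn_ge0.
by apply: is_cvg_geometric_series; rewrite ger0_norm // invf_lt1 // ltr1n.
Qed.

Lemma powR_le_root (r v S c : R) : 0 < r -> 0 <= v -> 0 <= S -> 0 < c ->
  v `^ r <= S * c `^ r -> v <= S `^ r^-1 * c.
Proof.
move=> r0 v0 S0 c0.
have -> : S * c `^ r = (S `^ r^-1 * c) `^ r.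
  by rewrite powRM ?powR_ge0 ?(ltW c0) // -powRrM mulVf ?gt_eqF // powRr1.
have Sc : 0 <= S `^ r^-1 * c by rewrite mulr_ge0 ?powR_ge0 // ltW.
move=> h; rewrite leNgt; apply/negP => h1; move: h; rewrite leNgt => /negP; apply.
by apply: gt0_ltr_powR => //; rewrite nnegrE.
Qed.

(** A fast subsequence converges almost everywhere, and Fatou's lemma upgrades this to norm
    convergence of the whole sequence. The last clause holds because the limit is defined at every
    point from the values [u n x] alone; it hands exact periodicity on to limits. *)
Lemma Lr_complete r (u : nat -> T -> R) : 1 <= r -> (forall n, Lr r (u n)) ->
  (forall e, 0 < e -> exists N, forall m n, (N <= m)%N -> (N <= n)%N ->
     nr r (fun x => u m x - u n x) <= e) ->
  exists g, [/\ Lr r g, (fun n => nr r (fun x => u n x - g x)) @ \oo --> 0 &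
    forall x y, (forall n, u n x = u n y) -> g x = g y].
Proof.
move=> r1 hu hC; have r0 : 0 < r by rewrite (lt_le_trans ltr01).
pose a (k : nat) : R := 2^-1 ^+ k.
have a0 k : 0 < a k by rewrite exprn_gt0.
have /choice[N hN] : forall k, exists N, forall m n, (N <= m)%N -> (N <= n)%N ->
    \int[mu]_x `|u m x - u n x| `^ r <= a k * a k `^ r.
  move=> k.
  have e0 : 0 < (a k * a k `^ r) `^ r^-1 by rewrite powR_gt0 // mulr_gt0 ?powR_gt0.
  have [N hN] := hC _ e0; exists N => m n hm hn.
  have := hN m n hm hn; rewrite nr_le_int ?powR_ge0 // -powRrM mulVf ?gt_eqF // powRr1 //.
  by rewrite mulr_ge0 ?powR_ge0 // ltW.
(* Summing [(N j).+1] makes the indices increasing and at least as large as both [N k] and [k]. *)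
pose s k := (\sum_(j < k.+1) (N j).+1)%N.
have sN k : (N k <= s k)%N by rewrite /s big_ord_recr /= (leq_trans (leqnSn _)) // leq_addl.
have ks k : (k <= s k)%N.
  rewrite /s -[leqLHS](card_ord k) -sum1_card big_ord_recr /= (leq_trans _ (leq_addr _ _)) //.
  by apply: leq_sum.
have sS k : (s k <= s k.+1)%N by rewrite {2}/s big_ord_recr /= leq_addr.
have smono k l : (k <= l)%N -> (s k <= s l)%N.
  by move=> kl; apply: (homo_leq (leqnn) leq_trans sS).
pose v k x : R := `|u (s k.+1) x - u (s k) x|.
have mv k : measurable_fun setT (fun x => u (s k.+1) x - u (s k) x).
  by apply: measurable_funB; [exact: (hu _).1|exact: (hu _).1].
have iv k : intg (fun x => v k x `^ r) by exact: (LrB (ltW r0) (hu _) (hu _)).2.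
(* The weight gives [W k] an integral of at most [2^-k]: the sum is integrable, hence finite almost
   everywhere, and a bound [W k x <= S] says that the increment [v k x] is at most
   [S^(1/r) * 2^-k]. *)
pose W k x : R := (a k `^ r)^-1 * v k x `^ r.
have W0 k x : 0 <= W k x by rewrite mulr_ge0 ?invr_ge0 ?powR_ge0.
have iW k : intg (W k) by exact: intgZ.
have mW k : measurable_fun setT (W k) by exact: intg_measurable (iW k).
have sumW : (\int[mu]_x (\sum_(0 <= k <oo) (W k x)%:E) < +oo)%E.
  rewrite integral_nneseries //; last 2 first.
  - by move=> k; exact/measurable_EFinP.
  - by move=> k x _; rewrite lee_fin.
  apply: (@le_lt_trans _ _ (\sum_(0 <= k <oo) (a k)%:E)%E).
    apply: lee_nneseries => [k _ _|k _]; first by apply: integral_ge0 => x _; rewrite lee_fin.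
    rewrite intg_EFin // lee_fin int_Z // mulrC ler_pdivrMr ?powR_gt0 //.
    by apply: hN; [exact: leq_trans (sN k) (sS k)|exact: sN].
  apply: (@le_lt_trans _ _ 2%:E); last exact: ltry.
  apply: lime_le; first by apply: is_cvg_nneseries => n _ _; rewrite lee_fin ltW.
  apply: nearW => n; rewrite sumEFin lee_fin.
  suff -> : \sum_(0 <= k < n) a k = 2 - 2 * a n by rewrite gerBl mulr_ge0 // ltW.
  elim: n => [|n ih]; first by rewrite big_geq // /a expr0; ring.
  by rewrite big_nat_recr //= ih /a exprS; lra.
have msum : measurable_fun setT (fun x => \sum_(0 <= k <oo) (W k x)%:E)%E.
  by apply: ge0_emeasurable_sum => [k x _ _|k _]; [rewrite lee_fin|exact/measurable_EFinP].
have sum0 x : (0 <= \sum_(0 <= k <oo) (W k x)%:E)%E.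
  by apply: nneseries_ge0 => k _ _; rewrite lee_fin.
have aefin : {ae mu, forall x, (\sum_(0 <= k <oo) (W k x)%:E)%E \is a fin_num}.
  have := @integrable_ae _ _ _ mu setT measurableT (fun x => \sum_(0 <= k <oo) (W k x)%:E)%E.
  have H : mu.-integrable setT (fun x => \sum_(0 <= k <oo) (W k x)%:E)%E.
    apply/integrableP; split => //.
    by under eq_integral => x _ do rewrite gee0_abs //.
  by move=> /(_ H); apply: filterS => x; apply.
have aecvg : {ae mu, forall x, cvgn (fun k => u (s k) x)}.
  apply: filterS aefin => x hx.
  pose S := fine (\sum_(0 <= k <oo) (W k x)%:E)%E.
  have S0 : 0 <= S by rewrite fine_ge0.
  apply: (@geometric_cvg_seq _ (S `^ r^-1)) => k.
  have WS : W k x <= S.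
    rewrite -lee_fin fineK //.
    apply: le_trans (nneseries_lim_ge k.+1 _); last by move=> j _; rewrite lee_fin.
    by rewrite big_nat_recr //= leeDr // sume_ge0 // => j _; rewrite lee_fin.
  apply: (@powR_le_root r) => //.
  by rewrite -ler_pdivrMr ?powR_gt0 // mulrC.
(* The limsup makes sense at every point, so [g] is measurable and agrees with the limit wherever
   the subsequence converges. *)
pose g x := fine (limn_esup (fun k => (u (s k) x)%:E)).
have mg : measurable_fun setT g.
  apply: (measurableT_comp (@fine_measurable R setT measurableT)).
  by apply: measurable_fun_limn_esup => k; apply/measurable_EFinP; exact: (hu _).1.
have gE x : cvgn (fun k => u (s k) x) -> u (s k) x @[k --> \oo] --> g x.
  move=> /cvg_ex[/= l hl]; rewrite /g.
  have hl' : (u (s k) x)%:E @[k --> \oo] --> l%:E by apply: cvg_EFin => //; exact: nearW.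
  by rewrite is_cvg_limn_esupE; [rewrite (cvg_lim _ hl')|apply/cvg_ex; exists l%:E].
(* Fatou's lemma along the subsequence bounds the distance from [u m] to the limit. *)
have main e m M : 0 < e -> (forall k, (M <= k)%N -> nr r (fun x => u m x - u k x) <= e) ->
    (\int[mu]_x (`|u m x - g x| `^ r)%:E <= (e `^ r)%:E)%E.
  move=> e0 hm.
  pose h k x := (`|u m x - u (s k) x| `^ r)%:E.
  have mh k : measurable_fun setT (h k).
    by apply/measurable_EFinP/measurable_normpowR/measurable_funB; exact: (hu _).1.
  have mum : measurable_fun setT (fun x => `|u m x - g x| `^ r).
    by apply/measurable_normpowR/measurable_funB => //; exact: (hu _).1.
  have -> : (\int[mu]_x (`|u m x - g x| `^ r)%:E = \int[mu]_x limn_einf (h^~ x))%E.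
    apply: ae_eq_integral => //; first exact/measurable_EFinP.
      have -> : (fun x => limn_einf (h^~ x)) = (fun x => - limn_esup (fun k => - h k x))%E.
        apply/funext => x; rewrite -limn_einfN; congr limn_einf.
        by apply/funext => k; rewrite /comp oppeK.
      apply: measurableT_comp => //; apply: measurable_fun_limn_esup => k.
      exact: measurableT_comp.
    apply: filterS aecvg => x /gE hx _.
    have H : h k x @[k --> \oo] --> (`|u m x - g x| `^ r)%:E.
      apply: cvg_EFin; first exact: nearW.
      have H : u m x - u (s k) x @[k --> \oo] --> u m x - g x.
        by apply: cvgB => //; exact: cvg_cst.
      exact: (@cvg_comp _ _ _ _ (fun z => `|z| `^ r) _ _ _ H (@continuous_normpowR R r r0 _)).
    by rewrite is_cvg_limn_einfE; [rewrite (cvg_lim _ H)|apply/cvg_ex; exists (`|u m x - g x| `^ r)%:E].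
  apply: le_trans (fatou mu measurableT mh _) _; first by move=> k x _; rewrite lee_fin powR_ge0.
  apply: limn_einf_le; exists M => // k /= Mk.
  rewrite intg_EFin; last exact: (LrB (ltW r0) (hu _) (hu _)).2.
  rewrite lee_fin -nr_le_int ?(ltW e0) //; apply: hm; exact: leq_trans Mk (ks k).
have hmg m e : 0 < e -> (exists M, forall k, (M <= k)%N -> nr r (fun x => u m x - u k x) <= e) ->
    Lr r (fun x => u m x - g x) /\ nr r (fun x => u m x - g x) <= e.
  move=> e0 [M hM].
  have mum : measurable_fun setT (fun x => u m x - g x).
    by apply: measurable_funB => //; exact: (hu _).1.
  have h := main _ _ _ e0 hM.
  have ig : intg (fun x => `|u m x - g x| `^ r).
    apply/intgP; [exact: measurable_normpowR|by move=> x; exact: powR_ge0|].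
    exact: le_lt_trans h (ltry _).
  split; first by split.
  by rewrite nr_le_int ?(ltW e0) // -lee_fin -intg_EFin.
exists g; split.
- have [M hM] := hC 1 ltr01.
  have [hMg _] : Lr r (fun x => u M x - g x) /\ nr r (fun x => u M x - g x) <= 1.
    by apply: hmg => //; exists M => k Mk; exact: hM.
  have -> : g = (fun x => u M x - (u M x - g x)) by apply/funext => x; rewrite opprB addrC subrK.
  exact: LrB (ltW r0) (hu M) hMg.
- apply/cvgrPdist_le => e e0; have [M hM] := hC e e0.
  exists M => // m /= Mm; rewrite sub0r normrN ger0_norm ?nr_ge0 //.
  have [] := @hmg m e e0 => //; exists M => k Mk; exact: hM.
- by move=> x y hxy; rewrite /g; under eq_fun do rewrite hxy.
Qed.

End LrSpaces.

(** * Orthonormal systems *)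

Section L2.
Context {d} {T : measurableType d} {R : realType}.
Variable mu : {measure set T -> \bar R}.
Implicit Types f g h : T -> R.
Local Notation L2 := (Lr mu 2).
Local Notation inner := (inner mu).

Let two_conj : (2 : R)^-1 + 2^-1 = 1. Proof. by lra. Qed.
Let two_gt1 : (1 : R) < 2. Proof. by lra. Qed.

Lemma L2_mul f g : L2 f -> L2 g -> intg mu (fun x => f x * g x).
Proof. exact: Lr_mul two_gt1 two_gt1 two_conj. Qed.

Lemma innerC f g : inner f g = inner g f.
Proof. by apply: eq_Rintegral => x _; rewrite mulrC. Qed.

Lemma innerDl f g h : L2 f -> L2 g -> L2 h ->
  inner (fun x => f x + g x) h = inner f h + inner g h.
Proof.
move=> hf hg hh; rewrite /Defs.inner -int_D; [|exact: L2_mul..].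
by apply: eq_Rintegral => x _; rewrite mulrDl.
Qed.

Lemma innerZl c f h : L2 f -> L2 h -> inner (fun x => c * f x) h = c * inner f h.
Proof.
move=> hf hh; rewrite /Defs.inner -int_Z; last exact: L2_mul.
by apply: eq_Rintegral => x _; rewrite mulrA.
Qed.

Lemma innerBl f g h : L2 f -> L2 g -> L2 h ->
  inner (fun x => f x - g x) h = inner f h - inner g h.
Proof.
move=> hf hg hh; rewrite /Defs.inner -int_B; [|exact: L2_mul..].
by apply: eq_Rintegral => x _; rewrite mulrBl.
Qed.

Lemma inner_suml J (s : seq J) (F : J -> T -> R) h : (forall i, L2 (F i)) -> L2 h ->
  inner (fun x => \sum_(i <- s) F i x) h = \sum_(i <- s) inner (F i) h.
Proof.
move=> hF hh; rewrite /Defs.inner -int_sum; last by move=> i; exact: L2_mul.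
by apply: eq_Rintegral => x _; rewrite mulr_suml.
Qed.

Lemma inner_ge0 f : 0 <= inner f f.
Proof. by apply: int_ge0 => x; rewrite -expr2 sqr_ge0. Qed.

Lemma nr2E f : nr mu 2 f ^+ 2 = inner f f.
Proof.
rewrite -powR_mulrn ?nr_ge0 // nrK //.
by apply: eq_Rintegral => x _; rewrite powR_mulrn // real_normK ?num_real // expr2.
Qed.

Lemma inner_le f g : L2 f -> L2 g -> `|inner f g| <= nr mu 2 f * nr mu 2 g.
Proof. exact: hoelder_nr two_gt1 two_gt1 two_conj. Qed.

Lemma inner_eq0_ae f : L2 f -> inner f f = 0 -> {ae mu, forall x, f x = 0}.
Proof.
move=> hf h; apply: (@nr_eq0 _ _ _ _ 2) => //.
by apply/eqP; rewrite -sqrf_eq0 nr2E h.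
Qed.

Lemma inner_cvg (f_ : nat -> T -> R) f g : (forall n, L2 (f_ n)) -> L2 f -> L2 g ->
  (fun n => nr mu 2 (fun x => f_ n x - f x)) @ \oo --> 0 ->
  (fun n => inner (f_ n) g) @ \oo --> inner f g.
Proof.
move=> hf_ hf hg h; apply/subr_cvg0.
apply: (@squeeze_cvgr _ _ _ _ (fun n => - (nr mu 2 (fun x => f_ n x - f x) * nr mu 2 g))
   (fun n => nr mu 2 (fun x => f_ n x - f x) * nr mu 2 g)).
- apply: nearW => n; rewrite -ler_norml -innerBl //.
  by apply: inner_le => //; exact: LrB.
- by rewrite -[X in _ --> X]oppr0; apply: cvgN; rewrite -(mul0r (nr mu 2 g)); apply: cvgM => //; exact: cvg_cst.
- by rewrite -(mul0r (nr mu 2 g)); apply: cvgM => //; exact: cvg_cst.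
Qed.

Section Orthonormal.
Context {I : choiceType}.
Variable m : I -> T -> R.
Hypothesis m2 : forall i, L2 (m i).
Hypothesis mo : forall i j, inner (m i) (m j) = (i == j)%:R.

Lemma L2_comb (s : seq I) (c : I -> R) : L2 (fun x => \sum_(i <- s) c i * m i x).
Proof. by apply: Lr_sum => // i; exact: LrZ. Qed.

Lemma inner_comb (s : seq I) (c : I -> R) g : L2 g ->
  inner (fun x => \sum_(i <- s) c i * m i x) g = \sum_(i <- s) c i * inner g (m i).
Proof.
move=> hg; rewrite inner_suml //; last by move=> i; exact: LrZ.
by apply: eq_bigr => i _; rewrite innerZl // innerC.
Qed.

Lemma coef_comb (s : seq I) (c : I -> R) j : uniq s ->
  inner (fun x => \sum_(i <- s) c i * m i x) (m j) = if j \in s then c j else 0.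
Proof.
move=> us; rewrite inner_comb //.
under eq_bigr do rewrite mo.
case: ifPn => js.
  rewrite (bigD1_seq j) //= eqxx mulr1 big1 ?addr0 // => i /negbTE.
  by rewrite eq_sym => ->; rewrite mulr0.
by rewrite big_seq big1 // => i si; case: eqP js => [->|]; rewrite ?si // mulr0.
Qed.

Lemma inner_comb_sqr (s : seq I) (c : I -> R) : uniq s ->
  inner (fun x => \sum_(i <- s) c i * m i x) (fun x => \sum_(i <- s) c i * m i x)
    = \sum_(i <- s) c i ^+ 2.
Proof.
move=> us; rewrite inner_comb; last exact: L2_comb.
by rewrite big_seq [RHS]big_seq; apply: eq_bigr => i si; rewrite coef_comb // si expr2.
Qed.

Lemma inner_sub_comb (s : seq I) (c : I -> R) f : uniq s -> L2 f ->
  inner (fun x => f x - \sum_(i <- s) c i * m i x) (fun x => f x - \sum_(i <- s) c i * m i x)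
  = inner f f - 2 * \sum_(i <- s) c i * inner f (m i) + \sum_(i <- s) c i ^+ 2.
Proof.
move=> us hf; have hs := L2_comb s c; have hfs : L2 (fun x => f x - \sum_(i <- s) c i * m i x) by exact: LrB.
rewrite innerBl // (innerC f) (innerC _ (fun x => f x - _)) !innerBl //.
by rewrite inner_comb_sqr // (innerC f (fun x => \sum_(i <- s) _)) inner_comb //; ring.
Qed.

Lemma bessel (s : seq I) f : uniq s -> L2 f ->
  \sum_(i <- s) inner f (m i) ^+ 2 <= inner f f.
Proof.
move=> us hf; rewrite -subr_ge0.
have := inner_ge0 (fun x => f x - \sum_(i <- s) inner f (m i) * m i x).
rewrite inner_sub_comb //.
have -> : \sum_(i <- s) inner f (m i) * inner f (m i) = \sum_(i <- s) inner f (m i) ^+ 2.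
  by apply: eq_bigr => i _; rewrite expr2.
by move=> h; lra.
Qed.

Lemma best_approx (s : seq I) (c : I -> R) f : uniq s -> L2 f ->
  nr mu 2 (fun x => f x - \sum_(i <- s) inner f (m i) * m i x) <=
  nr mu 2 (fun x => f x - \sum_(i <- s) c i * m i x).
Proof.
move=> us hf; rewrite -(@ler_pXn2r _ 2) ?nnegrE ?nr_ge0 // !nr2E !inner_sub_comb //.
rewrite -subr_ge0.
have -> : forall a b c' d' e : R, a - 2 * b + c' - (a - 2 * d' + e) = c' - 2 * b + 2 * d' - e by move=> *; ring.
rewrite !mulr_sumr -!sumrB -big_split -sumrB /=; apply: sumr_ge0 => i _.
have -> : c i ^+ 2 - 2 * (c i * inner f (m i)) + 2 * (inner f (m i) * inner f (m i))
   - inner f (m i) ^+ 2 = (c i - inner f (m i)) ^+ 2 by ring.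
exact: sqr_ge0.
Qed.

(** Fourier coefficients give the best approximation for a given index set, so they may replace the
    free coefficients of [in_closed_span]. *)
Lemma closed_spanP (S : set I) f : L2 f -> in_closed_span mu S m f <->
  (forall e, 0 < e -> exists s : {fset I}, (forall i, i \in s -> S i) /\
     nr mu 2 (fun x => f x - \sum_(i <- s) inner f (m i) * m i x) < e).
Proof.
move=> hf; split => h e e0; have [] := h e e0.
  move=> A [c [[Afin AS]]].
  have E : (fun z => f z - \sum_(i \in A) c i * m i z) =
      (fun z => f z - \sum_(i <- fset_set A) c i * m i z).
    by apply/funext => z; rewrite fsbig_finite.
  rewrite E Lr_Lnorm //; last by apply: LrB => //; exact: L2_comb.
  rewrite lte_fin => he; exists (fset_set A); split.
    by move=> i; rewrite in_fset_set // inE => /AS.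
  by apply: le_lt_trans he; apply: best_approx.
move=> s [sS hs]; exists [set` s], (fun i => inner f (m i)); split.
  by split; [exact: finite_fset|move=> i /sS].
have E : (fun z => f z - \sum_(i \in [set` s]) inner f (m i) * m i z) =
    (fun z => f z - \sum_(i <- s) inner f (m i) * m i z).
  by apply/funext => z; rewrite fsbig_finite ?set_fsetK //; exact: finite_fset.
by rewrite E Lr_Lnorm ?lte_fin //; apply: LrB => //; exact: L2_comb.
Qed.

(* Approximating [f] by its finite expansions makes every term of the pairing vanish. *)
Lemma inner_eq0_coef (S : set I) f g : L2 f -> L2 g -> in_closed_span mu S m f ->
  (forall i, S i -> inner f (m i) = 0 \/ inner g (m i) = 0) -> inner f g = 0.
Proof.
move=> hf hg /(closed_spanP S hf) h h0; apply/eqP; rewrite -normr_le0; apply/ler_addgt0Pr => e e0.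
rewrite add0r.
have g0 : 0 < nr mu 2 g + 1 by rewrite ltr_wpDl // nr_ge0.
have [s [sS hs]] := h _ (divr_gt0 e0 g0).
have hc := L2_comb s (fun i => inner f (m i)).
have -> : inner f g = inner (fun x => f x - \sum_(i <- s) inner f (m i) * m i x) g.
  rewrite innerBl // inner_comb // big_seq big1 ?subr0 // => i si.
  by have [->|->] := h0 i (sS i si); rewrite ?mul0r ?mulr0.
apply: le_trans (inner_le _ hg) _; first exact: LrB.
apply: (@le_trans _ _ (e / (nr mu 2 g + 1) * (nr mu 2 g + 1))); last by rewrite divfK ?gt_eqF.
by apply: ler_pM; rewrite ?nr_ge0 ?(ltW hs) // lerDl.
Qed.

Lemma closed_span_coef0 (S : set I) f j : L2 f -> in_closed_span mu S m f -> ~ S j ->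
  inner f (m j) = 0.
Proof.
move=> hf hs nSj; apply: (inner_eq0_coef hf (m2 j) hs) => i Si; right.
by rewrite mo; case: eqP => // ji; rewrite ji in nSj.
Qed.

Lemma closed_span_eq0 f : L2 f -> in_closed_span mu setT m f ->
  (forall i, inner f (m i) = 0) -> {ae mu, forall x, f x = 0}.
Proof.
move=> hf hs h; apply: inner_eq0_ae => //.
by apply: (inner_eq0_coef hf hf hs) => i _; left.
Qed.

(** The squared norm of a difference of partial sums is a difference of the bounded increasing sums
    of squares, so the partial sums are Cauchy. The last clause transfers pointwise symmetries of
    the [m i] to the limit. *)
Lemma riesz_fischer (G : nat -> {fset I}) (c : I -> R) (B : R) :
  (forall n, (G n `<=` G n.+1)%fset) ->
  (forall n, \sum_(i <- G n) c i ^+ 2 <= B) ->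
  exists g, [/\ L2 g,
    (fun n => nr mu 2 (fun x => \sum_(i <- G n) c i * m i x - g x)) @ \oo --> 0,
    forall n i, i \in G n -> inner g (m i) = c i &
    forall x y, (forall i, m i x = m i y) -> g x = g y].
Proof.
move=> GS hB.
have Gmono n k : (n <= k)%N -> (G n `<=` G k)%fset.
  move=> /subnKC <-; elim: (k - n)%N => [|j ih]; first by rewrite addn0 fsubset_refl.
  by rewrite addnS; apply: fsubset_trans ih (GS _).
pose a n := \sum_(i <- G n) c i ^+ 2.
pose S n x := \sum_(i <- G n) c i * m i x.
have S2 n : L2 (S n) by exact: L2_comb.
have diff n k : (n <= k)%N -> nr mu 2 (fun x => S k x - S n x) ^+ 2 = a k - a n.
  move=> nk.
  pose c' i := if i \in G n then 0 else c i.
  have e1 F : \sum_(i <- G n) F i = \sum_(i <- G k) (if i \in G n then F i else 0) :> R.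
    rewrite -(big_fset_incl _ (Gmono _ _ nk)) /=; last by move=> i _ /negbTE ->.
    by rewrite big_seq [RHS]big_seq; apply: eq_bigr => i ->.
  have -> : (fun x => S k x - S n x) = (fun x => \sum_(i <- G k) c' i * m i x).
    apply/funext => x; rewrite /S e1 -sumrB; apply: eq_bigr => i _.
    by rewrite /c'; case: ifP => _; rewrite ?subrr ?mul0r ?subr0.
  rewrite nr2E inner_comb_sqr ?fset_uniq // /a e1 -sumrB; apply: eq_bigr => i _.
  by rewrite /c'; case: ifP => _; rewrite ?subrr ?expr0n ?subr0.
have and_ : {homo a : n k / (n <= k)%N >-> n <= k}.
  by move=> n k nk; rewrite -subr_ge0 -diff // sqr_ge0.
have acvg : cvgn a.
  by apply: nondecreasing_is_cvgn => //; exists B => _ [n _ <-]; exact: hB.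
have hC e : 0 < e -> exists N, forall n k, (N <= n)%N -> (N <= k)%N ->
    nr mu 2 (fun x => S n x - S k x) <= e.
  move=> e0.
  have /cvgrPdist_le/(_ (e ^+ 2)) := acvg; rewrite exprn_gt0 // => /(_ erefl) [N _ hN].
  have alim n : a n <= limn a by apply: nondecreasing_cvgn_le.
  exists N; suff H n k : (N <= n)%N -> (n <= k)%N -> nr mu 2 (fun x => S k x - S n x) <= e.
    move=> n k Nn Nk; have [nk|/ltnW nk] := leqP n k; last exact: H.
    by rewrite nrBC; exact: H.
  move=> Nn nk; rewrite -(@ler_pXn2r _ 2) ?nnegrE ?nr_ge0 ?(ltW e0) // diff //.
  have := hN n Nn; rewrite ger0_norm ?subr_ge0 //; have := alim k; lra.
have [g [g2 gcvg ginv]] := Lr_complete (ler1n R 2) S2 hC.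
exists g; split => //.
  move=> n i iG.
  have h := inner_cvg S2 g2 (m2 i) gcvg.
  rewrite -(cvg_lim _ h) //; apply: lim_near_cst => //.
  exists n => // k /= nk; rewrite /S coef_comb ?fset_uniq //.
  by move/fsubsetP : (Gmono _ _ nk) => -> .
move=> x y hxy; apply: ginv => n; rewrite /S.
by apply: eq_bigr => i _; rewrite hxy.
Qed.

End Orthonormal.

End L2.

(** * The circle: Laplace eigenfunctions *)

Section CircleMeasure.
Context {R : realType}.
Local Notation mu1 := (@circle_measure R).
Local Notation mu2 := (@torus_measure R).
Local Notation T1 := (measurableTypeR R).
Local Notation T2 := (T1 * T1)%type.
Local Notation lam1 := (@lebesgue_measure R).
Local Notation tp := (2 * pi : R).

Lemma two_pi_gt0 : 0 < tp. Proof. by rewrite mulr_gt0 // pi_gt0. Qed.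

Lemma circle_invariant_int {V : Type} (f : R -> V) (k : int) x :
  circle_invariant f -> f (x + k%:~R * tp) = f x.
Proof.
move=> h; have hn (n : nat) y : f (y + n%:R * tp) = f y.
  elim: n => [|n ih] in y *; first by rewrite mul0r addr0.
  by rewrite -(ih y) -(h (y + n%:R * tp)) -natr1; congr f; ring.
case: k => n; first exact: hn.
by rewrite -(hn n.+1 (x + _)) NegzE mulrNz -addrA; congr f; ring.
Qed.

Lemma circle_reduce (x : R) : exists k : int, 0 <= x + k%:~R * tp < tp.
Proof.
exists (- Num.floor (x / tp)).
have tp0 := two_pi_gt0.
have /andP[h1 h2] := floor_itv (x / tp).
rewrite ler_pdivlMr // in h1; rewrite ltr_pdivrMr // in h2.
rewrite intrD mulrDl mul1r in h2.
rewrite mulrNz mulNr; apply/andP; split; lra.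
Qed.

Lemma ge0_integral_circle (f : R -> \bar R) : measurable_fun [set: T1] f ->
  (forall x, (0 <= f x)%E) ->
  (\int[mu1]_x f x = \int[lam1]_(x in `[0%R, tp[) f x)%E.
Proof.
move=> mf f0.
have mF := @measurable_fundamental_domain R.
have mD : measurable (~` (fundamental_domain : set T1)) by exact: measurableC.
rewrite (@ge0_negligible_integral _ _ _ mu1 setT (~` fundamental_domain)) //; last first.
  by rewrite /= /mfrestr /mrestr /= setICl measure0.
rewrite setTD setCK; apply: eq_measure_integral => A mA AD.
by rewrite /= /mfrestr /mrestr /= setIidl.
Qed.

(** Translation invariance comes from the uniqueness of Lebesgue measure: its pushforward by a
    translation gives half-open intervals their length. *)
Lemma ge0_integral_shift (h : R) (D : set R) (f : R -> \bar R) : measurable D ->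
  measurable_fun [set: T1] f -> (forall x, (0 <= f x)%E) ->
  (\int[lam1]_(x in D) f x =
    \int[lam1]_(x in (fun x : R => (x + h)%R) @^-1` D) f ((x : R) + h)%R)%E.
Proof.
move=> mD mf f0.
have mphi : measurable_fun [set: T1] (fun x : T1 => (x : R) + h : measurableTypeR R).
  exact: measurable_funD.
have := @ge0_integral_pushforward _ _ _ _ R _ mphi lam1 D f mD (measurable_funS measurableT (@subsetT _ _) mf) (fun y _ => f0 y).
move=> <-; apply: eq_measure_integral => A mA AD /=.
apply: (@lebesgue_measure_unique R (pushforward lam1 (fun x : measurableTypeR R => (x : R) + h : measurableTypeR R))) => //.
move=> X [[a b] _ <-] /=; rewrite /pushforward.
have -> : (fun x => x + h) @^-1` `]a, b] = `]a - h, b - h]%classic.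
  by apply/seteqP; split => x /=; rewrite !in_itv /= ltrBlDr lerBrDr.
by rewrite !lebesgue_measure_itv /= !lte_fin ltrD2r; case: ifP => // _; rewrite -!EFinB; congr EFin; ring.
Qed.

(** After reducing [h] modulo the period, the translated domain [[h, tp + h[] is cut at [tp] and its
    tail moved back by one period. *)
Lemma ge0_circle_translate (f : R -> \bar R) (h : R) : circle_invariant f ->
  measurable_fun [set: T1] f -> (forall x, (0 <= f x)%E) ->
  (\int[mu1]_x f ((x : R) + h)%R = \int[mu1]_x f x)%E.
Proof.
move=> fp mf f0.
have [k hk] := circle_reduce h.
have -> : (fun x => f (x + h)) = (fun x => f (x + (h + k%:~R * tp))).
  by apply/funext => x; rewrite addrA circle_invariant_int.
move: (h + _) hk => {h k} h /andP[h0 h1].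
have mshift c : measurable_fun [set: T1] (fun x : T1 => f ((x : R) + c)).
  by apply: measurableT_comp => //; exact: measurable_funD.
rewrite !ge0_integral_circle //.
have -> : (\int[lam1]_(x in `[0%R, tp[) f ((x : R) + h)%R = \int[lam1]_(x in `[h, (tp + h)%R[) f x)%E.
  rewrite (ge0_integral_shift h (D := `[h, tp + h[%classic)) //.
  congr (integral _ _ _); apply/seteqP; split => x /=; rewrite !in_itv /=; lra.
have -> : (`[h, tp + h[%classic : set R) = `[h, tp[ `|` `[tp, tp + h[.
  by apply/seteqP; split => x /=; rewrite !in_itv /=; [move=> ?; case: (ltP x tp) => ?; [left|right]; lra|move=> [|]; lra].
rewrite ge0_integral_setU //=; last 2 first.
- exact: measurable_funS mf.
- by apply/disj_setPRL => x /=; rewrite !in_itv /= => /andP[? ?]; apply/negP; lra.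
have -> : (\int[lam1]_(x in `[tp, (tp + h)%R[) f x = \int[lam1]_(x in `[0%R, h[) f x)%E.
  rewrite (ge0_integral_shift tp) //.
  have -> : (fun x => x + tp) @^-1` `[tp, tp + h[ = `[0, h[%classic.
    by apply/seteqP; split => x /=; rewrite !in_itv /=; lra.
  by apply: eq_integral => x _; rewrite fp.
have -> : (`[0, tp[%classic : set R) = `[0, h[ `|` `[h, tp[.
  by apply/seteqP; split => x /=; rewrite !in_itv /=; [move=> ?; case: (ltP x h) => ?; [left|right]; lra|move=> [|]; lra].
rewrite ge0_integral_setU //=; last 2 first.
- exact: measurable_funS mf.
- by apply/disj_setPRL => x /=; rewrite !in_itv /= => /andP[? ?]; apply/negP; lra.
by rewrite addeC.
Qed.

Lemma circle_measure_setT : mu1 setT = tp%:E.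
Proof.
rewrite /= /mfrestr /mrestr /= setTI /fundamental_domain lebesgue_measure_itv /= lte_fin two_pi_gt0.
by rewrite -EFinB subr0.
Qed.

Lemma torus_measure_setT : mu2 setT = (tp * tp)%:E.
Proof.
have -> : [set: measurableTypeR R * measurableTypeR R] = setT `*` setT by rewrite setXTT.
rewrite -[LHS]/((mu1 \x mu1)%E (setT `*` setT)) product_measure1E //.
by rewrite EFinM; congr (_ * _)%E; exact: circle_measure_setT.
Qed.

Lemma ge0_torus_fubini (f : R * R -> \bar R) : measurable_fun [set: T2] f ->
  (forall z, (0 <= f z)%E) ->
  (\int[mu2]_z f z = \int[mu1]_x \int[mu1]_t f (x, t))%E.
Proof. by move=> mf f0; rewrite /torus_measure fubini_tonelli1. Qed.

Lemma ge0_torus_fubini_sym (f : R * R -> \bar R) : measurable_fun [set: T2] f ->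
  (forall z, (0 <= f z)%E) ->
  (\int[mu2]_z f z = \int[mu1]_t \int[mu1]_x f (x, t))%E.
Proof. by move=> mf f0; rewrite /torus_measure fubini_tonelli2. Qed.

Lemma measurable_shift2 (h k : R) : measurable_fun [set: T2]
  (fun z : T2 =>
    ((z.1 : R) + h, (z.2 : R) + k) : measurableTypeR R * measurableTypeR R).
Proof.
apply/measurable_fun_pairP; split => /=.
  by apply: measurable_funD => //; exact: measurable_fst.
by apply: measurable_funD => //; exact: measurable_snd.
Qed.

Lemma ge0_torus_translate (f : R * R -> \bar R) (h k : R) : torus_invariant f ->
  measurable_fun [set: T2] f -> (forall z, (0 <= f z)%E) ->
  (\int[mu2]_z f ((z.1 : R) + h, (z.2 : R) + k)%R = \int[mu2]_z f z)%E.
Proof.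
move=> fp mf f0.
have ms h' k' : measurable_fun [set: T2] (fun z : T2 => f ((z.1 : R) + h', (z.2 : R) + k')).
  exact: (measurableT_comp mf (measurable_shift2 h' k')).
have ms0 : measurable_fun [set: T2] (fun z : T2 => f ((z.1 : R) + h, z.2)).
  by have := ms h 0; under eq_fun do rewrite addr0.
transitivity (\int[mu2]_z f ((z.1 : R) + h, z.2)%R)%E.
  rewrite (ge0_torus_fubini (ms h k) (fun=> f0 _)) (ge0_torus_fubini ms0 (fun=> f0 _)).
  apply: eq_integral => x _.
  apply: (@ge0_circle_translate (fun t => f ((x : R) + h, t))) => //.
  - by move=> t; rewrite (fp _ _).2.
  - exact: (measurableT_comp mf (measurable_pair1 ((x : R) + h))).
rewrite (ge0_torus_fubini_sym ms0 (fun=> f0 _)) (ge0_torus_fubini_sym mf f0).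
apply: eq_integral => t _.
apply: (@ge0_circle_translate (fun x => f (x, t))) => //.
- by move=> x; rewrite (fp _ _).1.
- exact: (measurableT_comp mf (measurable_pair2 t)).
Qed.

Lemma torus_translate (f : R * R -> R) (h k : R) : torus_invariant f ->
  measurable_fun [set: T2] f -> \int[mu2]_z f ((z.1 : R) + h, (z.2 : R) + k) = \int[mu2]_z f z.
Proof.
move=> fp mf; rewrite /Rintegral; congr fine.
rewrite integralE [RHS]integralE.
have mE : measurable_fun [set: T2] (EFin \o f) by exact/measurable_EFinP.
have ip : torus_invariant (EFin \o f)^\+%E by move=> x t; rewrite !funeposE /= !(fp x t).1 !(fp x t).2.
have in_ : torus_invariant (EFin \o f)^\-%E by move=> x t; rewrite !funenegE /= !(fp x t).1 !(fp x t).2.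
have Hp := ge0_torus_translate h k ip (measurable_funepos mE) (fun=> funepos_ge0 _ _).
have Hn := ge0_torus_translate h k in_ (measurable_funeneg mE) (fun=> funeneg_ge0 _ _).
congr (_ - _)%E.
  by rewrite -Hp; apply: eq_integral => x _; rewrite !funeposE.
by rewrite -Hn; apply: eq_integral => x _; rewrite !funenegE.
Qed.

End CircleMeasure.

(** * Integration by parts on the circle *)

Section CircleCalculus.
Context {R : realType}.
Local Notation mu1 := (@circle_measure R).
Local Notation T1 := (measurableTypeR R).
Local Notation lam1 := (@lebesgue_measure R).
Local Notation tp := (2 * pi : R).
Local Notation deriv f x l := (is_derive (x : R) (1 : R) (f : R -> R) (l : R)).
Implicit Types f g u v : R -> R.

Lemma deriv_mul u v (x u' v' : R) : deriv u x u' -> deriv v x v' ->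
  deriv (fun x => u x * v x) x (u' * v x + u x * v').
Proof.
move=> hu hv; apply: (is_derive_eq (is_deriveM hu hv)); rewrite /GRing.scale /=; ring.
Qed.

Lemma deriv_scale u (c x u' : R) : deriv u x u' -> deriv (fun x => c * u x) x (c * u').
Proof. move=> hu; exact: (is_derive_eq (is_deriveZ c hu)). Qed.

Lemma deriv_lin (a x : R) : deriv (fun y => a * y) x a.
Proof. by apply: is_derive_eq; rewrite /GRing.scale /= mulr1. Qed.

Lemma deriv_cos (a x : R) : deriv (fun y => cos (a * y)) x (- a * sin (a * x)).
Proof.
apply: (is_derive_eq (is_derive1_comp (is_derive_cos (a * x)) (deriv_lin a x))).
ring.
Qed.

Lemma deriv_sin (a x : R) : deriv (fun y => sin (a * y)) x (a * cos (a * x)).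
Proof.
apply: (is_derive_eq (is_derive1_comp (is_derive_sin (a * x)) (deriv_lin a x))).
ring.
Qed.

Lemma deriv_continuous u u' : (forall x, deriv u x (u' x)) -> continuous u.
Proof.
by move=> h x; apply: differentiable_continuous; apply/derivable1_diffP; exact: ex_derive.
Qed.

Lemma deriv_unique u (x a b : R) : deriv u x a -> deriv u x b -> a = b.
Proof. by move=> h1 h2; rewrite -(@derive_val _ _ _ _ _ _ _ h1) -(@derive_val _ _ _ _ _ _ _ h2). Qed.

Lemma deriv_invariant u u' : circle_invariant u -> (forall x, deriv u x (u' x)) ->
  circle_invariant u'.
Proof.
move=> hu h x; apply: (@deriv_unique u x) => //.
have hs : deriv (fun y => y + tp) x 1.
  by apply: is_derive_eq; rewrite addr0.
have := @is_derive1_comp R u (fun y => y + tp) x _ _ (h (x + tp)) hs; rewrite mulr1.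
by have -> : u \o (fun y => y + tp) = u by apply/funext => y /=; rewrite hu.
Qed.

Lemma continuous_measurable_circle f : continuous f -> measurable_fun [set: T1] f.
Proof. by move=> cf; exact: continuous_measurable_fun. Qed.

Lemma integral_circle (f : R -> \bar R) : measurable_fun [set: T1] f ->
  (\int[mu1]_x f x = \int[lam1]_(x in `[0%R, tp[) f x)%E.
Proof.
move=> mf; rewrite integralE [RHS]integralE.
by rewrite !ge0_integral_circle //; [exact: measurable_funeneg|exact: measurable_funepos].
Qed.

Lemma circle_bounded_intg f (C : R) : measurable_fun [set: T1] f ->
  (forall x, `|f x| <= C) -> intg mu1 f.
Proof.
move=> mf hf; apply: (measurable_bounded_integrable measurableT) => //.
  by rewrite [X in (X < _)%E]circle_measure_setT ltry.
exists C; split; first exact: num_real.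
by move=> M CM x _ /=; rewrite (le_trans (hf x)) // ltW.
Qed.

Lemma circle_bounded_Lr f (C r : R) : 0 <= r -> measurable_fun [set: T1] f ->
  (forall x, `|f x| <= C) -> Lr mu1 r f.
Proof.
move=> r0 mf hf; split => //; apply: (@circle_bounded_intg _ (C `^ r)).
  exact: measurable_normpowR.
move=> x; rewrite ger0_norm ?powR_ge0 //; apply: ge0_ler_powR => //; rewrite nnegrE //.
exact: le_trans (hf x).
Qed.

Lemma circle_continuous_bounded f : circle_invariant f -> continuous f ->
  exists C, forall x, `|f x| <= C.
Proof.
move=> pf cf.
have cn : continuous (fun x => `|f x|).
  by move=> x; apply: (continuous_comp (cf x)); exact: norm_continuous.
have [] := @EVT_max R (fun x => `|f x|) 0 tp (ltW two_pi_gt0).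
  exact: continuous_subspaceT.
move=> c _ hc; exists `|f c| => x.
have [k /andP[h1 h2]] := circle_reduce x.
rewrite -(circle_invariant_int k x pf); apply: hc.
by rewrite in_itv /= h1 ltW.
Qed.

Lemma circle_intg f : circle_invariant f -> continuous f -> intg mu1 f.
Proof.
move=> pf cf; have [C hC] := circle_continuous_bounded pf cf.
exact: circle_bounded_intg (continuous_measurable_circle cf) hC.
Qed.

Lemma circle_FTC F f : (forall x, deriv F x (f x)) -> continuous f ->
  \int[mu1]_x f x = F tp - F 0.
Proof.
move=> hF cf; have mf := continuous_measurable_circle cf.
have cF := deriv_continuous hF.
rewrite /Rintegral integral_circle; last exact/measurable_EFinP.
rewrite integral_itv_bndo_bndc; last first.
  by apply: measurable_funTS; exact/measurable_EFinP.
rewrite (@continuous_FTC2 _ f F 0 tp two_pi_gt0) //.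
- exact: continuous_subspaceT.
- split.
  + by move=> x _; exact: ex_derive.
  + by apply: cvg_at_right_filter; exact: cF.
  + by apply: cvg_at_left_filter; exact: cF.
- by move=> x _; rewrite derive1E; exact: derive_val.
Qed.

Lemma circle_int_deriv F f : circle_invariant F -> (forall x, deriv F x (f x)) ->
  continuous f -> \int[mu1]_x f x = 0.
Proof.
by move=> pF hF cf; rewrite (circle_FTC hF cf) -{1}[2 * pi]add0r pF subrr.
Qed.

Definition C2circle u u1 u2 := [/\ circle_invariant u, forall x, deriv u x (u1 x),
  forall x, deriv u1 x (u2 x) & continuous u2].

Lemma C2circle_facts u u1 u2 : C2circle u u1 u2 ->
  [/\ circle_invariant u1, circle_invariant u2, continuous u & continuous u1].
Proof.
move=> [pu du du1 cu2]; have pu1 := deriv_invariant pu du.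
split=> //; [exact: deriv_invariant pu1 du1|exact: deriv_continuous du|exact: deriv_continuous du1].
Qed.

Lemma continuousMR u v : continuous u -> continuous v -> continuous (fun x => u x * v x).
Proof. by move=> cu cv x; apply: cvgM; [exact: cu|exact: cv]. Qed.

Lemma circle_dirichlet u u1 u2 v v1 v2 : C2circle u u1 u2 -> C2circle v v1 v2 ->
  \int[mu1]_x (u2 x * v x) = - \int[mu1]_x (u1 x * v1 x).
Proof.
move=> hu hv; have [pu du du1 cu2] := hu; have [pv dv dv1 cv2] := hv.
have [pu1 pu2 cu cu1] := C2circle_facts hu; have [pv1 pv2 cv cv1] := C2circle_facts hv.
have i1 : intg mu1 (fun x => u2 x * v x).
  by apply: circle_intg; [move=> x; rewrite pu2 pv|exact: continuousMR].
have i2 : intg mu1 (fun x => u1 x * v1 x).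
  by apply: circle_intg; [move=> x; rewrite pu1 pv1|exact: continuousMR].
apply/eqP; rewrite -addr_eq0 -int_D //; apply/eqP.
apply: (@circle_int_deriv (fun x => u1 x * v x)).
- by move=> x; rewrite pu1 pv.
- by move=> x; exact: deriv_mul.
- by move=> x; apply: cvgD; [exact: (continuousMR cu2 cv)|exact: (continuousMR cu1 cv1)].
Qed.

Lemma circle_green u u1 u2 v v1 v2 : C2circle u u1 u2 -> C2circle v v1 v2 ->
  \int[mu1]_x (u2 x * v x) = \int[mu1]_x (u x * v2 x).
Proof.
move=> hu hv; rewrite (circle_dirichlet hu hv).
have -> : \int[mu1]_x (u x * v2 x) = \int[mu1]_x (v2 x * u x).
  by apply: eq_Rintegral => x _; rewrite mulrC.
rewrite (circle_dirichlet hv hu); congr (- _).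
by apply: eq_Rintegral => x _; rewrite mulrC.
Qed.

End CircleCalculus.

(** * The trigonometric system *)

Section Trig.
Context {R : realType}.
Local Notation mu1 := (@circle_measure R).
Local Notation T1 := (measurableTypeR R).
Local Notation tp := (2 * pi : R).
Local Notation deriv f x l := (is_derive (x : R) (1 : R) (f : R -> R) (l : R)).

(** The sign of the index encodes the parity: differentiation then maps the index [l] to [- l] up to
    the factor [- l], and the eigenvalue depends on [l ^+ 2] only. *)
Definition trig (l : int) (x : R) : R :=
  if 0 <= l then cos (l%:~R * x) else sin ((- l)%:~R * x).

Definition trig_scale (l : int) : R :=
  if l == 0 then (Num.sqrt (2 * pi))^-1 else (Num.sqrt pi)^-1.

Lemma trig_basisE (l : int) x : trig_basis l x = trig_scale l * trig l x.
Proof.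
rewrite /trig_basis /trig_scale /trig; case: eqP => [->|/eqP l0].
  by rewrite lexx mul0r cos0 mulr1.
by rewrite lt0r l0 /=; case: ifP.
Qed.

Lemma deriv_trig (l : int) x : deriv (trig l) x (- l%:~R * trig (- l) x).
Proof.
rewrite /trig; case: (ltgtP l 0) => [l0|l0|->].
- rewrite oppr_ge0 (ltW l0).
  by apply: (is_derive_eq (deriv_sin _ x)); rewrite mulrNz.
- rewrite oppr_ge0 leNgt l0 /= opprK.
  exact: deriv_cos.
- apply: (is_derive_eq (deriv_cos 0 x)).
  by rewrite !oppr0 lexx !mulr0z !mul0r.
Qed.

Lemma trig_norm (l : int) x : `|trig l x| <= 1.
Proof.
rewrite /trig; case: ifP => _; rewrite ler_norml.
  by rewrite cos_geN1 cos_le1.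
by rewrite sin_geN1 sin_le1.
Qed.

Lemma trig_sqr (l : int) x : l != 0 -> trig l x ^+ 2 + trig (- l) x ^+ 2 = 1.
Proof.
rewrite /trig oppr_ge0; case: (ltgtP l 0) => // l0 _ /=.
  by rewrite addrC cos2Dsin2.
by rewrite opprK cos2Dsin2.
Qed.

Lemma trig0 x : trig 0 x = 1. Proof. by rewrite /trig lexx mul0r cos0. Qed.

Lemma cos_int_2pi (k : int) : cos (k%:~R * tp) = 1 /\ sin (k%:~R * tp) = 0.
Proof.
have hn (n : nat) : cos (n%:R * tp) = 1 /\ sin (n%:R * tp) = 0.
  elim: n => [|n [h1 h2]]; first by rewrite mul0r cos0 sin0.
  have e : tp = pi *+ 2 by rewrite mulr_natl.
  by rewrite -natr1 mulrDl mul1r cosD sinD h1 h2 e cos2pi sin2pi; split; ring.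
case: k => n; first exact: hn.
by rewrite NegzE mulrNz mulNr cosN sinN; have [-> ->] := hn n.+1; rewrite oppr0.
Qed.

Lemma trig_shift (l : int) x h : trig l (x + h) =
  trig l x * cos (l%:~R * h) - trig (- l) x * sin (l%:~R * h).
Proof.
rewrite /trig; case: (ltgtP l 0) => l0.
- rewrite oppr_ge0 (ltW l0) mulrDr sinD mulrNz !mulNr !cosN !sinN; ring.
- rewrite oppr_ge0 leNgt l0 /= opprK mulrDr cosD; ring.
- by rewrite l0 oppr0 lexx !mul0r cos0 sin0; ring.
Qed.

Lemma trig_invariant (l : int) : circle_invariant (trig l).
Proof. by move=> x; rewrite trig_shift; have [-> ->] := cos_int_2pi l; ring. Qed.

Lemma trig_C2 (l : int) : C2circle (trig l) (fun x => - l%:~R * trig (- l) x)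
  (fun x => - l%:~R ^+ 2 * trig l x).
Proof.
split.
- exact: trig_invariant.
- by move=> x; exact: deriv_trig.
- move=> x; apply: (is_derive_eq (deriv_scale (- l%:~R) (deriv_trig (- l) x))).
  by rewrite opprK mulrNz; ring.
- by move=> x; apply: cvgM; [exact: cvg_cst|exact: (deriv_continuous (deriv_trig l))].
Qed.

Lemma trig_continuous (l : int) : continuous (trig l).
Proof. exact: deriv_continuous (deriv_trig l). Qed.

Lemma trig_measurable (l : int) : measurable_fun [set: T1] (trig l).
Proof. by apply: continuous_measurable_circle; exact: trig_continuous. Qed.

Lemma circle_int_cst (c : R) : \int[mu1]_x c = c * tp.
Proof.
have cc : continuous (fun _ : R => c) by move=> x; exact: cvg_cst.
by have := @circle_FTC R (fun x => c * x) (fun=> c) (deriv_lin c) cc; rewrite mulr0 subr0.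
Qed.

(** If the squares differ, Green's formula equates two different multiples of the integral. In the
    remaining case [m = - l] the product is a multiple of the derivative of the square of
    [trig l]. *)
Lemma trig_ortho (l m : int) : l != m -> \int[mu1]_x (trig l x * trig m x) = 0.
Proof.
move=> lm; have ilm a b : intg mu1 (fun x => trig a x * trig b x).
  apply: circle_intg; first by move=> x; rewrite !trig_invariant.
  by apply: continuousMR; exact: trig_continuous.
have [lm2|lm2] := eqVneq (l ^+ 2) (m ^+ 2); last first.
  have := circle_green (trig_C2 l) (trig_C2 m).
  have -> : \int[mu1]_x (- l%:~R ^+ 2 * trig l x * trig m x) =
      - l%:~R ^+ 2 * \int[mu1]_x (trig l x * trig m x).
    by rewrite -int_Z //; apply: eq_Rintegral => x _; rewrite mulrA.
  have -> : \int[mu1]_x (trig l x * (- m%:~R ^+ 2 * trig m x)) =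
      - m%:~R ^+ 2 * \int[mu1]_x (trig l x * trig m x).
    by rewrite -int_Z //; apply: eq_Rintegral => x _; rewrite mulrCA.
  move=> /eqP; rewrite -subr_eq0 -mulrBl mulf_eq0 => /orP[|/eqP //].
  rewrite opprK addrC subr_eq0 -!rmorphXn /= eqr_int.
  by rewrite eq_sym (negbTE lm2).
have ml : m = - l.
  by move/eqP : lm2; rewrite eqf_sqr => /orP[|/eqP ->]; [rewrite (negbTE lm)|rewrite opprK].
have l0 : l != 0 by apply: contra_neq lm => l0; rewrite ml l0 oppr0.
have l0' : l%:~R != 0 :> R by rewrite intr_eq0.
have := @circle_int_deriv _ (fun x => trig l x * trig l x)
  (fun x => - l%:~R * trig (- l) x * trig l x + trig l x * (- l%:~R * trig (- l) x)).
move=> /(_ _ _ _)/=.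
have H1 : circle_invariant (fun x => trig l x * trig l x) by move=> x; rewrite !trig_invariant.
have H2 : forall x, deriv (fun x => trig l x * trig l x) x
    (- l%:~R * trig (- l) x * trig l x + trig l x * (- l%:~R * trig (- l) x)).
  by move=> x; apply: deriv_mul; exact: deriv_trig.
have H3 : continuous (fun x => - l%:~R * trig (- l) x * trig l x + trig l x * (- l%:~R * trig (- l) x)).
  have c1 : continuous (fun x => - l%:~R * trig (- l) x).
    by move=> x; apply: cvgM; [exact: cvg_cst|exact: trig_continuous].
  by move=> x; apply: cvgD; [exact: (continuousMR c1 (@trig_continuous l))|exact: (continuousMR (@trig_continuous l) c1)].
move=> /(_ H1 H2 H3).
have -> : \int[mu1]_x (- l%:~R * trig (- l) x * trig l x + trig l x * (- l%:~R * trig (- l) x)) =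
   (- 2 * l%:~R) * \int[mu1]_x (trig l x * trig (- l) x).
  by rewrite -int_Z //; apply: eq_Rintegral => x _; ring.
by rewrite ml => /eqP; rewrite mulf_eq0 mulNr oppr_eq0 mulf_eq0 (negbTE l0') pnatr_eq0 => /eqP.
Qed.

(** For [l != 0], integration by parts equates the integrals of the squares of indices [l] and
    [- l], and these squares sum to 1. *)
Lemma trig_sqr_int (l : int) : \int[mu1]_x (trig l x * trig l x) =
  if l == 0 then tp else pi.
Proof.
case: eqP => [->|/eqP l0].
  under eq_Rintegral do rewrite trig0 mulr1.
  by rewrite circle_int_cst mul1r.
have ilm a b : intg mu1 (fun x => trig a x * trig b x).
  apply: circle_intg; first by move=> x; rewrite !trig_invariant.
  by apply: continuousMR; exact: trig_continuous.
have l0' : l%:~R != 0 :> R by rewrite intr_eq0.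
have h1 : \int[mu1]_x (trig l x * trig l x) + \int[mu1]_x (trig (- l) x * trig (- l) x) = tp.
  rewrite -int_D //.
  have -> : \int[mu1]_x (trig l x * trig l x + trig (- l) x * trig (- l) x) = \int[mu1]_x 1.
    by apply: eq_Rintegral => x _; rewrite -!expr2 trig_sqr.
  by rewrite circle_int_cst mul1r.
have h2 : \int[mu1]_x (trig l x * trig l x) = \int[mu1]_x (trig (- l) x * trig (- l) x).
  have := circle_dirichlet (trig_C2 l) (trig_C2 l).
  have -> : \int[mu1]_x (- l%:~R ^+ 2 * trig l x * trig l x) =
      - l%:~R ^+ 2 * \int[mu1]_x (trig l x * trig l x).
    by rewrite -int_Z //; apply: eq_Rintegral => x _; rewrite mulrA.
  have -> : \int[mu1]_x (- l%:~R * trig (- l) x * (- l%:~R * trig (- l) x)) =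
      l%:~R ^+ 2 * \int[mu1]_x (trig (- l) x * trig (- l) x).
    by rewrite -int_Z //; apply: eq_Rintegral => x _; ring.
  by rewrite mulNr => /oppr_inj /mulfI; apply; rewrite expf_neq0.
by rewrite -h2 in h1; lra.
Qed.

Lemma trig_scale_sqr (l : int) :
  trig_scale l ^+ 2 * (if l == 0 then tp else pi) = 1.
Proof.
have p0 := pi_gt0 R; have tp0 := @two_pi_gt0 R.
by rewrite /trig_scale; case: eqP => _; rewrite exprVn sqr_sqrtr ?ltW // mulVf // gt_eqF.
Qed.

Lemma trig_scale_gt0 (l : int) : 0 < trig_scale l.
Proof.
have p0 := pi_gt0 R; have tp0 := @two_pi_gt0 R.
by rewrite /trig_scale; case: eqP => _; rewrite invr_gt0 sqrtr_gt0.
Qed.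

Lemma trig_scale_le1 (l : int) : trig_scale l <= 1.
Proof.
have h := trig_scale_sqr l; have s0 := trig_scale_gt0 l.
have p2 := @pi_ge2 R.
rewrite -(@expr_le1 _ 2) ?(ltW s0) // -h ler_peMr ?sqr_ge0 //; case: ifP => _; lra.
Qed.

Lemma trig_basis_norm (l : int) x : `|trig_basis l x| <= 1 :> R.
Proof.
rewrite trig_basisE normrM (gtr0_norm (trig_scale_gt0 l)).
by rewrite mulr_ile1 ?trig_norm ?trig_scale_le1 ?(ltW (trig_scale_gt0 l)).
Qed.

Lemma trig_basis_L2 (l : int) : Lr mu1 2 (trig_basis l).
Proof.
have -> : trig_basis l = (fun x => trig_scale l * trig l x).
  by apply/funext => x; exact: trig_basisE.
apply: LrZ; apply: (@circle_bounded_Lr _ _ 1) => //; [exact: trig_measurable|exact: trig_norm].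
Qed.

Lemma trig_basis_ortho (l m : int) : inner mu1 (trig_basis l) (trig_basis m) = (l == m)%:R.
Proof.
have ilm a b : intg mu1 (fun x => trig a x * trig b x).
  apply: circle_intg; first by move=> x; rewrite !trig_invariant.
  by apply: continuousMR; exact: trig_continuous.
have -> : inner mu1 (trig_basis l) (trig_basis m) =
    trig_scale l * trig_scale m * \int[mu1]_x (trig l x * trig m x).
  by rewrite -int_Z //; apply: eq_Rintegral => x _; rewrite !trig_basisE; ring.
case: eqP => [<-|/eqP lm]; first by rewrite trig_sqr_int -expr2 trig_scale_sqr.
by rewrite trig_ortho // mulr0.
Qed.

(** Product-to-sum formulas: with equal frequencies in [x] and [t], the product splits into two
    travelling waves. *)
Lemma trig_dalembert (a b : int) : a ^+ 2 = b ^+ 2 ->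
  exists f g : R -> R, forall x t, trig a x * trig b t = f (x + t) + g (x - t).
Proof.
move=> /eqP; rewrite eqf_sqr => ab.
suff H (n : int) : 0 <= n -> forall s1 s2 : bool,
    exists f g : R -> R, forall x t,
    (if s1 then cos (n%:~R * x) else sin (n%:~R * x)) *
    (if s2 then cos (n%:~R * t) else sin (n%:~R * t)) = f (x + t) + g (x - t).
  have : `|a| = `|b| by move/orP : ab => [/eqP ->|/eqP ->]; rewrite ?normrN.
  move=> nab; have [f [g h]] := H `|a| (normr_ge0 a) (0 <= a) (0 <= b).
  exists f, g => x t; rewrite -h /trig; congr (_ * _).
    by case: ifP => [a0|/negbT]; [rewrite ger0_norm|rewrite -ltNge => /ltr0_norm ->].
  by rewrite nab; case: ifP => [a0|/negbT]; [rewrite ger0_norm|rewrite -ltNge => /ltr0_norm ->].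
move=> n0 [] [].
- exists (fun y => cos (n%:~R * y) / 2), (fun y => cos (n%:~R * y) / 2) => x t.
  by rewrite mulrDr mulrBr cosD cosB; lra.
- exists (fun y => sin (n%:~R * y) / 2), (fun y => - sin (n%:~R * y) / 2) => x t.
  by rewrite mulrDr mulrBr sinD sinB; lra.
- exists (fun y => sin (n%:~R * y) / 2), (fun y => sin (n%:~R * y) / 2) => x t.
  by rewrite mulrDr mulrBr sinD sinB; lra.
- exists (fun y => - cos (n%:~R * y) / 2), (fun y => cos (n%:~R * y) / 2) => x t.
  by rewrite mulrDr mulrBr cosD cosB; lra.
Qed.

End Trig.

(** * Eigenfunctions on the circle are trigonometric *)

Section Eigenfunctions.
Context {R : realType}.
Local Notation mu1 := (@circle_measure R).
Local Notation tp := (2 * pi : R).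
Local Notation deriv f x l := (is_derive (x : R) (1 : R) (f : R -> R) (l : R)).

(** For the fractional part [r] of [y], [cos (r * tp) = 1 - 2 * sin (r * pi) ^+ 2], and this sine is
    positive unless [r = 0]. *)
Lemma cos_eq1_int (y : R) : cos (y * tp) = 1 -> exists k : int, y = k%:~R.
Proof.
move=> h; exists (Num.floor y).
have /andP[h1 h2] := floor_itv y; rewrite intrD in h2.
set r := y - (Num.floor y)%:~R.
have p0 := pi_gt0 R.
have hr : cos (r * tp) = 1.
  rewrite /r mulrBl cosB h; have [-> ->] := @cos_int_2pi R (Num.floor y); ring.
have r0 : 0 <= r by rewrite /r; lra.
have r1 : r < 1 by rewrite /r; lra.
suff : r = 0 by rewrite /r => /eqP; rewrite subr_eq0 => /eqP.
apply/eqP; rewrite eq_le r0 andbT leNgt; apply/negP => rp.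
have sp : 0 < sin (r * pi).
  by apply: sin_gt0_pi; rewrite mulr_gt0 //= gtr_pMl.
have : cos (r * tp) = 1 - 2 * sin (r * pi) ^+ 2.
  have -> : r * tp = r * pi + r * pi by ring.
  by rewrite cosD -!expr2; have := cos2Dsin2 (r * pi); lra.
rewrite hr; have : 0 < sin (r * pi) ^+ 2 by rewrite exprn_gt0.
lra.
Qed.

Lemma laplace_eigen_C2 (nu0 : R) f : circle_invariant f -> laplace_eigen nu0 f ->
  C2circle f f^`()%classic (fun x => - nu0 * f x).
Proof.
move=> pf [df ddf hf].
have D1 x : deriv f x (f^`()%classic x) by rewrite derive1E; exact/derivableP.
split => // x.
  have -> : - nu0 * f x = derive1 f^`()%classic x by rewrite mulNr -hf opprK.
  by rewrite derive1E; exact/derivableP.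
by apply: cvgM; [exact: cvg_cst|exact: (deriv_continuous D1)].
Qed.

(** For positive [nu0] with root [s], the vector of [f] and [f' / s] rotates at constant speed [s],
    and undoing the rotation gives two constants of motion. Periodicity makes the rotation by
    [s * tp] fix a nonzero vector, hence [s] is an integer. For [l = 0] both basis functions
    coincide; the last clause fixes the representation. *)
Lemma laplace_eigen_trig (nu0 : R) f : circle_invariant f -> laplace_eigen nu0 f ->
  inner mu1 f f = 1 ->
  exists (l : nat) (a b : R), [/\ nu0 = l%:R ^+ 2,
    forall x, f x = a * trig_basis l%:Z x + b * trig_basis (- l%:Z) x &
    l = 0%N -> b = 0].
Proof.
move=> pf ef nf.
have hC := laplace_eigen_C2 pf ef.
have [_ d1 d2 _] := hC; have [pf1 _ cf cf1] := C2circle_facts hC.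
have iff : intg mu1 (fun x => f x * f x).
  by apply: circle_intg; [move=> x; rewrite pf|exact: continuousMR].
have nu_ge0 : 0 <= nu0.
  have := circle_dirichlet hC hC.
  have -> : \int[mu1]_x (- nu0 * f x * f x) = - nu0 * inner mu1 f f.
    by rewrite -int_Z //; apply: eq_Rintegral => x _; rewrite mulrA.
  rewrite nf mulr1 => /oppr_inj ->; apply: int_ge0 => x; rewrite -expr2; exact: sqr_ge0.
have [nu00|nu0n] := eqVneq nu0 0.
  (* Eigenvalue 0: [f] is affine, and periodicity makes it constant. *)
  have cst1 x : f^`()%classic x = f^`()%classic 0.
    apply: is_derive_0_is_cst => y; apply: (is_derive_eq (d2 y)).
    by rewrite nu00 oppr0 mul0r.
  have cst2 x : f x - f^`()%classic 0 * x = f 0 - f^`()%classic 0 * 0.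
    apply: (@is_derive_0_is_cst _ (fun y => f y - f^`()%classic 0 * y)) => y.
    apply: (is_derive_eq (is_deriveB (d1 y) (deriv_lin (f^`()%classic 0) y))).
    by rewrite cst1 subrr.
  have c0 : f^`()%classic 0 = 0.
    have := cst2 tp; rewrite -{1}[2 * pi]add0r pf mulr0 subr0 => /eqP.
    rewrite subr_eq addrC -subr_eq subrr eq_sym mulf_eq0 (gt_eqF two_pi_gt0) orbF.
    by move=> /eqP.
  exists 0%N, (f 0 / trig_scale 0), 0; split => //.
    by rewrite nu00 expr0n.
  move=> x; rewrite mul0r addr0 trig_basisE trig0 mulr1 divfK ?gt_eqF ?trig_scale_gt0 //.
  by have := cst2 x; rewrite c0 !mul0r !subr0.
set s := Num.sqrt nu0.
have s0 : 0 < s by rewrite sqrtr_gt0 lt0r nu0n nu_ge0.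
have sn : s != 0 by rewrite gt_eqF.
have s2 : nu0 = s ^+ 2 by rewrite sqr_sqrtr.
pose g x := f^`()%classic x / s.
have dg x : deriv g x (- s * f x).
  have := deriv_scale s^-1 (d2 x); rewrite /g.
  have -> : (fun y => f^`()%classic y / s) = (fun y => s^-1 * f^`()%classic y) by apply/funext => y; rewrite mulrC.
  by move=> h; apply: (is_derive_eq h); rewrite s2; field.
have d1' x : deriv f x (s * g x).
  by apply: (is_derive_eq (d1 x)); rewrite /g mulrC divfK.
have A_ x : f x * cos (s * x) - g x * sin (s * x) = f 0 * cos (s * 0) - g 0 * sin (s * 0).
  apply: (@is_derive_0_is_cst _ (fun x => f x * cos (s * x) - g x * sin (s * x))) => y.
  apply: (is_derive_eq (is_deriveB (deriv_mul (d1' y) (deriv_cos s y)) (deriv_mul (dg y) (deriv_sin s y)))).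
  ring.
have B_ x : f x * sin (s * x) + g x * cos (s * x) = f 0 * sin (s * 0) + g 0 * cos (s * 0).
  apply: (@is_derive_0_is_cst _ (fun x => f x * sin (s * x) + g x * cos (s * x))) => y.
  apply: (is_derive_eq (is_deriveD (deriv_mul (d1' y) (deriv_sin s y)) (deriv_mul (dg y) (deriv_cos s y)))).
  ring.
rewrite mulr0 cos0 sin0 !mulr0 !mulr1 subr0 in A_.
rewrite mulr0 cos0 sin0 !mulr0 !mulr1 add0r in B_.
have fE x : f x = f 0 * cos (s * x) + g 0 * sin (s * x).
  rewrite -[in RHS](A_ x) -[in RHS](B_ x).
  have c2 := cos2Dsin2 (s * x).
  have -> : forall C S : R, (f x * C - g x * S) * C + (f x * S + g x * C) * S = f x * (C ^+ 2 + S ^+ 2) by move=> C S; ring.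
  by rewrite c2 mulr1.
have pg : g tp = g 0 by rewrite /g -{1}[2 * pi]add0r pf1.
have pf0 : f tp = f 0 by rewrite -{1}[2 * pi]add0r pf.
have AB0 : 0 < f 0 ^+ 2 + g 0 ^+ 2.
  rewrite lt0r addr_ge0 ?sqr_ge0 // andbT paddr_eq0 ?sqr_ge0 // !sqrf_eq0.
  apply/negP => /andP[/eqP f00 /eqP g00]; move: nf.
  have -> : inner mu1 f f = 0; last by move=> /eqP; rewrite eq_sym oner_eq0.
  rewrite -[RHS](@int_0 _ _ R mu1); apply: eq_Rintegral => x _.
  by have -> : f x = 0; [rewrite (fE x) f00 g00 !mul0r addr0|rewrite mulr0].
have cos1 : cos (s * tp) = 1.
  have h1 := A_ tp; have h2 := B_ tp; rewrite pf0 pg in h1 h2.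
  have : (f 0 ^+ 2 + g 0 ^+ 2) * (cos (s * tp) - 1) = 0.
    have -> : (f 0 ^+ 2 + g 0 ^+ 2) * (cos (s * tp) - 1) =
      f 0 * (f 0 * cos (s * tp) - g 0 * sin (s * tp) - f 0) +
      g 0 * (f 0 * sin (s * tp) + g 0 * cos (s * tp) - g 0) by ring.
    by rewrite h1 h2 !subrr !mulr0 addr0.
  by move=> /eqP; rewrite mulf_eq0 (gt_eqF AB0) subr_eq0 => /eqP.
have [k kE] := cos_eq1_int cos1.
have k0 : 0 < k by rewrite -(ltr0z R) -kE.
have [l lE] : exists l : nat, k = l%:Z.
  by exists `|k|%N; rewrite gez0_abs // ltW.
rewrite lE in kE k0.
have l0 : (l%:Z == 0) = false by rewrite gt_eqF.
exists l, (f 0 / trig_scale l%:Z), (g 0 / trig_scale l%:Z); split.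
- by rewrite s2 kE.
- move=> x; rewrite !trig_basisE.
  have -> : trig_scale (- l%:Z) = trig_scale l%:Z :> R by rewrite /trig_scale oppr_eq0.
  have sc : trig_scale l%:Z != 0 :> R by rewrite gt_eqF ?trig_scale_gt0.
  rewrite !mulrA !divfK // fE kE /trig oppr_ge0 (ltW k0) opprK.
  by rewrite leNgt k0.
- by move=> l00; rewrite l00 in l0.
Qed.

Section Eigenbasis.
Variables (nu : nat -> R) (zeta : nat -> R -> R).
Hypothesis Hbasis : laplace_eigenbasis nu zeta.

Lemma zeta_invariant k : circle_invariant (zeta k).
Proof. by have [_ _ [h _ _] _] := Hbasis; have [] := h k. Qed.

Lemma zeta_L2 k : Lr mu1 2 (zeta k).
Proof. by have [_ _ [h _ _] _] := Hbasis; have [_ /Lfun_Lr] := h k; apply. Qed.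

Lemma zeta_ortho j k : inner mu1 (zeta j) (zeta k) = (j == k)%:R.
Proof. by have [_ _ [_ h _] _] := Hbasis. Qed.

Lemma zeta_C2 k : C2circle (zeta k) (zeta k)^`()%classic (fun x => - nu k * zeta k x).
Proof. by have [_ _ _ h] := Hbasis; exact: laplace_eigen_C2 (zeta_invariant k) (h k). Qed.

Lemma zeta_trig k : exists (l : nat) (a b : R), [/\ nu k = l%:R ^+ 2,
    forall x, zeta k x = a * trig_basis l%:Z x + b * trig_basis (- l%:Z) x &
    l = 0%N -> b = 0].
Proof.
have [_ _ _ h] := Hbasis; apply: laplace_eigen_trig (zeta_invariant k) (h k) _.
by rewrite zeta_ortho eqxx.
Qed.

Lemma zeta_inner k (l : nat) a b g :
  (forall x, zeta k x = a * trig_basis l%:Z x + b * trig_basis (- l%:Z) x) ->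
  Lr mu1 2 g ->
  inner mu1 (zeta k) g = a * inner mu1 (trig_basis l%:Z) g + b * inner mu1 (trig_basis (- l%:Z)) g.
Proof.
move=> hz hg; have -> : zeta k = (fun x => a * trig_basis l%:Z x + b * trig_basis (- l%:Z) x).
  exact/funext.
rewrite innerDl ?innerZl //; try exact: trig_basis_L2.
- by apply: LrZ; exact: trig_basis_L2.
- by apply: LrZ; exact: trig_basis_L2.
Qed.

Lemma zeta_trig_ortho k (m : int) : nu k != m%:~R ^+ 2 ->
  inner mu1 (zeta k) (trig_basis m) = 0.
Proof.
have [l [a [b [hn hz _]]]] := zeta_trig k; rewrite hn => nm.
rewrite (zeta_inner hz (trig_basis_L2 m)) !trig_basis_ortho.
case: eqP => [e|_]; first by rewrite -e eqxx in nm.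
case: eqP => [e|_]; first by rewrite -e mulrNz sqrrN eqxx in nm.
by rewrite !mulr0 addr0.
Qed.

(** A unit vector in the span of two orthonormal functions has coefficients of modulus at most 1.
    The last sum is only bounded below: for [l = 0] its two terms coincide and it equals 2. *)
Lemma zeta_coefs k : exists (l : nat) (a b : R), [/\ nu k = l%:R ^+ 2,
    forall x, zeta k x = a * trig_basis l%:Z x + b * trig_basis (- l%:Z) x,
    `|a| <= 1, `|b| <= 1 &
    1 <= inner mu1 (zeta k) (trig_basis l%:Z) ^+ 2 + inner mu1 (zeta k) (trig_basis (- l%:Z)) ^+ 2].
Proof.
have [l [a [b [hn hz hb]]]] := zeta_trig k; exists l, a, b.
have z1 : inner mu1 (zeta k) (zeta k) = 1 by rewrite zeta_ortho eqxx.
have bes (m : int) : inner mu1 (zeta k) (trig_basis m) ^+ 2 <= 1.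
  have := bessel (@trig_basis_L2 R) (@trig_basis_ortho R) (s := [:: m]) isT (zeta_L2 k).
  by rewrite z1 big_seq1.
have abs1 (x : R) : x ^+ 2 <= 1 -> `|x| <= 1.
  by move=> h; rewrite -(@expr_le1 _ 2) // real_normK ?num_real.
have hl := zeta_inner hz (trig_basis_L2 l%:Z).
have hml := zeta_inner hz (trig_basis_L2 (- l%:Z)).
have hzz := zeta_inner hz (zeta_L2 k).
rewrite !(innerC mu1 _ (zeta k)) z1 in hzz.
rewrite !trig_basis_ortho eqxx in hl; rewrite !trig_basis_ortho eqxx in hml.
have [l0|l0] := eqVneq l 0%N.
  move: (hb l0) => b0.
  have ha : inner mu1 (zeta k) (trig_basis l%:Z) = a by rewrite hl b0 mul0r addr0 mulr1.
  split => //; first by apply: abs1; rewrite -ha.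
    by rewrite b0 normr0.
  rewrite b0 mul0r addr0 ha in hzz; rewrite ha expr2 -hzz lerDl; exact: sqr_ge0.
have ne : (l%:Z == - l%:Z) = false by rewrite -addr_eq0 -PoszD eqz_nat addn_eq0 andbb (negbTE l0).
rewrite [_ == l%:Z]eq_sym ne mulr0 mulr1 addr0 in hl.
rewrite ne mulr0 mulr1 add0r in hml.
split => //.
- by apply: abs1; rewrite -hl.
- by apply: abs1; rewrite -hml.
- by rewrite hl hml in hzz *; rewrite !expr2 -hzz.
Qed.

(** A sup bound uniform in [k] and valid for every eigenbasis; the sup norm estimates for sums of
    modes rest on it. *)
Lemma zeta_bound k x : `|zeta k x| <= 2.
Proof.
have [l [a [b [_ -> ha hb _]]]] := zeta_coefs k.
have t1 := trig_basis_norm l%:Z x; have t2 := trig_basis_norm (- l%:Z) x.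
apply: le_trans (ler_normD _ _) _; rewrite !normrM.
apply: (@le_trans _ _ (1 + 1)); last by lra.
by apply: lerD; exact: mulr_ile1.
Qed.

(** Each [zeta k] of frequency [l] contributes at least 1 to the Bessel sums of [trig_basis l] and
    [trig_basis (- l)] together, and each of these two sums is at most 1. *)
Lemma zeta_multiplicity (l : nat) (s : seq nat) : uniq s ->
  (forall k, k \in s -> nu k = l%:R ^+ 2) -> (size s <= 2)%N.
Proof.
move=> us hs; rewrite -(ler_nat R).
have bes (m : int) : \sum_(k <- s) inner mu1 (zeta k) (trig_basis m) ^+ 2 <= 1.
  have := bessel zeta_L2 zeta_ortho us (trig_basis_L2 m).
  rewrite trig_basis_ortho eqxx; apply: le_trans.
  by rewrite le_eqVlt; apply/orP; left; apply/eqP; apply: eq_bigr => k _; rewrite innerC.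
apply: (@le_trans _ _ (\sum_(k <- s) (inner mu1 (zeta k) (trig_basis l%:Z) ^+ 2
    + inner mu1 (zeta k) (trig_basis (- l%:Z)) ^+ 2))).
  rewrite -sum1_size natr_sum big_seq [leRHS]big_seq; apply: ler_sum => k ks.
  have [l' [a [b [hn _ _ _]]]] := zeta_coefs k.
  suff -> : l' = l by [].
  have := hs k ks; rewrite hn => /eqP.
  by rewrite eqrXn2 // eqr_nat => /eqP.
rewrite big_split /=; have := bes l%:Z; have := bes (- l%:Z); lra.
Qed.

Lemma zeta_span f : L2_circle f -> in_closed_span mu1 setT zeta f.
Proof. by have [_ _ [_ _ h] _] := Hbasis; exact: h. Qed.

Lemma zeta_complete f : L2_circle f -> (forall k, inner mu1 f (zeta k) = 0) ->
  {ae mu1, forall x, f x = 0}.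
Proof.
move=> hf h; have [_ /Lfun_Lr h2] := hf.
by apply: (closed_span_eq0 zeta_L2 zeta_ortho (h2 _) (zeta_span hf)).
Qed.

(** The given basis is complete and consists of trigonometric combinations, so the trigonometric
    system inherits completeness. *)
Lemma trig_complete f : L2_circle f -> (forall l, inner mu1 f (trig_basis l) = 0) ->
  {ae mu1, forall x, f x = 0}.
Proof.
move=> hf h; have [_ /Lfun_Lr h2] := hf.
apply: zeta_complete => // k; have [l [a [b [_ hz _]]]] := zeta_trig k.
rewrite innerC (zeta_inner hz (h2 _)) // !(innerC mu1 _ f) !h; ring.
Qed.

Lemma trig_basis_invariant (l : int) : circle_invariant (@trig_basis R l).
Proof. by move=> x; rewrite !trig_basisE trig_invariant. Qed.

Lemma trig_L2_circle (l : int) : L2_circle (@trig_basis R l).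
Proof. by split; [exact: trig_basis_invariant|apply/Lfun_Lr => //; exact: trig_basis_L2]. Qed.

(** In the expansion of [trig_basis n] only the [zeta k] with eigenvalue [n ^+ 2] occur. *)
Lemma trig_inner0 f (n : int) : Lr mu1 2 f ->
  (forall k, nu k = n%:~R ^+ 2 -> inner mu1 f (zeta k) = 0) ->
  inner mu1 f (trig_basis n) = 0.
Proof.
move=> hf h; rewrite innerC.
apply: (inner_eq0_coef zeta_L2 zeta_ortho (trig_basis_L2 n) hf (zeta_span (trig_L2_circle n))).
move=> k _; have [e|ne] := eqVneq (nu k) (n%:~R ^+ 2); first by right; exact: h.
by left; rewrite innerC zeta_trig_ortho.
Qed.

End Eigenbasis.

End Eigenfunctions.

(** * The torus and its modes *)

Section AlmostEverywhere.
Context {d} {T : measurableType d} {R : realType}.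
Variable mu : {measure set T -> \bar R}.
Implicit Types f g : T -> R.

Lemma ae_imp (P Q : T -> Prop) : {ae mu, forall x, P x} -> (forall x, P x -> Q x) ->
  {ae mu, forall x, Q x}.
Proof. by move=> hP hPQ; apply: filterS hP. Qed.

Lemma ae_imp2 (P Q S : T -> Prop) : {ae mu, forall x, P x} -> {ae mu, forall x, Q x} ->
  (forall x, P x -> Q x -> S x) -> {ae mu, forall x, S x}.
Proof. by move=> hP hQ hS; apply: filterS2 hP hQ. Qed.

Lemma intg_le_ae f g : measurable_fun setT f -> {ae mu, forall x, `|f x| <= g x} ->
  intg mu g -> intg mu f.
Proof.
move=> mf fg ig; have mg := intg_measurable ig.
apply/integrableP; split; first exact/measurable_EFinP.
have /integrableP[_] := ig; apply: le_lt_trans.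
apply: ae_ge0_le_integral => //.
- by apply: measurableT_comp => //; exact/measurable_EFinP.
- by apply: measurableT_comp => //; exact/measurable_EFinP.
by apply: filterS fg => x h _; rewrite !abse_EFin lee_fin (le_trans h) // ler_norm.
Qed.

Lemma bounded_intg f (C : R) : (mu setT < +oo)%E -> measurable_fun setT f ->
  (forall x, `|f x| <= C) -> intg mu f.
Proof.
move=> mufin mf hf; apply: (measurable_bounded_integrable measurableT) => //.
exists C; split; first exact: num_real.
by move=> M CM x _ /=; rewrite (le_trans (hf x)) // ltW.
Qed.

Lemma bounded_Lr f (C r : R) : (mu setT < +oo)%E -> 0 <= r -> measurable_fun setT f ->
  (forall x, `|f x| <= C) -> Lr mu r f.
Proof.
move=> mufin r0 mf hf; split => //; apply: (@bounded_intg _ (C `^ r)) => //.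
  exact: measurable_normpowR.
move=> x; rewrite ger0_norm ?powR_ge0 //; apply: ge0_ler_powR => //; rewrite nnegrE //.
exact: le_trans (hf x).
Qed.

Lemma Lr_mul_bounded f g (C r : R) : 0 <= r -> measurable_fun setT g ->
  (forall x, `|g x| <= C) -> Lr mu r f -> Lr mu r (fun x => f x * g x).
Proof.
move=> r0 mg hg [mf hf].
apply: (Lr_le (g := fun x => C * f x) r0); last exact: LrZ.
  exact: measurable_funM.
move=> x; rewrite !normrM mulrC ler_wpM2r //.
by rewrite (le_trans (hg x)) // ler_norm.
Qed.

End AlmostEverywhere.

(** * Fubini and partial Fourier coefficients on the torus *)

Section Torus.
Context {R : realType}.
Local Notation mu1 := (@circle_measure R).
Local Notation mu2 := (@torus_measure R).
Local Notation T1 := (measurableTypeR R).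
Local Notation T2 := (T1 * T1)%type.

Lemma circle_measure_fin : (mu1 setT < +oo)%E.
Proof. by rewrite [X in (X < _)%E]circle_measure_setT ltry. Qed.

Lemma torus_measure_fin : (mu2 setT < +oo)%E.
Proof. by rewrite [X in (X < _)%E]torus_measure_setT ltry. Qed.

Lemma L2_torusP (u : R * R -> R) : L2_torus u <-> torus_invariant u /\ Lr mu2 2 u.
Proof. by split => -[h1 h2]; split => //; apply/Lfun_Lr. Qed.

Lemma L2_circleP (f : R -> R) : L2_circle f <-> circle_invariant f /\ Lr mu1 2 f.
Proof. by split => -[h1 h2]; split => //; apply/Lfun_Lr. Qed.

Lemma measurable_tensor (a b : R -> R) : measurable_fun [set: T1] a ->
  measurable_fun [set: T1] b -> measurable_fun [set: T2] (fun z : T2 => a z.1 * b z.2).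
Proof.
move=> ma mb; apply: measurable_funM.
  exact: (measurableT_comp ma (@measurable_fst _ _ T1 T1)).
exact: (measurableT_comp mb (@measurable_snd _ _ T1 T1)).
Qed.

Lemma torus_fubini (f : R * R -> R) : intg mu2 f ->
  \int[mu2]_z f z = \int[mu1]_x \int[mu1]_t f (x, t).
Proof.
move=> hf; rewrite /Rintegral; congr fine.
have := @integral12_prod_meas1 _ _ T1 T1 R mu1 mu1 (EFin \o f) hf.
have h := @integrable_fubini_F _ _ T1 T1 R mu1 mu1 (EFin \o f) hf.
move=> e; rewrite -[LHS]e; apply: ae_eq_integral => //.
- by move/measurable_int : h.
- apply/measurable_EFinP; apply: (measurableT_comp (@fine_measurable R setT measurableT)).
  by move/measurable_int : h.
apply: (ae_imp (mu := mu1) (integrable_ae measurableT h)) => x /(_ I) hx _.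
by rewrite fineK.
Qed.

Lemma torus_section_intg (f : R * R -> R) : intg mu2 f ->
  {ae mu1, forall x, intg mu1 (fun t => f (x, t))}.
Proof.
move=> hf; have := @ae_integrable1 _ _ T1 T1 R mu1 mu1 (EFin \o f) hf.
by apply: filterS.
Qed.

Lemma torus_section_intg_int (f : R * R -> R) : intg mu2 f ->
  intg mu1 (fun x => \int[mu1]_t f (x, t)).
Proof.
move=> hf; have h := @integrable_fubini_F _ _ T1 T1 R mu1 mu1 (EFin \o f) hf.
have mh : measurable_fun [set: T1] (fun x => \int[mu1]_t f (x, t)).
  apply: (measurableT_comp (@fine_measurable R setT measurableT)).
  by move/measurable_int : h.
apply/integrableP; split; first exact/measurable_EFinP.
have /integrableP[_] := h; apply: le_lt_trans.
rewrite le_eqVlt; apply/orP; left; apply/eqP; apply: ae_eq_integral => //.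
- by apply: measurableT_comp => //; exact/measurable_EFinP.
- by apply: measurableT_comp => //; move/measurable_int : h.
apply: (ae_imp (mu := mu1) (integrable_ae measurableT h)) => x /(_ I) hx _.
have e : (\int[mu1]_t f (x, t))%:E = fubini_F mu1 (EFin \o f) x by rewrite /Rintegral fineK.
exact: (congr1 (@abse R) e).
Qed.

Lemma int_tensor (a b : R -> R) : intg mu2 (fun z => a z.1 * b z.2) ->
  intg mu1 b -> intg mu1 a ->
  \int[mu2]_z (a z.1 * b z.2) = \int[mu1]_x a x * \int[mu1]_t b t.
Proof.
move=> h hb ha; rewrite torus_fubini //.
have -> : \int[mu1]_x \int[mu1]_t (a x * b t) = \int[mu1]_x ((\int[mu1]_t b t) * a x).
  by apply: eq_Rintegral => x _; rewrite int_Z // mulrC.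
by rewrite int_Z // mulrC.
Qed.

(** Cauchy-Schwarz on almost every section bounds the square of the partial coefficient by a
    multiple of the section's squared L^2 norm, which is integrable in [x]. Periodicity holds at
    every [x], since the partial integral is formed pointwise. *)
Lemma torus_section_L2 (u : R * R -> R) (b : R -> R) (C : R) : L2_torus u ->
  measurable_fun [set: T1] b -> (forall t, `|b t| <= C) ->
  L2_circle (fun x => \int[mu1]_t (u (x, t) * b t)) /\
  forall (a : R -> R) D, measurable_fun [set: T1] a -> (forall x, `|a x| <= D) ->
    inner mu1 (fun x => \int[mu1]_t (u (x, t) * b t)) a = inner mu2 u (fun z => a z.1 * b z.2).
Proof.
move=> /L2_torusP[pu hu] mb hb.
have mb2 : measurable_fun [set: T2] (fun z : T2 => b z.2).
  exact: (measurableT_comp mb (@measurable_snd _ _ T1 T1)).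
have hub : Lr mu2 2 (fun z => u z * b z.2) by apply: (Lr_mul_bounded (C := C)) => // z; exact: hb.
have one2 : Lr mu2 2 (fun _ => 1).
  apply: (bounded_Lr (C := 1)) => //; first exact: torus_measure_fin.
  by move=> x; rewrite normr1.
have iub : intg mu2 (fun z => u z * b z.2).
  by have := L2_mul hub one2; under eq_fun do rewrite mulr1.
have usq : intg mu2 (fun z => u z * u z) by exact: L2_mul.
have hb2 : Lr mu1 2 b.
  by apply: (bounded_Lr (C := C)) => //; exact: circle_measure_fin.
have iH := torus_section_intg_int iub.
have mH := intg_measurable iH.
have H2 : Lr mu1 2 (fun x => \int[mu1]_t (u (x, t) * b t)).
  split => //.
  apply: (intg_le_ae (mu := mu1) (g := fun x => (inner mu1 b b) * \int[mu1]_t (u (x, t) * u (x, t)))).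
  - exact: measurable_normpowR.
  - apply: (ae_imp (mu := mu1) (torus_section_intg usq)) => x hx.
    rewrite ger0_norm ?powR_ge0 // powR_mulrn // mulrC.
    have ux2 : Lr mu1 2 (fun t => u (x, t)).
      split; first exact: (measurableT_comp hu.1 (measurable_pair1 (x : T1))).
      by move: hx; under eq_fun do rewrite -expr2 -real_normK ?num_real // -powR_mulrn //.
    have := inner_le ux2 hb2.
    rewrite -(@ler_pXn2r _ 2) ?nnegrE ?mulr_ge0 ?nr_ge0 // exprMn !nr2E.
    exact.
  - by apply: intgZ; exact: (torus_section_intg_int usq).
split.
  apply/L2_circleP; split => // x.
  by apply: eq_Rintegral => t _; rewrite (pu x t).1.
move=> a D ma ha.
have ma2 : measurable_fun [set: T2] (fun z : T2 => a z.1).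
  exact: (measurableT_comp ma (@measurable_fst _ _ T1 T1)).
have iuab : intg mu2 (fun z => u z * (a z.1 * b z.2)).
  have : Lr mu2 2 (fun z => (u z * b z.2) * a z.1).
    by apply: (Lr_mul_bounded (C := D)) => // z; exact: ha.
  move=> h; have := L2_mul h one2; under eq_fun do rewrite mulr1 -mulrA (mulrC (b _)).
  exact.
rewrite /inner (torus_fubini iuab).
apply: int_ae_eq.
- exact: measurable_funM.
- by apply: intg_measurable; exact: torus_section_intg_int iuab.
apply: (ae_imp (mu := mu1) (torus_section_intg iub)) => x hx.
rewrite mulrC -int_Z //; apply: eq_Rintegral => t _ /=; ring.
Qed.

End Torus.

(** * Orthonormality and completeness of the modes *)

Section Modes.
Context {R : realType}.
Variables (nu : nat -> R) (zeta : nat -> R -> R).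
Hypothesis Hbasis : laplace_eigenbasis nu zeta.
Local Notation mu1 := (@circle_measure R).
Local Notation mu2 := (@torus_measure R).
Local Notation T1 := (measurableTypeR R).
Local Notation T2 := (T1 * T1)%type.
Local Notation mode := (mode zeta).
Local Notation coef := (coef zeta).
Local Notation lam := (lam nu).

Lemma zeta_measurable k : measurable_fun [set: T1] (zeta k).
Proof. exact: (zeta_L2 Hbasis k).1. Qed.

Lemma trig_basis_measurable l : measurable_fun [set: T1] (@trig_basis R l).
Proof. exact: (trig_basis_L2 l).1. Qed.

Lemma mode_measurable i : measurable_fun [set: T2] (mode i).
Proof. by apply: measurable_tensor; [exact: zeta_measurable|exact: trig_basis_measurable]. Qed.

Lemma mode_bound i z : `|mode i z| <= 2.
Proof.
rewrite /Defs.mode normrM; apply: (@le_trans _ _ (2 * 1)); last by rewrite mulr1.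
by apply: ler_pM => //; [exact: zeta_bound Hbasis _ _|exact: trig_basis_norm].
Qed.

Lemma mode_invariant i : torus_invariant (mode i).
Proof.
move=> x t; rewrite /Defs.mode /=; split.
  by rewrite (zeta_invariant Hbasis i.1 x).
by rewrite trig_basis_invariant.
Qed.

Lemma mode_Lr r i : 0 <= r -> Lr mu2 r (mode i).
Proof.
move=> r0; apply: (bounded_Lr (C := 2)) => //.
- exact: torus_measure_fin.
- exact: mode_measurable.
- exact: mode_bound.
Qed.

Lemma mode_L2 i : Lr mu2 2 (mode i). Proof. exact: mode_Lr. Qed.

Lemma mode_L2_torus i : L2_torus (mode i).
Proof. by apply/L2_torusP; split; [exact: mode_invariant|exact: mode_L2]. Qed.

Lemma mode_ortho i j : inner mu2 (mode i) (mode j) = (i == j)%:R.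
Proof.
have h := L2_mul (mode_L2 i) (mode_L2 j).
have e : (fun z => mode i z * mode j z) =
   (fun z => (zeta i.1 z.1 * zeta j.1 z.1) * (trig_basis i.2 z.2 * trig_basis j.2 z.2)).
  by apply/funext => z; rewrite /Defs.mode; ring.
have -> : inner mu2 (mode i) (mode j) = inner mu1 (zeta i.1) (zeta j.1) *
    inner mu1 (trig_basis i.2) (trig_basis j.2).
  rewrite /inner -(int_tensor (a := fun x => zeta i.1 x * zeta j.1 x)
    (b := fun t => trig_basis i.2 t * trig_basis j.2 t)).
  - by apply: eq_Rintegral => z _; rewrite /Defs.mode; ring.
  - by rewrite -[X in intg _ X]e.
  - by apply: L2_mul; exact: trig_basis_L2.
  - by apply: L2_mul; exact: zeta_L2 Hbasis _.
rewrite (zeta_ortho Hbasis) trig_basis_ortho -natrM mulnb.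
by case: i j {h e} => [k l] [k' l'].
Qed.

(** Separation of variables: completeness in [x] kills each partial coefficient [H l] almost
    everywhere, hence all the countably many of them for almost every [x]; completeness in [t] then
    kills the section. *)
Lemma mode_complete u : L2_torus u -> (forall i, coef u i = 0) ->
  {ae mu2, forall z, u z = 0}.
Proof.
move=> hu h0.
pose H (l : int) x := \int[mu1]_t (u (x, t) * trig_basis l t).
have H0 l : {ae mu1, forall x, H l x = 0}.
  have [h1 h2] := torus_section_L2 hu (trig_basis_measurable l) (trig_basis_norm l).
  apply: (zeta_complete Hbasis h1) => k.
  rewrite (h2 _ 2 (zeta_measurable k) (zeta_bound Hbasis k)).
  exact: (h0 (k, l)).
have H0' : {ae mu1, forall x, forall l, H l x = 0}.
  have h1 : {ae mu1, forall x, forall n : nat, H n%:Z x = 0} by apply/ae_foralln => n; exact: H0.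
  have h2 : {ae mu1, forall x, forall n : nat, H (- n%:Z) x = 0} by apply/ae_foralln => n; exact: H0.
  apply: (ae_imp2 (mu := mu1) h1 h2) => x hx1 hx2 [n|n]; first exact: hx1.
  by rewrite NegzE; exact: hx2.
have /L2_torusP[pu hu2] := hu.
have usq : intg mu2 (fun z => u z * u z) by exact: L2_mul.
apply: (inner_eq0_ae hu2); rewrite /inner (torus_fubini usq).
rewrite -[RHS](@int_0 _ _ R mu1); apply: int_ae_eq.
- by apply: intg_measurable; exact: torus_section_intg_int usq.
- exact: measurable_cst.
apply: (ae_imp2 (mu := mu1) H0' (torus_section_intg usq)) => x hx ix.
have mx : measurable_fun [set: T1] (fun t => u (x, t)).
  exact: (measurableT_comp hu2.1 (measurable_pair1 (x : T1))).
have ux2 : Lr mu1 2 (fun t => u (x, t)).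
  split => //.
  by move: ix; under eq_fun do rewrite -expr2 -real_normK ?num_real // -powR_mulrn //.
have : {ae mu1, forall t, u (x, t) = 0}.
  apply: (trig_complete Hbasis) => [|l]; last exact: hx.
  by apply/L2_circleP; split => // t; rewrite (pu x t).2.
move=> u0; rewrite -[RHS](@int_0 _ _ R mu1); apply: int_ae_eq.
- exact: measurable_funM.
- exact: measurable_cst.
by apply: (ae_imp (mu := mu1) u0) => t ->; rewrite mul0r.
Qed.

(** [trig_basis a] only involves [zeta k] with eigenvalue [a ^+ 2], and combined with the frequency
    [b] these give modes with [lam] different from 0. *)
Lemma ker_trig_ortho u (a b : int) : L2_torus u -> (forall i, lam i != 0 -> coef u i = 0) ->
  a ^+ 2 != b ^+ 2 -> inner mu2 u (fun z => trig_basis a z.1 * trig_basis b z.2) = 0.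
Proof.
move=> hu h0 ab.
have [h1 h2] := torus_section_L2 hu (trig_basis_measurable b) (trig_basis_norm b).
rewrite -(h2 _ 1 (trig_basis_measurable a) (trig_basis_norm a)).
have /L2_circleP[_ h12] := h1.
apply: (trig_inner0 Hbasis h12) => k hk.
rewrite (h2 _ 2 (zeta_measurable k) (zeta_bound Hbasis k)).
apply: (h0 (k, b)); rewrite /Defs.lam /= hk subr_eq0 -!rmorphXn /= eqr_int //.
Qed.

End Modes.

(** * The kernel of the wave operator *)

Section TorusShift.
Context {R : realType}.
Local Notation mu1 := (@circle_measure R).
Local Notation mu2 := (@torus_measure R).
Local Notation T1 := (measurableTypeR R).
Local Notation T2 := (T1 * T1)%type.

Definition tshift (h : R * R) (z : R * R) : R * R := (z.1 + h.1, z.2 + h.2).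

Lemma tshift_measurable h : measurable_fun [set: T2] (tshift h : T2 -> T2).
Proof. exact: measurable_shift2. Qed.

Lemma tshift_invariant {V : Type} (f : R * R -> V) h : torus_invariant f ->
  torus_invariant (fun z => f (tshift h z)).
Proof.
move=> pf x t; rewrite /tshift /=; split.
  by rewrite -[in RHS](pf (x + h.1) (t + h.2)).1; congr (f (_, _)); ring.
by rewrite -[in RHS](pf (x + h.1) (t + h.2)).2; congr (f (_, _)); ring.
Qed.

Lemma tshift_tshift h k z : tshift h (tshift k z) = tshift (k.1 + h.1, k.2 + h.2) z.
Proof. by rewrite /tshift /= !addrA. Qed.

Lemma ge0_integral_tshift (f : R * R -> \bar R) h : torus_invariant f ->
  measurable_fun [set: T2] f -> (forall z, (0 <= f z)%E) ->
  (\int[mu2]_z f (tshift h z) = \int[mu2]_z f z)%E.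
Proof. exact: ge0_torus_translate. Qed.

Lemma intg_tshift (f : R * R -> R) h : torus_invariant f -> intg mu2 f ->
  intg mu2 (fun z => f (tshift h z)).
Proof.
move=> pf hf; have mf := intg_measurable hf.
apply/integrableP; split.
  by apply/measurable_EFinP; exact: (measurableT_comp mf (tshift_measurable h)).
have /integrableP[_] := hf; apply: le_lt_trans.
have := @ge0_integral_tshift (fun z => `|(f z)%:E|)%E h.
move=> -> //; first by move=> x t; rewrite !(pf x t).1 !(pf x t).2.
by apply: measurableT_comp => //; exact/measurable_EFinP.
Qed.

Lemma int_tshift (f : R * R -> R) h : torus_invariant f -> measurable_fun [set: T2] f ->
  \int[mu2]_z f (tshift h z) = \int[mu2]_z f z.
Proof. exact: torus_translate. Qed.

Lemma Lr_tshift r (f : R * R -> R) h : torus_invariant f -> Lr mu2 r f ->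
  Lr mu2 r (fun z => f (tshift h z)).
Proof.
move=> pf [mf hf]; split; first exact: (measurableT_comp mf (tshift_measurable h)).
apply: (@intg_tshift (fun z => `|f z| `^ r)) => //.
by move=> x t; rewrite !(pf x t).1 !(pf x t).2.
Qed.

(** The same measure, equipped with the finiteness structure under which Tonelli's theorem is
    applied. *)
Let torus_measure_finite : {finite_measure set T2 -> \bar R} :=
  mfrestr measurableT (@torus_measure_fin R).

Let torus_measure_finiteE (f : T2 -> \bar R) :
  (\int[torus_measure_finite]_z f z = \int[mu2]_z f z)%E.
Proof. by apply: eq_measure_integral => A mA _; rewrite /= /mfrestr /mrestr /= setIT. Qed.

Lemma ge0_circle_torus_swap (K : T1 * T2 -> \bar R) : measurable_fun [set: T1 * T2] K ->
  (forall x, (0 <= K x)%E) ->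
  measurable_fun [set: T2] (fun z => \int[mu1]_a K (a, z))%E /\
  (\int[mu1]_a \int[mu2]_z K (a, z) = \int[mu2]_z \int[mu1]_a K (a, z))%E.
Proof.
move=> mK K0; split.
  exact: (@measurable_fun_fubini_tonelli_G _ _ T1 T2 R mu1 K mK K0).
rewrite -[RHS]torus_measure_finiteE.
rewrite -(@fubini_tonelli _ _ T1 T2 R mu1 torus_measure_finite K mK K0).
by apply: eq_integral => a _; rewrite torus_measure_finiteE.
Qed.

Lemma ge0_torus_torus_swap (K : T2 * T2 -> \bar R) : measurable_fun [set: T2 * T2] K ->
  (forall x, (0 <= K x)%E) ->
  measurable_fun [set: T2] (fun z => \int[mu2]_h K (h, z))%E /\
  (\int[mu2]_h \int[mu2]_z K (h, z) = \int[mu2]_z \int[mu2]_h K (h, z))%E.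
Proof.
move=> mK K0; split.
  have := @measurable_fun_fubini_tonelli_G _ _ T2 T2 R torus_measure_finite K mK K0.
  by apply: eq_measurable_fun => z _; rewrite /fubini_G torus_measure_finiteE.
rewrite -[RHS]torus_measure_finiteE -[LHS]torus_measure_finiteE.
transitivity (\int[torus_measure_finite]_h \int[torus_measure_finite]_z K (h, z))%E.
  by apply: eq_integral => h _; rewrite torus_measure_finiteE.
transitivity (\int[torus_measure_finite]_z \int[torus_measure_finite]_h K (h, z))%E.
  exact: (@fubini_tonelli _ _ T2 T2 R torus_measure_finite torus_measure_finite K mK K0).
by apply: eq_integral => z _; rewrite torus_measure_finiteE.
Qed.

End TorusShift.

(** * Vanishing mixed differences of kernel elements *)

Section Parallelogram.
Context {R : realType}.
Variables (nu : nat -> R) (zeta : nat -> R -> R).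
Hypothesis Hbasis : laplace_eigenbasis nu zeta.
Local Notation mu2 := (@torus_measure R).
Local Notation T1 := (measurableTypeR R).
Local Notation T2 := (T1 * T1)%type.
Local Notation coef := (coef zeta).
Local Notation lam := (lam nu).

Definition trig2 (a b : int) (z : R * R) : R := trig a z.1 * trig b z.2.

Lemma trig2_measurable a b : measurable_fun [set: T2] (trig2 a b).
Proof. by apply: measurable_tensor; exact: trig_measurable. Qed.

Lemma trig2_norm a b z : `|trig2 a b z| <= 1.
Proof. by rewrite /trig2 normrM mulr_ile1 // trig_norm. Qed.

Lemma trig2_invariant a b : torus_invariant (trig2 a b).
Proof. by move=> x t; rewrite /trig2 /= !trig_invariant. Qed.

Lemma trig2_L2 a b : Lr mu2 2 (trig2 a b).
Proof.
apply: (bounded_Lr (C := 1)) => //.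
- exact: torus_measure_fin.
- exact: trig2_measurable.
- exact: trig2_norm.
Qed.

Lemma trig2_complete u : L2_torus u -> (forall a b, inner mu2 u (trig2 a b) = 0) ->
  {ae mu2, forall z, u z = 0}.
Proof.
move=> hu h0; apply: (mode_complete Hbasis hu) => -[k l].
have /L2_torusP[_ hu2] := hu.
have [m [a [b [_ hz _]]]] := zeta_trig Hbasis k.
pose s := trig_scale m%:Z : R; pose s' := trig_scale l : R.
have e : mode zeta (k, l) = (fun z => a * s * s' * trig2 m%:Z l z + b * s * s' * trig2 (- m%:Z) l z).
  apply/funext => z; rewrite /mode /trig2 /= hz !trig_basisE.
  have -> : trig_scale (- m%:Z) = s :> R by rewrite /s /trig_scale oppr_eq0.
  by rewrite -/s -/s'; ring.
rewrite /Defs.coef innerC e innerDl //; [|exact/LrZ/trig2_L2|exact/LrZ/trig2_L2].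
by rewrite !innerZl ?(innerC mu2 _ u) ?h0 ?mulr0 ?addr0 //; exact: trig2_L2.
Qed.

(** Translating only mixes the indices [a], [- a] and [b], [- b], so the squares, and with them
    orthogonality to the kernel, are preserved. *)
Lemma trig2_tshift a b h z : trig2 a b (tshift h z) =
  cos (a%:~R * h.1) * cos (b%:~R * h.2) * trig2 a b z
  + (- (sin (a%:~R * h.1) * cos (b%:~R * h.2))) * trig2 (- a) b z
  + (- (cos (a%:~R * h.1) * sin (b%:~R * h.2))) * trig2 a (- b) z
  + sin (a%:~R * h.1) * sin (b%:~R * h.2) * trig2 (- a) (- b) z.
Proof. by rewrite /trig2 /tshift /= !trig_shift; ring. Qed.

Lemma ker_trig2_tshift u a b h : L2_torus u -> (forall i, lam i != 0 -> coef u i = 0) ->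
  a ^+ 2 != b ^+ 2 -> inner mu2 u (fun z => trig2 a b (tshift h z)) = 0.
Proof.
move=> hu h0 ab; have /L2_torusP[_ hu2] := hu.
have z0 a' b' : a' ^+ 2 != b' ^+ 2 -> inner mu2 (trig2 a' b') u = 0.
  move=> ab'; have := ker_trig_ortho Hbasis hu h0 ab'.
  have -> : (fun z : R * R => trig_basis a' z.1 * trig_basis b' z.2) =
      (fun z => (trig_scale a' * trig_scale b') * trig2 a' b' z).
    by apply/funext => z; rewrite /trig2 !trig_basisE; ring.
  rewrite innerC innerZl //; last exact: trig2_L2.
  by move=> /eqP; rewrite mulf_eq0 gt_eqF ?mulr_gt0 ?trig_scale_gt0 // => /eqP.
rewrite innerC; under eq_fun do rewrite trig2_tshift.
have L c a' b' : Lr mu2 2 (fun z => c * trig2 a' b' z) by exact/LrZ/trig2_L2.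
rewrite !innerDl ?innerZl ?z0 ?sqrrN //; first ring;
  by [exact: trig2_L2|apply: LrD => //; exact: LrD|exact: LrD].
Qed.

(* Travelling waves f(x + t) + g(x - t) have vanishing mixed differences along the characteristic
   directions (1,1) and (1,-1); this is tested on products of trigonometric functions. *)
Lemma ker_parallelogram u (al be : R) : L2_torus u ->
  (forall i, lam i != 0 -> coef u i = 0) ->
  {ae mu2, forall z, u (tshift (al + be, al - be) z) - u (tshift (al, al) z)
     - u (tshift (be, - be) z) + u z = 0}.
Proof.
move=> hu h0; have /L2_torusP[pu hu2] := hu.
have hs h : Lr mu2 2 (fun z => u (tshift h z)) by exact: Lr_tshift.
have two0 : (0 : R) <= 2 by [].
apply: trig2_complete.
  apply/L2_torusP; split.
    move=> x t; have H h := tshift_invariant h pu x t.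
    by rewrite !(H _).1 !(H _).2 !(pu x t).1 !(pu x t).2.
  by apply: LrD => //; apply: LrB => //; apply: LrB.
move=> a b.
have G2 := trig2_L2 a b.
(* Translation invariance moves every shift onto the test function. *)
have adj h : inner mu2 (fun z => u (tshift h z)) (trig2 a b) =
    inner mu2 u (fun z => trig2 a b (tshift (- h.1, - h.2) z)).
  rewrite /inner -(@int_tshift R (fun z => u z * trig2 a b (tshift (- h.1, - h.2) z)) h).
  - apply: eq_Rintegral => z _; rewrite tshift_tshift /= !subrr.
    by congr (_ * trig2 a b _); case: z => x t; rewrite /tshift /= !addr0.
  - move=> x t; have H := tshift_invariant (- h.1, - h.2) (trig2_invariant a b) x t.
    by rewrite H.1 H.2 (pu x t).1 (pu x t).2.
  - apply: measurable_funM; first exact: hu2.1.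
    exact: (measurableT_comp (trig2_measurable a b) (tshift_measurable _)).
have hs1 := LrB two0 (hs (al + be, al - be)) (hs (al, al)).
rewrite innerDl ?innerBl ?innerBl //; last by apply: LrB.
rewrite !adj /=.
(* If the squares differ, each shifted test function is orthogonal to the kernel; otherwise the test
   function is itself a sum of travelling waves and its mixed difference [D] vanishes
   identically. *)
have [ab|ab] := eqVneq (a ^+ 2) (b ^+ 2); last first.
  rewrite !(ker_trig2_tshift _ hu h0 ab).
  have := ker_trig2_tshift (0, 0) hu h0 ab.
  have -> : (fun z => trig2 a b (tshift (0, 0) z)) = trig2 a b.
    by apply/funext => -[x t]; rewrite /tshift /= !addr0.
  by move=> ->; ring.
have hG h : Lr mu2 2 (fun z => trig2 a b (tshift h z)).
  by apply: Lr_tshift => //; exact: trig2_invariant.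
pose D z := trig2 a b (tshift (- (al + be), - (al - be)) z) - trig2 a b (tshift (- al, - al) z)
  - trig2 a b (tshift (- be, - - be) z) + trig2 a b z.
transitivity (inner mu2 D u).
  rewrite /D innerDl //; last by apply: LrB => //; exact: LrB.
  rewrite innerBl //; last exact: LrB.
  by rewrite innerBl // !(innerC mu2 _ u).
have [f [g fg]] := @trig_dalembert R a b ab.
transitivity (inner mu2 (fun=> 0) u); last first.
  by rewrite -[RHS](@int_0 _ _ R mu2); apply: eq_Rintegral => z _; rewrite mul0r.
congr (inner mu2 _ u); apply/funext => -[x t]; rewrite /D /trig2 /tshift /= !fg.
have -> : x - (al + be) + (t - (al - be)) = x - al + (t - al) by ring.
have -> : x - (al + be) - (t - (al - be)) = x - be - (t - - be) by ring.
have -> : x - be + (t - - be) = x + t by ring.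
have -> : x - al - (t - al) = x - t by ring.
ring.
Qed.

End Parallelogram.

(** * Periodic rectangles and the characteristic lines that meet them *)

Section CosBalls.
Context {R : realType}.
Local Notation mu1 := (@circle_measure R).
Local Notation mu2 := (@torus_measure R).
Local Notation T1 := (measurableTypeR R).
Local Notation T2 := (T1 * T1)%type.
Local Notation tp := (2 * pi : R).

Lemma cos_invariant_int (k : int) (y : R) : cos (y + k%:~R * tp) = cos y.
Proof. by rewrite cosD; have [-> ->] := @cos_int_2pi R k; ring. Qed.

Lemma cos_ball (h y : R) : h <= pi -> `|y| <= h -> cos h <= cos y.
Proof.
move=> hpi yh; have -> : cos y = cos `|y|.
  by have [_|_] := ler0P y; rewrite ?cosN.
have p0 := pi_gt0 R.
rewrite leNgt ltr_cos ?in_itv /= ?normr_ge0 //= -?leNgt //.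
- by rewrite hpi andbT (le_trans _ yh).
- by rewrite (le_trans yh).
Qed.

Lemma cos_ballP (h y : R) : 0 <= h -> h <= pi -> cos h <= cos y ->
  exists k : int, `|y + k%:~R * tp| <= h.
Proof.
move=> h0 hpi hy; have [k /andP[k1 k2]] := circle_reduce (y + pi).
exists k; have p0 := pi_gt0 R.
have hk : `|y + k%:~R * tp| <= pi by rewrite ler_norml; apply/andP; split; lra.
rewrite leNgt; apply/negP => hlt.
move: hy; rewrite leNgt => /negP; apply; rewrite -(cos_invariant_int k).
have -> : cos (y + k%:~R * tp) = cos `|y + k%:~R * tp|.
  by have [_|_] := ler0P (y + k%:~R * tp); rewrite ?cosN.
by rewrite ltr_cos ?in_itv /= ?normr_ge0 ?h0.
Qed.

Lemma circle_integral_lower (g : R -> R) (m kap : R) : measurable_fun [set: T1] g ->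
  circle_invariant g -> (forall x, 0 <= g x) -> 0 <= kap <= tp ->
  (forall s, 0 <= s <= kap -> 1 <= g (s + m)) ->
  (kap%:E <= \int[mu1]_x (g x)%:E)%E.
Proof.
move=> mg pg g0 /andP[k0 ktp] hg.
have pE : circle_invariant (EFin \o g) by move=> x /=; rewrite pg.
have mE : measurable_fun [set: T1] (EFin \o g) by exact/measurable_EFinP.
have := @ge0_circle_translate R (EFin \o g) m pE mE (fun x => g0 x).
move=> /= <-.
have mE' : measurable_fun [set: T1] (fun x : T1 => (g ((x : R) + m))%:E).
  apply/measurable_EFinP; apply: (measurableT_comp mg).
  exact: measurable_funD.
rewrite ge0_integral_circle //; last by move=> x; rewrite lee_fin.
apply: (@le_trans _ _ (\int[@lebesgue_measure R]_(x in `[0%R, kap]) (1%:E))%E).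
  rewrite integral_cst //= mul1e lebesgue_measure_itv /= lte_fin.
  by case: ltP => h; rewrite ?sube0 // lee_fin.
have [kz|kn] := eqVneq kap tp.
  rewrite integral_itv_bndo_bndc; last by apply: measurable_funTS.
  rewrite kz; apply: ge0_le_integral => //; first exact: measurable_funTS.
  by move=> x /=; rewrite in_itv /= => hx; rewrite lee_fin; apply: hg; rewrite kz.
have kl : kap < tp by rewrite lt_neqAle kn ktp.
apply: (@le_trans _ _ (\int[@lebesgue_measure R]_(x in `[0%R, kap]) (g (x + m))%:E)%E).
  by apply: ge0_le_integral => //; exact: measurable_funTS.
apply: ge0_subset_integral => //.
- by apply: measurable_funTS.
- by move=> x _; rewrite lee_fin.
- by move=> x /=; rewrite !in_itv /=; lra.
Qed.

(** For half-sides [g1], [g2] between 0 and [pi], the periodic copies of the rectangle with centre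
    [(c1, c2)]. The encoding by cosines makes it periodic in both variables and measurable at
    once. *)
Definition cosbox (c1 c2 g1 g2 : R) (z : R * R) : bool :=
  (cos g1 <= cos (z.1 - c1)) && (cos g2 <= cos (z.2 - c2)).

Definition cosbox_ind c1 c2 g1 g2 (z : R * R) : R := (cosbox c1 c2 g1 g2 z)%:R.

Lemma cosbox_ind_ge0 c1 c2 g1 g2 z : 0 <= cosbox_ind c1 c2 g1 g2 z.
Proof. exact: ler0n. Qed.

Lemma cosbox_ind_invariant c1 c2 g1 g2 : torus_invariant (cosbox_ind c1 c2 g1 g2).
Proof.
have H (y c : R) : cos (y + tp - c) = cos (y - c).
  by rewrite -(cos_invariant_int 1 (y - c)) mul1r; congr cos; ring.
by move=> x t; rewrite /cosbox_ind /cosbox /= !H.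
Qed.

Lemma measurable_cos_le (c g : R) : measurable_fun [set: T1] (fun x => cos g <= cos (x - c)).
Proof.
apply: measurable_fun_ler => //.
apply: continuous_measurable_circle => x.
apply: (@continuous_comp _ _ _ (fun x : R => x - c) cos); last exact: continuous_cos.
by apply: cvgB; [exact: cvg_id|exact: cvg_cst].
Qed.

Lemma cosbox_ind_measurable c1 c2 g1 g2 : measurable_fun [set: T2] (cosbox_ind c1 c2 g1 g2).
Proof.
have -> : cosbox_ind c1 c2 g1 g2 = (fun z => (if cos g1 <= cos (z.1 - c1) then 1 else 0)
    * (if cos g2 <= cos (z.2 - c2) then 1 else 0)).
  by apply/funext => z; rewrite /cosbox_ind /cosbox; do 2 case: ifP => _; rewrite ?mulr1 ?mulr0.
apply: (measurable_tensor (a := fun x : R => if cos g1 <= cos (x - c1) then 1 else 0)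
  (b := fun x : R => if cos g2 <= cos (x - c2) then 1 else 0)).
- by apply: measurable_fun_ifT => //; exact: measurable_cos_le.
- by apply: measurable_fun_ifT => //; exact: measurable_cos_le.
Qed.

(** Along the line each coordinate condition holds on an interval modulo [tp], of length [2 * g1] or
    [2 * g2]. With the offset [tau'] of their centres reduced to [[-pi, pi]], the overlap is at
    least the minimum of [2 * g1], [2 * g2] and [g1 + g2 - pi]. *)
Lemma cosbox_line c1 c2 (g1 g2 kap sg : R) z : g1 <= pi -> g2 <= pi -> 0 <= kap ->
  kap <= 2 * g1 -> kap <= 2 * g2 -> pi + kap <= g1 + g2 -> sg = 1 \/ sg = -1 ->
  (kap%:E <= \int[mu1]_a (cosbox_ind c1 c2 g1 g2 (tshift (a, sg * a) z))%:E)%E.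
Proof.
move=> g1pi g2pi k0 k1 k2 k12 hsg.
pose tau : R := sg * (z.2 - c2) - (z.1 - c1).
have [k /andP[t1 t2]] := circle_reduce (tau + pi).
pose tau' : R := tau + k%:~R * tp.
have t1' : - pi <= tau' by rewrite /tau'; lra.
have t2' : tau' <= pi by rewrite /tau'; lra.
(* Left end of the overlap of [[-g1, g1]] and [[-tau' - g2, -tau' + g2]]. *)
pose m' : R := Num.max (- g1) (- tau' - g2).
have ptp := pi_gt0 R.
apply: (@circle_integral_lower (fun a => cosbox_ind c1 c2 g1 g2 (tshift (a, sg * a) z)) (m' + c1 - z.1)).
- have msh : measurable_fun [set: T1] (fun a : T1 => tshift ((a : R), sg * (a : R)) z : T2).
    apply/measurable_fun_pairP; split.
      by rewrite /comp /tshift /=; apply: measurable_funD.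
    by rewrite /comp /tshift /=; apply: measurable_funD => //; exact: measurable_funM.
  exact: (measurableT_comp (cosbox_ind_measurable c1 c2 g1 g2) msh).
- move=> a; have H := @cosbox_ind_invariant c1 c2 g1 g2.
  rewrite /tshift /=.
  have -> : z.1 + (a + tp) = (z.1 + a) + tp by ring.
  rewrite (H _ _).1; case: hsg => ->.
    have -> : z.2 + 1 * (a + tp) = (z.2 + 1 * a) + tp by ring.
    by rewrite (H _ _).2.
  have -> : z.2 + -1 * a = (z.2 + -1 * (a + tp)) + tp by ring.
  by rewrite (H _ _).2.
- by move=> a; exact: cosbox_ind_ge0.
- by rewrite k0 /=; lra.
move=> s /andP[s0 sk]; rewrite /cosbox_ind /cosbox /tshift /=.
have m1 : - g1 <= m' by rewrite /m' le_max lexx.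
have m2 : - tau' - g2 <= m' by rewrite /m' le_max lexx orbT.
have m3 : m' + kap <= g1 by rewrite -lerBrDr /m' ge_max; apply/andP; split; lra.
have m4 : m' <= g2 - tau' - kap by rewrite /m' ge_max; apply/andP; split; lra.
have -> : z.1 + (s + (m' + c1 - z.1)) - c1 = s + m' by ring.
have -> : cos (z.2 + sg * (s + (m' + c1 - z.1)) - c2) = cos (s + m' + tau').
  have -> : s + m' + tau' = (s + m' + tau) + k%:~R * tp by rewrite /tau'; ring.
  rewrite cos_invariant_int /tau.
  case: hsg => ->; first by congr cos; ring.
  by rewrite -cosN; congr cos; ring.
rewrite !cos_ball //= ler_norml; apply/andP; split; lra.
Qed.

(** Translating the integral of [F * chi] along the line moves only [chi], because [F] does not
    change; averaging over the translations, [chi] contributes at least [kap / tp] at every point.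
    Thus [F] is controlled by its part on the support of [chi]. *)
Lemma torus_average (F chi : R * R -> R) (kap sg : R) :
  measurable_fun [set: T2] F -> torus_invariant F -> (forall z, 0 <= F z) ->
  (forall a, {ae mu2, forall z, F (tshift (a, sg * a) z) = F z}) ->
  measurable_fun [set: T2] chi -> torus_invariant chi -> (forall z, 0 <= chi z) ->
  (forall z, (kap%:E <= \int[mu1]_a (chi (tshift (a, sg * a) z))%:E)%E) -> 0 <= kap ->
  (kap%:E * \int[mu2]_z (F z)%:E <= tp%:E * \int[mu2]_z (F z * chi z)%:E)%E.
Proof.
move=> mF pF F0 Finv mchi pchi chi0 hk k0.
pose K (az : T1 * T2) := (F az.2 * chi (tshift ((az.1 : R), sg * (az.1 : R)) az.2))%:E.
have msh : measurable_fun [set: T1 * T2] (fun az : T1 * T2 => tshift ((az.1 : R), sg * (az.1 : R)) az.2 : T2).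
  have m1 : measurable_fun [set: T1 * T2] (fun az : T1 * T2 => az.1) by exact: measurable_fst.
  have m2 : measurable_fun [set: T1 * T2] (fun az : T1 * T2 => az.2) by exact: measurable_snd.
  apply/measurable_fun_pairP; split.
    apply: measurable_funD => //; exact: (measurableT_comp measurable_fst m2).
  apply: measurable_funD; first exact: (measurableT_comp measurable_snd m2).
  exact: measurable_funM.
have mK : measurable_fun [set: T1 * T2] K.
  apply/measurable_EFinP; apply: measurable_funM.
    exact: (measurableT_comp mF (@measurable_snd _ _ T1 T2)).
  exact: (measurableT_comp mchi msh).
have K0 x : (0 <= K x)%E by rewrite lee_fin mulr_ge0.
have [mI swap] := ge0_circle_torus_swap mK K0.
have mFchi : measurable_fun [set: T2] (fun z => F z * chi z) by exact: measurable_funM.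
have -> : (tp%:E * \int[mu2]_z (F z * chi z)%:E = \int[mu1]_a \int[mu2]_z K (a, z))%E.
  transitivity (\int[mu1]_a (\int[mu2]_z (F z * chi z)%:E))%E.
    rewrite integral_cst // muleC; congr (_ * _)%E; exact: esym circle_measure_setT.
  apply: eq_integral => a _.
  have pE : torus_invariant (fun z => (F z * chi z)%:E).
    by move=> x t; rewrite !(pF x t).1 !(pF x t).2 !(pchi x t).1 !(pchi x t).2.
  have mE : measurable_fun [set: T2] (fun z => (F z * chi z)%:E) by exact/measurable_EFinP.
  have E0 z : (0 <= (F z * chi z)%:E)%E by rewrite lee_fin mulr_ge0.
  rewrite -(@ge0_integral_tshift _ _ ((a : R), sg * (a : R)) pE mE E0).
  apply: ae_eq_integral => //.
  - exact: (measurableT_comp mE (tshift_measurable _)).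
  - have mm : measurable_fun [set: T2] (fun z => F z * chi (tshift ((a : R), sg * (a : R)) z)).
      apply: measurable_funM; first exact: mF.
      exact: (measurableT_comp mchi (tshift_measurable ((a : R), sg * (a : R)))).
    exact/measurable_EFinP.
  - by apply: (ae_imp (mu := mu2) (Finv a)) => z hz _; rewrite /K /= hz.
rewrite swap -ge0_integralZl //; last 2 first.
- exact/measurable_EFinP.
- by move=> z _; rewrite lee_fin.
apply: ge0_le_integral => //.
- by move=> z _; rewrite mule_ge0 ?lee_fin.
- by apply: measurable_funeM; exact/measurable_EFinP.
move=> z _; rewrite /K.
under eq_integral do rewrite /= EFinM.
rewrite ge0_integralZl //; last 3 first.
- apply/measurable_EFinP; apply: (measurableT_comp mchi).
  exact: (measurableT_comp msh (@measurable_pair2 _ _ T1 T2 z)).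
- by move=> a _; rewrite lee_fin.
- by rewrite lee_fin.
by rewrite muleC lee_wpmul2l // lee_fin.
Qed.

End CosBalls.

(** * Shift differences in L^p *)

Section ShiftDefect.
Context {R : realType}.
Local Notation mu2 := (@torus_measure R).
Local Notation T1 := (measurableTypeR R).
Local Notation T2 := (T1 * T1)%type.
Local Notation tp := (2 * pi : R).

Definition shift_pow (p : R) (u : R * R -> R) (h z : R * R) : R := `|u (tshift h z) - u z| `^ p.

(** Extended-real valued: the kernel elements it is applied to are only known to be square
    integrable, and their membership in L^p is derived from its bounds. *)
Definition shift_defect (p : R) (u : R * R -> R) (h : R * R) : \bar R :=
  (\int[mu2]_z (shift_pow p u h z)%:E)%E.

Variables (p : R) (u : R * R -> R).
Hypothesis p0 : 0 <= p.
Hypothesis pu : torus_invariant u.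
Hypothesis mu_ : measurable_fun [set: T2] u.

Lemma shift_pow_ge0 h z : 0 <= shift_pow p u h z. Proof. exact: powR_ge0. Qed.

Lemma shift_pow_measurable h : measurable_fun [set: T2] (shift_pow p u h).
Proof.
apply: measurable_normpowR; apply: measurable_funB => //.
exact: (measurableT_comp mu_ (tshift_measurable h)).
Qed.

Lemma shift_pow_measurableE h : measurable_fun [set: T2] (fun z => (shift_pow p u h z)%:E).
Proof. by apply/measurable_EFinP; exact: shift_pow_measurable. Qed.

Lemma shift_pow_invariant h : torus_invariant (shift_pow p u h).
Proof.
move=> x t; have H := tshift_invariant h pu x t.
by rewrite /shift_pow H.1 H.2 (pu x t).1 (pu x t).2.
Qed.

Lemma shift_defect_ge0 h : (0 <= shift_defect p u h)%E.
Proof. by apply: integral_ge0 => z _; rewrite lee_fin; exact: shift_pow_ge0. Qed.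

Lemma shift_pow_add h k z : shift_pow p u (h.1 + k.1, h.2 + k.2) z <=
  2 `^ p * (shift_pow p u h (tshift k z) + shift_pow p u k z).
Proof.
rewrite /shift_pow tshift_tshift /= [k.1 + _]addrC [k.2 + _]addrC.
set A := u (tshift (h.1 + k.1, h.2 + k.2) z); set B := u (tshift k z).
have -> : A - u z = (A - B) + (B - u z) by ring.
exact: powR_normD.
Qed.

Lemma shift_defect_add h k : (shift_defect p u (h.1 + k.1, h.2 + k.2)%R <=
  (2 `^ p)%:E * (shift_defect p u h + shift_defect p u k))%E.
Proof.
have pE : torus_invariant (fun z => (shift_pow p u h z)%:E).
  by move=> x t; rewrite !(shift_pow_invariant h x t).1 !(shift_pow_invariant h x t).2.
have E0 h' z : (0 <= (shift_pow p u h' z)%:E)%E by rewrite lee_fin; exact: shift_pow_ge0.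
have e : shift_defect p u h = (\int[mu2]_z (shift_pow p u h (tshift k z))%:E)%E.
  by apply: esym; exact: (ge0_integral_tshift k pE (shift_pow_measurableE h) (E0 h)).
have m1 := shift_pow_measurableE k.
have m2 : measurable_fun [set: T2] (fun z => (shift_pow p u h (tshift k z))%:E).
  exact: (measurableT_comp (shift_pow_measurableE h) (tshift_measurable k)).
have mD := emeasurable_funD m2 m1.
have D0 z : [set: T2] z -> (0 <= (shift_pow p u h (tshift k z))%:E + (shift_pow p u k z)%:E)%E.
  by move=> _; exact: (adde_ge0 (E0 h _) (E0 k _)).
rewrite e /shift_defect -(ge0_integralD mu2 measurableT (fun z _ => E0 h (tshift k z)) m2 (fun z _ => E0 k z) m1).
rewrite -(ge0_integralZl mu2 measurableT mD D0); last by rewrite lee_fin; exact: powR_ge0.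
apply: (ge0_le_integral mu2 measurableT).
- by move=> z _; exact: E0.
- exact: shift_pow_measurableE.
- exact: measurable_funeM.
by move=> z _; rewrite -EFinD -EFinM lee_fin; exact: shift_pow_add.
Qed.

Lemma shift_defect_add_le h k (X : R) : (shift_defect p u h <= X%:E)%E ->
  (shift_defect p u k <= X%:E)%E ->
  (shift_defect p u (h.1 + k.1, h.2 + k.2)%R <= (2 `^ p * 2 * X)%:E)%E.
Proof.
move=> hh hk; apply: (le_trans (shift_defect_add h k)).
have -> : ((2 `^ p * 2 * X)%:E = (2 `^ p)%:E * (X%:E + X%:E))%E.
  by rewrite -EFinD -EFinM; congr EFin; ring.
apply: lee_wpmul2l; first by rewrite lee_fin; exact: powR_ge0.
exact: leeD hh hk.
Qed.

Lemma eq_shift_defect a b a' b' : a = a' -> b = b' ->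
  shift_defect p u (a, b) = shift_defect p u (a', b').
Proof. by move=> -> ->. Qed.

Lemma shift_defect_reduce h : exists xy : R * R, [/\ 0 <= xy.1 < tp, 0 <= xy.2 < tp &
  shift_defect p u h = shift_defect p u xy].
Proof.
have [k1 K1] := circle_reduce h.1; have [k2 K2] := circle_reduce h.2.
exists (h.1 + k1%:~R * tp, h.2 + k2%:~R * tp); split; [exact: K1|exact: K2|].
apply: eq_integral => z _; rewrite /shift_pow; congr (`|_ - _| `^ p)%:E.
rewrite /tshift /= !addrA.
have e1 t : u (z.1 + h.1 + k1%:~R * tp, t) = u (z.1 + h.1, t).
  by apply: (@circle_invariant_int _ _ (fun s => u (s, t))) => s; exact: (pu s t).1.
have e2 s : u (s, z.2 + h.2 + k2%:~R * tp) = u (s, z.2 + h.2).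
  by apply: (@circle_invariant_int _ _ (fun t => u (s, t))) => t; exact: (pu s t).2.
by rewrite e1 e2.
Qed.

(* Decompose a shift into its components along (1,1) and (1,-1). *)
Lemma shift_defect_bound (X : R) :
  (forall sg b, sg = 1 \/ sg = -1 -> `|b| <= tp -> (shift_defect p u (b, - sg * b)%R <= X%:E)%E) ->
  forall h, (shift_defect p u h <= (2 `^ p * 2 * X)%:E)%E.
Proof.
move=> H h; have [[x y] [/= /andP[x0 x1] /andP[y0 y1] ->]] := shift_defect_reduce h.
pose al : R := (x + y) / 2; pose be : R := (x - y) / 2.
have h1 : `|al| <= tp by rewrite ler_norml /al; apply/andP; split; lra.
have h2 : `|be| <= tp by rewrite ler_norml /be; apply/andP; split; lra.
have := shift_defect_add_le (H _ _ (or_intror erefl) h1) (H _ _ (or_introl erefl) h2).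
have e1 : al + be = x by rewrite /al /be; field.
have e2 : - -1 * al + - 1 * be = y by rewrite /al /be; field.
by rewrite /fst /snd (eq_shift_defect e1 e2).
Qed.

(** Halving [n] times reduces a shift to a small one; each doubling back costs the factor [2^p * 2]
    of the quasi-triangle inequality. *)
Lemma shift_defect_double sg b n (X : R) :
  (shift_defect p u (b / 2 ^+ n, - sg * (b / 2 ^+ n))%R <= X%:E)%E ->
  (shift_defect p u (b, - sg * b)%R <= ((2 `^ p * 2) ^+ n * X)%:E)%E.
Proof.
elim: n b => [|n ih] b hb; first by move: hb; rewrite expr0 divr1 mul1r.
have hb2 : (shift_defect p u (b / 2, - sg * (b / 2))%R <= ((2 `^ p * 2) ^+ n * X)%:E)%E.
  apply: ih; have e : b / 2 ^+ n.+1 = b / 2 / 2 ^+ n by rewrite exprS invfM mulrA.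
  have e2 : - sg * (b / 2 ^+ n.+1) = - sg * (b / 2 / 2 ^+ n) by rewrite e.
  by rewrite -(eq_shift_defect e e2).
have := shift_defect_add_le hb2 hb2.
have e1 : b / 2 + b / 2 = b by field.
have e2 : - sg * (b / 2) + - sg * (b / 2) = - sg * b by field.
by rewrite /fst /snd (eq_shift_defect e1 e2) exprS mulrA.
Qed.

(* Compare u(z + h) with u(z) at points weighted by q(z), and average over h. *)
Lemma shift_defect_average (q : R * R -> R) (K C3 Iu : R) :
  measurable_fun [set: T2] q -> (forall z, 0 <= q z) -> (forall z, q z <= K) ->
  intg mu2 (fun z => q z * `|u z| `^ p) -> \int[mu2]_z (q z * `|u z| `^ p) = Iu ->
  (forall h, (shift_defect p u h <= C3%:E)%E) ->
  ((\int[mu2]_z q z)%:E * \int[mu2]_z (`|u z| `^ p)%:E <=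
    (2 `^ p * (K * (tp * tp * C3) + tp * tp * Iu))%:E)%E.
Proof.
move=> mq q0 qK iqu eIu D_bound.
have iq : intg mu2 q.
  apply: (bounded_intg (C := K)) => //; first exact: torus_measure_fin.
  by move=> z; rewrite ger0_norm.
have pE : torus_invariant (fun z => (`|u z| `^ p)%:E).
  by move=> x t; have [e1 e2] := pu x t; rewrite e1 e2; split; reflexivity.
have tp0 : 0 <= tp * tp by apply: mulr_ge0; exact: ltW two_pi_gt0.
have K0 : 0 <= K by rewrite (le_trans (q0 (0, 0))).
have K0E : (0 <= K%:E)%E by rewrite lee_fin.
have twoE : (0 <= (2 `^ p)%:E :> \bar R)%E by rewrite lee_fin; exact: powR_ge0.
pose KK (hz : T2 * T2) := (shift_pow p u hz.1 hz.2)%:E.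
have mKK : measurable_fun [set: T2 * T2] KK.
  have m1 : measurable_fun [set: T2 * T2] (fun hz : T2 * T2 => hz.1) by exact: measurable_fst.
  have m2 : measurable_fun [set: T2 * T2] (fun hz : T2 * T2 => hz.2) by exact: measurable_snd.
  have msh : measurable_fun [set: T2 * T2] (fun hz : T2 * T2 => tshift hz.1 hz.2 : T2).
    apply/measurable_fun_pairP; split; rewrite /comp /tshift /=; apply: measurable_funD.
    - exact: (measurableT_comp measurable_fst m2).
    - exact: (measurableT_comp measurable_fst m1).
    - exact: (measurableT_comp measurable_snd m2).
    - exact: (measurableT_comp measurable_snd m1).
  apply/measurable_EFinP; apply: measurable_normpowR; apply: measurable_funB.
    exact: (measurableT_comp mu_ msh).
  exact: (measurableT_comp mu_ m2).
have KK0 hz : (0 <= KK hz)%E by rewrite lee_fin; exact: shift_pow_ge0.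
have [mI swap] := ge0_torus_torus_swap mKK KK0.
have mKKs : measurable_fun [set: T2 * T2] (fun zh : T2 * T2 => KK (zh.2, zh.1)).
  exact: (measurableT_comp mKK (@measurable_swap _ _ T2 T2)).
have [mI2 _] := ge0_torus_torus_swap mKKs (fun zh => KK0 (zh.2, zh.1)).
pose J := (\int[mu2]_z (`|u z| `^ p)%:E)%E.
pose D2 (z : T2) := (\int[mu2]_h KK (h, z))%E.
have D20 z : (0 <= D2 z)%E by apply: integral_ge0 => h _; exact: KK0.
have up0 z : (0 <= (`|u z| `^ p)%:E)%E by rewrite lee_fin; exact: powR_ge0.
have mup : measurable_fun [set: T2] (fun z => (`|u z| `^ p)%:E).
  by apply/measurable_EFinP; exact: measurable_normpowR.
have mKz z : measurable_fun [set: T2] (fun h => KK (h, z)).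
  exact: (measurableT_comp mKK (measurable_pair2 z)).
have tpu0 z : (0 <= (tp * tp * `|u z| `^ p)%:E)%E.
  by rewrite lee_fin; exact: (mulr_ge0 tp0 (powR_ge0 _ _)).
(* For fixed [z], translation invariance writes [J] as the integral over all shifts [h] of
   [|u (z + h)|^p], which is then compared with [|u z|^p]. *)
have Jle z : (J <= (2 `^ p)%:E * (D2 z + (tp * tp * `|u z| `^ p)%:E))%E.
  have -> : J = (\int[mu2]_h (`|u (tshift h z)| `^ p)%:E)%E.
    rewrite /J -(ge0_integral_tshift z pE mup up0).
    by apply: eq_integral => h _; rewrite /tshift [h.1 + _]addrC [h.2 + _]addrC.
  have -> : ((tp * tp * `|u z| `^ p)%:E = \int[mu2]_h (`|u z| `^ p)%:E)%E.
    by rewrite (integral_cst mu2 measurableT) (mulrC (tp * tp)) EFinM -torus_measure_setT.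
  have mc : measurable_fun [set: T2] (fun _ : T2 => (`|u z| `^ p)%:E) by exact: measurable_cst.
  rewrite /D2 -(ge0_integralD mu2 measurableT (fun h _ => KK0 (h, z)) (mKz z) (fun h _ => up0 z) mc).
  have mD := emeasurable_funD (mKz z) mc.
  rewrite -(ge0_integralZl mu2 measurableT mD (fun h _ => adde_ge0 (KK0 (h, z)) (up0 z)) twoE).
  apply: (ge0_le_integral mu2 measurableT).
  - by move=> h _; exact: up0.
  - have e : (fun h => tshift h z) = (tshift z : T2 -> T2).
      by apply/funext => h; rewrite /tshift [h.1 + _]addrC [h.2 + _]addrC.
    by have := measurableT_comp mup (tshift_measurable z); rewrite -e.
  - exact: measurable_funeM.
  move=> h _; rewrite -EFinD -EFinM lee_fin /shift_pow /=.
  have {1}-> : u (tshift h z) = (u (tshift h z) - u z) + u z by ring.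
  exact: powR_normD.
have mqE : measurable_fun [set: T2] (EFin \o q) by apply/measurable_EFinP.
have mD2 : measurable_fun [set: T2] D2 by exact: mI.
have mG : measurable_fun [set: T2] (fun z => (q z * `|u z| `^ p)%:E).
  by apply/measurable_EFinP; exact: intg_measurable iqu.
have mA : measurable_fun [set: T2] (fun z => K%:E * D2 z)%E by exact: measurable_funeM.
have mB : measurable_fun [set: T2] (fun z => (tp * tp)%:E * (q z * `|u z| `^ p)%:E)%E.
  exact: measurable_funeM.
have A0 z : (0 <= K%:E * D2 z)%E by exact: mule_ge0.
have G0 z : (0 <= (q z * `|u z| `^ p)%:E)%E by rewrite lee_fin; exact: (mulr_ge0 (q0 z) (powR_ge0 _ _)).
have tpE : (0 <= (tp * tp)%:E)%E by rewrite lee_fin.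
have B0 z : (0 <= (tp * tp)%:E * (q z * `|u z| `^ p)%:E)%E by exact: mule_ge0.
have mAB := emeasurable_funD mA mB.
have J0 : (0 <= J)%E by apply: integral_ge0 => z _; exact: up0.
have qE0 z : (0 <= (q z)%:E)%E by rewrite lee_fin.
apply: (@le_trans _ _ (\int[mu2]_z ((2 `^ p)%:E * (K%:E * D2 z + (tp * tp)%:E * (q z * `|u z| `^ p)%:E)))%E).
  rewrite -(intg_EFin iq) muleC -(ge0_integralZl mu2 measurableT mqE (fun z _ => qE0 z) J0).
  apply: (ge0_le_integral mu2 measurableT).
  - by move=> z _; exact: (mule_ge0 J0 (qE0 z)).
  - exact: measurable_funeM.
  - exact: measurable_funeM.
  move=> z _; apply: (@le_trans _ _ ((q z)%:E * ((2 `^ p)%:E * (D2 z + (tp * tp * `|u z| `^ p)%:E)))%E).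
    by rewrite muleC; apply: lee_wpmul2l; [exact: qE0|exact: Jle].
  rewrite muleCA; apply: lee_wpmul2l; first exact: twoE.
  rewrite (ge0_muleDr _ (D20 z) (tpu0 z)); apply: leeD.
    by apply: lee_wpmul2r; [exact: D20|rewrite lee_fin].
  by rewrite -!EFinM lee_fin le_eqVlt; apply/orP; left; apply/eqP; rewrite mulrCA.
rewrite (ge0_integralZl mu2 measurableT mAB (fun z _ => adde_ge0 (A0 z) (B0 z)) twoE).
rewrite [X in (_ <= X)%E]EFinM; apply: lee_wpmul2l; first exact: twoE.
rewrite (ge0_integralD mu2 measurableT (fun z _ => A0 z) mA (fun z _ => B0 z) mB).
rewrite EFinD; apply: leeD.
  rewrite (ge0_integralZl mu2 measurableT mD2 (fun z _ => D20 z) K0E) [X in (_ <= X)%E]EFinM.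
  apply: lee_wpmul2l; first exact: K0E.
  rewrite /D2 -swap.
  apply: (@le_trans _ _ (\int[mu2]_h C3%:E)%E).
    apply: (ge0_le_integral mu2 measurableT).
    - by move=> h _; exact: shift_defect_ge0.
    - exact: mI2.
    - exact: measurable_cst.
    - by move=> h _; exact: D_bound.
  rewrite (integral_cst mu2 measurableT) [X in (_ <= X)%E]EFinM muleC; apply: lee_wpmul2r.
    exact: (le_trans (shift_defect_ge0 (0, 0)) (D_bound _)).
  by rewrite le_eqVlt; apply/orP; left; apply/eqP; exact: torus_measure_setT.
rewrite (ge0_integralZl mu2 measurableT mG (fun z _ => G0 z) tpE).
by rewrite (intg_EFin iqu) eIu -EFinM.
Qed.

End ShiftDefect.

(** * Control of the kernel by the weight *)

Section KernelControl.
Context {R : realType}.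
Variables (nu : nat -> R) (zeta : nat -> R -> R).
Hypothesis Hbasis : laplace_eigenbasis nu zeta.
Local Notation mu1 := (@circle_measure R).
Local Notation mu2 := (@torus_measure R).
Local Notation T1 := (measurableTypeR R).
Local Notation T2 := (T1 * T1)%type.
Local Notation tp := (2 * pi : R).
Local Notation coef := (coef zeta).
Local Notation lam := (lam nu).

Variables (p : R) (q : R * R -> R) (c K h1 h2 c1 c2 : R).
Hypothesis p1 : 1 <= p.
Hypothesis mq : measurable_fun [set: T2] q.
Hypothesis pq : torus_invariant q.
Hypothesis q0 : forall z, 0 <= q z.
Hypothesis qK : forall z, q z <= K.
Hypothesis c0 : 0 < c.
Hypothesis h10 : 0 < h1.
Hypothesis h20 : 0 < h2.
Hypothesis h1pi : h1 <= (pi : R).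
Hypothesis h2pi : h2 <= (pi : R).
Hypothesis h12 : pi < h1 + h2.
Hypothesis qc : forall z, cosbox c1 c2 h1 h2 z -> c <= q z.

Let p0 : 0 <= p. Proof. by rewrite (le_trans ler01). Qed.

(** After shrinking both half-sides by [del] their sum still exceeds [pi] by at least [2 * del], so
    every characteristic line meets the smaller box in length at least [2 * del]. *)
Lemma box_margin : exists del : R,
  [/\ 0 < del, 4 * del <= h1, 4 * del <= h2 & 4 * del <= h1 + h2 - pi].
Proof.
exists (Num.min (Num.min h1 h2) (h1 + h2 - pi) / 4); set del := _ / 4.
have e : 4 * del = Num.min (Num.min h1 h2) (h1 + h2 - pi) by rewrite /del mulrC divfK.
split.
- by rewrite /del divr_gt0 // !lt_min h10 h20 /= subr_gt0.
- by rewrite e !ge_min lexx.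
- by rewrite e !ge_min lexx orbT.
- by rewrite e !ge_min lexx orbT.
Qed.

(** Averaging along characteristic lines, applied to the constant 1, shows that the box has positive
    measure. *)
Lemma weight_int_gt0 : 0 < \int[mu2]_z q z.
Proof.
have [del [d0 d1 d2 d3]] := box_margin.
pose chi := cosbox_ind c1 c2 h1 h2.
have mchi := cosbox_ind_measurable c1 c2 h1 h2.
have m1 : measurable_fun [set: T2] (fun _ : R * R => 1 : R) by exact: measurable_cst.
have H := @torus_average R (fun _ => 1) chi (4 * del) 1 m1 (fun _ _ => conj erefl erefl)
  (fun _ => ler01) _ mchi (cosbox_ind_invariant _ _ _ _) (cosbox_ind_ge0 _ _ _ _) _ _.
have {}H : ((4 * del)%:E * \int[mu2]_z (1 : R)%:E <= tp%:E * \int[mu2]_z (1 * chi z)%:E)%E.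
  apply: H.
  - by move=> a; exact: aeW.
  - by move=> z; apply: cosbox_line => //; [lra|lra|lra|lra|left].
  - lra.
have tp0 := @two_pi_gt0 R.
have ichi : intg mu2 chi.
  apply: (bounded_intg (C := 1)) => //; first exact: torus_measure_fin.
  by move=> z; rewrite ger0_norm ?cosbox_ind_ge0 // /chi /cosbox_ind; case: cosbox.
have iq : intg mu2 q.
  apply: (bounded_intg (C := K)) => //; first exact: torus_measure_fin.
  by move=> z; rewrite ger0_norm.
have hq : c * \int[mu2]_z chi z <= \int[mu2]_z q z.
  rewrite -int_Z //; apply: int_le => //; first exact: intgZ.
  move=> z; rewrite /chi /cosbox_ind; case: (boolP (cosbox _ _ _ _ z)) => [/qc|_].
    by rewrite mulr1.
  by rewrite mulr0.
apply: lt_le_trans hq; rewrite mulr_gt0 //.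
move: H; have -> : (\int[mu2]_z (1 * chi z)%:E = (\int[mu2]_z chi z)%:E)%E.
  by rewrite -intg_EFin //; apply: eq_integral => z _; rewrite mul1r.
have -> : (\int[mu2]_z (1 : R)%:E = (tp * tp)%:E)%E.
  by rewrite integral_cst // mul1e; exact: torus_measure_setT.
rewrite -!EFinM lee_fin => H.
have : 0 < tp * \int[mu2]_z chi z.
  by apply: lt_le_trans H; exact: (mulr_gt0 (mulr_gt0 _ d0) (mulr_gt0 tp0 tp0)).
by rewrite pmulr_rgt0.
Qed.

(** The parallelogram identity says that a difference along one characteristic direction does not
    change when the base point moves along the other. *)
Lemma ker_shift_pow_invariant u (sg a b : R) : L2_torus u -> (forall i, lam i != 0 -> coef u i = 0) ->
  sg = 1 \/ sg = -1 ->
  {ae mu2, forall z, shift_pow p u (b, - sg * b) (tshift (a, sg * a) z)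
    = shift_pow p u (b, - sg * b) z}.
Proof.
move=> hu uker; case=> sE.
  apply: (ae_imp (mu := mu2) (ker_parallelogram Hbasis a b hu uker)) => z.
  rewrite /shift_pow sE !mul1r !mulN1r !tshift_tshift /= => H; congr (`|_| `^ p).
  by lra.
apply: (ae_imp (mu := mu2) (ker_parallelogram Hbasis b a hu uker)) => z.
rewrite /shift_pow sE !opprK !mulN1r !mul1r !tshift_tshift /= => H; congr (`|_| `^ p).
have -> : (a + b, - a + b) = (b + a, b - a) by rewrite addrC [- a + b]addrC.
by lra.
Qed.

Lemma cosbox_inner (del sg b : R) z : 0 <= del -> del <= h1 -> del <= h2 ->
  sg = 1 \/ sg = -1 -> `|b| <= del ->
  cosbox c1 c2 (h1 - del) (h2 - del) z -> c <= q z /\ c <= q (tshift (b, - sg * b) z).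
Proof.
move=> d0 d1 d2 hsg hb /andP[hz1 hz2].
have A1 : 0 <= h1 - del by lra.
have A2 : h1 - del <= (pi : R) by rewrite lerBlDr (le_trans h1pi) // lerDl.
have A3 : 0 <= h2 - del by lra.
have A4 : h2 - del <= (pi : R) by rewrite lerBlDr (le_trans h2pi) // lerDl.
have [k1 hk1] := cos_ballP A1 A2 hz1.
have [k2 hk2] := cos_ballP A3 A4 hz2.
have sgb : `|- sg * b| <= del by case: hsg => ->; rewrite ?mulN1r ?opprK ?normrN ?mul1r.
split; apply: qc; rewrite /cosbox; apply/andP; split.
- by rewrite -(cos_invariant_int k1 (_ - c1)); apply: (cos_ball h1pi); lra.
- by rewrite -(cos_invariant_int k2 (_ - c2)); apply: (cos_ball h2pi); lra.
- rewrite /tshift /= -(cos_invariant_int k1 (_ - c1)); apply: (cos_ball h1pi).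
  have -> : z.1 + b - c1 + k1%:~R * tp = (z.1 - c1 + k1%:~R * tp) + b by ring.
  by rewrite (le_trans (ler_normD _ _)) //; lra.
rewrite /tshift /= -(cos_invariant_int k2 (_ - c2)); apply: (cos_ball h2pi).
have -> : z.2 + - sg * b - c2 + k2%:~R * tp = (z.2 - c2 + k2%:~R * tp) + (- sg * b) by ring.
by rewrite (le_trans (ler_normD _ _)) //; lra.
Qed.

(** The difference is constant along the transversal characteristic, so its integral over the torus
    is at most [tp / (2 * del)] times that over the shrunken box. There both [z] and its shifted
    copy lie where [q >= c], whence the factor [2^p / c] and two equal integrals. *)
Lemma ker_shift_defect_small u (del sg b : R) : L2_torus u -> (forall i, lam i != 0 -> coef u i = 0) ->
  intg mu2 (fun z => q z * `|u z| `^ p) -> 0 < del -> 4 * del <= h1 -> 4 * del <= h2 ->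
  4 * del <= h1 + h2 - pi -> sg = 1 \/ sg = -1 -> `|b| <= del ->
  (shift_defect p u (b, - sg * b)%R <=
    (tp / (2 * del) * (2 `^ p / c * (2 * \int[mu2]_z (q z * `|u z| `^ p))))%:E)%E.
Proof.
move=> hu uker iqu d0 d1 d2 d3 hsg hb.
have [pu [mu_ _]] : torus_invariant u /\ Lr mu2 2 u by exact/L2_torusP.
set w := (b, - sg * b).
have k0 : 0 < 2 * del by rewrite mulr_gt0.
pose chi := cosbox_ind c1 c2 (h1 - del) (h2 - del).
have mchi : measurable_fun [set: T2] chi by exact: cosbox_ind_measurable.
have chi0 z : 0 <= chi z by exact: cosbox_ind_ge0.
have A1 : h1 - del <= (pi : R) by rewrite lerBlDr (le_trans h1pi) // lerDl ltW.
have A2 : h2 - del <= (pi : R) by rewrite lerBlDr (le_trans h2pi) // lerDl ltW.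
have A3 : 2 * del <= 2 * (h1 - del) by lra.
have A4 : 2 * del <= 2 * (h2 - del) by lra.
have A5 : pi + 2 * del <= h1 - del + (h2 - del) by lra.
have line z : ((2 * del)%:E <= \int[mu1]_a (chi (tshift (a, sg * a) z))%:E)%E.
  exact: (cosbox_line c1 c2 z A1 A2 (ltW k0) A3 A4 A5 hsg).
have mF := shift_pow_measurable p mu_ w.
have F0 := shift_pow_ge0 p u w.
have Hav := torus_average mF (shift_pow_invariant p pu w) F0
  (fun a => ker_shift_pow_invariant a b hu uker hsg) mchi (cosbox_ind_invariant _ _ _ _) chi0 line (ltW k0).
pose G z := q z * `|u z| `^ p.
have pG : torus_invariant G.
  by move=> x t; rewrite /G !(pq x t).1 !(pq x t).2 !(pu x t).1 !(pu x t).2.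
have iG2 : intg mu2 (fun z => G (tshift w z)) by exact: intg_tshift.
have G0 z : 0 <= G z by rewrite /G mulr_ge0 ?powR_ge0.
have pc0 : 0 <= 2 `^ p / c by apply: divr_ge0; [exact: powR_ge0|exact: ltW].
have GG0 z : 0 <= 2 `^ p / c * (G (tshift w z) + G z).
  by apply: mulr_ge0 => //; exact: addr_ge0.
have bnd z : shift_pow p u w z * chi z <= 2 `^ p / c * (G (tshift w z) + G z).
  rewrite /chi /cosbox_ind; case: (boolP (cosbox _ _ _ _ z)) => hz; last by rewrite mulr0.
  rewrite mulr1.
  have [||qz qwz] := cosbox_inner (ltW d0) _ _ hsg hb hz; [lra|lra|].
  apply: (@le_trans _ _ (2 `^ p * (`|u (tshift w z)| `^ p + `|u z| `^ p))).
    by rewrite /shift_pow -(normrN (u z)); exact: (powR_normD _ _ p0).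
  rewrite -mulrA; apply: ler_wpM2l; first exact: powR_ge0.
  rewrite ler_pdivlMl // mulrDr.
  by apply: lerD; apply: ler_wpM2r => //; exact: powR_ge0.
have iS : intg mu2 (fun z => 2 `^ p / c * (G (tshift w z) + G z)).
  by apply: intgZ; exact: intgD.
have {}Hav : ((2 * del)%:E * shift_defect p u w <= (tp * (2 `^ p / c * (2 * \int[mu2]_z G z)))%:E)%E.
  apply: (le_trans Hav); rewrite [X in (_ <= X)%E]EFinM; apply: lee_wpmul2l; first by rewrite lee_fin; exact: ltW two_pi_gt0.
  apply: (@le_trans _ _ (\int[mu2]_z (2 `^ p / c * (G (tshift w z) + G z))%:E)%E).
    apply: (ge0_le_integral mu2 measurableT).
    - by move=> z _; rewrite lee_fin; exact: mulr_ge0.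
    - by apply/measurable_EFinP; exact: measurable_funM.
    - by apply/measurable_EFinP; exact: (intg_measurable iS).
    - by move=> z _; rewrite lee_fin.
  rewrite (intg_EFin iS) lee_fin int_Z; last exact: intgD.
  rewrite int_D // (int_tshift w pG (intg_measurable iqu)).
  by rewrite le_eqVlt; apply/orP; left; apply/eqP; congr (_ * _); rewrite mulr_natl mulr2n.
have -> : tp / (2 * del) * (2 `^ p / c * (2 * \int[mu2]_z G z)) =
    (2 * del)^-1 * (tp * (2 `^ p / c * (2 * \int[mu2]_z G z))) by clear; move: (_ * \int[_]_z _) => I; ring.
by move: Hav; rewrite -lee_pdivlMl // -EFinM.
Qed.

(** Small characteristic shifts are doubled up to length [tp] and combined into arbitrary shifts;
    averaging over these against [q], whose integral is positive, bounds [u] itself. That [u] lies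
    in L^p is part of the conclusion. *)
Lemma ker_control : exists C, forall u, L2_torus u -> (forall i, lam i != 0 -> coef u i = 0) ->
  intg mu2 (fun z => q z * `|u z| `^ p) ->
  Lr mu2 p u /\ \int[mu2]_z `|u z| `^ p <= C * \int[mu2]_z (q z * `|u z| `^ p).
Proof.
have [del [d0 d1 d2 d3]] := box_margin.
have A0 := weight_int_gt0.
(* The number of doublings that lead from length [del] to a full period. *)
have [n0 hn0] : exists n0 : nat, tp <= 2 ^+ n0 * del.
  exists (Num.bound (tp / del)); rewrite -ler_pdivrMr //.
  apply: (@le_trans _ _ (Num.bound (tp / del))%:R).
    by rewrite ltW // archi_boundP // divr_ge0 ?(ltW two_pi_gt0) // ltW.
  by rewrite -natrX ler_nat ltnW // ltn_expl.
set A := \int[mu2]_z q z in A0.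
pose C2 : R := 2 `^ p * 2 * ((2 `^ p * 2) ^+ n0 * (tp / (2 * del) * (2 `^ p / c * 2))).
exists (A^-1 * (2 `^ p * (K * (tp * tp * C2) + tp * tp))).
move=> u hu uker iqu.
have [pu [mu_ _]] : torus_invariant u /\ Lr mu2 2 u by exact/L2_torusP.
set Iu := \int[mu2]_z (q z * `|u z| `^ p).
have bnd h : (shift_defect p u h <= (C2 * Iu)%:E)%E.
  have -> : C2 * Iu = 2 `^ p * 2 * ((2 `^ p * 2) ^+ n0 * (tp / (2 * del) * (2 `^ p / c * (2 * Iu)))).
    by rewrite /C2 !mulrA.
  apply: (shift_defect_bound p0 pu mu_) => sg b hsg hb.
  apply: (shift_defect_double p0 pu mu_).
  apply: ker_shift_defect_small => //.
  rewrite normrM (@ger0_norm _ (2 ^+ n0)^-1) ?invr_ge0 ?exprn_ge0 //.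
  by rewrite ler_pdivrMr ?exprn_gt0 // mulrC (le_trans hb).
have H := shift_defect_average p0 pu mu_ mq q0 qK iqu erefl bnd.
have mup : measurable_fun [set: T2] (fun z => `|u z| `^ p) by exact: measurable_normpowR.
have fin : (\int[mu2]_z (`|u z| `^ p)%:E < +oo)%E.
  move: H; rewrite -lee_pdivlMl // => H; apply: (le_lt_trans H).
  by rewrite -EFinM ltry.
have iup : intg mu2 (fun z => `|u z| `^ p).
  by apply/intgP => // z; exact: powR_ge0.
split; first by split.
move: H; rewrite (intg_EFin iup) -EFinM lee_fin -ler_pdivlMl // => H.
apply: (le_trans H); rewrite -/Iu -/A le_eqVlt; apply/orP; left; apply/eqP.
by clearbody C2 Iu; ring.
Qed.

End KernelControl.

Definition small_ints (N : nat) : seq int :=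
  [seq a%:Z | a <- index_iota 1 N] ++ [seq - a%:Z | a <- index_iota 1 N].

Lemma small_intsP N (a : int) : a \in small_ints N = (a != 0) && (`|a| < N)%N.
Proof.
have pos x : (Posz x \in [seq i%:Z | i <- index_iota 1 N]) = (0 < x < N)%N.
  by rewrite mem_map ?mem_index_iota // => u v [].
have neg x : (- Posz x \in [seq - i%:Z | i <- index_iota 1 N]) = (0 < x < N)%N.
  rewrite (mem_map (f := fun i : nat => - i%:Z)) ?mem_index_iota //.
  by move=> u v /oppr_inj [].
have posN x : (0 < x)%N -> (Posz x \in [seq - i%:Z | i <- index_iota 1 N]) = false.
  by move=> x0; apply/negbTE/negP => /mapP[y]; rewrite mem_index_iota => /andP[y0 _] h; move: y0; lia.
have negP x : (0 < x)%N -> (- Posz x \in [seq i%:Z | i <- index_iota 1 N]) = false.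
  by move=> x0; apply/negbTE/negP => /mapP[y]; rewrite mem_index_iota => /andP[y0 _] h; move: y0; lia.
rewrite mem_cat; case: a => x; last first.
  by rewrite NegzE neg negP //= abszN.
case: x => [|x]; last by rewrite pos posN // orbF.
by have := pos 0%N; have := neg 0%N; rewrite oppr0 => -> ->.
Qed.

Lemma small_ints_uniq N : uniq (small_ints N).
Proof.
rewrite cat_uniq !map_inj_uniq ?iota_uniq ?andbT /=.
- apply/hasPn => x /mapP[a]; rewrite mem_index_iota => /andP[a0 _] ->.
  by apply/negP => /mapP[y]; rewrite mem_index_iota => /andP[y0 _] h; move: y0; lia.
- by move=> u v /oppr_inj [].
- by move=> u v [].
Qed.

(** * The embedding of the energy space *)

Section FiniteSums.
Context {R : realType}.

Lemma sum_cauchy_schwarz (I : eqType) (s : seq I) (x a e : I -> R) :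
  (forall i, i \in s -> 0 <= a i) -> (forall i, i \in s -> 0 <= e i) ->
  (forall i, i \in s -> x i ^+ 2 <= a i * e i) ->
  (\sum_(i <- s) `|x i|) ^+ 2 <= (\sum_(i <- s) a i) * (\sum_(i <- s) e i).
Proof.
elim: s => [|i s ih] ha he hx; first by rewrite !big_nil expr0n mul0r.
rewrite !big_cons.
have ms j : j \in s -> j \in i :: s by move=> js; rewrite inE js orbT.
have {}ih := ih (fun j js => ha j (ms j js)) (fun j js => he j (ms j js)) (fun j js => hx j (ms j js)).
have a0 := ha i (mem_head _ _); have e0 := he i (mem_head _ _).
have x0 := hx i (mem_head _ _).
have X0 : 0 <= \sum_(j <- s) `|x j| by apply: sumr_ge0.
have A0 : 0 <= \sum_(j <- s) a j by rewrite big_seq; apply: sumr_ge0 => j /ms; exact: ha.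
have E0 : 0 <= \sum_(j <- s) e j by rewrite big_seq; apply: sumr_ge0 => j /ms; exact: he.
have x1 : `|x i| ^+ 2 <= a i * e i by rewrite real_normK ?num_real.
move: (normr_ge0 (x i)) ih x1 a0 e0 X0 A0 E0.
move: (`|x i|) (a i) (e i) (\sum_(j <- s) `|x j|) (\sum_(j <- s) a j) (\sum_(j <- s) e j).
move=> y b f X A G y0 hX hy b0 f0 X0 A0 G0.
(* The cross term of the square, by the inequality of arithmetic and geometric means for [A * f] and
   [b * G]. *)
have key : 2 * (X * y) <= A * f + b * G.
  rewrite -(ler_pXn2r (n := 2)) // ?nnegrE; last 2 first.
  - by rewrite mulr_ge0 // mulr_ge0.
  - by rewrite addr_ge0 // mulr_ge0.
  apply: (@le_trans _ _ (4 * ((A * G) * (b * f)))).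
    have : (X ^+ 2) * (y ^+ 2) <= (A * G) * (b * f) by apply: ler_pM => //; exact: sqr_ge0.
    by move: (A * G) (b * f) => u v h; nra.
  have := sqr_ge0 (A * f - b * G); nra.
nra.
Qed.

Lemma sum_fiber_le (I J : eqType) (g : I -> J) (f : J -> R) (s : seq I) (t : seq J) (M : nat) :
  uniq t -> (forall i, i \in s -> g i \in t) -> (forall y, 0 <= f y) ->
  (forall y, y \in t -> (count (fun i => g i == y) s <= M)%N) ->
  \sum_(i <- s) f (g i) <= M%:R * \sum_(y <- t) f y.
Proof.
move=> ut st f0 hM.
have -> : \sum_(i <- s) f (g i) = \sum_(i <- s) \sum_(y <- t | g i == y) f y.
  rewrite big_seq [RHS]big_seq; apply: eq_bigr => i /st it.
  rewrite -big_filter (_ : [seq y <- t | g i == y] = [:: g i]) ?big_seq1 //.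
  by rewrite (eq_filter (a2 := pred1 (g i))) ?filter_pred1_uniq // => y; rewrite /= eq_sym.
rewrite (exchange_big_dep xpredT) //= big_distrr /= big_seq [X in _ <= X]big_seq.
apply: ler_sum => y yt.
rewrite big_const_seq iter_addr_0 -[X in X <= _]mulr_natl ler_wpM2r // ler_nat.
by apply: leq_trans (hM y yt); rewrite leq_eqVlt; apply/orP; left; apply/eqP/eq_count.
Qed.

(** Each dyadic block has [2^j] terms of size at most [2^-j]. *)
Lemma harmonic_pow2 j : \sum_(1 <= a < 2 ^ j) a%:R^-1 <= j%:R :> R.
Proof.
elim: j => [|j ih]; first by rewrite expn0 big_geq.
rewrite (big_cat_nat (n := 2 ^ j)) /=; last 2 first.
- by rewrite expn_gt0.
- by rewrite leq_exp2l.
rewrite -natr1; apply: lerD => //.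
apply: (@le_trans _ _ (\sum_(2 ^ j <= a < 2 ^ j.+1) ((2 ^ j)%:R^-1 : R))).
  rewrite big_nat [X in _ <= X]big_nat; apply: ler_sum => a /andP[ha _].
  by rewrite lef_pV2 ?posrE ?ltr0n ?expn_gt0 // ?ler_nat // (leq_trans _ ha) // expn_gt0.
rewrite big_const_nat iter_addr_0 expnS mul2n -addnn addnK -[X in X <= _]mulr_natl mulfV //.
Qed.

Lemma small_ints_sum j : \sum_(a <- small_ints (2 ^ j)) `|a%:~R|^-1 <= 2 * j%:R :> R.
Proof.
rewrite big_cat !big_map /= mulr_natl mulr2n.
have e : \sum_(a <- index_iota 1 (2 ^ j)) `|(- a%:Z)%:~R|^-1 = \sum_(1 <= a < 2 ^ j) a%:R^-1 :> R.
  by apply: eq_bigr => a _; rewrite mulrNz normrN ger0_norm.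
rewrite e; have -> : \sum_(a <- index_iota 1 (2 ^ j)) `|(a%:Z)%:~R|^-1 = \sum_(1 <= a < 2 ^ j) a%:R^-1 :> R.
  by apply: eq_bigr => a _; rewrite ger0_norm.
by apply: lerD; exact: harmonic_pow2.
Qed.

End FiniteSums.

(** * Eigenvalue bands and sums of reciprocal eigenvalues *)

Section Bands.
Context {R : realType}.
Variables (nu : nat -> R) (zeta : nat -> R -> R).
Hypothesis Hbasis : laplace_eigenbasis nu zeta.
Local Notation lam := (lam nu).

Lemma frequency : exists m : nat -> nat, forall k, nu k = (m k)%:R ^+ 2.
Proof.
have H k : exists l : nat, nu k = l%:R ^+ 2.
  by have [l [a [b [e _ _]]]] := zeta_trig Hbasis k; exists l.
by exists (fun k => projT1 (cid (H k))) => k; exact: projT2 (cid (H k)).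
Qed.

Lemma lam_factor m i : (forall k, nu k = (m k)%:R ^+ 2) ->
  lam i = (((m i.1)%:Z - i.2) * ((m i.1)%:Z + i.2))%:~R.
Proof.
by move=> hm; rewrite /Defs.lam hm intrM !intrD rmorphN /=; ring.
Qed.

(** Eigenvalues are integers, so there is a spectral gap around 0. *)
Lemma lam_ge1 i : lam i != 0 -> 1 <= `|lam i|.
Proof.
have [m hm] := frequency; rewrite (lam_factor i hm) intr_eq0 -intr_norm => h.
by rewrite -[1]/(1%:~R) ler_int -gtz0_ge1 normr_gt0.
Qed.

Lemma lam_factors_lt m i (N : nat) : (forall k, nu k = (m k)%:R ^+ 2) ->
  0 < `|lam i| -> `|lam i| < N%:R ->
  ((m i.1)%:Z - i.2 \in small_ints N) && ((m i.1)%:Z + i.2 \in small_ints N).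
Proof.
move=> hm; rewrite (lam_factor i hm) normr_gt0 intr_eq0 mulf_eq0 negb_or => /andP[a0 b0].
rewrite -intr_norm -[N%:R]/((N%:Z)%:~R) ltr_int !small_intsP.
move: ((m i.1)%:Z - i.2) ((m i.1)%:Z + i.2) a0 b0 => a b a0 b0 h; rewrite a0 b0 /=.
have {}h : (`|a| * `|b| < N)%N by rewrite -abszM; lia.
have a1 : (0 < `|a|)%N by rewrite absz_gt0.
have b1 : (0 < `|b|)%N by rewrite absz_gt0.
by apply/andP; split; apply: leq_ltn_trans h; [rewrite leq_pmulr|rewrite leq_pmull].
Qed.

(** The map from an index to the pair of factors of its eigenvalue is at most two-to-one, by the
    multiplicity bound, and both factors are nonzero integers below [2^j] in modulus. The sum over
    all such pairs is the square of a sum that is at most [2 * j], and twice its square is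
    [8 * j^2]. *)
Lemma sum_inv_lam (s : seq (nat * int)) j : uniq s ->
  (forall i, i \in s -> 0 < `|lam i| < 2 ^+ j) ->
  \sum_(i <- s) `|lam i|^-1 <= 8 * j%:R ^+ 2.
Proof.
move=> us hs; have [m hm] := frequency.
pose g (i : nat * int) : int * int := ((m i.1)%:Z - i.2, (m i.1)%:Z + i.2).
pose f (y : int * int) : R := `|y.1%:~R|^-1 * `|y.2%:~R|^-1.
pose t := [seq (a, b) | a <- small_ints (2 ^ j), b <- small_ints (2 ^ j)].
have -> : \sum_(i <- s) `|lam i|^-1 = \sum_(i <- s) f (g i).
  by apply: eq_bigr => i _; rewrite (lam_factor i hm) intrM normrM invfM.
apply: le_trans (@sum_fiber_le _ _ _ g f s t 2 _ _ _ _) _.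
- by apply: allpairs_uniq => //; [exact: small_ints_uniq|exact: small_ints_uniq|case=> ? ? [? ?] _ _ [-> ->]].
- move=> i /hs /andP[l0 l1]; apply/allpairsP; exists (g i).
  have /andP[h1 h2] : ((m i.1)%:Z - i.2 \in small_ints (2 ^ j)) && ((m i.1)%:Z + i.2 \in small_ints (2 ^ j)).
    by apply: lam_factors_lt => //; rewrite natrX.
  by split.
- by move=> y; rewrite mulr_ge0 ?invr_ge0.
- move=> [a b] _; rewrite -size_filter -(size_map fst).
  set s' := [seq i <- s | g i == (a, b)].
  have s'P i : i \in s' -> (m i.1)%:Z - i.2 = a /\ (m i.1)%:Z + i.2 = b.
    by rewrite mem_filter => /andP[/eqP[]].
  case es: s' => [|i0 s0] //; rewrite -es.
  have i0s : i0 \in s' by rewrite es mem_head.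
  have [a0 b0] := s'P _ i0s.
  apply: (zeta_multiplicity Hbasis (l := m i0.1)).
    rewrite map_inj_in_uniq; first exact: filter_uniq.
    move=> [k l] [k' l'] /s'P [/= e1 e2] /s'P [/= e3 e4] /= ek; subst k'; congr pair; lia.
  move=> k /mapP[[k' l'] /s'P[/= e1 e2] ->] /=; rewrite hm.
  have e3 : (m k')%:Z - l' = (m i0.1)%:Z - i0.2 by rewrite e1 a0.
  have e4 : (m k')%:Z + l' = (m i0.1)%:Z + i0.2 by rewrite e2 b0.
  have -> : m k' = m i0.1 by clear -e3 e4; lia.
  by [].
rewrite /t big_allpairs /f /=.
have -> : \sum_(i1 <- small_ints (2 ^ j)) \sum_(i2 <- small_ints (2 ^ j)) (`|i1%:~R|^-1 * `|i2%:~R|^-1)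
   = (\sum_(a <- small_ints (2 ^ j)) `|a%:~R|^-1) ^+ 2 :> R.
  rewrite expr2 big_distrl /=; apply: eq_bigr => a _; by rewrite big_distrr.
have h := @small_ints_sum R j.
have h0 : 0 <= \sum_(a <- small_ints (2 ^ j)) `|a%:~R|^-1 :> R by apply: sumr_ge0 => a _; rewrite invr_ge0.
by move: h h0 (ler0n R j); set X := \sum_(_ <- _) _; move: X (j%:R : R) => X Y h h0 Y0; nra.
Qed.

Definition band_set (n : nat) : set (nat * int) := [set i | 0 < `|lam i| < 2 ^+ n].

(** Both factors of [lam] are small, so [l] and the frequency of [zeta k] are bounded; as [nu k]
    tends to infinity, finitely many [k] remain. *)
Lemma finite_band n : finite_set (band_set n).
Proof.
have [m hm] := frequency.
have [_ /cvgryPge cvg _ _] := Hbasis.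
have [K _ hK] := cvg ((2 ^+ n) ^+ 2).
pose s := [seq (k, l) | k <- iota 0 K, l <- 0 :: small_ints (2 ^ n)].
apply: (sub_finite_set _ (finite_seq s)) => -[k l] /= /andP[l0 l1].
have /andP[] : ((m k)%:Z - l \in small_ints (2 ^ n)) && ((m k)%:Z + l \in small_ints (2 ^ n)).
  by apply: (lam_factors_lt (i := (k, l))) => //; rewrite natrX.
rewrite !small_intsP => /andP[a0 a1] /andP[b0 b1].
apply/allpairsP; exists (k, l); split => //=.
- rewrite mem_iota /= add0n ltnNge; apply/negP => Kk.
  have := hK k Kk; rewrite hm /= -natrX -!natrX ler_nat leq_exp2r //.
  by move: a0 a1 b0 b1; lia.
rewrite inE small_intsP; case: (l == 0) => //=.
by move: a0 a1 b0 b1; lia.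
Qed.

Definition band (n : nat) : {fset nat * int} := fset_set (band_set n).

Lemma bandP n i : (i \in band n) = (0 < `|lam i| < 2 ^+ n).
Proof.
by rewrite in_fset_set; [apply/idP/idP; rewrite inE|exact: finite_band].
Qed.

Lemma band_mono n n' : (n <= n')%N -> (band n `<=` band n')%fset.
Proof.
move=> nn; apply/fsubsetP => i; rewrite !bandP => /andP[-> /lt_le_trans]; apply.
by rewrite ler_eXn2l // ltr1n.
Qed.

Lemma band_exhaust i : lam i != 0 -> exists n, i \in band n.
Proof.
move=> h; exists (Num.bound `|lam i|); rewrite bandP normr_gt0 h /=.
apply: (lt_trans (archi_boundP (normr_ge0 _))).
by rewrite -natrX ltr_nat ltn_expl.
Qed.

End Bands.

Section LrInclusion.
Context {d : measure_display} {T : measurableType d} {R : realType}.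
Variable mu : {measure set T -> \bar R}.

Lemma powR_le_exponent (r p x : R) : 0 <= r -> r <= p -> `|x| `^ r <= 1 + `|x| `^ p.
Proof.
move=> r0 rp; have [x1|x1] := leP `|x| 1.
  apply: (@le_trans _ _ 1); last by rewrite lerDl powR_ge0.
  have := @ge0_ler_powR _ _ r0 `|x| 1; rewrite powR1 !nnegrE; exact.
apply: (@le_trans _ _ (`|x| `^ p)); last by rewrite lerDr.
by apply: ler_powR => //; exact: ltW.
Qed.

Lemma Lr_exponent (r p : R) f : (mu setT < +oo)%E -> 0 <= r -> r <= p -> Lr mu p f -> Lr mu r f.
Proof.
move=> fin r0 rp [mf hf]; split => //.
have i1 : intg mu (fun _ => 1 : R) by apply: (bounded_intg (C := 1)) => // x; rewrite normr1.
apply: intg_le (intgD i1 hf); first exact: measurable_normpowR.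
by move=> x; rewrite ger0_norm ?powR_ge0 //; exact: powR_le_exponent.
Qed.

End LrInclusion.

(** * L^p estimates for sums of modes *)

Section Embedding.
Context {R : realType}.
Variables (nu : nat -> R) (zeta : nat -> R -> R).
Hypothesis Hbasis : laplace_eigenbasis nu zeta.
Local Notation mu2 := (@torus_measure R).
Local Notation T1 := (measurableTypeR R).
Local Notation mode := (mode zeta).
Local Notation coef := (coef zeta).
Local Notation lam := (lam nu).
Local Notation band := (band nu).

Definition mode_comb (s : seq (nat * int)) (c : nat * int -> R) (z : R * R) : R :=
  \sum_(i <- s) c i * mode i z.

Definition energy_sum (s : seq (nat * int)) (c : nat * int -> R) : R :=
  \sum_(i <- s) `|lam i| * c i ^+ 2.

Lemma energy_sum_ge0 s c : 0 <= energy_sum s c.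
Proof. by apply: sumr_ge0 => i _; rewrite mulr_ge0 ?sqr_ge0. Qed.

Lemma mode_comb_Lr r s c : 0 < r -> Lr mu2 r (mode_comb s c).
Proof. by move=> r0; apply: Lr_sum => // i; apply: LrZ; exact: mode_Lr Hbasis _ _ (ltW r0). Qed.

(** Modes are bounded by 2, and Cauchy-Schwarz with weights [|lam i|] splits the sum of [|c i|] into
    the sum of reciprocals, at most [8 * j^2], and the energy. The constant 6 exceeds
    [2 * sqrt 8]. *)
Lemma mode_comb_sup s c j z : uniq s -> (forall i, i \in s -> 0 < `|lam i| < 2 ^+ j) ->
  `|mode_comb s c z| <= 6 * j%:R * Num.sqrt (energy_sum s c).
Proof.
move=> us hs; have E0 := energy_sum_ge0 s c.
have h1 : `|mode_comb s c z| <= 2 * \sum_(i <- s) `|c i|.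
  rewrite big_distrr /=; apply: le_trans (ler_norm_sum _ _ _) _; apply: ler_sum => i _.
  by rewrite normrM mulrC ler_wpM2r //; exact: mode_bound Hbasis _ _.
apply: (le_trans h1).
have h2 : (\sum_(i <- s) `|c i|) ^+ 2 <= (\sum_(i <- s) `|lam i|^-1) * energy_sum s c.
  apply: sum_cauchy_schwarz => i /hs /andP[l0 _].
  - by rewrite invr_ge0.
  - by rewrite mulr_ge0 ?sqr_ge0.
  - by rewrite mulKf // gt_eqF.
have h3 := sum_inv_lam Hbasis us hs.
have h4 : (\sum_(i <- s) `|c i|) ^+ 2 <= 8 * j%:R ^+ 2 * energy_sum s c.
  by apply: (le_trans h2); apply: ler_wpM2r.
have s0 : 0 <= \sum_(i <- s) `|c i| by apply: sumr_ge0.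
have sE := sqr_sqrtr E0.
rewrite -(ler_pXn2r (n := 2)) // ?nnegrE; last 2 first.
- by rewrite mulr_ge0.
- by rewrite !mulr_ge0 ?sqrtr_ge0.
rewrite !exprMn sE; move: h4 E0 (sqr_ge0 (j%:R : R)).
move: (j%:R ^+ 2 : R) (energy_sum s c) ((\sum_(i <- s) `|c i|) ^+ 2) => J E X h4 E0 J0.
have : 0 <= J * E by exact: mulr_ge0.
nra.
Qed.

Lemma mode_comb_int2 s c : uniq s -> \int[mu2]_z (mode_comb s c z ^+ 2) = \sum_(i <- s) c i ^+ 2.
Proof.
move=> us; have <- := inner_comb_sqr (mode_L2 Hbasis) (mode_ortho Hbasis) c us.
by apply: eq_Rintegral => z _; rewrite expr2.
Qed.

Variables (p : R).
Hypothesis p2 : 2 < p.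

Let p0 : 0 < p. Proof. by rewrite (lt_trans _ p2). Qed.
Let p1 : 1 < p. Proof. by apply: lt_trans p2; rewrite ltr1n. Qed.

(** The loss [(j + 1)^(p - 2)] from the sup norm is absorbed by [2^(j / 2)], half of the gain in the
    exponent, leaving a geometric rate. *)
Lemma block_constants : exists K th : R, [/\ 0 < K, 0 < th, th < 1 &
  forall j : nat, (6 * j.+1%:R) `^ (p - 2) * (2 ^+ j)^-1 <= (K * th ^+ j) `^ p].
Proof.
have a0 : 0 < p - 2 by rewrite subr_gt0.
(* Chosen so that [rho^(p - 2) = sqrt 2]; Bernoulli's inequality gives [j + 1 <= C * rho^j]. *)
pose rho : R := 2 `^ (2 * (p - 2))^-1.
have i0 : 0 < (2 * (p - 2))^-1 by rewrite invr_gt0 mulr_gt0.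
have rho1 : 1 < rho by have := @gt0_ltr_powR _ _ i0 1 2; rewrite powR1 !nnegrE ltr1n; exact.
pose C : R := 1 + (rho - 1)^-1.
have C1 : 1 <= C by rewrite lerDl invr_ge0 subr_ge0 ltW.
have bern (y x : R) : 1 < y -> 0 <= x -> 1 + (x + 1) * (y - 1) <= y * (1 + x * (y - 1)).
  move=> y1 x0; rewrite -subr_ge0 (_ : _ - _ = x * (y - 1) ^+ 2); last by ring.
  by rewrite mulr_ge0 ?sqr_ge0.
have hj (j : nat) : j.+1%:R <= C * rho ^+ j.
  have hb : 1 + j%:R * (rho - 1) <= rho ^+ j.
    elim: j => [|j ih]; first by rewrite mul0r addr0.
    rewrite exprS -natr1; have j0 : 0 <= (j%:R : R) by [].
    apply: (@le_trans _ _ (rho * (1 + j%:R * (rho - 1)))).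
      exact: bern.
    by rewrite ler_wpM2l // (le_trans ler01) // ltW.
  apply: (@le_trans _ _ (C * (1 + j%:R * (rho - 1)))); last by rewrite ler_wpM2l // (le_trans ler01).
  have r10 : rho - 1 != 0 by rewrite subr_eq0 gt_eqF.
  have -> : C * (1 + j%:R * (rho - 1)) = 1 + j%:R * (rho - 1) + (rho - 1)^-1 + j%:R.
    by rewrite /C; move: (rho - 1) r10 => z z0; field.
  rewrite -natr1.
  have : 0 <= j%:R * (rho - 1) by rewrite mulr_ge0 // subr_ge0 ltW.
  have : 0 <= (rho - 1)^-1 by rewrite invr_ge0 subr_ge0 ltW.
  lra.
(* What remains of the factor [1 / 2] per step after [sqrt 2] is spent on the polynomial loss. *)
pose eta : R := 2 `^ 2^-1 / 2.
have eta0 : 0 < eta by rewrite divr_gt0 // powR_gt0.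
have eta1 : eta < 1.
  rewrite ltr_pdivrMr // mul1r powR12_sqrt // -(ltr_pXn2r (n := 2)) ?nnegrE ?sqrtr_ge0 //.
  by rewrite sqr_sqrtr // -natrX ltr_nat.
exists ((6 * C) `^ ((p - 2) / p)), (eta `^ p^-1); split.
- by rewrite powR_gt0 // mulr_gt0 // (lt_le_trans ltr01).
- by rewrite powR_gt0.
- by have := @gt0_ltr_powR _ p^-1 _ eta 1; rewrite powR1 !nnegrE invr_gt0 ler01 (ltW eta0); exact.
move=> j.
have -> : ((6 * C) `^ ((p - 2) / p) * eta `^ p^-1 ^+ j) `^ p = (6 * C) `^ (p - 2) * eta ^+ j.
  rewrite powRM ?powR_ge0 ?exprn_ge0 ?powR_ge0 // -powRrM divfK ?gt_eqF //.
  congr (_ * _); rewrite -(powR_mulrn _ (powR_ge0 _ _)) -!powRrM -(powR_mulrn _ (ltW eta0)).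
  by congr (_ `^ _); rewrite mulrCA mulVf ?mulr1 // gt_eqF.
rewrite /eta expr_div_n mulrA; apply: ler_wpM2r; first by rewrite invr_ge0 exprn_ge0.
have C0 : 0 <= C by exact: le_trans C1.
have rho0 : 0 <= rho ^+ j by rewrite exprn_ge0 // powR_ge0.
apply: (@le_trans _ _ ((6 * (C * rho ^+ j)) `^ (p - 2))).
  apply: (ge0_ler_powR (ltW a0)); rewrite ?nnegrE.
  - by rewrite mulr_ge0.
  - by rewrite mulr_ge0 // mulr_ge0.
  - by rewrite ler_wpM2l.
rewrite mulrA (powRM _ (mulr_ge0 _ C0) rho0) //.
apply: ler_wpM2l; first exact: powR_ge0.
have -> : (rho ^+ j) `^ (p - 2) = (2 `^ 2^-1) ^+ j; last by [].
rewrite /rho -(powR_mulrn j (powR_ge0 2 (2 * (p - 2))^-1)) -(powR_mulrn j (powR_ge0 2 2^-1)) -!powRrM.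
congr (2 `^ _); field.
by rewrite gt_eqF.
Qed.

(** Interpolation: the integral of [|f|^p] is at most [sup |f|^(p - 2)] times that of [f^2]. On a
    block the first factor costs a power of [j], and the second gains [2^-j] over the energy. *)
Lemma block_bound : exists K th : R, [/\ 0 < K, 0 < th, th < 1 &
  forall j s c, uniq s -> (forall i, i \in s -> 2 ^+ j <= `|lam i| < 2 ^+ j.+1) ->
   nr mu2 p (mode_comb s c) <= K * th ^+ j * Num.sqrt (energy_sum s c)].
Proof.
have [K [th [K0 th0 th1 hK]]] := block_constants.
exists K, th; split => // j s c us hs.
have E0 := energy_sum_ge0 s c.
set e := Num.sqrt (energy_sum s c).
have e0 : 0 <= e by exact: sqrtr_ge0.
have eE : e ^+ 2 = energy_sum s c by exact: sqr_sqrtr.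
have hs' i : i \in s -> 0 < `|lam i| < 2 ^+ j.+1.
  by move=> /hs /andP[h ->]; rewrite andbT (lt_le_trans _ h) // exprn_gt0.
have a0 : 0 <= p - 2 by rewrite subr_ge0 ltW.
have hsup z : `|mode_comb s c z| <= 6 * j.+1%:R * e by exact: mode_comb_sup.
have M0 : 0 <= 6 * j.+1%:R :> R by rewrite mulr_ge0.
have Ke0 : 0 <= K * th ^+ j by rewrite mulr_ge0 ?exprn_ge0 // ltW.
rewrite nr_le_int //; last exact: mulr_ge0.
have hp z : `|mode_comb s c z| `^ p <= (6 * j.+1%:R * e) `^ (p - 2) * (mode_comb s c z ^+ 2).
  have -> : mode_comb s c z ^+ 2 = `|mode_comb s c z| `^ 2 by rewrite powR_mulrn ?real_normK ?num_real.
  have [->|z0] := eqVneq `|mode_comb s c z| 0.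
    by rewrite powR0 ?gt_eqF // mulr_ge0 ?powR_ge0.
  have {1}-> : p = (p - 2) + 2 by rewrite subrK.
  rewrite powRD; last by rewrite z0 implybT.
  apply: ler_wpM2r; first exact: powR_ge0.
  by apply: ge0_ler_powR; rewrite ?nnegrE ?mulr_ge0.
have [_ ip] := mode_comb_Lr s c p0.
have i2 : intg mu2 (fun z => mode_comb s c z ^+ 2).
  have h2 : Lr mu2 2 (mode_comb s c) by exact: mode_comb_Lr.
  by have := L2_mul h2 h2; apply: eq_integrable => // z _; rewrite expr2.
apply: (@le_trans _ _ ((6 * j.+1%:R * e) `^ (p - 2) * ((2 ^+ j)^-1 * e ^+ 2))).
  apply: (@le_trans _ _ (\int[mu2]_z ((6 * j.+1%:R * e) `^ (p - 2) * (mode_comb s c z ^+ 2)))).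
    by apply: int_le => //; exact: intgZ.
  rewrite int_Z // mode_comb_int2 //; apply: ler_wpM2l; first exact: powR_ge0.
  rewrite eE mulrC ler_pdivlMr ?exprn_gt0 // mulr_suml big_seq [X in _ <= X]big_seq.
  apply: ler_sum => i /hs /andP[h _]; rewrite mulrC; apply: ler_wpM2r => //; exact: sqr_ge0.
rewrite (powRM _ M0 e0) (powRM _ Ke0 e0) mulrACA.
have -> : e `^ (p - 2) * e ^+ 2 = e `^ p.
  have [->|en0] := eqVneq e 0; first by rewrite expr0n mulr0 powR0 ?gt_eqF.
  by rewrite -powR_mulrn // -powRD ?subrK // en0 implybT.
by apply: ler_wpM2r; [exact: powR_ge0|exact: hK].
Qed.

(** The lowest dyadic block is peeled off repeatedly and the geometric series summed. Here sits the
    compactness: sums of high modes with bounded energy are uniformly small in L^p. *)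
Lemma tail_bound : exists K th : R, [/\ 0 < K, 0 < th, th < 1 &
  forall J s c, uniq s -> (forall i, i \in s -> 2 ^+ J <= `|lam i|) ->
   nr mu2 p (mode_comb s c) <= K * th ^+ J * Num.sqrt (energy_sum s c)].
Proof.
have [K [th [K0 th0 th1 hK]]] := block_bound.
have t1 : 0 < 1 - th by rewrite subr_gt0.
exists (K / (1 - th)), th; split => //; first by rewrite divr_gt0.
have main n : forall J s c, uniq s -> (forall i, i \in s -> 2 ^+ J <= `|lam i| < 2 ^+ (J + n)) ->
   nr mu2 p (mode_comb s c) <= K / (1 - th) * th ^+ J * Num.sqrt (energy_sum s c).
  elim: n => [|n ih] J s c us hs.
    have -> : s = [::].
      by case: s us hs => // i s _ /(_ i (mem_head _ _)) /andP[h1 h2]; rewrite addn0 ltNge h1 in h2.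
    rewrite /mode_comb /energy_sum big_nil sqrtr0 mulr0.
    under eq_fun do rewrite big_nil.
    by rewrite nrE; under eq_Rintegral => z _ do rewrite normr0 (powR0 (lt0r_neq0 p0)); rewrite int_0 powR0 // gt_eqF ?invr_gt0.
  pose s1 := [seq i <- s | `|lam i| < 2 ^+ J.+1]; pose s2 := [seq i <- s | ~~ (`|lam i| < 2 ^+ J.+1)].
  have ec : mode_comb s c = fun z => mode_comb s1 c z + mode_comb s2 c z.
    by apply/funext => z; rewrite /mode_comb !big_filter; exact: bigID.
  have eE : energy_sum s c = energy_sum s1 c + energy_sum s2 c.
    by rewrite /energy_sum !big_filter; exact: bigID.
  have hs1 i : i \in s1 -> 2 ^+ J <= `|lam i| < 2 ^+ J.+1.
    by rewrite mem_filter => /andP[-> /hs /andP[-> _]].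
  have hs2 i : i \in s2 -> 2 ^+ J.+1 <= `|lam i| < 2 ^+ (J.+1 + n).
    by rewrite mem_filter -leNgt => /andP[-> /hs /andP[_]]; rewrite addSnnS.
  have H1 := hK J s1 c (filter_uniq _ us) hs1.
  have H2 := ih J.+1 s2 c (filter_uniq _ us) hs2.
  rewrite ec; apply: le_trans (nrD (ltW p1) (mode_comb_Lr _ _ p0) (mode_comb_Lr _ _ p0)) _.
  have S1 : Num.sqrt (energy_sum s1 c) <= Num.sqrt (energy_sum s c).
    by rewrite ler_wsqrtr // eE lerDl energy_sum_ge0.
  have S2 : Num.sqrt (energy_sum s2 c) <= Num.sqrt (energy_sum s c).
    by rewrite ler_wsqrtr // eE lerDr energy_sum_ge0.
  have c1 : 0 <= K * th ^+ J by rewrite mulr_ge0 ?exprn_ge0 // ltW.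
  have c2 : 0 <= K / (1 - th) * th ^+ J.+1 by rewrite !mulr_ge0 ?exprn_ge0 ?invr_ge0 // ltW.
  apply: (@le_trans _ _ (K * th ^+ J * Num.sqrt (energy_sum s c) +
     K / (1 - th) * th ^+ J.+1 * Num.sqrt (energy_sum s c))).
    apply: lerD; [apply: (le_trans H1)|apply: (le_trans H2)]; exact: ler_wpM2l.
  rewrite -mulrDl le_eqVlt; apply/orP; left; apply/eqP; congr (_ * _).
  rewrite exprS; move: (th ^+ J) => y; field.
  by rewrite gt_eqF.
move=> J s c us hs.
have [n hn] : exists n, forall i, i \in s -> `|lam i| < 2 ^+ (J + n).
  elim: (s) => [|i t [n hn]]; first by exists 0%N.
  exists (maxn n (Num.bound `|lam i|)) => k; rewrite inE => /orP[/eqP->|/hn h].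
    apply: (lt_le_trans (archi_boundP (normr_ge0 _))); rewrite -natrX ler_nat.
    apply: (@leq_trans (2 ^ Num.bound `|lam i|)); first exact: ltnW (ltn_expl _ _).
    by rewrite leq_exp2l // (leq_trans (leq_maxr n _)) // leq_addl.
  by apply: (lt_le_trans h); rewrite ler_eXn2l ?ltr1n // leq_add2l leq_maxl.
by apply: (main n) => // i is_; rewrite hs ?hn.
Qed.

Variable r : R.
Hypothesis r1 : 1 < r.
Hypothesis pr : p^-1 + r^-1 = 1.

Lemma mode_comb_pairing s c h : Lr mu2 r h ->
  \int[mu2]_z (mode_comb s c z * h z) = \sum_(i <- s) c i * coef h i.
Proof.
move=> hh.
have ih i : intg mu2 (fun z => mode i z * h z).
  by apply: (Lr_mul p1 r1 pr) => //; exact: mode_Lr Hbasis _ _ (ltW p0).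
transitivity (\int[mu2]_z (\sum_(i <- s) c i * (mode i z * h z))).
  by apply: eq_Rintegral => z _; rewrite /mode_comb mulr_suml; apply: eq_bigr => i _; rewrite mulrA.
rewrite int_sum; last by move=> i; exact: intgZ.
by apply: eq_bigr => i _; rewrite int_Z // /Defs.coef innerC.
Qed.

(** Duality: pairing [h] with the combination of coefficients [coef h i / |lam i|] gives the sum [D]
    itself, while Hoelder's inequality and [tail_bound] bound the pairing by a multiple of
    [sqrt D]. *)
Lemma dual_tail_bound : exists K th : R, [/\ 0 < K, 0 < th, th < 1 &
  forall J s h, Lr mu2 r h -> uniq s -> (forall i, i \in s -> 2 ^+ J <= `|lam i|) ->
   \sum_(i <- s) coef h i ^+ 2 / `|lam i| <= (K * th ^+ J * nr mu2 r h) ^+ 2].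
Proof.
have [K [th [K0 th0 th1 hK]]] := tail_bound.
exists K, th; split => // J s h hh us hs.
pose c i := coef h i / `|lam i|.
set D := \sum_(i <- s) _.
have l0 i : i \in s -> `|lam i| != 0.
  by move=> /hs h0; rewrite gt_eqF // (lt_le_trans _ h0) // exprn_gt0.
have eE : energy_sum s c = D.
  rewrite /energy_sum /D big_seq [RHS]big_seq; apply: eq_bigr => i /l0 li.
  by rewrite /c expr_div_n expr2 mulrCA; congr (_ * _); rewrite expr2 invfM mulrA mulfV // mul1r.
have D0 : 0 <= D by rewrite -eE energy_sum_ge0.
have eD : \int[mu2]_z (mode_comb s c z * h z) = D.
  by rewrite mode_comb_pairing //; apply: eq_bigr => i _; rewrite /c expr2 mulrAC.
have H := hoelder_nr p1 r1 pr (mode_comb_Lr s c p0) hh.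
rewrite eD ger0_norm // in H.
have := hK J s c us hs; rewrite eE => H2.
have n0 := nr_ge0 mu2 r h.
have {}H : D <= K * th ^+ J * nr mu2 r h * Num.sqrt D.
  by apply: (le_trans H); rewrite mulrAC; apply: ler_wpM2r.
have [D00|D00] := eqVneq D 0; first by rewrite D00 sqr_ge0.
have sD : 0 < Num.sqrt D by rewrite sqrtr_gt0 lt_def D00.
move: H; rewrite -{1}(sqr_sqrtr D0) expr2 ler_pM2r // => H.
rewrite -(sqr_sqrtr D0) ler_pXn2r // nnegrE ?sqrtr_ge0 //.
by rewrite !mulr_ge0 ?exprn_ge0 // ltW.
Qed.

(** The partial sums over bands are Cauchy in L^p by [tail_bound], so pairings with all of L^r pass
    to the limit. Bands omit the kernel modes, whence the coefficient 0 there. *)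
Lemma energy_synthesis (c : nat * int -> R) (B : R) :
  (forall n, energy_sum (band n) c <= B) ->
  exists g, [/\ torus_invariant g, Lr mu2 p g, Lr mu2 2 g,
    (forall i, coef g i = if lam i == 0 then 0 else c i) &
    (forall h, Lr mu2 r h -> (fun n => \sum_(i <- band n) c i * coef h i) @ \oo
       --> \int[mu2]_z (g z * h z))].
Proof.
move=> hB; have [K [th [K0 th0 th1 hK]]] := tail_bound.
have B0 : 0 <= B by apply: le_trans (hB 0%N); exact: energy_sum_ge0.
have diff m n : (m <= n)%N ->
    nr mu2 p (fun z => mode_comb (band n) c z - mode_comb (band m) c z) <= K * th ^+ m * Num.sqrt B.
  move=> mn; pose s := [seq i <- band n | i \notin band m].
  have e z : mode_comb (band n) c z = mode_comb (band m) c z + mode_comb s c z.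
    rewrite /mode_comb /s big_filter (bigID (fun i => i \in band m)) /=; congr (_ + _).
    rewrite -big_filter; apply: perm_big; apply: uniq_perm.
    - exact: filter_uniq (fset_uniq _).
    - exact: fset_uniq.
    move=> i; rewrite mem_filter; have /fsubsetP h := band_mono Hbasis mn.
    by apply/andP/idP => [[]//|im]; split => //; exact: h.
  have -> : (fun z => mode_comb (band n) c z - mode_comb (band m) c z) = mode_comb s c.
    by apply/funext => z; rewrite e addrC addKr.
  have hs i : i \in s -> 2 ^+ m <= `|lam i|.
    rewrite mem_filter !(bandP Hbasis) => /andP[h /andP[h1 _]].
    by move: h; rewrite h1 /= -leNgt.
  apply: (le_trans (hK m s c (filter_uniq _ (fset_uniq _)) hs)).
  apply: ler_wpM2l; first by rewrite mulr_ge0 ?exprn_ge0 // ltW.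
  apply: ler_wsqrtr; apply: le_trans (hB n).
  rewrite /energy_sum /s big_filter [X in _ <= X](bigID (fun i => i \in band m)) /= lerDr.
  by apply: sumr_ge0 => i _; rewrite mulr_ge0 ?sqr_ge0.
have cau e : 0 < e -> exists N, forall m n, (N <= m)%N -> (N <= n)%N ->
    nr mu2 p (fun z => mode_comb (band m) c z - mode_comb (band n) c z) <= e.
  move=> e0; have cv : (fun n => K * th ^+ n * Num.sqrt B) @ \oo --> (0 : R).
    have -> : (0 : R) = K * 0 * Num.sqrt B by rewrite mulr0 mul0r.
    by apply: cvgMl; apply: cvgMr; apply: cvg_expr; rewrite ger0_norm // ltW.
  have [N _ hN] : \forall n \near \oo, K * th ^+ n * Num.sqrt B < e by exact: cvgr_lt cv _ e0.
  exists N => m n Nm Nn; wlog mn : m n Nm Nn / (m <= n)%N.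
    by move=> H; case: (leqP m n) => [|/ltnW] mn; [exact: H|rewrite nrBC; exact: H].
  by rewrite nrBC (le_trans (diff m n mn)) // ltW //; exact: hN.
have [g [hg gcv ginv]] := Lr_complete (ltW p1) (fun n => mode_comb_Lr (band n) c p0) cau.
have g2 : Lr mu2 2 g by apply: Lr_exponent hg => //; [exact: torus_measure_fin|exact: ltW].
have pair h : Lr mu2 r h -> (fun n => \sum_(i <- band n) c i * coef h i) @ \oo
       --> \int[mu2]_z (g z * h z).
  move=> hh.
  have e n : \sum_(i <- band n) c i * coef h i - \int[mu2]_z (g z * h z)
      = \int[mu2]_z ((mode_comb (band n) c z - g z) * h z).
    rewrite -mode_comb_pairing // -int_B; last 2 first.
    - exact: Lr_mul p1 r1 pr (mode_comb_Lr _ _ p0) hh.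
    - exact: Lr_mul p1 r1 pr hg hh.
    by apply: eq_Rintegral => z _; rewrite mulrBl.
  apply/cvgrPdist_le => eps eps0.
  have cv : (fun n => nr mu2 p (fun z => mode_comb (band n) c z - g z) * nr mu2 r h) @ \oo --> (0 : R).
    have -> : (0 : R) = 0 * nr mu2 r h by rewrite mul0r.
    exact: cvgMl gcv.
  have : \forall n \near \oo, nr mu2 p (fun z => mode_comb (band n) c z - g z) * nr mu2 r h < eps.
    exact: cvgr_lt cv _ eps0.
  apply: filterS => n hn; rewrite distrC e (le_trans _ (ltW hn)) //.
  apply: (hoelder_nr p1 r1 pr) => //.
  by apply: LrB => //; [exact: ltW|exact: mode_comb_Lr].
exists g; split => //.
- move=> x t; split; apply: ginv => n; apply: eq_bigr => i _; congr (_ * _).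
    exact: (mode_invariant Hbasis i x t).1.
  exact: (mode_invariant Hbasis i x t).2.
move=> i; have hm : Lr mu2 r (mode i) by apply: mode_Lr Hbasis _ _ _; rewrite ltW // (lt_trans ltr01).
have H := pair _ hm.
have ec n : \sum_(k <- band n) c k * coef (mode i) k = if i \in band n then c i else 0.
  rewrite -(coef_comb (mode_L2 Hbasis) (mode_ortho Hbasis) c i (fset_uniq (band n))).
  rewrite (inner_comb (mode_L2 Hbasis) _ c (mode_L2 Hbasis i)).
  by apply: eq_bigr.
have {}H : (fun n => if i \in band n then c i else 0) @ \oo --> coef g i.
  by move: H; under eq_fun do rewrite ec.
apply: (cvg_unique _ H) => //.
case: ifPn => [/eqP l0|l0].
  have -> : (fun n => if i \in band n then c i else 0) = (fun _ => 0 : R).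
    by apply/funext => n; rewrite (bandP Hbasis) l0 normr0 ltxx.
  exact: cvg_cst.
have [N hN] := band_exhaust Hbasis l0.
apply/cvgrPdist_le => eps eps0; exists N => // n /= Nn.
by rewrite (fsubsetP (band_mono Hbasis Nn) _ hN) subrr normr0 ltW.
Qed.

(** A square integrable function is determined almost everywhere by its coefficients, so [u] agrees
    with the synthesized function: finite energy embeds into L^p. *)
Lemma energy_pairing u (B : R) : L2_torus u -> (forall i, lam i = 0 -> coef u i = 0) ->
  (forall n, energy_sum (band n) (coef u) <= B) ->
  Lr mu2 p u /\ (forall h, Lr mu2 r h -> (fun n => \sum_(i <- band n) coef u i * coef h i) @ \oo
       --> \int[mu2]_z (u z * h z)).
Proof.
move=> hu u0 uB; have [pu hu2] : torus_invariant u /\ Lr mu2 2 u by exact/L2_torusP.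
have [g [pg hg g2 gc gp]] := energy_synthesis uB.
have ae : {ae mu2, forall z, g z - u z = 0}.
  apply: (mode_complete Hbasis).
    apply/L2_torusP; split; last exact: LrB.
    by move=> x t; rewrite !(pg x t).1 !(pg x t).2 !(pu x t).1 !(pu x t).2.
  move=> i; rewrite /Defs.coef innerBl //; last exact: mode_L2 Hbasis i.
  have := gc i; rewrite /Defs.coef => ->; case: ifPn => [/eqP/u0|_]; last by rewrite subrr.
  by rewrite /Defs.coef => ->; rewrite subrr.
have ae' : {ae mu2, forall z, g z = u z}.
  by apply: (ae_imp (mu := mu2) ae) => z /eqP; rewrite subr_eq0 => /eqP.
have [mg _] := hg; have [mu_ _] := hu2.
split; first exact: Lr_ae_eq mu_ ae' hg.
move=> h hh; have -> : \int[mu2]_z (u z * h z) = \int[mu2]_z (g z * h z); last exact: gp.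
have [mh _] := hh.
apply: int_ae_eq; [exact: measurable_funM|exact: measurable_funM|].
by apply: (ae_imp (mu := mu2) ae') => z ->.
Qed.

End Embedding.

(** * The spectral definitions in terms of coefficients *)

Section UnconditionalSums.
Context {R : realType} {I : choiceType}.
Variables (S : set I) (G : nat -> {fset I}).
Hypothesis Gmono : forall n m, (n <= m)%N -> (G n `<=` G m)%fset.
Hypothesis Gex : forall i, S i -> exists n, i \in G n.

Lemma fset_exhaust (s : seq I) : (forall i, i \in s -> S i) -> exists n, forall i, i \in s -> i \in G n.
Proof.
elim: s => [|i s ih] hs; first by exists 0%N.
have [|n hn] := ih; first by move=> k ks; apply: hs; rewrite inE ks orbT.
have [m hm] := Gex (hs i (mem_head _ _)).
exists (maxn n m) => k; rewrite inE => /orP[/eqP->|/hn].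
  exact: (fsubsetP (Gmono (leq_maxr n m)) _ hm).
exact: (fsubsetP (Gmono (leq_maxl n m))).
Qed.

Lemma esum_exhaust (b : I -> R) (B : R) : (forall i, 0 <= b i) ->
  (forall n, \sum_(i <- G n | i \in S) b i <= B) ->
  (\esum_(i in S) (b i)%:E < +oo)%E /\
  (fun n => \sum_(i <- G n | i \in S) b i) @ \oo --> fine (\esum_(i in S) (b i)%:E).
Proof.
move=> b0 hB; set X : nat -> R := fun n => \sum_(i <- G n | i \in S) b i.
have Xle (s t : {fset I}) : (forall i, i \in s -> S i -> i \in t) ->
    \sum_(i <- s | i \in S) b i <= \sum_(i <- t | i \in S) b i.
  move=> st; rewrite [X in _ <= X](bigID (fun i => i \in s)) /=.
  have -> : \sum_(i <- s | i \in S) b i = \sum_(i <- t | (i \in S) && (i \in s)) b i.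
    rewrite -big_filter -[RHS]big_filter; apply: perm_big; apply: uniq_perm.
    - exact: filter_uniq (fset_uniq _).
    - exact: filter_uniq (fset_uniq _).
    move=> i; rewrite !mem_filter; apply/andP/andP => [[iS is_]|[/andP[-> ->] _]] //.
    by rewrite iS is_ st //; exact: set_mem.
  by rewrite lerDl; apply: sumr_ge0.
have Xnd : nondecreasing_seq X by move=> m n mn; apply: Xle => i im _; exact: (fsubsetP (Gmono mn)).
have Xcv : cvgn X by apply: nondecreasing_is_cvgn => //; exists B => _ [n _ <-]; exact: hB.
set l := limn X.
have hl : X @ \oo --> l by [].
have Xl n : X n <= l by exact: nondecreasing_cvgn_le.
have up : (\esum_(i in S) (b i)%:E <= l%:E)%E.
  apply: ge_ereal_sup => _ [A [Afin AS] <-].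
  rewrite fsbig_finite // sumEFin lee_fin.
  have [|n hn] := fset_exhaust (s := fset_set A).
    by move=> i; rewrite in_fset_set // inE => /AS.
  apply: le_trans (Xl n); rewrite /X.
  have -> : \sum_(i <- fset_set A) b i = \sum_(i <- fset_set A | i \in S) b i.
    rewrite big_seq [RHS]big_seq_cond; apply: eq_bigl => i.
    by case: (boolP (i \in fset_set A)) => //=; rewrite in_fset_set // => /set_mem /AS iS; rewrite mem_set.
  by apply: Xle => i iA _; exact: hn.
have lo n : ((X n)%:E <= \esum_(i in S) (b i)%:E)%E.
  apply: esum_ge; exists [set` [fset i in G n | i \in S]%fset].
    split; first exact: finite_fset.
    by move=> i /=; rewrite !inE => /andP[_]; exact: set_mem.
  rewrite fsbig_finite; last exact: finite_fset.
  rewrite set_fsetK sumEFin lee_fin /X -big_filter.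
  rewrite le_eqVlt; apply/orP; left; apply/eqP; apply: perm_big; apply: uniq_perm.
  - exact: filter_uniq (fset_uniq _).
  - exact: fset_uniq.
  by move=> i; rewrite mem_filter !inE andbC.
have fin : \esum_(i in S) (b i)%:E \is a fin_num.
  rewrite ge0_fin_numE; first exact: le_lt_trans up (ltry _).
  by apply: le_trans (lo 0%N); rewrite lee_fin; apply: sumr_ge0.
split; first by rewrite -ge0_fin_numE // esum_ge0 // => i _; rewrite lee_fin.
suff -> : fine (\esum_(i in S) (b i)%:E) = l by [].
apply/eqP; rewrite eq_le -!lee_fin fineK // up /= -[X in (_ <= X)%E]fineK // lee_fin.
by apply: limr_le => //; apply: nearW => n; rewrite -lee_fin fineK.
Qed.

(** Absolute summability lets the positive and negative parts be summed separately along the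
    exhausting sets. *)
Lemma usum_cvg (a : I -> R) (B : R) :
  (forall n, \sum_(i <- G n | i \in S) `|a i| <= B) ->
  (fun n => \sum_(i <- G n | i \in S) a i) @ \oo --> usum S a.
Proof.
move=> hB.
have p0 i : 0 <= a^\+ i by exact: funrpos_ge0.
have n0 i : 0 <= a^\- i by exact: funrneg_ge0.
have e i : a^\+ i + a^\- i = `|a i| by have := congr1 (fun f => f i) (funrposDneg a).
have e2 i : a^\+ i - a^\- i = a i by have := congr1 (fun f => f i) (funrposBneg a).
have [|_ H1] := @esum_exhaust a^\+ B p0.
  by move=> n; apply: le_trans (hB n); apply: ler_sum => i _; rewrite -e lerDl.
have [|_ H2] := @esum_exhaust a^\- B n0.
  by move=> n; apply: le_trans (hB n); apply: ler_sum => i _; rewrite -e lerDr.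
rewrite /usum.
have -> : (fun n => \sum_(i <- G n | i \in S) a i) =
    (fun n => \sum_(i <- G n | i \in S) a^\+ i - \sum_(i <- G n | i \in S) a^\- i).
  by apply/funext => n; rewrite -sumrB; apply: eq_bigr => i _.
exact: cvgB.
Qed.

End UnconditionalSums.

Section SpectralSpaces.
Context {R : realType}.
Variables (nu : nat -> R) (zeta : nat -> R -> R).
Hypothesis Hbasis : laplace_eigenbasis nu zeta.
Local Notation mu2 := (@torus_measure R).
Local Notation T1 := (measurableTypeR R).
Local Notation mode := (mode zeta).
Local Notation coef := (coef zeta).
Local Notation lam := (lam nu).
Local Notation band := (band nu).
Local Notation energy_sum := (energy_sum nu).

(** Exhausts all indices through their countable encoding; unlike the bands it reaches the kernel
    modes. *)
Definition index_ball (n : nat) : {fset nat * int} :=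
  [fset i in pmap (@choice.unpickle (nat * int)%type) (iota 0 n)]%fset.

Lemma index_ball_mono n m : (n <= m)%N -> (index_ball n `<=` index_ball m)%fset.
Proof.
move=> nm; apply/fsubsetP => i; rewrite !inE !mem_pmap => /mapP[k]; rewrite mem_iota /= => kn ->.
by apply/mapP; exists k => //; rewrite mem_iota /= add0n (leq_trans _ nm).
Qed.

Lemma index_ball_exhaust i : exists n, i \in index_ball n.
Proof.
exists (choice.pickle i).+1; rewrite inE mem_pmap; apply/mapP; exists (choice.pickle i).
  by rewrite mem_iota /= add0n.
by rewrite choice.pickleK.
Qed.

Lemma L2_synthesis (c : nat * int -> R) (B : R) :
  (forall n, \sum_(i <- index_ball n) c i ^+ 2 <= B) ->
  exists g, [/\ L2_torus g, forall i, coef g i = c i &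
    (fun n => nr mu2 2 (fun z => \sum_(i <- index_ball n) c i * mode i z - g z)) @ \oo --> 0].
Proof.
move=> hB.
have [g [g2 gcv gc ginv]] := riesz_fischer (mode_L2 Hbasis) (mode_ortho Hbasis)
  (fun n => index_ball_mono (leqnSn n)) hB.
exists g; split => //.
  apply/L2_torusP; split => // x t; split; apply: ginv => i.
    exact: (mode_invariant Hbasis i x t).1.
  exact: (mode_invariant Hbasis i x t).2.
by move=> i; have [n hn] := index_ball_exhaust i; exact: gc hn.
Qed.

Lemma L2_torusB u v : L2_torus u -> L2_torus v -> L2_torus (fun z => u z - v z : R).
Proof.
move=> /L2_torusP[pu hu] /L2_torusP[pv hv]; apply/L2_torusP; split; last exact: LrB.
by move=> x t; rewrite !(pu x t).1 !(pu x t).2 !(pv x t).1 !(pv x t).2.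
Qed.

Lemma L2_torusD u v : L2_torus u -> L2_torus v -> L2_torus (fun z => u z + v z : R).
Proof.
move=> /L2_torusP[pu hu] /L2_torusP[pv hv]; apply/L2_torusP; split; last exact: LrD.
by move=> x t; rewrite !(pu x t).1 !(pu x t).2 !(pv x t).1 !(pv x t).2.
Qed.

Lemma coefB u v i : L2_torus u -> L2_torus v -> coef (fun z => u z - v z) i = coef u i - coef v i.
Proof.
by move=> /L2_torusP[_ hu] /L2_torusP[_ hv]; rewrite /Defs.coef innerBl //; exact: mode_L2 Hbasis _.
Qed.

Lemma coefD u v i : L2_torus u -> L2_torus v -> coef (fun z => u z + v z) i = coef u i + coef v i.
Proof.
by move=> /L2_torusP[_ hu] /L2_torusP[_ hv]; rewrite /Defs.coef innerDl //; exact: mode_L2 Hbasis _.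
Qed.

Lemma coef_inj u v : L2_torus u -> L2_torus v -> (forall i, coef u i = coef v i) ->
  {ae mu2, forall z, u z = v z}.
Proof.
move=> hu hv e; have := mode_complete Hbasis (L2_torusB hu hv).
move=> H; apply: (ae_imp (mu := mu2) (H _)) => [i|z /eqP].
  by rewrite coefB // e subrr.
by rewrite subr_eq0 => /eqP.
Qed.

Lemma coef_bessel u : L2_torus u -> forall n, \sum_(i <- index_ball n) coef u i ^+ 2 <= inner mu2 u u.
Proof.
move=> /L2_torusP[_ hu] n.
exact: (bessel (mode_L2 Hbasis) (mode_ortho Hbasis) (fset_uniq _) hu).
Qed.

(** By completeness [u] is the sum of its own Fourier series, in which only indices in [S]
    contribute. *)
Lemma mode_span (S : set (nat * int)) u : L2_torus u -> (forall i, ~ S i -> coef u i = 0) ->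
  in_closed_span mu2 S mode u.
Proof.
move=> hu u0; have [_ hu2] : torus_invariant u /\ Lr mu2 2 u by exact/L2_torusP.
apply/(closed_spanP (mode_L2 Hbasis) (mode_ortho Hbasis)) => // e e0.
have [g [hg gc gcv]] := L2_synthesis (coef_bessel hu).
have [_ hg2] : torus_invariant g /\ Lr mu2 2 g by exact/L2_torusP.
have [n _ hn] : \forall n \near \oo,
    nr mu2 2 (fun z => \sum_(i <- index_ball n) coef u i * mode i z - g z) < e.
  exact: cvgr_lt gcv _ e0.
exists [fset i in index_ball n | i \in S]%fset; split.
  by move=> i; rewrite !inE => /andP[_]; exact: set_mem.
apply: le_lt_trans (hn n (leqnn n)).
rewrite nrBC le_eqVlt; apply/orP; left; apply/eqP.
have ec z : \sum_(i <- [fset i in index_ball n | i \in S]%fset) inner mu2 u (mode i) * mode i z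
    = \sum_(i <- index_ball n) coef u i * mode i z.
  rewrite [RHS](bigID (fun i => i \in S)) /= [X in _ = _ + X]big1 ?addr0; last first.
    by move=> i iS; rewrite u0 ?mul0r // => /mem_set; exact/negP.
  rewrite -[RHS]big_filter; apply: perm_big; apply: uniq_perm.
  - exact: fset_uniq.
  - exact: filter_uniq (fset_uniq _).
  by move=> i; rewrite mem_filter !inE andbC.
have hc : Lr mu2 2 (fun z => \sum_(i <- index_ball n) coef u i * mode i z).
  exact: L2_comb (mode_L2 Hbasis) _ _.
apply: nr_ae_eq.
- apply: measurable_funB; last by have [] := hu2.
  by under eq_fun do rewrite ec; have [] := hc.
- by apply: measurable_funB; [have [] := hc|have [] := hg2].
have := coef_inj hu hg (fun i => esym (gc i)).
by move=> H; apply: (ae_imp (mu := mu2) H) => z; rewrite ec => ->.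
Qed.

Lemma spectral_spaceP (S : set (nat * int)) u : spectral_space zeta S u <->
  L2_torus u /\ forall i, ~ S i -> coef u i = 0.
Proof.
split=> [[hu sp]|[hu u0]]; split => //; last exact: mode_span.
move=> i iS; have [_ hu2] : torus_invariant u /\ Lr mu2 2 u by exact/L2_torusP.
exact: (closed_span_coef0 (mode_L2 Hbasis) (mode_ortho Hbasis) hu2 sp iS).
Qed.

Lemma spectral_part (S : set (nat * int)) u : L2_torus u -> exists v,
  spectral_space zeta S v /\ forall i, S i -> coef v i = coef u i.
Proof.
move=> hu.
have [|v [hv vc _]] := @L2_synthesis (fun i => if i \in S then coef u i else 0) (inner mu2 u u).
  move=> n; apply: le_trans (coef_bessel hu n); apply: ler_sum => i _.
  by case: ifP => // _; rewrite expr0n sqr_ge0.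
exists v; split; last by move=> i iS; rewrite vc mem_set.
by apply/spectral_spaceP; split => // i iS; rewrite vc memNset.
Qed.

(** [orth_proj] selects an unspecified representative; synthesis shows that one exists, and
    orthogonality tested on the modes in [S] determines its coefficients. *)
Lemma spectral_projP (S : set (nat * int)) u : L2_torus u ->
  spectral_space zeta S (spectral_proj zeta S u) /\
  forall i, S i -> coef (spectral_proj zeta S u) i = coef u i.
Proof.
move=> hu; have [v [hv vc]] := spectral_part S hu.
pose P := [set v | spectral_space zeta S v /\
  forall w, spectral_space zeta S w -> inner mu2 (u \- v) w = 0].
have H : P (spectral_proj zeta S u).
  apply: xgetPex; exists v; split => // w [hw sw]; rewrite innerC.
  have [hv1 _] := hv.
  apply: (inner_eq0_coef (mode_L2 Hbasis) (mode_ortho Hbasis) (S := S)) => //.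
  - by have /L2_torusP[] := hw.
  - by have /L2_torusP[] := L2_torusB hu hv1.
  by move=> i iS; right; have := coefB i hu hv1; rewrite vc // subrr.
have [hP Pw] := H; split => // i iS.
have [hP1 _] := hP.
have mS : spectral_space zeta S (mode i).
  apply/spectral_spaceP; split; first exact: mode_L2_torus Hbasis i.
  move=> j jS; rewrite /Defs.coef (mode_ortho Hbasis).
  by case: eqP => // ij; case: jS; rewrite -ij.
have := Pw _ mS; have := coefB i hu hP1; rewrite /Defs.coef => -> /eqP.
by rewrite subr_eq0 => /eqP.
Qed.

Definition energy_bounded (u : R * R -> R) : Prop :=
  exists B, forall n, energy_sum (band n) (coef u) <= B.

Definition nonkernel : set (nat * int) := [set i | lam i != 0].

Lemma band_sum_subset (S : set (nat * int)) (f : nat * int -> R) n :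
  (forall i, ~ S i -> f i = 0) -> \sum_(i <- band n) f i = \sum_(i <- band n | i \in S) f i.
Proof.
move=> f0; rewrite (bigID (fun i => i \in S)) /= [X in _ + X]big1 ?addr0 //.
by move=> i iS; apply: f0 => /mem_set; exact/negP.
Qed.

Lemma band_exhaust_sub (S : set (nat * int)) : S `<=` nonkernel ->
  forall i, S i -> exists n, i \in band n.
Proof. by move=> SN i /SN; exact: band_exhaust Hbasis _. Qed.

(** Bands exhaust every [S] without kernel modes, so summability of the energy amounts to a bound on
    its sums over bands. *)
Lemma E_spectralP (S : set (nat * int)) u : S `<=` nonkernel ->
  E_spectral nu zeta S u <->
  [/\ L2_torus u, forall i, ~ S i -> coef u i = 0 & energy_bounded u].
Proof.
move=> SN; pose b i := `|lam i| * coef u i ^+ 2.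
have b0 i : 0 <= b i by rewrite mulr_ge0 ?sqr_ge0.
have eb : summable S (fun i => (`|lam i| * coef u i * coef u i)%:E) =
    (\esum_(i in S) (b i)%:E < +oo)%E.
  rewrite /summable; congr (_ < +oo)%E; apply: eq_esum => i _.
  by rewrite -mulrA -expr2 gee0_abs // lee_fin b0.
have sumS : (forall i, ~ S i -> coef u i = 0) -> forall n,
    energy_sum (band n) (coef u) = \sum_(i <- band n | i \in S) b i.
  by move=> u0 n; apply: band_sum_subset => i /u0 ->; rewrite expr0n mulr0.
split.
  move=> [/spectral_spaceP[hu u0]]; rewrite eb => fin; split => //.
  exists (fine (\esum_(i in S) (b i)%:E)) => n; rewrite sumS // -lee_fin fineK; last first.
    by rewrite ge0_fin_numE // esum_ge0 // => i _; rewrite lee_fin.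
  apply: esum_ge; exists [set` [fset i in band n | i \in S]%fset].
    split; first exact: finite_fset.
    by move=> i /=; rewrite !inE => /andP[_]; exact: set_mem.
  rewrite fsbig_finite; last exact: finite_fset.
  rewrite set_fsetK sumEFin lee_fin -big_filter.
  rewrite le_eqVlt; apply/orP; left; apply/eqP; apply: perm_big; apply: uniq_perm.
  - exact: filter_uniq (fset_uniq _).
  - exact: fset_uniq.
  by move=> i; rewrite mem_filter !inE andbC.
move=> [hu u0 [B hB]]; split; first exact/spectral_spaceP.
rewrite eb; apply: (proj1 (esum_exhaust (band_mono Hbasis) (band_exhaust_sub SN) b0 (B := B) _)).
by move=> n; rewrite -sumS.
Qed.

Lemma ker_LAP u : ker_LA nu zeta u <-> L2_torus u /\ forall i, lam i != 0 -> coef u i = 0.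
Proof.
have z0 i : coef (cst 0) i = 0.
  by rewrite /Defs.coef /inner; under eq_Rintegral => z _ do rewrite mul0r; rewrite int_0.
split.
  move=> [hu _ h]; split => // i li; apply/eqP.
  have := h i; rewrite z0 => /eqP; rewrite eq_sym mulf_eq0 => /orP[/eqP e|//].
  by rewrite e eqxx in li.
move=> [hu u0]; split => //.
  by apply/L2_torusP; split => //; exact: Lr0.
move=> i; rewrite z0; have [->|/u0 ->] := eqVneq (lam i) 0; first by rewrite mul0r.
by rewrite mulr0.
Qed.

Variables (p : R) (q : R * R -> R).
Local Notation E_space := (E_space nu zeta p q).
Local Notation E_zero := (E_zero nu zeta p q).

Lemma Ipos_nonkernel : Ipos nu `<=` nonkernel.
Proof. by move=> i h; rewrite /nonkernel /= gt_eqF. Qed.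

Lemma Ineg_nonkernel : Ineg nu `<=` nonkernel.
Proof. by move=> i h; rewrite /nonkernel /= lt_eqF. Qed.

Lemma energy_bounded_le u v : (forall i, coef v i ^+ 2 <= coef u i ^+ 2) ->
  energy_bounded u -> energy_bounded v.
Proof.
move=> vu [B hB]; exists B => n; apply: le_trans (hB n); apply: ler_sum => i _.
by rewrite ler_wpM2l.
Qed.

Lemma energy_boundedD u v w : (forall i, coef w i = coef u i + coef v i) ->
  energy_bounded u -> energy_bounded v -> energy_bounded w.
Proof.
move=> e [B hB] [C hC]; exists (2 * B + 2 * C) => n.
apply: (@le_trans _ _ (2 * energy_sum (band n) (coef u) + 2 * energy_sum (band n) (coef v))).
  rewrite /energy_sum !big_distrr /= -big_split /=; apply: ler_sum => i _.
  rewrite !(mulrCA 2) -mulrDr ler_wpM2l // e.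
  by move: (coef u i) (coef v i) => x y; have := sqr_ge0 (x - y); nra.
by apply: lerD; rewrite ler_wpM2l.
Qed.

(** The positive and negative components are merged into one component [g] without kernel
    coefficients; the sign of [lam] recovers the splitting. *)
Lemma E_spaceP u : E_space u <-> exists g phi, [/\ u = g \+ phi, L2_torus g,
  (forall i, lam i = 0 -> coef g i = 0), energy_bounded g & E_zero phi].
Proof.
split.
  move=> [um [u0 [up [hm h0 hp ->]]]].
  have [m2 mc mb] := (E_spectralP _ Ineg_nonkernel).1 hm.
  have [p2 pc pb] := (E_spectralP _ Ipos_nonkernel).1 hp.
  exists (fun z => um z + up z), u0; split => //.
  - by apply/funext => z /=; rewrite addrAC.
  - exact: L2_torusD.
  - move=> i li; rewrite coefD // mc ?pc ?addr0 // /Ipos /Ineg /= li ltxx.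
      by [].
    by [].
  - by apply: energy_boundedD mb pb => i; rewrite coefD.
move=> [g [phi [-> g2 gc gb hphi]]].
have [up [/spectral_spaceP[p2 p0] pc]] := spectral_part (Ipos nu) g2.
exists (fun z => g z - up z), phi, up; split => //; last first.
- by apply/funext => z /=; rewrite addrAC subrK.
- apply/(E_spectralP _ Ipos_nonkernel); split => //.
  apply: energy_bounded_le gb => i.
  have [h|h] := pselect (Ipos nu i); first by rewrite pc.
  by rewrite p0 // expr0n sqr_ge0.
apply/(E_spectralP _ Ineg_nonkernel); split; first exact: L2_torusB.
- move=> i hi; rewrite coefB //.
  have [h|h] := pselect (Ipos nu i); first by rewrite pc // subrr.
  rewrite p0 // subr0 gc //; apply/eqP; move: hi h; rewrite /Ipos /Ineg /=.
  by case: ltgtP.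
apply: energy_bounded_le gb => i; rewrite coefB //.
have [h|h] := pselect (Ipos nu i); first by rewrite pc // subrr expr0n sqr_ge0.
by rewrite p0 // subr0.
Qed.

Lemma E_space_energy u : E_space u -> L2_torus u /\ energy_bounded u.
Proof.
move=> /E_spaceP[g [phi [-> g2 gc gb [/ker_LAP[k2 kc] _]]]].
split; first exact: L2_torusD.
have [B hB] := gb; exists B => n; apply: le_trans (hB n).
rewrite le_eqVlt; apply/orP; left; apply/eqP.
rewrite /energy_sum !big_seq; apply: eq_bigr => i.
rewrite (bandP Hbasis) => /andP[li _]; congr (_ * _ ^+ 2).
by rewrite coefD // kc ?addr0 // -normr_gt0.
Qed.

(** The difference of the two forms becomes a single sum weighted by the signed [lam i]. Each
    unconditional sum is computed along the bands because its terms are dominated by the two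
    energies. *)
Lemma form_cvg u v : E_space u -> E_space v ->
  (fun n => \sum_(i <- band n) lam i * (coef u i * coef v i)) @ \oo -->
  spectral_form nu zeta (Ipos nu) (spectral_proj zeta (Ipos nu) u) (spectral_proj zeta (Ipos nu) v)
  - spectral_form nu zeta (Ineg nu) (spectral_proj zeta (Ineg nu) u) (spectral_proj zeta (Ineg nu) v).
Proof.
move=> /E_space_energy[hu [B hB]] /E_space_energy[hv [C hC]].
have main S : S `<=` nonkernel ->
   (fun n => \sum_(i <- band n | i \in S) `|lam i| * (coef u i * coef v i)) @ \oo -->
   spectral_form nu zeta S (spectral_proj zeta S u) (spectral_proj zeta S v).
  move=> SN; have [_ uc] := spectral_projP S hu; have [_ vc] := spectral_projP S hv.
  rewrite /spectral_form.
  have -> : (fun n => \sum_(i <- band n | i \in S) `|lam i| * (coef u i * coef v i)) =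
     (fun n => \sum_(i <- band n | i \in S) `|lam i| * coef (spectral_proj zeta S u) i
        * coef (spectral_proj zeta S v) i).
    by apply/funext => n; apply: eq_bigr => i /set_mem iS; rewrite uc // vc // mulrA.
  apply: (usum_cvg (band_mono Hbasis) (band_exhaust_sub SN) (B := B + C)) => n.
  apply: le_trans (lerD (hB n) (hC n)); rewrite /energy_sum -big_split /=.
  rewrite [X in _ <= X](bigID (fun i => i \in S)) /= -[X in X <= _]addr0; apply: lerD.
    apply: ler_sum => i /set_mem iS; rewrite uc // vc // -mulrA normrM normr_id -mulrDr ler_wpM2l //.
    rewrite normrM; move: (coef u i) (coef v i) => x y.
    rewrite -(real_normK (num_real x)) -(real_normK (num_real y)).
    by have := sqr_ge0 (`|x| - `|y|); have := normr_ge0 x; have := normr_ge0 y; nra.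
  by apply: sumr_ge0 => i _; rewrite addr_ge0 // mulr_ge0 ?sqr_ge0.
have H1 := main _ Ipos_nonkernel; have H2 := main _ Ineg_nonkernel.
have -> : (fun n => \sum_(i <- band n) lam i * (coef u i * coef v i)) =
   (fun n => \sum_(i <- band n | i \in Ipos nu) `|lam i| * (coef u i * coef v i)
      - \sum_(i <- band n | i \in Ineg nu) `|lam i| * (coef u i * coef v i)).
  apply/funext => n; rewrite (bigID (fun i => i \in Ipos nu)) /=; congr (_ + _).
    by apply: eq_bigr => i /set_mem h; rewrite gtr0_norm.
  rewrite -sumrN big_seq_cond [RHS]big_seq_cond; apply: eq_big => i.
    case: (boolP (i \in band n)) => //=; rewrite (bandP Hbasis) normr_gt0 => /andP[li _].
    apply/idP/idP => [h|/set_mem h].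
      by apply/mem_set; rewrite /Ineg /=; move: h li; case: ltgtP => // h /negP[]; exact/mem_set.
    by apply/negP => /set_mem; rewrite /Ipos /= => h'; have := lt_trans h h'; rewrite ltxx.
  move=> /andP[ib h]; have : lam i < 0.
    move: ib; rewrite (bandP Hbasis) normr_gt0 => /andP[li _].
    by move: h li; case: ltgtP => // h' /negP[]; exact/mem_set.
  by move=> h'; rewrite ltr0_norm // mulNr opprK.
exact: cvgB H1 H2.
Qed.

End SpectralSpaces.

(** * A state of positive energy *)

Section Bump.
Context {R : realType}.
Local Notation mu1 := (@circle_measure R).
Local Notation mu2 := (@torus_measure R).
Local Notation T1 := (measurableTypeR R).
Local Notation T2 := (T1 * T1)%type.
Local Notation tp := (2 * pi : R).
Local Notation deriv f x l := (is_derive (x : R) (1 : R) (f : R -> R) (l : R)).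

Lemma deriv_of_quadratic (f : R -> R) (x l C : R) : (forall h, `|f (x + h) - f x - l * h| <= C * h ^+ 2) ->
  deriv f x l.
Proof.
move=> H.
have C0 : 0 <= C by have := le_trans (normr_ge0 _) (H 1); rewrite expr1n mulr1.
have cv : h^-1 *: ((f \o shift x) (h *: (1 : R)) - f x) @[h --> 0^'] --> l.
  apply/cvgrPdist_le => e e0.
  have C1 : 0 < C + 1 by rewrite ltr_wpDl.
  exists (e / (C + 1)) => /=; first exact: divr_gt0.
  move=> h /=; rewrite sub0r normrN => hd h0.
  rewrite /GRing.scale /= mulr1 /shift /= [h + x]addrC.
  have -> : l - h^-1 * (f (x + h) - f x) = - ((f (x + h) - f x - l * h) / h) by field.
  rewrite normrN normrM normfV ler_pdivrMr ?normr_gt0 //.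
  apply: (le_trans (H h)); rewrite -(real_normK (num_real h)) expr2 mulrA; apply: ler_wpM2r => //.
  move: hd; rewrite ltr_pdivlMr // => /ltW; apply: le_trans.
  by rewrite mulrC ler_wpM2l // lerDl.
apply: DeriveDef; first exact: cvgP cv.
exact: cvg_lim cv.
Qed.

Definition pospart (y : R) : R := Num.max 0 y.

Lemma pospart_ge0 y : 0 <= pospart y. Proof. by rewrite /pospart le_max lexx. Qed.

Lemma pospartM y : y * pospart y = pospart y ^+ 2.
Proof. by rewrite /pospart; case: (leP 0 y) => h; rewrite expr2 ?mulr0. Qed.

Lemma deriv_pospart2 y : deriv (fun y => pospart y ^+ 2) y (2 * pospart y).
Proof.
apply: (deriv_of_quadratic (C := 1)) => h; rewrite mul1r /pospart ler_norml.
case: (leP 0 y) => y0; case: (leP 0 (y + h)) => h0; apply/andP; split; nra.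
Qed.

Lemma deriv_pospart3 y : deriv (fun y => pospart y ^+ 3) y (3 * pospart y ^+ 2).
Proof.
have -> : (fun y => pospart y ^+ 3) = (fun y => y * pospart y ^+ 2).
  by apply/funext => z; rewrite exprSr -{1}pospartM -mulrA -expr2.
have hid : deriv (fun z : R => z) y 1 by have := deriv_lin 1 y; under eq_fun do rewrite mul1r.
have := deriv_mul hid (deriv_pospart2 y); congr (is_derive _ _ _ _).
by have := pospartM y; rewrite mul1r mulrCA => ->; ring.
Qed.

Section Cap.
Variables (c d : R).
Definition capbase (x : R) : R := pospart (cos (x - c) - d).
(** The third power of a positive part is the lowest integer power of class C^2, as integration by
    parts requires; [d] close to 1 narrows the support around [c]. *)
Definition cap (x : R) : R := capbase x ^+ 3.
Definition cap1 (x : R) : R := - 3 * capbase x ^+ 2 * sin (x - c).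
Definition cap2 (x : R) : R :=
  6 * capbase x * sin (x - c) ^+ 2 - 3 * capbase x ^+ 2 * cos (x - c).

Lemma deriv_shift (x : R) : deriv (fun y => y - c) x 1.
Proof. by apply: is_derive_eq; rewrite subr0. Qed.

Lemma deriv_cosc (x : R) : deriv (fun y => cos (y - c)) x (- sin (x - c)).
Proof.
by have := @is_derive1_comp R cos (fun y => y - c) x _ _ (is_derive_cos (x - c)) (deriv_shift x); rewrite mulr1.
Qed.

Lemma deriv_sinc (x : R) : deriv (fun y => sin (y - c)) x (cos (x - c)).
Proof.
by have := @is_derive1_comp R sin (fun y => y - c) x _ _ (is_derive_sin (x - c)) (deriv_shift x); rewrite mulr1.
Qed.

Lemma deriv_arg (x : R) : deriv (fun y => cos (y - c) - d) x (- sin (x - c)).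
Proof.
by have h := deriv_cosc x; apply: is_derive_eq; rewrite subr0.
Qed.

Lemma deriv_capbase2 (x : R) : deriv (fun y => capbase y ^+ 2) x (- 2 * capbase x * sin (x - c)).
Proof.
have := @is_derive1_comp R (fun y => pospart y ^+ 2) (fun y => cos (y - c) - d) x _ _
  (deriv_pospart2 (cos (x - c) - d)) (deriv_arg x).
by congr (is_derive _ _ _ _); rewrite /capbase; ring.
Qed.

Lemma deriv_cap (x : R) : deriv cap x (cap1 x).
Proof.
have := @is_derive1_comp R (fun y => pospart y ^+ 3) (fun y => cos (y - c) - d) x _ _
  (deriv_pospart3 (cos (x - c) - d)) (deriv_arg x).
by congr (is_derive _ _ _ _); rewrite /cap1 /capbase; ring.
Qed.

Lemma deriv_cap1 (x : R) : deriv cap1 x (cap2 x).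
Proof.
have := deriv_mul (deriv_scale (- 3) (deriv_capbase2 x)) (deriv_sinc x).
by congr (is_derive _ _ _ _); rewrite /cap2; ring.
Qed.

Lemma capbase_continuous : continuous capbase.
Proof.
have -> : capbase = (fun x => ((cos (x - c) - d) + `|cos (x - c) - d|) / 2).
  apply/funext => x; rewrite /capbase /pospart; set y := _ - d.
  by case: (leP 0 y) => h; [rewrite ger0_norm //; field|rewrite ltr0_norm //; field].
have ca := deriv_continuous (fun x => deriv_arg x).
move=> x; apply: cvgM; last exact: cvg_cst.
by apply: cvgD; [exact: ca|apply: cvg_norm; exact: ca].
Qed.

Lemma cap_C2 : C2circle cap cap1 cap2.
Proof.
have inv (x : R) : cos (x + tp - c) = cos (x - c).
  by rewrite -(cos_invariant_int 1 (x - c)) mul1r; congr cos; ring.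
split; [|exact: deriv_cap|exact: deriv_cap1|].
  by move=> x; rewrite /cap /capbase inv.
have cc := deriv_continuous deriv_cosc; have cs := deriv_continuous deriv_sinc.
have cb := capbase_continuous.
have cs2 : continuous (fun y => sin (y - c) ^+ 2).
  by under eq_fun do rewrite expr2; exact: continuousMR.
have cb2 : continuous (fun y => capbase y ^+ 2).
  by under eq_fun do rewrite expr2; exact: continuousMR.
rewrite /cap2; move=> x; apply: cvgB.
  apply: cvgM; last exact: cs2.
  by apply: cvgM; [exact: cvg_cst|exact: cb].
apply: cvgM; last exact: cc.
by apply: cvgM; [exact: cvg_cst|exact: cb2].
Qed.

Lemma cap_support x : cap x != 0 -> d <= cos (x - c).
Proof.
by rewrite /cap /capbase /pospart; case: (leP 0 (_ - d)) => h; [lra|rewrite expr0n eqxx].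
Qed.

Lemma cap2_support x : cap2 x != 0 -> d <= cos (x - c).
Proof.
rewrite /cap2 /capbase /pospart; case: (leP 0 (_ - d)) => h; first by lra.
by rewrite expr0n !mulr0 !mul0r subrr eqxx.
Qed.

Lemma cap_int_gt0 : 0 <= d -> d < 1 -> 0 < \int[mu1]_x (cap x * cap x).
Proof.
move=> d0 d1; have [pu _ _ _] := cap_C2; have [_ _ cu _] := C2circle_facts cap_C2.
(* For [0 <= s <= k] the cosine is at least [(1 + d) / 2], so [capbase] is at least [(1 - d) / 2] on
   an interval of length [k]; [e] is the sixth power of that value. *)
pose k := acos ((1 + d) / 2).
have r1 : -1 <= (1 + d) / 2 <= 1 by apply/andP; split; lra.
have k0 : 0 < k by apply: acos_gt0; apply/andP; split; lra.
have kpi : k <= pi by exact: acos_lepi.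
have ck : cos k = (1 + d) / 2 by apply: acosK; rewrite in_itv /=.
pose e : R := ((1 - d) / 2) ^+ 6.
have e0 : 0 < e by rewrite exprn_gt0 // divr_gt0 // subr_gt0.
have pp : circle_invariant (fun x => cap x * cap x) by move=> x; rewrite !pu.
have ccu := continuousMR cu cu.
have ii : intg mu1 (fun x => cap x * cap x) by exact: circle_intg.
have := @circle_integral_lower R (fun x => e^-1 * (cap x * cap x)) c k.
have mm : measurable_fun [set: T1] (fun x => e^-1 * (cap x * cap x)).
  by apply: measurable_funM => //; exact: (intg_measurable ii).
move=> /(_ mm) H.
have {}H : (k%:E <= \int[mu1]_x (e^-1 * (cap x * cap x))%:E)%E.
  apply: H.
  - by move=> x; rewrite !pu.
  - by move=> x; rewrite mulr_ge0 ?invr_ge0 ?(ltW e0) // -expr2 sqr_ge0.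
  - rewrite (ltW k0) /= (le_trans kpi) //; have := pi_gt0 R; lra.
  move=> s /andP[s0 sk]; rewrite mulrC ler_pdivlMr // mul1r /cap -exprD.
  rewrite ler_pXn2r // ?nnegrE ?pospart_ge0 //; last by rewrite divr_ge0 // subr_ge0 ltW.
  have hs : cos k <= cos s by apply: cos_ball => //; rewrite ger0_norm.
  rewrite /capbase addrK /pospart le_max; apply/orP; right; lra.
rewrite (intg_EFin (intgZ _ ii)) lee_fin (int_Z _ ii) in H.
have : 0 < e^-1 * \int[mu1]_x (cap x * cap x) by apply: lt_le_trans H.
by rewrite pmulr_rgt0 // invr_gt0.
Qed.

(* Integrating by parts, the Dirichlet integral is 9/5 of the integral of b^5 cos, and
   b^5 cos = b^6 + d b^5 with b^6 <= (1 - d) b^5, where b = capbase. *)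
Lemma cap_poincare : 0 <= d -> d < 1 ->
  \int[mu1]_x (cap x * cap x) <= (1 - d) * \int[mu1]_x (cap1 x * cap1 x).
Proof.
move=> d0 d1.
have [pu _ _ _] := cap_C2; have [pu1 pu2 cu cu1] := C2circle_facts cap_C2.
have [_ _ _ cu2] := cap_C2.
have H := circle_dirichlet cap_C2 cap_C2.
have i00 : intg mu1 (fun x => cap x * cap x).
  by apply: circle_intg; [move=> x; rewrite !pu|exact: continuousMR].
have i11 : intg mu1 (fun x => cap1 x * cap1 x).
  by apply: circle_intg; [move=> x; rewrite !pu1|exact: continuousMR].
have i20 : intg mu1 (fun x => cap2 x * cap x).
  by apply: circle_intg; [move=> x; rewrite pu pu2|exact: continuousMR].
(* The coefficients 2 and 3 cancel the terms with the squared sine; by parts, the integral of [f] is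
   5 times the Dirichlet integral. *)
pose f (x : R) : R := 2 * (cap1 x * cap1 x) - 3 * (cap2 x * cap x).
have fE x : f x = 9 * capbase x ^+ 5 * cos (x - c).
  by rewrite /f /cap1 /cap2 /cap; ring.
have if_ : intg mu1 f by apply: intgB; exact: intgZ.
have eqf : \int[mu1]_x f x = 5 * \int[mu1]_x (cap1 x * cap1 x).
  rewrite /f int_B; [|exact: intgZ|exact: intgZ].
  rewrite (int_Z _ i11) (int_Z _ i20) H; move: (\int[mu1]_x (cap1 x * cap1 x)) => I; ring.
have le1 x : cap x * cap x <= (1 - d) / 5 * f x.
  rewrite fE /cap; have : capbase x = 0 \/ (0 < capbase x /\ cos (x - c) = capbase x + d).
    rewrite /capbase /pospart; case: (ltgtP 0 (cos (x - c) - d)) => h; [right|left|left] => //.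
    by split => //; lra.
  move=> [->|[b0 ->]]; first by rewrite !expr0n /= !mulr0 !mul0r mulr0.
  have b1 : capbase x <= 1 - d.
    by have := cos_le1 (x - c); rewrite /capbase /pospart ge_max subr_ge0 (ltW d1) /=; lra.
  have b5 : 0 < capbase x ^+ 5 by rewrite exprn_gt0.
  move: (capbase x) b0 b1 b5 => b b0 b1 b5.
  have -> : b ^+ 3 * b ^+ 3 = b ^+ 5 * b by ring.
  have -> : (1 - d) / 5 * (9 * b ^+ 5 * (b + d)) = b ^+ 5 * (9 / 5 * (1 - d) * (b + d)) by ring.
  rewrite ler_pM2l //; nra.
have := int_le i00 (intgZ ((1 - d) / 5) if_) le1.
by rewrite (int_Z _ if_) eqf mulrA divfK.
Qed.

End Cap.

Lemma tensor_bounded (a b : R -> R) : circle_invariant a -> circle_invariant b ->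
  continuous a -> continuous b ->
  [/\ torus_invariant (fun z : R * R => a z.1 * b z.2),
      measurable_fun [set: T2] (fun z => a z.1 * b z.2) &
      exists C, forall z : R * R, `|a z.1 * b z.2| <= C].
Proof.
move=> pa pb ca cb; split.
- by move=> x t /=; rewrite pa pb.
- by apply: measurable_tensor; exact: continuous_measurable_circle.
have [A hA] := circle_continuous_bounded pa ca; have [B hB] := circle_continuous_bounded pb cb.
exists (A * B) => z; rewrite normrM; exact: ler_pM.
Qed.

Lemma tensor_int (a b : R -> R) : circle_invariant a -> circle_invariant b ->
  continuous a -> continuous b ->
  intg mu2 (fun z => a z.1 * b z.2) /\
  \int[mu2]_z (a z.1 * b z.2) = \int[mu1]_x a x * \int[mu1]_t b t.
Proof.
move=> pa pb ca cb; have [_ m [C hC]] := tensor_bounded pa pb ca cb.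
have i : intg mu2 (fun z => a z.1 * b z.2).
  by apply: (bounded_intg (C := C)) => //; exact: torus_measure_fin.
by split => //; apply: int_tensor => //; exact: circle_intg.
Qed.

Variables (nu : nat -> R) (zeta : nat -> R -> R).
Hypothesis Hbasis : laplace_eigenbasis nu zeta.
Local Notation mode := (mode zeta).
Local Notation coef := (coef zeta).
Local Notation lam := (lam nu).

Lemma tensor_coef (a b : R -> R) i : circle_invariant a -> circle_invariant b ->
  continuous a -> continuous b ->
  coef (fun z => a z.1 * b z.2) i =
    \int[mu1]_x (a x * zeta i.1 x) * (trig_scale i.2 * \int[mu1]_t (b t * trig i.2 t)).
Proof.
move=> pa pb ca cb.
have [_ _ cz _] := C2circle_facts (zeta_C2 Hbasis i.1).
have pz := zeta_invariant Hbasis i.1.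
have pt := @trig_invariant R i.2; have ct := @trig_continuous R i.2.
have p1 : circle_invariant (fun x => a x * zeta i.1 x) by move=> x; rewrite pa pz.
have p2 : circle_invariant (fun t => b t * trig i.2 t) by move=> x; rewrite pb pt.
have [ii e] := tensor_int p1 p2 (continuousMR ca cz) (continuousMR cb ct).
rewrite mulrCA -e -(int_Z _ ii); apply: eq_Rintegral => z _.
by rewrite /Defs.mode trig_basisE; ring.
Qed.

(** Green's formula in each variable moves the second derivatives onto the mode, where they become
    the factors [nu i.1] and [- i.2 ^+ 2]. *)
Lemma wave_tensor_coef (a a1 a2 b b1 b2 : R -> R) i : C2circle a a1 a2 -> C2circle b b1 b2 ->
  coef (fun z => - (a2 z.1 * b z.2) + a z.1 * b2 z.2) i = lam i * coef (fun z => a z.1 * b z.2) i.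
Proof.
move=> hA hB.
have [pa _ _ ca2] := hA; have [_ pa2 ca _] := C2circle_facts hA.
have [pb _ _ cb2] := hB; have [_ pb2 cb _] := C2circle_facts hB.
have Ga := circle_green hA (zeta_C2 Hbasis i.1).
have Gb := circle_green hB (@trig_C2 R i.2).
have ea : \int[mu1]_x (a2 x * zeta i.1 x) = - nu i.1 * \int[mu1]_x (a x * zeta i.1 x).
  rewrite Ga -int_Z; first by apply: eq_Rintegral => x _; rewrite mulrCA.
  have [_ _ cz _] := C2circle_facts (zeta_C2 Hbasis i.1).
  by apply: circle_intg; [move=> x; rewrite pa (zeta_invariant Hbasis)|exact: continuousMR].
have eb : \int[mu1]_x (b2 x * trig i.2 x) = - i.2%:~R ^+ 2 * \int[mu1]_x (b x * trig i.2 x).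
  rewrite Gb -int_Z; first by apply: eq_Rintegral => x _; rewrite mulrCA.
  have [_ _ cz _] := C2circle_facts (@trig_C2 R i.2).
  by apply: circle_intg; [move=> x; rewrite pb trig_invariant|exact: continuousMR].
have L2t (f g : R -> R) : circle_invariant f -> circle_invariant g -> continuous f -> continuous g ->
    Lr mu2 2 (fun z => f z.1 * g z.2).
  move=> pf pg cf cg; have [_ m [C hC]] := tensor_bounded pf pg cf cg.
  by apply: (bounded_Lr (C := C)) => //; exact: torus_measure_fin.
have -> : coef (fun z => - (a2 z.1 * b z.2) + a z.1 * b2 z.2) i =
   - coef (fun z => a2 z.1 * b z.2) i + coef (fun z => a z.1 * b2 z.2) i.
  have hm := mode_L2 Hbasis i.
  have e : (fun z : R * R => - (a2 z.1 * b z.2) + a z.1 * b2 z.2) =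
     (fun z => (a z.1 * b2 z.2) - (a2 z.1 * b z.2)) by apply/funext => z; rewrite addrC.
  by rewrite /Defs.coef e innerBl //; [rewrite addrC|exact: L2t|exact: L2t].
rewrite !tensor_coef // ea eb /Defs.lam.
move: (\int[mu1]_x (a x * _)) (\int[mu1]_x (b x * _)) => X Y; ring.
Qed.

Lemma dirichlet_gap (a0 a1 b0 b1 e y : R) : 0 < a0 -> a0 <= y * a1 -> 0 < b0 -> 0 <= b1 ->
  e * b1 < b0 -> y <= e -> 0 < e -> 0 <= y -> 0 < - (- a1 * b0) + a0 * - b1.
Proof.
move=> A0 A1 B0 B1 eB ye e0 y0.
have a10 : 0 < a1 by rewrite ltNge; apply/negP => a10; nra.
have : a0 * b1 <= a1 * (e * b1).
  have h1 : a0 <= e * a1 by apply: (le_trans A1); rewrite ler_wpM2r // ltW.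
  have : a0 * b1 <= e * a1 * b1 by rewrite ler_wpM2r.
  by rewrite [e * a1]mulrC mulrA.
have : a1 * (e * b1) < a1 * b0 by rewrite ltr_pM2l.
lra.
Qed.

(** Take [psi = a(x) b(t)] for two caps and [v] its image under the wave operator. By parts their
    pairing is [|a'|^2 |b|^2 - |a|^2 |b'|^2] in squared L^2 norms. With [b] fixed, narrowing [a]
    makes the ratio of [|a|^2] to [|a'|^2] as small as desired. *)
Lemma bump_exists (c1 c2 h1 h2 : R) : 0 < h1 -> h1 <= pi -> 0 < h2 -> h2 <= pi ->
  exists v psi : R * R -> R, [/\ torus_invariant v, measurable_fun [set: T2] v,
    (exists C, forall z, `|v z| <= C), (forall z, v z != 0 -> cosbox c1 c2 h1 h2 z) &
    [/\ L2_torus psi, forall i, coef v i = lam i * coef psi i & 0 < inner mu2 v psi]].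
Proof.
move=> h10 h1pi h20 h2pi.
have cos_lt1 (h : R) : 0 < h -> h <= pi -> cos h < 1.
  move=> h0 hpi; rewrite -(@cos0 R) ltr_cos // in_itv /= ?lexx ?(ltW h0) //; exact: pi_ge0.
pose d2 := Num.max 0 (cos h2).
have d20 : 0 <= d2 by rewrite /d2 le_max lexx.
have d21 : d2 < 1 by rewrite /d2 gt_max ltr01 cos_lt1.
have d2h : cos h2 <= d2 by rewrite /d2 le_max lexx orbT.
set b := cap c2 d2; set b1 := cap1 c2 d2; set b2 := cap2 c2 d2.
have B0 := cap_int_gt0 c2 d20 d21; rewrite -/b in B0.
pose B1 := \int[mu1]_x (b1 x * b1 x).
have B10 : 0 <= B1 by apply: int_ge0 => x; rewrite -expr2 sqr_ge0.
(* Chosen to keep [eta * B1] below the integral of [b^2]; adding that integral to [B1] keeps the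
   denominator positive. *)
pose eta := \int[mu1]_x (b x * b x) / (2 * (B1 + \int[mu1]_x (b x * b x))).
have den : 0 < 2 * (B1 + \int[mu1]_x (b x * b x)) by rewrite mulr_gt0 // ltr_wpDl.
have eta0 : 0 < eta by exact: divr_gt0.
have etaB : eta * B1 < \int[mu1]_x (b x * b x).
  rewrite /eta mulrAC ltr_pdivrMr // ltr_pM2l //.
  by move: B0; rewrite -/B1; move: (\int[mu1]_x (b x * b x)) => X X0; lra.
pose d1 := Num.max (Num.max 0 (1 - eta)) (cos h1).
have d10 : 0 <= d1 by rewrite /d1 !le_max lexx.
have d11 : d1 < 1 by rewrite /d1 !gt_max ltr01 cos_lt1 // andbT /= ltrBlDr ltrDl.
have d1h : cos h1 <= d1 by rewrite /d1 le_max lexx orbT.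
have d1e : 1 - d1 <= eta.
  by rewrite lerBlDr -lerBlDl /d1 !le_max lexx orbT.
set a := cap c1 d1; set a1 := cap1 c1 d1; set a2 := cap2 c1 d1.
have A0 := cap_int_gt0 c1 d10 d11; rewrite -/a in A0.
have A1 := cap_poincare c1 d10 d11; rewrite -/a -/a1 in A1.
have hA : C2circle a a1 a2 by exact: cap_C2.
have hB : C2circle b b1 b2 by exact: cap_C2.
have [pa _ _ ca2] := hA; have [_ pa2 ca _] := C2circle_facts hA.
have [pb _ _ cb2] := hB; have [_ pb2 cb _] := C2circle_facts hB.
have [t1 m1 [C1 hC1]] := tensor_bounded pa2 pb ca2 cb.
have [t2 m2 [C2 hC2]] := tensor_bounded pa pb2 ca cb2.
have [t3 m3 [C3 hC3]] := tensor_bounded pa pb ca cb.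
exists (fun z => - (a2 z.1 * b z.2) + a z.1 * b2 z.2), (fun z => a z.1 * b z.2); split.
- by move=> x t; rewrite (t1 x t).1 (t1 x t).2 (t2 x t).1 (t2 x t).2.
- by apply: measurable_funD => //; exact: measurableT_comp.
- by exists (C1 + C2) => z; apply: le_trans (ler_normD _ _) _; rewrite normrN; exact: lerD.
- move=> z nz; apply/andP.
  have : (a2 z.1 != 0) && (b z.2 != 0) || (a z.1 != 0) && (b2 z.2 != 0).
    move: nz; apply: contraNT; rewrite negb_or !negb_and !negbK.
    by move=> /andP[/orP[]/eqP-> /orP[]/eqP->]; rewrite ?mul0r ?mulr0 ?oppr0 ?addr0.
  move=> /orP[]/andP[u1 u2]; split.
  + exact: le_trans d1h (cap2_support u1).
  + exact: le_trans d2h (cap_support u2).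
  + exact: le_trans d1h (cap_support u1).
  + exact: le_trans d2h (cap2_support u2).
split.
- apply/L2_torusP; split => //; apply: (bounded_Lr (C := C3)) => //; exact: torus_measure_fin.
- by move=> i; exact: wave_tensor_coef hA hB.
have [i1 e1] := tensor_int (a := fun x => a2 x * a x) (b := fun x => b x * b x)
  (fun x => congr2 *%R (pa2 x) (pa x)) (fun x => congr2 *%R (pb x) (pb x))
  (continuousMR ca2 ca) (continuousMR cb cb).
have [i2 e2] := tensor_int (a := fun x => a x * a x) (b := fun x => b2 x * b x)
  (fun x => congr2 *%R (pa x) (pa x)) (fun x => congr2 *%R (pb2 x) (pb x))
  (continuousMR ca ca) (continuousMR cb2 cb).
have -> : inner mu2 (fun z => - (a2 z.1 * b z.2) + a z.1 * b2 z.2) (fun z => a z.1 * b z.2) =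
    - (\int[mu1]_x (a2 x * a x) * \int[mu1]_t (b t * b t)) +
    \int[mu1]_x (a x * a x) * \int[mu1]_t (b2 t * b t).
  rewrite -e1 -e2 -int_N // -int_D //; last exact: intgN.
  by apply: eq_Rintegral => z _; ring.
rewrite (circle_dirichlet hA hA) (circle_dirichlet hB hB) -/B1.
apply: (dirichlet_gap A0 A1 B0 B10 etaB d1e eta0).
by rewrite subr_ge0 ltW.
Qed.

End Bump.

(** * The dual variational problem *)

Section NormTools.
Context {d : measure_display} {T : measurableType d} {R : realType}.
Variable mu : {measure set T -> \bar R}.

Lemma nr_mul_bounded (r K : R) (f g : T -> R) : 0 < r -> 0 <= K -> measurable_fun setT g ->
  (forall x, `|g x| <= K) -> Lr mu r f -> nr mu r (fun x => f x * g x) <= K * nr mu r f.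
Proof.
move=> r0 K0 mg gK hf.
have hfg := Lr_mul_bounded (ltW r0) mg gK hf.
have -> : K * nr mu r f = nr mu r (fun x => K * f x) by rewrite (nrZ K r0 hf) ger0_norm.
have [_ ifg] := hfg; have [_ iK] := LrZ K hf.
rewrite nr_le_int // ?nr_ge0 //.
rewrite (_ : nr mu r (fun x => K * f x) `^ r = \int[mu]_x `|K * f x| `^ r); last first.
  by rewrite nrE -powRrM mulVf ?gt_eqF // powRr1 // int_pow_ge0.
apply: int_le => // x; apply: (ge0_ler_powR (ltW r0)); rewrite ?nnegrE //.
by rewrite !normrM mulrC (ger0_norm K0) ler_wpM2r.
Qed.

Lemma int_nr (r : R) (f : T -> R) : 0 < r -> \int[mu]_x `|f x| `^ r = nr mu r f `^ r.
Proof. by move=> r0; rewrite nrE -powRrM mulVf ?gt_eqF // powRr1 // int_pow_ge0. Qed.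

End NormTools.

(** * The dual quadratic form *)

Section DualForm.
Context {R : realType}.
Variables (nu : nat -> R) (zeta : nat -> R -> R).
Hypothesis Hbasis : laplace_eigenbasis nu zeta.
Local Notation mu2 := (@torus_measure R).
Local Notation T1 := (measurableTypeR R).
Local Notation T2 := (T1 * T1)%type.
Local Notation mode := (mode zeta).
Local Notation coef := (coef zeta).
Local Notation lam := (lam nu).
Local Notation band := (band nu).

Variables (p r : R).
Hypothesis p2 : 2 < p.
Hypothesis r1 : 1 < r.
Hypothesis pr : p^-1 + r^-1 = 1.
Variables (kap : R * R -> R) (K : R).
Hypothesis mk : measurable_fun [set: T2] kap.
Hypothesis kK : forall z, `|kap z| <= K.

Let p1 : 1 < p. Proof. by apply: lt_trans p2; rewrite ltr1n. Qed.
Let r0 : 0 < r. Proof. by apply: lt_trans r1. Qed.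
Let rp : r^-1 + p^-1 = 1. Proof. by rewrite addrC. Qed.
Let p0 : 0 <= p. Proof. by rewrite ltW // (lt_trans _ p1). Qed.
Let K0 : 0 <= K. Proof. exact: le_trans (normr_ge0 _) (kK (0, 0)). Qed.

Definition wcoef (w : R * R -> R) (i : nat * int) : R := coef (fun z => w z * kap z) i.

Lemma weight_Lr w : Lr mu2 r w -> Lr mu2 r (fun z => w z * kap z).
Proof. exact: Lr_mul_bounded (ltW r0) mk kK. Qed.

Lemma wcoef_intg w i : Lr mu2 r w -> intg mu2 (fun z => (w z * kap z) * mode i z).
Proof.
by move=> hw; exact: (Lr_mul r1 p1 rp (weight_Lr hw) (mode_Lr Hbasis i p0)).
Qed.

Lemma wcoefD w w' i : Lr mu2 r w -> Lr mu2 r w' ->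
  wcoef (fun z => w z + w' z) i = wcoef w i + wcoef w' i.
Proof.
move=> hw hw'; rewrite /wcoef /Defs.coef /inner -int_D; [|exact: wcoef_intg|exact: wcoef_intg].
by apply: eq_Rintegral => z _; ring.
Qed.

Lemma wcoefZ c w i : Lr mu2 r w -> wcoef (fun z => c * w z) i = c * wcoef w i.
Proof.
move=> hw; rewrite /wcoef /Defs.coef /inner -int_Z; last exact: wcoef_intg.
by apply: eq_Rintegral => z _; ring.
Qed.

Lemma wcoef_bound i : exists C, forall w, Lr mu2 r w -> `|wcoef w i| <= C * nr mu2 r w.
Proof.
exists (K * nr mu2 p (mode i)) => w hw.
have hm : Lr mu2 p (mode i) := mode_Lr Hbasis i p0.
apply: (le_trans (hoelder_nr r1 p1 rp (weight_Lr hw) hm)).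
rewrite mulrAC; apply: ler_wpM2r; first exact: nr_ge0.
exact: nr_mul_bounded.
Qed.

Lemma wcoef_tail : exists C th : R, [/\ 0 < C, 0 < th, th < 1 & forall J s w,
  Lr mu2 r w -> uniq s -> (forall i, i \in s -> 2 ^+ J <= `|lam i|) ->
  \sum_(i <- s) wcoef w i ^+ 2 / `|lam i| <= (C * th ^+ J * nr mu2 r w) ^+ 2].
Proof.
have [C [th [C0 th0 th1 hC]]] := dual_tail_bound Hbasis p2 r1 pr.
have K1 : 0 < K + 1 by rewrite ltr_wpDl.
exists (C * (K + 1)), th; split => //; first exact: mulr_gt0.
move=> J s w hw us hs; apply: (le_trans (hC J s _ (weight_Lr hw) us hs)).
have a0 : 0 <= C * th ^+ J by rewrite mulr_ge0 ?exprn_ge0 // ltW.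
rewrite ler_pXn2r ?nnegrE // ?mulr_ge0 ?nr_ge0 ?exprn_ge0 // ?(ltW C0) ?(ltW K1) ?(ltW th0) //.
rewrite [X in _ <= X](_ : _ = C * th ^+ J * ((K + 1) * nr mu2 r w)); last by ring.
have H := nr_mul_bounded r0 K0 mk kK hw.
have H2 : nr mu2 r (fun z => w z * kap z) <= (K + 1) * nr mu2 r w.
  by apply: (le_trans H); apply: ler_wpM2r; rewrite ?nr_ge0 // lerDl.
exact: ler_wpM2l.
Qed.

Definition form_sum (n : nat) (w w' : R * R -> R) : R :=
  \sum_(i <- band n) wcoef w i * wcoef w' i / lam i.

(** The bilinear form of the inverse wave operator off the kernel, conjugated by [kap]. As a [limn]
    it is meaningful on L^r, where [form_sum_cvg] provides convergence. *)
Definition form (w w' : R * R -> R) : R := limn (fun n => form_sum n w w').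

Lemma form_sum_le s w w' (A A' : R) :
  \sum_(i <- s) wcoef w i ^+ 2 / `|lam i| <= A ^+ 2 -> \sum_(i <- s) wcoef w' i ^+ 2 / `|lam i| <= A' ^+ 2 ->
  0 <= A -> 0 <= A' -> `|\sum_(i <- s) wcoef w i * wcoef w' i / lam i| <= A * A'.
Proof.
move=> hA hA' A0 A0'.
have a0 u i : 0 <= wcoef u i ^+ 2 / `|lam i| by rewrite divr_ge0 ?sqr_ge0.
have H := @sum_cauchy_schwarz R _ s (fun i => wcoef w i * wcoef w' i / lam i)
  (fun i => wcoef w i ^+ 2 / `|lam i|) (fun i => wcoef w' i ^+ 2 / `|lam i|)
  (fun i _ => a0 w i) (fun i _ => a0 w' i).
apply: (le_trans (ler_norm_sum _ _ _)).
rewrite -(ler_pXn2r (n := 2)) // ?nnegrE ?mulr_ge0 ?sumr_ge0 //.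
apply: le_trans (H _) _.
  move=> i _; rewrite mulrACA -exprMn -invfM -expr2 real_normK ?num_real //.
  by rewrite exprMn -exprVn exprMn !exprMn.
by rewrite exprMn; apply: ler_pM => //; apply: sumr_ge0.
Qed.

Lemma band_lam_ge1 n i : i \in band n -> 2 ^+ 0 <= `|lam i|.
Proof.
by rewrite (bandP Hbasis) normr_gt0 => /andP[li _]; rewrite expr0; exact: (lam_ge1 Hbasis li).
Qed.

(** [g] is the inverse of the wave operator, off the kernel, applied to [w * kap]. The dual tail
    bound gives it finite energy, and synthesis then places it in L^p. *)
Lemma green_exists w : Lr mu2 r w -> exists g, [/\ L2_torus g, Lr mu2 p g,
  (forall i, coef g i = if lam i == 0 then 0 else wcoef w i / lam i),
  energy_bounded nu zeta g &
  forall w', Lr mu2 r w' -> (fun n => form_sum n w w') @ \oo --> \int[mu2]_z (g z * (w' z * kap z))].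
Proof.
move=> hw; have [C [th [C0 th0 th1 hC]]] := wcoef_tail.
have eE n : energy_sum nu (band n) (fun i => wcoef w i / lam i) =
    \sum_(i <- band n) wcoef w i ^+ 2 / `|lam i|.
  rewrite /energy_sum big_seq [RHS]big_seq; apply: eq_bigr => i /band_lam_ge1; rewrite expr0 => li.
  have l0 : `|lam i| != 0 by rewrite gt_eqF // (lt_le_trans ltr01).
  rewrite expr_div_n -(real_normK (num_real (lam i))) mulrCA; congr (_ * _).
  by rewrite expr2 invfM mulrA mulfV // mul1r.
have hB n : energy_sum nu (band n) (fun i => wcoef w i / lam i) <= (C * th ^+ 0 * nr mu2 r w) ^+ 2.
  by rewrite eE; apply: hC => //; [exact: fset_uniq|exact: band_lam_ge1].
have [g [pg gp g2 gc gl]] := energy_synthesis Hbasis p2 r1 pr hB.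
exists g; split => //.
- exact/L2_torusP.
- exists ((C * th ^+ 0 * nr mu2 r w) ^+ 2) => n; apply: le_trans (hB n); apply: ler_sum => i _.
  by rewrite ler_wpM2l // gc; case: ifP => // _; rewrite expr0n sqr_ge0.
move=> w' hw'; have := gl _ (weight_Lr hw').
have -> : (fun n => form_sum n w w') =
    (fun n => \sum_(i <- band n) wcoef w i / lam i * coef (fun z => w' z * kap z) i); last by [].
by apply/funext => n; apply: eq_bigr => i _; rewrite mulrAC.
Qed.

Lemma form_sum_cvg w w' : Lr mu2 r w -> Lr mu2 r w' -> (fun n => form_sum n w w') @ \oo --> form w w'.
Proof. by move=> hw hw'; have [g [_ _ _ _ /(_ _ hw')/cvgP]] := green_exists hw. Qed.

Lemma formC w w' : form w w' = form w' w.
Proof.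
rewrite /form; congr (limn _); apply/funext => n; apply: eq_bigr => i _; congr (_ / _).
exact: mulrC.
Qed.

Lemma formDl w1 w2 w' : Lr mu2 r w1 -> Lr mu2 r w2 -> Lr mu2 r w' ->
  form (fun z => w1 z + w2 z) w' = form w1 w' + form w2 w'.
Proof.
move=> h1 h2 h'; apply: (cvg_unique _ (form_sum_cvg _ h')) => //.
  by apply: LrD => //; exact: ltW.
have -> : (fun n => form_sum n (fun z => w1 z + w2 z) w') =
    (fun n => form_sum n w1 w' + form_sum n w2 w').
  apply/funext => n; rewrite /form_sum -big_split; apply: eq_bigr => i _ /=.
  by rewrite wcoefD // !mulrDl.
exact: cvgD (form_sum_cvg h1 h') (form_sum_cvg h2 h').
Qed.

Lemma formZl c w w' : Lr mu2 r w -> Lr mu2 r w' -> form (fun z => c * w z) w' = c * form w w'.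
Proof.
move=> h1 h'; apply: (cvg_unique _ (form_sum_cvg _ h')) => //; first exact: LrZ.
have -> : (fun n => form_sum n (fun z => c * w z) w') = (fun n => c * form_sum n w w').
  apply/funext => n; rewrite /form_sum big_distrr; apply: eq_bigr => i _ /=.
  by rewrite wcoefZ // !mulrA.
exact: cvgMr (form_sum_cvg h1 h').
Qed.

Lemma formDD w h t : Lr mu2 r w -> Lr mu2 r h ->
  form (fun z => w z + t * h z) (fun z => w z + t * h z) =
    form w w + 2 * t * form w h + t ^+ 2 * form h h.
Proof.
move=> hw hh; have hth : Lr mu2 r (fun z => t * h z) by exact: LrZ.
have hs : Lr mu2 r (fun z => w z + t * h z) by exact: LrD (ltW r0) hw hth.
rewrite (formDl hw hth hs) (formZl t hh hs) (formC w) (formC h).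
rewrite (formDl hw hth hw) (formDl hw hth hh) (formZl t hh hw) (formZl t hh hh) (formC h w).
move: (form w w) (form w h) (form h h) => x y z; ring.
Qed.

Lemma form_parallelogram w h : Lr mu2 r w -> Lr mu2 r h ->
  form (fun z => w z + h z) (fun z => w z + h z) =
    2 * form w w + 2 * form h h - form (fun z => w z - h z) (fun z => w z - h z).
Proof.
move=> hw hh; have e1 := formDD 1 hw hh; have e2 := formDD (-1) hw hh.
have f1 : (fun z => w z + 1 * h z) = (fun z => w z + h z) by apply/funext => z; rewrite mul1r.
have f2 : (fun z => w z + -1 * h z) = (fun z => w z - h z) by apply/funext => z; rewrite mulN1r.
rewrite f1 in e1; rewrite f2 in e2; rewrite e1 e2.
move: (form w w) (form w h) (form h h) => x y z; ring.
Qed.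

Lemma form_bound : exists2 C, 0 < C & forall w w', Lr mu2 r w -> Lr mu2 r w' ->
  `|form w w'| <= C * nr mu2 r w * nr mu2 r w'.
Proof.
have [C [th [C0 th0 th1 hC]]] := wcoef_tail.
exists (C * C); first exact: mulr_gt0.
move=> w w' hw hw'.
have b n : `|form_sum n w w'| <= C * C * nr mu2 r w * nr mu2 r w'.
  have -> : C * C * nr mu2 r w * nr mu2 r w' = (C * th ^+ 0 * nr mu2 r w) * (C * th ^+ 0 * nr mu2 r w').
    by rewrite expr0; ring.
  have C1 : 0 <= C * th ^+ 0 by rewrite expr0 mulr1 ltW.
  by apply: form_sum_le; [apply: hC => //|apply: hC => //|exact: (mulr_ge0 C1 (nr_ge0 _ _ _))|exact: (mulr_ge0 C1 (nr_ge0 _ _ _))];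
    [exact: fset_uniq|exact: band_lam_ge1|exact: fset_uniq|exact: band_lam_ge1].
have cv : (fun n => `|form_sum n w w'|) @ \oo --> `|form w w'|.
  by apply: cvg_norm; exact: form_sum_cvg.
by apply: (cvgr_to_le cv); exact: nearW.
Qed.

(* Only finitely many coefficients of [w] contribute to [form w w], up to an error that is
   uniform on bounded sets: this replaces weak continuity of the form. *)
Lemma form_finite (e : R) (A : R) : 0 < e -> 0 <= A -> exists J, forall w, Lr mu2 r w -> nr mu2 r w <= A ->
  form w w <= \sum_(i <- band J) wcoef w i ^+ 2 + e.
Proof.
move=> e0 A0; have [C [th [C0 th0 th1 hC]]] := wcoef_tail.
have cv : (fun n => (C * th ^+ n * A) ^+ 2) @ \oo --> (0 : R).
  have -> : (0 : R) = (C * 0 * A) * (C * 0 * A) by rewrite mulr0 mul0r mulr0.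
  under eq_fun do rewrite expr2.
  have ca : (fun n => C * th ^+ n * A) @ \oo --> C * 0 * A.
    by apply: cvgMl; apply: cvgMr; apply: cvg_expr; rewrite ger0_norm // ltW.
  by apply: cvgM; exact: ca.
have [J _ hJ] : \forall n \near \oo, (C * th ^+ n * A) ^+ 2 < e by exact: cvgr_lt cv _ e0.
exists J => w hw wA.
have H n : (J <= n)%N -> form_sum n w w <= \sum_(i <- band J) wcoef w i ^+ 2 + e.
  move=> Jn.
  (* For an upper bound the signs of [lam] may be dropped; inside band [J] the eigenvalues have
     modulus at least 1, and beyond it the tail bound applies. *)
  apply: (@le_trans _ _ (\sum_(i <- band n) wcoef w i ^+ 2 / `|lam i|)).
    apply: ler_sum => i _; rewrite -expr2; apply: ler_wpM2l; first exact: sqr_ge0.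
    by rewrite -normfV; exact: ler_norm.
  rewrite (bigID (fun i => i \in band J)) /=; apply: lerD.
    have -> : \sum_(i <- band n | i \in band J) wcoef w i ^+ 2 / `|lam i| =
        \sum_(i <- band J) wcoef w i ^+ 2 / `|lam i|.
      rewrite -big_filter; apply: perm_big; apply: uniq_perm.
      - exact: filter_uniq (fset_uniq _).
      - exact: fset_uniq.
      move=> i; rewrite mem_filter; have /fsubsetP h := band_mono Hbasis Jn.
      by apply/andP/idP => [[]//|iJ]; split => //; exact: h.
    rewrite big_seq [X in _ <= X]big_seq; apply: ler_sum => i /band_lam_ge1; rewrite expr0 => li.
    rewrite -[X in _ <= X]mulr1; apply: ler_wpM2l; first exact: sqr_ge0.
    by rewrite invf_le1 // (lt_le_trans ltr01).
  rewrite -big_filter; set s := [seq _ <- _ | _].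
  apply: (le_trans (hC J s w hw (filter_uniq _ (fset_uniq _)) _)).
    move=> i; rewrite mem_filter !(bandP Hbasis) => /andP[h /andP[h1 _]].
    by move: h; rewrite h1 /= -leNgt.
  apply: le_trans (ltW (hJ J (leqnn J))).
  have a0 : 0 <= C * th ^+ J by rewrite mulr_ge0 ?exprn_ge0 // ltW.
  have a1 : 0 <= C * th ^+ J * nr mu2 r w by exact: (mulr_ge0 a0 (nr_ge0 _ _ _)).
  have a2 : 0 <= C * th ^+ J * A by exact: mulr_ge0.
  by rewrite ler_pXn2r // ler_wpM2l.
have cv2 := form_sum_cvg hw hw.
by apply: (cvgr_to_le cv2); exists J.
Qed.

End DualForm.

(** * Limits along an ultrafilter *)

Section UltraLimits.
Context {R : realType}.

(** Compactness of a segment. Applied to every coefficient of a bounded sequence of functions, it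
    makes them all converge along the same ultrafilter, which replaces a diagonal extraction. *)
Lemma ultra_bounded_cvg (U : set_system nat) (f : nat -> R) (B : R) : UltraFilter U ->
  (forall n, `|f n| <= B) -> exists l : R, f @ U --> l.
Proof.
move=> UU hB; have UF : ProperFilter U by exact: ultra_proper.
have FA : (f @ U) `[- B, B]%classic.
  have e : f @^-1` `[- B, B]%classic = setT.
    by apply/seteqP; split => // n _; rewrite /= in_itv /= -ler_norml; exact: hB.
  by rewrite /nbhs /= e; exact: filterT.
have [l [_ cl]] := @segment_compact R (- B) B (f @ U) _ FA.
exists l => V Vl; case: (in_ultra_setVsetC (f @^-1` V) UU) => // h.
by have [x [/= nVx Vx]] := cl (~` V) V h Vl.
Qed.

Lemma ultra_finite_cauchy (I : Type) (U : set_system nat) (f : I -> nat -> R) (s : seq I) :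
  UltraFilter U -> (forall i, exists B, forall n, `|f i n| <= B) ->
  forall e, 0 < e -> exists2 S, U S & forall n m, S n -> S m -> \sum_(i <- s) (f i n - f i m) ^+ 2 <= e.
Proof.
move=> UU hB; have UF : ProperFilter U by exact: ultra_proper.
elim: s => [|i s ih] e e0.
  by exists setT; [exact: filterT|move=> n m _ _; rewrite big_nil ltW].
have [B /(ultra_bounded_cvg UU)[l fl]] := hB i.
have e2 : 0 < e / 2 by rewrite divr_gt0.
have [S US hS] := ih _ e2.
pose eta := Num.sqrt (e / 8).
have e8 : 0 < e / 8 by rewrite divr_gt0.
have eta0 : 0 < eta by rewrite sqrtr_gt0.
have UV : U [set n | `|l - f i n| < eta] by move/cvgrPdist_lt : fl; apply.
exists (S `&` [set n | `|l - f i n| < eta]); first exact: filterI.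
move=> n m [Sn hn] [Sm hm]; rewrite big_cons.
rewrite [X in _ <= X](splitr e); apply: lerD; last exact: hS.
have h : `|f i n - f i m| <= eta + eta.
  have -> : f i n - f i m = - (l - f i n) + (l - f i m) by ring.
  by apply: le_trans (ler_normD _ _) _; rewrite normrN; apply: lerD; exact: ltW.
have -> : e / 2 = (eta + eta) ^+ 2.
  have := sqr_sqrtr (ltW e8); rewrite -/eta => h8.
  have -> : (eta + eta) ^+ 2 = 4 * eta ^+ 2 by ring.
  by rewrite h8; field.
by rewrite -(real_normK (num_real (f i n - f i m))) ler_pXn2r ?nnegrE // addr_ge0 // ltW.
Qed.

(** Finite intersections of sets of [U] are nonempty; a point chosen in each turns statements along
    the ultrafilter back into an ordinary sequence. *)
Lemma ultra_extract (U : set_system nat) (P : nat -> nat -> Prop) : UltraFilter U ->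
  (forall k, exists2 S, U S & forall n, S n -> P k n) ->
  exists s : nat -> nat, forall j k, (j <= k)%N -> P j (s k).
Proof.
move=> UU h; have UF : ProperFilter U by exact: ultra_proper.
have UP k : U [set n | forall j, (j <= k)%N -> P j n].
  elim: k => [|k ih].
    by have [S US hS] := h 0%N; apply: filterS US => n Sn j; rewrite leqn0 => /eqP->; exact: hS.
  have [S US hS] := h k.+1; apply: filterS (filterI US ih) => n [Sn hn] j.
  by rewrite leq_eqVlt => /orP[/eqP->|]; [exact: hS|exact: hn].
have ne k : exists n, forall j, (j <= k)%N -> P j n by have [n] := filter_ex (UP k); exists n.
by exists (fun k => projT1 (cid (ne k))) => j k; exact: (projT2 (cid (ne k))).
Qed.

Lemma natSinv_lt (e : R) : 0 < e -> \forall n \near \oo, n.+1%:R^-1 < e.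
Proof. by move=> e0; have := @cvg_harmonic R; move=> /cvgr_lt /(_ _ e0); exact. Qed.

Lemma conjugate_le2 (p r : R) : 2 < p -> 0 < r -> p^-1 + r^-1 = 1 -> r <= 2.
Proof.
move=> p2 r0 pr; have : 2^-1 <= r^-1.
  have : p^-1 <= 2^-1 by rewrite lef_pV2 ?posrE ?(lt_trans _ p2) // ltW.
  by move: pr; lra.
by rewrite lef_pV2 ?posrE.
Qed.

Lemma parallelogram_gap (M d x y v t : R) : 4^-1 * (2 * x + 2 * y - v) <= M * t ->
  M - d <= x -> M - d <= y -> v <= d -> 4 * M - 5 * d <= 4 * M * t.
Proof. move=> h1 h2 h3 h4; lra. Qed.

Lemma maximum_gap (M x y z a b k de C e : R) : M - k <= x -> `|y| <= C * a * b ->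
  `|z| <= C * b * b -> b < de -> a <= 1 -> 0 <= b -> 0 <= a -> k < de ->
  de * (4 * C + 1) <= e -> de <= 1 -> 0 < C -> M <= x + 2 * 1 * y + 1 ^+ 2 * z + e.
Proof.
move=> h1; rewrite !ler_norml => /andP[h2 _] /andP[h3 _] bd a1 b0 a0 kd de1 d1 C0.
have : C * a * b <= C * de.
  rewrite -mulrA ler_wpM2l ?(ltW C0) //; apply: le_trans (ltW bd).
  by rewrite -[X in _ <= X]mul1r ler_wpM2r.
have : C * b * b <= C * de.
  rewrite -mulrA ler_wpM2l ?(ltW C0) //; apply: le_trans (ltW bd).
  by rewrite -[X in _ <= X]mulr1 ler_wpM2l // (le_trans (ltW bd)).
have : 0 <= C * de by rewrite mulr_ge0 ?(ltW C0) // (le_trans b0) // ltW.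
move: de1; have -> : de * (4 * C + 1) = 4 * (C * de) + de by ring.
lra.
Qed.

End UltraLimits.

Lemma int_le1 {d : measure_display} {T : measurableType d} {R : realType}
    (mu : {measure set T -> \bar R}) (r : R) (f : T -> R) : 0 < r -> nr mu r f <= 1 ->
  \int[mu]_x `|f x| `^ r <= 1.
Proof. by move=> r0; rewrite nr_le_int // powR1. Qed.

(** * A maximizer of the dual form on the unit ball *)

Section Maximizer.
Context {R : realType}.
Variables (nu : nat -> R) (zeta : nat -> R -> R).
Hypothesis Hbasis : laplace_eigenbasis nu zeta.
Local Notation mu2 := (@torus_measure R).
Local Notation T1 := (measurableTypeR R).
Local Notation T2 := (T1 * T1)%type.

Variables (p r : R).
Hypothesis p2 : 2 < p.
Hypothesis r1 : 1 < r.
Hypothesis pr : p^-1 + r^-1 = 1.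
Variables (kap : R * R -> R) (K : R).
Hypothesis mk : measurable_fun [set: T2] kap.
Hypothesis kK : forall z, `|kap z| <= K.

Local Notation form := (form nu zeta kap).
Local Notation wcoef := (wcoef zeta kap).

Variable X : set (R * R -> R).
Hypothesis XLr : forall w, X w -> Lr mu2 r w.
Hypothesis XZ : forall c w, X w -> X (fun z => c * w z).
Hypothesis XD : forall w h, X w -> X h -> X (fun z => w z + h z).
Hypothesis Xclosed : forall (w_ : nat -> R * R -> R) w, (forall n, X (w_ n)) -> Lr mu2 r w ->
  (fun n => nr mu2 r (fun z => w_ n z - w z)) @ \oo --> 0 -> X w.

Let r0 : 0 < r. Proof. by apply: lt_trans r1. Qed.
Let r1' : 1 <= r. Proof. exact: ltW. Qed.
Let p1 : 1 < p. Proof. by apply: lt_trans p2; rewrite ltr1n. Qed.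

(** By [form_finite] the form of a difference is bounded, up to a small error, by finitely many
    coefficient differences, which are small on a set of [U]. *)
Lemma ultra_form_small (U : set_system nat) (w_ : nat -> R * R -> R) (A : R) : UltraFilter U ->
  (forall n, Lr mu2 r (w_ n)) -> (forall n, nr mu2 r (w_ n) <= A) -> forall e, 0 < e ->
  exists2 S, U S & forall n m, S n -> S m ->
    form (fun z => w_ n z - w_ m z) (fun z => w_ n z - w_ m z) <= e.
Proof.
move=> UU hw hA e e0; have A0 : 0 <= A := le_trans (nr_ge0 _ _ _) (hA 0%N).
have e2 : 0 < e / 2 by rewrite divr_gt0.
have [J hJ] := form_finite Hbasis p2 r1 pr mk kK e2 (addr_ge0 A0 A0).
have hB i : exists B, forall n, `|wcoef (w_ n) i| <= B.
  have [C hC] := wcoef_bound Hbasis p2 r1 pr mk kK i.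
  exists (`|C| * A) => n; apply: (le_trans (hC _ (hw n))).
  apply: (@le_trans _ _ (`|C| * nr mu2 r (w_ n))); first by apply: ler_wpM2r; [exact: nr_ge0|exact: ler_norm].
  by apply: ler_wpM2l.
have [S US hS] := ultra_finite_cauchy (band nu J) UU hB e2.
exists S => // n m Sn Sm.
have hd : Lr mu2 r (fun z => w_ n z - w_ m z) by exact: (LrB (ltW r0) (hw n) (hw m)).
have nd : nr mu2 r (fun z => w_ n z - w_ m z) <= A + A.
  by apply: (le_trans (nrB r1' (hw n) (hw m))); exact: lerD.
apply: (le_trans (hJ _ hd nd)); rewrite [X in _ <= X](splitr e).
apply: lerD => //; apply: le_trans (hS n m Sn Sm); apply: ler_sum => i _.
have hN : Lr mu2 r (fun z => -1 * w_ m z) := LrZ _ (hw m).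
have -> : (fun z => w_ n z - w_ m z) = (fun z => w_ n z + -1 * w_ m z).
  by apply/funext => z; rewrite mulN1r.
by rewrite (wcoefD Hbasis p2 r1 pr mk kK i (hw n) hN) (wcoefZ Hbasis p2 r1 pr mk kK _ i (hw m)) mulN1r.
Qed.

Variable M : R.
Hypothesis M0 : 0 < M.
Hypothesis QM : forall w, X w -> form w w <= M * nr mu2 r w ^+ 2.

(* Almost maximizers whose difference has small energy are close in norm, by the parallelogram
   law and uniform convexity. *)
Lemma almost_maximizers (e : R) : 0 < e -> exists2 del, 0 < del & forall w h, X w -> X h ->
  nr mu2 r w <= 1 -> nr mu2 r h <= 1 -> M - del <= form w w -> M - del <= form h h ->
  form (fun z => w z - h z) (fun z => w z - h z) <= del -> nr mu2 r (fun z => w z - h z) <= e.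
Proof.
move=> e0; have er0 : 0 < e `^ r by rewrite powR_gt0.
have [C C0 hC] := Lr_unif_convex mu2 r1 (divr_gt0 er0 (ltr0n R 4)).
(* The parallelogram law gives the midpoint a norm [s] with [s ^+ 2 >= 1 - 5 * del / (4 * M)]; this
   [del] makes [C] times the resulting convexity defect at most half of [e^r]. *)
pose del := Num.min (M / 5) (e `^ r / 4 * (M / (5 * C))).
have C5 : 0 < 5 * C by rewrite mulr_gt0.
have del0 : 0 < del.
  by rewrite /del lt_min; apply/andP; split; [exact: divr_gt0|apply: mulr_gt0; exact: divr_gt0].
have d1 : 5 * del <= M by rewrite mulrC -ler_pdivlMr // /del ge_min lexx.
have d2 : C * (5 * del) <= e `^ r / 4 * M.
  have -> : C * (5 * del) = del * (5 * C) by ring.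
  have h : del <= e `^ r / 4 * (M / (5 * C)) by rewrite /del ge_min lexx orbT.
  by rewrite -ler_pdivlMr //; apply: (le_trans h); rewrite mulrA.
exists del => // w h Xw Xh nw nh Qw Qh Qd.
have hw := XLr Xw; have hh := XLr Xh.
rewrite nr_le_int // ?(ltW e0) //; apply: (le_trans (hC w h hw hh)).
have Iw : \int[mu2]_z `|w z| `^ r <= 1 := int_le1 r0 nw.
have Ih : \int[mu2]_z `|h z| `^ r <= 1 := int_le1 r0 nh.
have par := form_parallelogram Hbasis p2 r1 pr mk kK hw hh.
have hs : Lr mu2 r (fun z => (w z + h z) / 2).
  have := LrZ 2^-1 (LrD (ltW r0) hw hh); congr (Lr _ _ _).
  by apply/funext => z; rewrite mulrC.
have Xs := XZ 2^-1 (XD Xw Xh).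
have es : (fun z => 2^-1 * (w z + h z)) = (fun z => (w z + h z) / 2) by apply/funext => z; rewrite mulrC.
have := QM Xs; rewrite es.
have -> : form (fun z => (w z + h z) / 2) (fun z => (w z + h z) / 2) =
    4^-1 * form (fun z => w z + h z) (fun z => w z + h z).
  have hs' := LrD (ltW r0) hw hh; rewrite -es.
  rewrite (formZl Hbasis p2 r1 pr mk kK _ hs' (LrZ _ hs')) formC (formZl Hbasis p2 r1 pr mk kK _ hs' hs').
  by move: (form _ _) => x; field.
rewrite par => Hs.
set s := nr mu2 r (fun z => (w z + h z) / 2) in Hs.
have s0 : 0 <= s := nr_ge0 _ _ _.
have s2 : 1 - 5 * del / (4 * M) <= s ^+ 2.
  have M4 : 0 < 4 * M by rewrite mulr_gt0.
  rewrite -(ler_pM2l M4) mulrBr mulr1 mulrCA mulfV ?gt_eqF // mulr1.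
  exact: parallelogram_gap Hs Qw Qh Qd.
have sle : s <= 1.
  rewrite /s; have := nrZ (2^-1) r0 (LrD (ltW r0) hw hh); rewrite es => ->.
  rewrite (@ger0_norm _ (2^-1)) // -ler_pdivlMl ?invr_gt0 // invrK mulr1.
  by apply: (le_trans (nrD r1' hw hh)); rewrite -[2]/(1 + 1); exact: lerD.
have r2 : r <= 2 := conjugate_le2 p2 r0 pr.
(* Since [0 <= s <= 1] and [r <= 2], [s ^+ 2] is at most [s^r], which is the integral in
   question. *)
have Is : 1 - 5 * del / (4 * M) <= \int[mu2]_z `|(w z + h z) / 2| `^ r.
  rewrite int_nr // -/s; apply: (le_trans s2).
  have [->|sn] := eqVneq s 0; first by rewrite expr0n powR_ge0.
  have sp : 0 < s by rewrite lt_def sn.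
  have -> : s ^+ 2 = s `^ 2 by rewrite powR_mulrn.
  have := @ler_powR _ (s^-1) _ r 2 r2.
  rewrite invf_ge1 // => /(_ sle).
  rewrite -!powR_inv1 // -!powRrM !mulN1r !powRN lef_pV2 ?posrE ?powR_gt0 //.
have key : C * (1 + 1 - 2 * (1 - 5 * del / (4 * M))) <= e `^ r / 4 * 2.
  have -> : C * (1 + 1 - 2 * (1 - 5 * del / (4 * M))) = C * (5 * del) / (2 * M).
    by field; rewrite gt_eqF.
  rewrite ler_pdivrMr ?mulr_gt0 //; apply: (le_trans d2).
  have : 0 <= e `^ r / 4 * M by rewrite mulr_ge0 ?(ltW M0) // divr_ge0 // ltW.
  have -> : e `^ r / 4 * 2 * (2 * M) = 4 * (e `^ r / 4 * M) by ring.
  by move=> h0; rewrite ler_peMl // ler1n.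
apply: (@le_trans _ _ (e `^ r / 4 * (1 + 1) + C * (1 + 1 - 2 * (1 - 5 * del / (4 * M))))).
  have e4 : 0 <= e `^ r / 4 by rewrite divr_ge0 // ltW.
  apply: lerD; first exact: (ler_wpM2l e4 (lerD Iw Ih)).
  apply: ler_wpM2l; first exact: ltW.
  apply: (lerD (lerD Iw Ih)); rewrite lerN2; exact: ler_wpM2l Is.
apply: (@le_trans _ _ (e `^ r / 4 * (1 + 1) + e `^ r / 4 * 2)); first by rewrite lerD2l.
by rewrite le_eqVlt; apply/orP; left; apply/eqP; field.
Qed.

Hypothesis Msup : forall e, 0 < e -> exists w, [/\ X w, nr mu2 r w <= 1 & M - e <= form w w].

(* Along an ultrafilter the coefficients of a bounded sequence converge, so by [form_finite] the
   differences have small energy and a maximizing sequence is Cauchy in norm. *)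
Lemma maximizer_exists : exists w, [/\ X w, nr mu2 r w = 1 & form w w = M].
Proof.
have seqw n : exists w, [/\ X w, nr mu2 r w <= 1 & M - n.+1%:R^-1 <= form w w].
  by apply: Msup; rewrite invr_gt0.
pose w_ n := projT1 (cid (seqw n)).
have [Xw nw Qw] : [/\ forall n, X (w_ n), forall n, nr mu2 r (w_ n) <= 1 &
    forall n, M - n.+1%:R^-1 <= form (w_ n) (w_ n)].
  by split => n; have [] := projT2 (cid (seqw n)).
have hw n := XLr (Xw n).
(* [U] refines the filter at infinity: tails belong to it, so near maximality holds on sets of
   [U]. *)
have [U [UU ooU]] := @ultraFilterLemma nat \oo _.
have UF : ProperFilter U by exact: ultra_proper.
have large (e : R) : 0 < e -> exists2 S, U S & forall n m, S n -> S m ->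
    nr mu2 r (fun z => w_ n z - w_ m z) <= e /\ M - e <= form (w_ n) (w_ n).
  move=> e0; have [del del0 hdel] := almost_maximizers e0.
  have [S US hS] := ultra_form_small UU hw nw del0.
  have m0 : 0 < Num.min del e by rewrite lt_min del0.
  have Ut : U [set n | n.+1%:R^-1 < Num.min del e].
    by apply: ooU; exact: natSinv_lt.
  exists (S `&` [set n | n.+1%:R^-1 < Num.min del e]); first exact: filterI.
  move=> n m [Sn] /=; rewrite lt_min => /andP[n1 n2] [Sm] /=; rewrite lt_min => /andP[m1 m2].
  split; last by apply: le_trans (Qw n); rewrite lerD2l lerN2 ltW.
  apply: hdel => //; last exact: hS.
  - by apply: le_trans (Qw n); rewrite lerD2l lerN2 ltW.
  - by apply: le_trans (Qw m); rewrite lerD2l lerN2 ltW.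
have ik0 (k : nat) : 0 < k.+1%:R^-1 :> R by rewrite invr_gt0.
have HA k : exists S, U S /\ forall n m, S n -> S m ->
    nr mu2 r (fun z => w_ n z - w_ m z) <= k.+1%:R^-1 /\ M - k.+1%:R^-1 <= form (w_ n) (w_ n).
  by have [S US hS] := large _ (ik0 k); exists S.
pose A k := projT1 (cid (HA k)).
have UA k : U (A k) := (projT2 (cid (HA k))).1.
have hA k := (projT2 (cid (HA k))).2.
have hex k : exists2 S, U S & forall n, S n -> A k n by exists (A k).
have [s hs] := ultra_extract UU hex.
have cau e : 0 < e -> exists N, forall m n, (N <= m)%N -> (N <= n)%N ->
    nr mu2 r (fun z => w_ (s m) z - w_ (s n) z) <= e.
  move=> e0; have [N _ hN] : \forall n \near \oo, n.+1%:R^-1 < e by exact: natSinv_lt.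
  exists N => m n Nm Nn; apply: le_trans (ltW (hN N (leqnn N))).
  by have [] := hA N _ _ (hs N m Nm) (hs N n Nn).
have [w [hw' wcv _]] := Lr_complete r1' (fun n => hw (s n)) cau.
have Xw' : X w by apply: (Xclosed (fun n => Xw (s n)) hw' wcv).
have nw1 : nr mu2 r w <= 1.
  apply/ler_addgt0Pr => e e0.
  have [n _ hn] : \forall n \near \oo, nr mu2 r (fun z => w_ (s n) z - w z) < e by exact: cvgr_lt wcv _ e0.
  have := nr_dist r1' hw' (hw (s n)); rewrite (nrBC mu2 r w) => /(le_trans (ler_norm _)) H.
  by have := ltW (hn n (leqnn n)); have := nw (s n); lra.
have Qw1 : M <= form w w.
  have [C C0 hC] := form_bound Hbasis p2 r1 pr mk kK.
  apply/ler_addgt0Pr => e e0.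
  (* Expanding the form of [w] around [w_ (s n)] leaves an error of at most [del * (4 * C + 1)]. *)
  pose del := Num.min 1 (e / (4 * C + 1)).
  have den : 0 < 4 * C + 1 by rewrite addr_gt0 // mulr_gt0.
  have del0 : 0 < del by rewrite lt_min ltr01 divr_gt0.
  have del1 : del <= 1 by rewrite ge_min lexx.
  have dele : del * (4 * C + 1) <= e by rewrite -ler_pdivlMr // ge_min lexx orbT.
  have [n1 _ hn1] : \forall n \near \oo, nr mu2 r (fun z => w_ (s n) z - w z) < del by exact: cvgr_lt wcv _ del0.
  have [n2 _ hn2] : \forall n \near \oo, n.+1%:R^-1 < del by exact: natSinv_lt.
  pose n := maxn n1 n2.
  have dn := hn1 n (leq_maxl _ _); have en := hn2 n (leq_maxr _ _).
  have [_ Qn] := hA n _ _ (hs n n (leqnn n)) (hs n n (leqnn n)).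
  have hdf : Lr mu2 r (fun z => w z - w_ (s n) z) by exact: (LrB (ltW r0) hw' (hw (s n))).
  have := formDD Hbasis p2 r1 pr mk kK 1 (hw (s n)) hdf.
  have -> : (fun z => w_ (s n) z + 1 * (w z - w_ (s n) z)) = w by apply/funext => z; ring.
  move=> ->.
  have b1 := hC _ _ (hw (s n)) hdf; have b2 := hC _ _ hdf hdf.
  rewrite nrBC in dn; have nwn := nw (s n); have nd0 := nr_ge0 mu2 r (fun z => w z - w_ (s n) z).
  have nw0 := nr_ge0 mu2 r (w_ (s n)).
  exact: (maximum_gap Qn b1 b2 dn nwn nd0 nw0 en dele del1 C0).
have QMw := QM Xw'.
have n1 : nr mu2 r w = 1.
  apply/eqP; rewrite eq_le nw1 /= -(ler_pXn2r (n := 2)) ?nnegrE ?nr_ge0 // expr1n.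
  by rewrite -(ler_pM2l M0) mulr1 (le_trans Qw1).
exists w; split => //; apply/eqP; rewrite eq_le Qw1 andbT.
by move: QMw; rewrite n1 expr1n mulr1.
Qed.

End Maximizer.

Lemma quotient_gap {R : realType} (M s x z v : R) : M + 2 * s * x + s ^+ 2 * z <= M * (1 + 2 * s * v) ->
  s * (2 * x + s * z) <= s * (2 * M * v).
Proof.
move=> h; rewrite -subr_ge0 in h; rewrite -subr_ge0; move: h; congr (_ <= _); ring.
Qed.

Lemma minimizer_gap {R : realType} (E D X C I1 I2 I3 : R) : I1 <= X + E / (4 * C) -> I2 <= X + E / (4 * C) ->
  I1 <= D -> I2 <= D -> X <= I3 -> 0 < E -> 0 < D -> 0 < C ->
  E / (4 * D) * (I1 + I2) + C * (I1 + I2 - 2 * I3) <= E.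
Proof.
move=> h1 h2 h3 h4 h5 E0 D0 C0.
have b1 : E / (4 * D) * (I1 + I2) <= E / 2.
  have -> : E / 2 = E / (4 * D) * (D + D) by field; rewrite gt_eqF.
  by apply: ler_wpM2l (lerD h3 h4); rewrite divr_ge0 ?(ltW E0) // mulr_ge0 // ltW.
have b2 : C * (I1 + I2 - 2 * I3) <= E / 2.
  have -> : E / 2 = C * (2 * (E / (4 * C))) by field; rewrite gt_eqF.
  apply: (ler_wpM2l (ltW C0)); move: h1 h2 h5; move: (E / (4 * C)) => Y; lra.
by rewrite [X in _ <= X](splitr E); exact: lerD b1 b2.
Qed.

Lemma conjugate_lt2 {R : realType} (p r : R) : 2 < p -> 0 < r -> p^-1 + r^-1 = 1 -> r < 2.
Proof.
move=> p2 r0 pr; have : 2^-1 < r^-1.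
  have : p^-1 < 2^-1 by rewrite ltf_pV2 ?posrE // (lt_trans _ p2).
  by move: pr; lra.
by rewrite ltf_pV2 ?posrE.
Qed.

(** * Minimizing sequences for the distance to a midpoint-convex set *)

Section ClosestPoint.
Context {d : measure_display} {T : measurableType d} {R : realType}.
Variable mu : {measure set T -> \bar R}.
Variable p : R.
Hypothesis p1 : 1 < p.

Let p0 : 0 < p. Proof. by apply: lt_trans p1. Qed.

(** Midpoints stay in [A] and cannot be closer to [y] than the infimum, so uniform convexity makes a
    minimizing sequence Cauchy. Whether its limit stays in [A] is settled where the lemma is
    used. *)
Lemma Lr_near_minimizers (A : set (T -> R)) (y : T -> R) : A !=set0 -> (forall a, A a -> Lr mu p a) ->
  (forall a b, A a -> A b -> A (fun x => (a x + b x) / 2)) -> Lr mu p y ->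
  exists (a_ : nat -> T -> R) (del : R), [/\ forall n, A (a_ n),
    forall e, 0 < e -> exists N, forall m n, (N <= m)%N -> (N <= n)%N ->
      nr mu p (fun x => a_ m x - a_ n x) <= e,
    (fun n => nr mu p (fun x => y x - a_ n x)) @ \oo --> del &
    forall a, A a -> del <= nr mu p (fun x => y x - a x)].
Proof.
move=> [b0 Ab0] AL Amid hy.
pose V := [set nr mu p (fun x => y x - a x) | a in A].
have hV : has_inf V.
  split; first by exists (nr mu p (fun x => y x - b0 x)), b0.
  by exists 0 => _ [a _ <-]; exact: nr_ge0.
pose del : R := inf V.
have dlb a : A a -> del <= nr mu p (fun x => y x - a x).
  by move=> Aa; apply: ge_inf; [exact: hV.2|exists a].
have d0 : 0 <= del by apply: lb_le_inf; [exact: hV.1|move=> _ [a _ <-]; exact: nr_ge0].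
have ex n : exists a, A a /\ nr mu p (fun x => y x - a x) < del + n.+1%:R^-1.
  have n0 : 0 < n.+1%:R^-1 :> R by rewrite invr_gt0.
  by have [_ [a Aa <-] h] := inf_adherent n0 hV; exists a.
pose a_ n := projT1 (cid (ex n)).
have Aa n : A (a_ n) := (projT2 (cid (ex n))).1.
have ha n : nr mu p (fun x => y x - a_ n x) < del + n.+1%:R^-1 := (projT2 (cid (ex n))).2.
have hLa n := AL _ (Aa n).
have hya n : Lr mu p (fun x => y x - a_ n x) := LrB (ltW p0) hy (hLa n).
have hcv : (fun n => del + n.+1%:R^-1) @ \oo --> del.
  by rewrite -[X in _ --> X]addr0; apply: cvgD; [exact: cvg_cst|exact: cvg_harmonic].
exists a_, del; split => //; last first.
  apply: (squeeze_cvgr (f := fun=> del) (h := fun n => del + n.+1%:R^-1)) => //; last exact: cvg_cst.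
  by apply: nearW => n; rewrite dlb //= ltW.
move=> e e0; have ep0 : 0 < e `^ p by rewrite powR_gt0.
have D1 : 0 < (del + 1) `^ p by rewrite powR_gt0 // ltr_wpDl.
(* Splits [e^p] into halves: the distance integrals are at most [(del + 1)^p], and the second half
   is kept for the convexity defect. *)
have e1 : 0 < e `^ p / (4 * (del + 1) `^ p) by apply: divr_gt0 => //; exact: mulr_gt0.
have [C C0 hC] := Lr_unif_convex mu p1 e1.
have hcp : (fun n => `|del + n.+1%:R^-1| `^ p) @ \oo --> `|del| `^ p.
  exact: (cvg_comp _ _ hcv (@continuous_normpowR R p p0 del)).
have e2 : 0 < e `^ p / (4 * C) by apply: divr_gt0 => //; exact: mulr_gt0.
have hlt : `|del| `^ p < `|del| `^ p + e `^ p / (4 * C) by rewrite ltrDl.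
have [N _ hN] : \forall n \near \oo, `|del + n.+1%:R^-1| `^ p < `|del| `^ p + e `^ p / (4 * C).
  exact: cvgr_lt hcp _ hlt.
exists N => m n Nm Nn.
have Ib k : (N <= k)%N -> \int[mu]_x `|y x - a_ k x| `^ p <= del `^ p + e `^ p / (4 * C).
  move=> Nk; have := hN k Nk.
  have k0 : 0 <= (k.+1%:R^-1 : R) by rewrite invr_ge0.
  rewrite (ger0_norm d0) (ger0_norm (addr_ge0 d0 k0)) => /ltW; apply: le_trans.
  rewrite int_nr //; apply: (ge0_ler_powR (ltW p0)); rewrite ?nnegrE ?nr_ge0 ?addr_ge0 //.
  exact: ltW.
have Ib1 k : \int[mu]_x `|y x - a_ k x| `^ p <= (del + 1) `^ p.
  have k1 : (k.+1%:R^-1 : R) <= 1 by rewrite invf_le1 // ler1n.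
  rewrite int_nr //; apply: (ge0_ler_powR (ltW p0)); rewrite ?nnegrE ?nr_ge0 ?addr_ge0 //.
  by apply: (le_trans (ltW (ha k))); rewrite lerD2l.
have mid : del `^ p <= \int[mu]_x `|((y x - a_ n x) + (y x - a_ m x)) / 2| `^ p.
  have -> : (fun x => `|((y x - a_ n x) + (y x - a_ m x)) / 2| `^ p) =
      (fun x => `|y x - (a_ n x + a_ m x) / 2| `^ p).
    by apply/funext => x; congr (`|_| `^ p); field.
  rewrite (int_nr mu (fun x => y x - (a_ n x + a_ m x) / 2)) //.
  apply: (ge0_ler_powR (ltW p0)); rewrite ?nnegrE ?nr_ge0 //.
  exact: (dlb _ (Amid _ _ (Aa n) (Aa m))).
rewrite nr_le_int // ?(ltW e0) //.
have -> : (fun x => `|a_ m x - a_ n x| `^ p) = (fun x => `|(y x - a_ n x) - (y x - a_ m x)| `^ p).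
  by apply/funext => x; congr (`|_| `^ p); ring.
apply: (le_trans (hC _ _ (hya n) (hya m))).
exact: (minimizer_gap (Ib n Nn) (Ib m Nm) (Ib1 n) (Ib1 m) mid ep0 D1 C0).
Qed.

End ClosestPoint.

(** * The Euler-Lagrange equation of the maximizer *)

Section EulerLagrange.
Context {R : realType}.
Variables (nu : nat -> R) (zeta : nat -> R -> R).
Hypothesis Hbasis : laplace_eigenbasis nu zeta.
Local Notation mu2 := (@torus_measure R).
Local Notation T1 := (measurableTypeR R).
Local Notation T2 := (T1 * T1)%type.

Variables (p r : R).
Hypothesis p2 : 2 < p.
Hypothesis r1 : 1 < r.
Hypothesis pr : p^-1 + r^-1 = 1.
Variables (kap : R * R -> R) (K : R).
Hypothesis mk : measurable_fun [set: T2] kap.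
Hypothesis kK : forall z, `|kap z| <= K.

Local Notation form := (form nu zeta kap).

Variable X : set (R * R -> R).
Hypothesis XLr : forall w, X w -> Lr mu2 r w.
Hypothesis XZ : forall c w, X w -> X (fun z => c * w z).
Hypothesis XD : forall w h, X w -> X h -> X (fun z => w z + h z).

Let r0 : 0 < r. Proof. by apply: lt_trans r1. Qed.
Let r1' : 1 <= r. Proof. exact: ltW. Qed.
Let p1 : 1 < p. Proof. by apply: lt_trans p2; rewrite ltr1n. Qed.

(** The supremum over the unit ball is finite by [form_bound] and positive because of the given
    state; homogeneity extends it to all of [X]. *)
Lemma form_sup : (exists2 w, X w & 0 < form w w) -> exists2 M, 0 < M &
  (forall w, X w -> form w w <= M * nr mu2 r w ^+ 2) /\
  (forall e, 0 < e -> exists w, [/\ X w, nr mu2 r w <= 1 & M - e <= form w w]).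
Proof.
move=> [w0 Xw0 Q0].
have [C C0 hC] := form_bound Hbasis p2 r1 pr mk kK.
pose V := [set form w w | w in [set w | X w /\ nr mu2 r w <= 1]].
have scale w : X w -> nr mu2 r w != 0 -> let w' := fun z => (nr mu2 r w)^-1 * w z in
    [/\ X w', nr mu2 r w' = 1 & form w' w' = (nr mu2 r w)^-1 ^+ 2 * form w w].
  move=> Xw n0 w'; have hw := XLr Xw; split; first exact: XZ.
    by rewrite /w' (nrZ _ r0 hw) ger0_norm ?invr_ge0 ?nr_ge0 // mulVf.
  rewrite /w' (formZl Hbasis p2 r1 pr mk kK _ hw (LrZ _ hw)) formC.
  by rewrite (formZl Hbasis p2 r1 pr mk kK _ hw hw) mulrA -expr2.
have nn w : X w -> 0 < form w w -> nr mu2 r w != 0.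
  move=> Xw; apply: contraTneq => n0; rewrite -leNgt.
  by have := hC _ _ (XLr Xw) (XLr Xw); rewrite n0 !mulr0; apply: le_trans; exact: ler_norm.
have [Xs ns Qs] := scale _ Xw0 (nn _ Xw0 Q0).
have hV : has_sup V.
  split; first by exists (form w0 w0 * (nr mu2 r w0)^-1 ^+ 2), (fun z => (nr mu2 r w0)^-1 * w0 z);
    [split => //; rewrite ns|rewrite Qs mulrC].
  exists C => _ [w [Xw nw] <-].
  apply: (le_trans (ler_norm _)); apply: (le_trans (hC _ _ (XLr Xw) (XLr Xw))).
  rewrite -mulrA ler_piMr ?(ltW C0) // mulr_ile1 // nr_ge0 //.
pose M : R := sup V.
have ub w : X w -> nr mu2 r w <= 1 -> form w w <= M.
  by move=> Xw nw; apply: sup_upper_bound => //; exists w.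
exists M.
  apply: (@lt_le_trans _ _ (form (fun z => (nr mu2 r w0)^-1 * w0 z) (fun z => (nr mu2 r w0)^-1 * w0 z))).
    rewrite Qs mulr_gt0 // exprn_gt0 // invr_gt0 lt_def nr_ge0 andbT; exact: nn.
  by apply: ub => //; rewrite ns.
split.
  move=> w Xw; have [n0|n0] := eqVneq (nr mu2 r w) 0.
    have := hC _ _ (XLr Xw) (XLr Xw); rewrite n0 expr0n !mulr0.
    by apply: le_trans; exact: ler_norm.
  have [Xw' nw' Qw'] := scale _ Xw n0.
  have := ub _ Xw'; rewrite nw' Qw' => /(_ (lexx _)).
  by rewrite exprVn ler_pdivrMl // ?(mulrC _ M) // exprn_gt0 // lt_def n0 nr_ge0.
move=> e e0; have [_ [w [Xw nw] <-] h] := sup_adherent e0 hV.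
by exists w; split => //; exact: ltW.
Qed.

Variables (M : R) (w : R * R -> R).
Hypothesis M0 : 0 < M.
Hypothesis QM : forall h, X h -> form h h <= M * nr mu2 r h ^+ 2.
Hypothesis Xw : X w.
Hypothesis nw : nr mu2 r w = 1.
Hypothesis Qw : form w w = M.

Let hw : Lr mu2 r w. Proof. exact: XLr. Qed.

(** Maximality is applied at [w + t h]. The form there is an exact quadratic polynomial in [t]; the
    squared norm is bounded by the tangent line inequality used twice, for [|x|^r] and for the power
    [2 / r > 1] that turns the r-th power integral into the squared norm. Division by [t] and
    [t -> 0] give the claim. *)
Lemma euler_lagrange_le h : X h -> form w h <= M * \int[mu2]_z (jmap r (w z) * h z).
Proof.
move=> Xh; have hh := XLr Xh.
have r2 : r < 2 := conjugate_lt2 p2 r0 pr.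
pose a : R := 2 / r.
have a1 : 1 < a by rewrite /a ltr_pdivlMr // mul1r.
have ar : a * r = 2 by rewrite /a divfK // gt_eqF.
pose t (n : nat) : R := n.+1%:R^-1.
have t0 n : 0 < t n by rewrite invr_gt0.
have t1 n : `|t n| <= 1 by rewrite ger0_norm ?(ltW (t0 n)) // invf_le1 // ler1n.
have tcv : t @ \oo --> 0 by exact: cvg_harmonic.
pose wt n z := w z + t n * h z.
have hth n : Lr mu2 r (fun z => t n * h z) := LrZ _ hh.
have hwt n : Lr mu2 r (wt n) := LrD (ltW r0) hw (hth n).
pose y n := \int[mu2]_z `|wt n z| `^ r.
pose D n := \int[mu2]_z (jmap r (wt n z) * h z).
have Dcv : D @ \oo --> \int[mu2]_z (jmap r (w z) * h z).
  by apply: (cvg_Lr_jmap r1 p1 _ hw hh tcv t1); rewrite addrC.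
have ycv : y @ \oo --> (1 : R).
  have ncv : (fun n => nr mu2 r (wt n)) @ \oo --> (1 : R).
    have hb n : `|nr mu2 r (wt n) - 1| <= t n * nr mu2 r h.
      rewrite -nw; apply: (le_trans (nr_dist r1' (hwt n) hw)).
      have -> : (fun z => wt n z - w z) = (fun z => t n * h z).
        by apply/funext => z; rewrite /wt addrC addKr.
      by rewrite (nrZ _ r0 hh) ger0_norm // ltW.
    have cv0 : (fun n => t n * nr mu2 r h) @ \oo --> (0 : R).
      have -> : (0 : R) = 0 * nr mu2 r h by rewrite mul0r.
      exact: cvgMl tcv.
    apply/cvgrPdist_le => e e0.
    have : \forall n \near \oo, t n * nr mu2 r h < e by exact: cvgr_lt cv0 _ e0.
    by apply: filterS => n /ltW; apply: le_trans; rewrite distrC.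
  have -> : y = (fun n => `|nr mu2 r (wt n)| `^ r).
    by apply/funext => n; rewrite /y int_nr // ger0_norm // nr_ge0.
  have -> : (1 : R) = `|1| `^ r by rewrite normr1 powR1.
  exact: (cvg_comp _ _ ncv (@continuous_normpowR R r r0 1)).
have jcv : (fun n => jmap a (y n)) @ \oo --> (1 : R).
  have -> : (1 : R) = jmap a 1 by rewrite /jmap normr1 powR1 mulr1.
  exact: (cvg_comp _ _ ycv (@continuous_jmap R a a1 1)).
have y0 n : 0 <= y n by exact: int_pow_ge0.
have j0 n : 0 <= jmap a (y n) by rewrite /jmap mulr_ge0 ?powR_ge0.
have Iw1 : \int[mu2]_z `|w z| `^ r = 1 by rewrite int_nr // nw powR1.
(* The tangent line at [wt n], evaluated at [w] and integrated; the r-th power integral of [w] is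
   1. *)
have yD n : y n - 1 <= r * (t n * D n).
  have [_ iwt] := hwt n; have [_ iw] := hw.
  have hj : Lr mu2 p (fun z => jmap r (wt n z)) by apply: (Lr_jmap r1 p1) => //; rewrite addrC.
  have ij : intg mu2 (fun z => jmap r (wt n z) * h z) := Lr_mul p1 r1 pr hj hh.
  have := int_le (intgD iwt (intgZ (r * - t n) ij)) iw.
  rewrite int_D //; last exact: intgZ.
  rewrite (int_Z _ ij) -/(y n) -/(D n) Iw1 => H.
  have {}H : y n + r * - t n * D n <= 1.
    apply: H => z; have := @jmap_convex R r (wt n z) (w z) r1.
    have -> : w z - wt n z = - t n * h z by rewrite /wt; ring.
    have -> : r * (jmap r (wt n z) * (- t n * h z)) = r * - t n * (jmap r (wt n z) * h z) by ring.
    by [].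
  by move: H; move: (y n) (t n) (D n) => A B E; lra.
have main n : 2 * form w h + t n * form h h <= 2 * M * (jmap a (y n) * D n).
  have Xwt : X (wt n) by apply: XD => //; exact: XZ.
  have := QM Xwt; rewrite (formDD Hbasis p2 r1 pr mk kK _ hw hh) Qw.
  have -> : nr mu2 r (wt n) ^+ 2 = y n `^ a.
    by rewrite /y int_nr // -powRrM mulrC ar powR_mulrn // nr_ge0.
  have := @jmap_convex R a (y n) 1 a1.
  rewrite (ger0_norm (y0 n)) normr1 powR1 => h1 h2.
  have h3 : y n `^ a <= 1 + a * (jmap a (y n) * (r * (t n * D n))).
    have : a * (jmap a (y n) * (y n - 1)) <= a * (jmap a (y n) * (r * (t n * D n))).
      by apply: ler_wpM2l; [rewrite ltW // (lt_trans _ a1)|apply: ler_wpM2l].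
    have : a * (jmap a (y n) * (1 - y n)) = - (a * (jmap a (y n) * (y n - 1))) by ring.
    by move: h1; move: (a * (jmap a (y n) * (1 - y n))) => B; lra.
  have h4 : a * (jmap a (y n) * (r * (t n * D n))) = 2 * t n * (jmap a (y n) * D n).
    by rewrite -ar; ring.
  rewrite h4 in h3.
  have h5 : M * y n `^ a <= M * (1 + 2 * t n * (jmap a (y n) * D n)) by apply: ler_wpM2l => //; exact: ltW.
  rewrite -(ler_pM2l (t0 n)).
  exact: (quotient_gap (le_trans h2 h5)).
have L : (fun n => 2 * form w h + t n * form h h) @ \oo --> 2 * form w h + 0 * form h h.
  by apply: cvgD; [exact: cvg_cst|exact: cvgMl].
have Rr : (fun n => 2 * M * (jmap a (y n) * D n)) @ \oo -->
    2 * M * (1 * \int[mu2]_z (jmap r (w z) * h z)).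
  by apply: cvgMr; exact: cvgM jcv Dcv.
have : 2 * form w h + 0 * form h h <= 2 * M * (1 * \int[mu2]_z (jmap r (w z) * h z)).
  by apply: (ler_cvg_to L Rr); exact: nearW.
by rewrite mul0r addr0 mul1r -mulrA ler_pM2l.
Qed.

Lemma euler_lagrange h : X h -> form w h = M * \int[mu2]_z (jmap r (w z) * h z).
Proof.
move=> Xh; have hh := XLr Xh; apply/eqP; rewrite eq_le euler_lagrange_le //=.
have := euler_lagrange_le (XZ (-1) Xh).
rewrite formC (formZl Hbasis p2 r1 pr mk kK _ hh hw) formC.
have -> : \int[mu2]_z (jmap r (w z) * (-1 * h z)) = - \int[mu2]_z (jmap r (w z) * h z).
  have hj : Lr mu2 p (fun z => jmap r (w z)) by apply: (Lr_jmap r1 p1) => //; rewrite addrC.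
  rewrite -int_N; last exact: Lr_mul p1 r1 pr hj hh.
  by apply: eq_Rintegral => z _; ring.
by rewrite mulrN mulN1r lerN2.
Qed.

End EulerLagrange.

(** * The constraint space and its annihilator *)

Section KernelSpace.
Context {R : realType}.
Variables (nu : nat -> R) (zeta : nat -> R -> R).
Hypothesis Hbasis : laplace_eigenbasis nu zeta.
Local Notation mu2 := (@torus_measure R).
Local Notation T1 := (measurableTypeR R).
Local Notation T2 := (T1 * T1)%type.
Local Notation mode := (mode zeta).
Local Notation coef := (coef zeta).
Local Notation lam := (lam nu).

Variables (p r : R).
Hypothesis p2 : 2 < p.
Hypothesis r1 : 1 < r.
Hypothesis pr : p^-1 + r^-1 = 1.
Variables (kap : R * R -> R) (K : R).
Hypothesis mk : measurable_fun [set: T2] kap.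
Hypothesis kK : forall z, `|kap z| <= K.

Let p1 : 1 < p. Proof. by apply: lt_trans p2; rewrite ltr1n. Qed.
Let p0 : 0 < p. Proof. by apply: lt_trans p1. Qed.
Let r0 : 0 < r. Proof. by apply: lt_trans r1. Qed.
Let rp : r^-1 + p^-1 = 1. Proof. by rewrite addrC. Qed.
Let K0 : 0 <= K. Proof. exact: le_trans (normr_ge0 _) (kK (0, 0)). Qed.

Definition kernel_Lr (phi : R * R -> R) : Prop :=
  [/\ L2_torus phi, forall i, lam i != 0 -> coef phi i = 0 & Lr mu2 p phi].

(** The space X: orthogonality of [w * kap] to the kernel is the solvability condition for the
    linear wave equation with this right-hand side. *)
Definition admissible (w : R * R -> R) : Prop :=
  Lr mu2 r w /\ forall phi, kernel_Lr phi -> \int[mu2]_z (phi z * (w z * kap z)) = 0.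

Lemma kernel_Lr0 : kernel_Lr (fun=> 0).
Proof.
split; [|move=> i _|exact: Lr0].
  by apply/L2_torusP; split => //; exact: Lr0.
by rewrite /Defs.coef /inner; under eq_Rintegral => z _ do rewrite mul0r; rewrite int_0.
Qed.

Lemma coefZ c u i : L2_torus u -> coef (fun z => c * u z) i = c * coef u i.
Proof. by move=> /L2_torusP[_ hu]; rewrite /Defs.coef innerZl //; exact: mode_L2 Hbasis i. Qed.

Lemma L2_torusZ c (u : R * R -> R) : L2_torus u -> L2_torus (fun z => c * u z).
Proof.
move=> /L2_torusP[pu hu]; apply/L2_torusP; split; last exact: LrZ.
by move=> x t; rewrite !(pu x t).1 !(pu x t).2.
Qed.

Lemma kernel_LrZ c phi : kernel_Lr phi -> kernel_Lr (fun z => c * phi z).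
Proof.
move=> [h1 h2 h3]; split; [exact: L2_torusZ|move=> i li|exact: LrZ].
by rewrite coefZ // h2 // mulr0.
Qed.

Lemma kernel_LrD phi psi : kernel_Lr phi -> kernel_Lr psi -> kernel_Lr (fun z => phi z + psi z).
Proof.
move=> [h1 h2 h3] [g1 g2 g3]; split; [exact: L2_torusD|move=> i li|exact: (LrD (ltW p0))].
by rewrite (coefD Hbasis) // h2 // g2 // addr0.
Qed.

Lemma pair_intg phi w : Lr mu2 p phi -> Lr mu2 r w -> intg mu2 (fun z => phi z * (w z * kap z)).
Proof. by move=> hp hw; exact: Lr_mul p1 r1 pr hp (weight_Lr r1 mk kK hw). Qed.

Lemma admissible_Lr w : admissible w -> Lr mu2 r w. Proof. by case. Qed.

Lemma admissibleZ c w : admissible w -> admissible (fun z => c * w z).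
Proof.
move=> [hw h]; split; first exact: LrZ.
move=> phi hphi; have [_ _ hp] := hphi.
rewrite -[RHS](mulr0 c) -(h _ hphi) -int_Z; last exact: pair_intg.
by apply: eq_Rintegral => z _; ring.
Qed.

Lemma admissibleD w h : admissible w -> admissible h -> admissible (fun z => w z + h z).
Proof.
move=> [hw aw] [hh ah]; split; first exact: LrD (ltW r0) hw hh.
move=> phi hphi; have [_ _ hp] := hphi.
rewrite -[RHS]addr0 -{1}(aw _ hphi) -(ah _ hphi) -int_D; [|exact: pair_intg|exact: pair_intg].
by apply: eq_Rintegral => z _; ring.
Qed.

Lemma admissible_closed (w_ : nat -> R * R -> R) w : (forall n, admissible (w_ n)) -> Lr mu2 r w ->
  (fun n => nr mu2 r (fun z => w_ n z - w z)) @ \oo --> 0 -> admissible w.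
Proof.
move=> aw hw cv; split => // phi hphi; have [_ _ hp] := hphi.
apply/eqP; rewrite -normr_le0; apply/ler_addgt0Pr => e e0; rewrite add0r.
have cv2 : (fun n => nr mu2 p phi * K * nr mu2 r (fun z => w_ n z - w z)) @ \oo --> (0 : R).
  have -> : (0 : R) = nr mu2 p phi * K * 0 by rewrite mulr0.
  exact: cvgMr cv.
have [n _ hn] : \forall n \near \oo, nr mu2 p phi * K * nr mu2 r (fun z => w_ n z - w z) < e.
  exact: cvgr_lt cv2 _ e0.
apply: le_trans (ltW (hn n (leqnn n))).
have [hwn an] := aw n.
have hd := LrB (ltW r0) hwn hw.
have -> : \int[mu2]_z (phi z * (w z * kap z)) =
    - \int[mu2]_z (phi z * ((w_ n z - w z) * kap z)).
  have i1 := pair_intg hp hwn; have i2 := pair_intg hp hw.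
  have -> : \int[mu2]_z (phi z * ((w_ n z - w z) * kap z)) =
     \int[mu2]_z (phi z * (w_ n z * kap z)) - \int[mu2]_z (phi z * (w z * kap z)).
    by rewrite -int_B //; apply: eq_Rintegral => z _; ring.
  by rewrite (an _ hphi) sub0r opprK.
rewrite normrN; apply: (le_trans (hoelder_nr p1 r1 pr hp (weight_Lr r1 mk kK hd))).
rewrite -mulrA; apply: ler_wpM2l; first exact: nr_ge0.
exact: nr_mul_bounded r0 K0 mk kK hd.
Qed.

Variable C : R.
Hypothesis control : forall phi, kernel_Lr phi -> nr mu2 p phi <= C * nr mu2 p (fun z => phi z * kap z).

(* The weighted kernel is closed in L^p because of [control]; subtracting the closest point of it
   plays the role of the Hahn-Banach theorem. *)
Lemma kernel_bipolar y : Lr mu2 p y -> (forall h, admissible h -> \int[mu2]_z (y z * h z) = 0) ->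
  exists2 phi, kernel_Lr phi & {ae mu2, forall z, y z = phi z * kap z}.
Proof.
move=> hy yX.
have hwp f : Lr mu2 p f -> Lr mu2 p (fun z => f z * kap z) := Lr_mul_bounded (ltW p0) mk kK.
pose A := [set (fun z => phi z * kap z) | phi in kernel_Lr].
have [a_ [del [Aa cau dcv dlb]]] : exists (a_ : nat -> R * R -> R) (del : R), [/\ forall n, A (a_ n),
    forall e, 0 < e -> exists N, forall m n, (N <= m)%N -> (N <= n)%N ->
      nr mu2 p (fun x => a_ m x - a_ n x) <= e,
    (fun n => nr mu2 p (fun x => y x - a_ n x)) @ \oo --> del &
    forall a, A a -> del <= nr mu2 p (fun x => y x - a x)].
  apply: (@Lr_near_minimizers _ T2 R mu2 p p1 A y _ _ _ hy).
  - by exists (fun z => (fun=> 0) z * kap z), (fun=> 0) => //; exact: kernel_Lr0.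
  - by move=> _ [phi [_ _ hp] <-]; exact: hwp.
  move=> _ _ [phi hphi <-] [psi hpsi <-]; exists (fun z => 2^-1 * (phi z + psi z)).
    by apply: kernel_LrZ; exact: kernel_LrD.
  by apply/funext => z; field.
have ex n : exists phi, kernel_Lr phi /\ forall z, a_ n z = phi z * kap z.
  by have [phi hphi e] := Aa n; exists phi; split => // z; rewrite -e.
pose f_ n := projT1 (cid (ex n)).
have hf n : kernel_Lr (f_ n) := (projT2 (cid (ex n))).1.
have ef n : forall z, a_ n z = f_ n z * kap z := (projT2 (cid (ex n))).2.
have fL n : Lr mu2 p (f_ n) by have [] := hf n.
have hdif m n : kernel_Lr (fun z => f_ m z - f_ n z).
  have := kernel_LrD (hf m) (kernel_LrZ (-1) (hf n)).
  by congr kernel_Lr; apply/funext => z; rewrite mulN1r.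
(* Only the weighted functions are known to be Cauchy; [control] transfers this to the kernel
   elements themselves. *)
have fcau e : 0 < e -> exists N, forall m n, (N <= m)%N -> (N <= n)%N ->
    nr mu2 p (fun z => f_ m z - f_ n z) <= e.
  move=> e0; have C1 : 0 < `|C| + 1 by rewrite ltr_wpDl.
  have [N hN] := cau _ (divr_gt0 e0 C1); exists N => m n Nm Nn.
  apply: (le_trans (control (hdif m n))).
  have -> : (fun z => (f_ m z - f_ n z) * kap z) = (fun z => a_ m z - a_ n z).
    by apply/funext => z; rewrite !ef mulrBl.
  apply: (@le_trans _ _ ((`|C| + 1) * nr mu2 p (fun z => a_ m z - a_ n z))).
    by apply: ler_wpM2r; [exact: nr_ge0|rewrite (le_trans (ler_norm _)) // lerDl].
  by rewrite mulrC -ler_pdivlMr //; exact: hN.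
have [phi [hp fcv finv]] := Lr_complete (ltW p1) fL fcau.
have p2l : Lr mu2 2 phi by apply: (Lr_exponent (p := p)) => //; [exact: torus_measure_fin|exact: ltW].
have hphi : kernel_Lr phi.
  split => //.
    apply/L2_torusP; split => // x t.
    have pf n : torus_invariant (f_ n) by have [/L2_torusP[]] := hf n.
    by split; apply: finv => n; have [e1 e2] := pf n x t.
  move=> i li; apply/eqP; rewrite -normr_le0; apply/ler_addgt0Pr => e e0; rewrite add0r.
  have hm : Lr mu2 r (mode i) := mode_Lr Hbasis i (ltW r0).
  have cv2 : (fun n => nr mu2 p (fun z => f_ n z - phi z) * nr mu2 r (mode i)) @ \oo --> (0 : R).
    have -> : (0 : R) = 0 * nr mu2 r (mode i) by rewrite mul0r.
    exact: cvgMl fcv.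
  have [n _ hn] : \forall n \near \oo, nr mu2 p (fun z => f_ n z - phi z) * nr mu2 r (mode i) < e.
    exact: cvgr_lt cv2 _ e0.
  apply: le_trans (ltW (hn n (leqnn n))).
  have [_ fn0 _] := hf n.
  have -> : coef phi i = - \int[mu2]_z ((f_ n z - phi z) * mode i z).
    have i1 := Lr_mul p1 r1 pr (fL n) hm; have i2 := Lr_mul p1 r1 pr hp hm.
    have -> : \int[mu2]_z ((f_ n z - phi z) * mode i z) =
       \int[mu2]_z (f_ n z * mode i z) - \int[mu2]_z (phi z * mode i z).
      by rewrite -int_B //; apply: eq_Rintegral => z _; rewrite mulrBl.
    by have := fn0 i li; rewrite /Defs.coef /inner => ->; rewrite sub0r opprK.
  by rewrite normrN; apply: (hoelder_nr p1 r1 pr) => //; exact: LrB (ltW p0) (fL n) hp.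
pose v z := y z - phi z * kap z.
have hv : Lr mu2 p v := LrB (ltW p0) hy (hwp _ hp).
have vdel : nr mu2 p v <= del.
  apply/ler_addgt0Pr => e e0; have e2 : 0 < e / 2 by rewrite divr_gt0.
  have cv2 : (fun n => K * nr mu2 p (fun z => f_ n z - phi z)) @ \oo --> (0 : R).
    have -> : (0 : R) = K * 0 by rewrite mulr0.
    exact: cvgMr fcv.
  have [n1 _ hn1] : \forall n \near \oo, K * nr mu2 p (fun z => f_ n z - phi z) < e / 2 by exact: cvgr_lt cv2 _ e2.
  have dlt : del < del + e / 2 by rewrite ltrDl.
  have [n2 _ hn2] : \forall n \near \oo, nr mu2 p (fun z => y z - a_ n z) < del + e / 2 by exact: cvgr_lt dcv _ dlt.
  pose n := maxn n1 n2.
  have k1 := hn1 n (leq_maxl _ _); have k2 := hn2 n (leq_maxr _ _).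
  have ha : Lr mu2 p (a_ n) by have [f [_ _ h] <-] := Aa n; exact: hwp.
  apply: (le_trans (nr_tri (ltW p1) hy ha (hwp _ hp))).
  have -> : (fun z => a_ n z - phi z * kap z) = (fun z => (f_ n z - phi z) * kap z).
    by apply/funext => z; rewrite ef mulrBl.
  have H := nr_mul_bounded p0 K0 mk kK (LrB (ltW p0) (fL n) hp).
  rewrite (splitr e) addrA; apply: lerD; first exact: ltW.
  exact: le_trans H (ltW k1).
(* The first-order condition at the closest point makes the dual image [W] of the residual [v]
   admissible. Both [y] and the weighted kernel then pair to 0 with [W], while the pairing of [v]
   with [W] is the integral of [|v|^p]. *)
pose W z := jmap p (v z).
have hW : Lr mu2 r W := Lr_jmap p1 r1 pr hv.
have aW : admissible W.
  split => // psi hpsi; have [_ _ hpp] := hpsi.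
  have H := Lr_minimizer_jmap p1 r1 pr hv (hwp _ hpp).
  rewrite -[RHS]H; first by apply: eq_Rintegral => z _; rewrite /W mulrCA mulrC [psi z * _]mulrC mulrC mulrCA.
  move=> s; rewrite !int_nr //; apply: (ge0_ler_powR (ltW p0)); rewrite ?nnegrE ?nr_ge0 //.
  apply: (le_trans vdel).
  have hs : A (fun z => (phi z + - s * psi z) * kap z).
    by exists (fun z => phi z + - s * psi z) => //; apply: kernel_LrD => //; exact: kernel_LrZ.
  have := dlb _ hs; congr (_ <= nr mu2 p _).
  by apply/funext => z; rewrite /v; ring.
have [_ aWk] := aW.
have I0 : \int[mu2]_z `|v z| `^ p = 0.
  have i1 := Lr_mul p1 r1 pr hy hW; have i2 := pair_intg hp hW.
  have -> : \int[mu2]_z `|v z| `^ p = \int[mu2]_z (y z * W z) - \int[mu2]_z (phi z * (W z * kap z)).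
    rewrite -int_B //; apply: eq_Rintegral => z _.
    by rewrite -(jmapM _ p1) /W {2}/v; ring.
  by rewrite (yX _ aW) (aWk _ hphi) subrr.
exists phi => //.
have [_ iv] := hv.
have := int_eq0_ae iv (fun z => powR_ge0 _ _) I0.
move=> H; apply: (ae_imp (mu := mu2) H) => z /powR_eq0_eq0 /eqP.
by rewrite normr_eq0 /v subr_eq0 => /eqP.
Qed.

End KernelSpace.

Lemma half_sqrt_sub (R : rcfType) (a b x y : R) : 0 <= a -> 0 <= b -> a - b = x ->
  2^-1 * (Num.sqrt a ^+ 2 - Num.sqrt b ^+ 2) - y * x = (2^-1 - y) * x.
Proof. by move=> a0 b0 h; rewrite !sqr_sqrtr // h mulrBl. Qed.

Lemma nr_ae0 {d} {T : measurableType d} {R : realType} (mu : {measure set T -> \bar R}) (r : R)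
    (f : T -> R) : 0 < r -> measurable_fun setT f -> {ae mu, forall z, f z = 0} -> nr mu r f = 0.
Proof.
move=> r0 mf f0.
have -> : nr mu r f = nr mu r (fun=> 0) by apply: nr_ae_eq => //; exact: measurable_cst.
rewrite nrE; under eq_Rintegral => z _ do rewrite normr0 (powR0 (lt0r_neq0 r0)).
by rewrite int_0 powR0 // invr_eq0 gt_eqF.
Qed.

(** * Ground states *)

Section GroundState.
Context {R : realType}.
Variables (nu : nat -> R) (zeta : nat -> R -> R).
Hypothesis Hbasis : laplace_eigenbasis nu zeta.
Local Notation mu2 := (@torus_measure R).
Local Notation T1 := (measurableTypeR R).
Local Notation T2 := (T1 * T1)%type.
Local Notation mode := (mode zeta).
Local Notation coef := (coef zeta).
Local Notation lam := (lam nu).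
Local Notation band := (band nu).

Lemma mode_energy_bounded i : energy_bounded nu zeta (mode i).
Proof.
exists (`|lam i| * 1) => n.
have hm := mode_L2 Hbasis i.
apply: (@le_trans _ _ (`|lam i| * \sum_(j <- band n) coef (mode i) j ^+ 2)).
  rewrite big_distrr /=; apply: ler_sum => j _.
  by rewrite /Defs.coef (mode_ortho Hbasis); case: eqP => [->|_]; rewrite ?expr0n ?mulr0.
apply: ler_wpM2l => //.
have := bessel (mode_L2 Hbasis) (mode_ortho Hbasis) (fset_uniq (band n)) hm.
by rewrite (mode_ortho Hbasis) eqxx.
Qed.

(** Bands omit the kernel modes, so this form of Parseval's identity asks one factor to have no
    kernel coefficients. *)
Lemma band_parseval v h : L2_torus v -> L2_torus h -> (forall i, lam i = 0 -> coef v i = 0) ->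
  (fun n => \sum_(i <- band n) coef v i * coef h i) @ \oo --> inner mu2 v h.
Proof.
move=> hv hh v0; have [_ v2] : torus_invariant v /\ Lr mu2 2 v by exact/L2_torusP.
have [_ h2] : torus_invariant h /\ Lr mu2 2 h by exact/L2_torusP.
pose P n z := \sum_(i <- band n) coef v i * mode i z.
have hP n : Lr mu2 2 (P n) := L2_comb (mode_L2 Hbasis) (band n) (coef v).
have cv : (fun n => nr mu2 2 (fun z => P n z - v z)) @ \oo --> (0 : R).
  apply/cvgrPdist_le => e e0.
  have sp : in_closed_span mu2 (nonkernel nu) mode v.
    apply: (mode_span Hbasis hv) => i hi; apply: v0; apply/eqP; apply: contrapT => li.
    by apply: hi; apply/negP.
  have [s [sS hs]] := (closed_spanP (mode_L2 Hbasis) (mode_ortho Hbasis) (nonkernel nu) v2).1 sp _ e0.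
  have [N hN] := fset_exhaust (band_mono Hbasis) (fun i hi => band_exhaust Hbasis hi) sS.
  exists N => // n /= Nn; rewrite sub0r normrN ger0_norm ?nr_ge0 // nrBC.
  apply: le_trans (ltW hs).
  have := best_approx (mode_L2 Hbasis) (mode_ortho Hbasis) (fun i => if i \in s then coef v i else 0)
    (fset_uniq (band n)) v2.
  congr (_ <= nr mu2 2 _); apply/funext => z; congr (_ - _).
  rewrite [LHS](bigID (fun i => i \in s)) /= [X in _ + X]big1 ?addr0; last first.
    by move=> i /negbTE ->; rewrite mul0r.
  rewrite -big_filter; rewrite (perm_big s) /=.
    by rewrite big_seq [RHS]big_seq; apply: eq_bigr => i ->.
  apply: uniq_perm; [exact: filter_uniq (fset_uniq _)|exact: fset_uniq|].
  move=> i; rewrite mem_filter; apply/andP/idP => [[]//|is_]; split => //.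
  exact: (fsubsetP (band_mono Hbasis Nn) _ (hN i is_)).
have := inner_cvg hP v2 h2 cv.
have -> // : (fun n => inner mu2 (P n) h) = (fun n => \sum_(i <- band n) coef v i * coef h i).
by apply/funext => n; rewrite (inner_comb (mode_L2 Hbasis) _ _ h2).
Qed.

Variables (p r : R).
Hypothesis p2 : 2 < p.
Hypothesis r1 : 1 < r.
Hypothesis pr : p^-1 + r^-1 = 1.

Variables (q : R * R -> R) (c K h1 h2 c1 c2 : R).
Hypothesis mq : measurable_fun [set: T2] q.
Hypothesis pq : torus_invariant q.
Hypothesis q0 : forall z, 0 <= q z.
Hypothesis qK : forall z, q z <= K.
Hypothesis c0 : 0 < c.
Hypothesis h10 : 0 < h1.
Hypothesis h20 : 0 < h2.
Hypothesis h1pi : h1 <= (pi : R).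
Hypothesis h2pi : h2 <= (pi : R).
Hypothesis h12 : pi < h1 + h2.
Hypothesis qc : forall z, cosbox c1 c2 h1 h2 z -> c <= q z.

Local Notation E_space := (E_space nu zeta p q).
Local Notation E_zero := (E_zero nu zeta p q).
Local Notation weak_solution := (weak_solution nu zeta p q).
Local Notation energy := (energy nu zeta p q).

Let p1 : 1 < p. Proof. by apply: lt_trans p2; rewrite ltr1n. Qed.
Let p0 : 0 < p. Proof. by apply: lt_trans p1. Qed.
Let r0 : 0 < r. Proof. by apply: lt_trans r1. Qed.
Let rp : r^-1 + p^-1 = 1. Proof. by rewrite addrC. Qed.

Definition weight (z : R * R) : R := q z `^ p^-1.

Lemma weight_ge0 z : 0 <= weight z. Proof. exact: powR_ge0. Qed.

Lemma weight_measurable : measurable_fun [set: T2] weight.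
Proof. by apply: (measurableT_comp (measurable_powR _)). Qed.

Lemma weight_bound z : `|weight z| <= K `^ p^-1.
Proof.
rewrite ger0_norm ?weight_ge0 //; apply: ge0_ler_powR; rewrite ?nnegrE ?invr_ge0 ?(ltW p0) //.
exact: le_trans (qK z).
Qed.

Lemma weight_powR z : weight z `^ p = q z.
Proof. by rewrite /weight -powRrM mulVf ?powRr1 // gt_eqF. Qed.

Lemma weighted_pow u z : `|u z * weight z| `^ p = q z * `|u z| `^ p.
Proof.
rewrite normrM (ger0_norm (weight_ge0 z)) powRM ?weight_ge0 // weight_powR.
exact: mulrC.
Qed.

(** Factors the nonlinearity as the weight times the dual variable; where the weight vanishes both
    sides are 0. *)
Lemma jmap_weighted u z : jmap p (u z * weight z) * weight z = q z * `|u z| `^ (p - 2) * u z.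
Proof.
rewrite /jmap normrM (ger0_norm (weight_ge0 z)) powRM ?weight_ge0 //.
have [w0|w0] := eqVneq (weight z) 0.
  have -> : q z = 0 by rewrite -weight_powR w0 powR0 // gt_eqF.
  by rewrite w0 mulr0 !mul0r.
rewrite -(weight_powR z); have -> : weight z `^ p = weight z `^ (p - 2) * weight z ^+ 2.
  by rewrite -powR_mulrn ?weight_ge0 // -powRD ?subrK // w0 implybT.
ring.
Qed.

Local Notation kernel_Lr := (kernel_Lr nu zeta p).
Local Notation admissible := (admissible nu zeta p r weight).
Local Notation wcoef := (wcoef zeta weight).
Local Notation form := (form nu zeta weight).

(** Integrability of [q |phi|^p] yields that of [|phi|^p] by [ker_control], and the converse holds
    as [q] is bounded. *)
Lemma E_zeroP phi : E_zero phi <-> kernel_Lr phi.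
Proof.
have [C hC] := ker_control Hbasis (ltW p1) mq pq q0 qK c0 h10 h20 h1pi h2pi h12 qc.
split.
  move=> [/(ker_LAP nu zeta)[hphi phi0] fin]; split => //.
  have [_ [mphi _]] : torus_invariant phi /\ Lr mu2 2 phi by exact/L2_torusP.
  have iq : intg mu2 (fun z => q z * `|phi z| `^ p).
    apply/intgP => //; first by apply: measurable_funM => //; exact: measurable_normpowR.
    by move=> z; rewrite mulr_ge0 ?powR_ge0.
  by have [] := hC phi hphi phi0 iq.
move=> [hphi phi0 hp]; split; first exact/(ker_LAP nu zeta).
have [mphi ip] := hp.
have iq : intg mu2 (fun z => q z * `|phi z| `^ p).
  apply: intg_le (intgZ K ip).
    by apply: measurable_funM => //; exact: measurable_normpowR.
  by move=> z; rewrite ger0_norm ?mulr_ge0 ?powR_ge0 // ler_wpM2r ?powR_ge0.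
by rewrite intg_EFin // ltry.
Qed.

Lemma weighted_Lr u : Lr mu2 p u -> Lr mu2 p (fun z => u z * weight z).
Proof. exact: Lr_mul_bounded (ltW p0) weight_measurable weight_bound. Qed.

Lemma kernel_weight_control : exists C, forall phi, kernel_Lr phi ->
  nr mu2 p phi <= C * nr mu2 p (fun z => phi z * weight z).
Proof.
have [C hC] := ker_control Hbasis (ltW p1) mq pq q0 qK c0 h10 h20 h1pi h2pi h12 qc.
exists (`|C| `^ p^-1) => phi [hphi phi0 hp].
have [_ iw] := weighted_Lr hp.
have iq : intg mu2 (fun z => q z * `|phi z| `^ p).
  have -> : (fun z => q z * `|phi z| `^ p) = (fun z => `|phi z * weight z| `^ p).
    by apply/funext => z; rewrite weighted_pow.
  exact: iw.
have [_ H] := hC phi hphi phi0 iq.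
have n0 := nr_ge0 mu2 p (fun z => phi z * weight z).
rewrite nr_le_int //; last by rewrite mulr_ge0 ?powR_ge0.
rewrite powRM ?powR_ge0 // -powRrM mulVf ?gt_eqF // powRr1 // -int_nr //.
apply: (le_trans H).
have -> : \int[mu2]_z `|phi z * weight z| `^ p = \int[mu2]_z (q z * `|phi z| `^ p).
  by apply: eq_Rintegral => z _; exact: weighted_pow.
apply: ler_wpM2r; last exact: ler_norm.
by apply: int_ge0 => z; rewrite mulr_ge0 ?powR_ge0.
Qed.

Lemma E_space_Lr u : E_space u -> Lr mu2 p u.
Proof.
move=> /(E_spaceP Hbasis)[g [phi [-> g2 gc [B hB] /E_zeroP[_ _ hp]]]].
have [hg _] := energy_pairing Hbasis p2 r1 pr g2 gc hB.
exact: LrD (ltW p0) hg hp.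
Qed.

Lemma kernel_E_space phi : kernel_Lr phi -> E_space phi.
Proof.
move=> hphi; apply/(E_spaceP Hbasis); exists (fun=> 0), phi.
have z0 i : coef (fun=> 0) i = 0.
  by rewrite /Defs.coef /inner; under eq_Rintegral => z _ do rewrite mul0r; rewrite int_0.
split => //.
- by apply/funext => z /=; rewrite add0r.
- by apply/L2_torusP; split => //; exact: Lr0.
- exists 0 => n; rewrite /energy_sum big1 // => i _.
  by rewrite z0 expr0n mulr0.
exact/E_zeroP.
Qed.

Lemma mode_E_space i : lam i != 0 -> E_space (mode i).
Proof.
move=> li; apply/(E_spaceP Hbasis); exists (mode i), (fun=> 0); split.
- by apply/funext => z /=; rewrite addr0.
- exact: mode_L2_torus Hbasis i.
- move=> j lj; rewrite /Defs.coef (mode_ortho Hbasis); case: eqP => // ij.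
  by rewrite ij lj eqxx in li.
- exact: mode_energy_bounded.
by apply/E_zeroP; exact: kernel_Lr0.
Qed.

Lemma kernel_coef phi n i : kernel_Lr phi -> i \in band n -> coef phi i = 0.
Proof. by move=> [_ h _]; rewrite (bandP Hbasis) normr_gt0 => /andP[/h]. Qed.

Definition dual_state (u : R * R -> R) (z : R * R) : R := jmap p (u z * weight z).

Lemma dual_state_Lr u : Lr mu2 p u -> Lr mu2 r (dual_state u).
Proof. by move=> hu; exact: Lr_jmap p1 r1 pr (weighted_Lr hu). Qed.

Lemma dual_state_pairing u v :
  \int[mu2]_z (q z * `|u z| `^ (p - 2) * u z * v z) = \int[mu2]_z (v z * (dual_state u z * weight z)).
Proof. by apply: eq_Rintegral => z _; rewrite jmap_weighted mulrC. Qed.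

Lemma dual_state_int u : \int[mu2]_z (q z * `|u z| `^ p) = \int[mu2]_z `|dual_state u z| `^ r.
Proof.
apply: eq_Rintegral => z _; rewrite -weighted_pow norm_jmap // -powRrM.
congr (_ `^ _); have := pr; have pn : p != 0 by rewrite gt_eqF.
have rn : r != 0 by rewrite gt_eqF.
move=> h; have : r + p = p * r.
  have -> : r + p = (p^-1 + r^-1) * (p * r) by field; rewrite pn rn.
  by rewrite h mul1r.
by move=> h'; rewrite mulrBl mul1r -h' addrAC subrr add0r.
Qed.

Lemma spectral_form_ge0 S u : 0 <= spectral_form nu zeta S u u.
Proof.
pose a i : R := `|lam i| * coef u i * coef u i.
rewrite /spectral_form -/a /usum.
have a0 i : 0 <= a i by rewrite /a -mulrA mulr_ge0 // -expr2 sqr_ge0.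
have -> : \esum_(i in S) (a^\- i)%:E = 0%E.
  by apply: esum1 => i _; rewrite /funrneg; congr EFin; apply/max_idPr; rewrite oppr_le0.
rewrite /= subr0; apply: fine_ge0; apply: esum_ge0 => i _.
by rewrite lee_fin funrpos_ge0.
Qed.

(** Testing the equation with [u] itself identifies the quadratic part of the energy with the
    integral. *)
Lemma weak_solution_energy u : weak_solution u ->
  energy u = (2^-1 - p^-1) * \int[mu2]_z (q z * `|u z| `^ p).
Proof.
move=> [Eu /(_ _ Eu) H].
have I : \int[mu2]_z (q z * `|u z| `^ (p - 2) * u z * u z) = \int[mu2]_z (q z * `|u z| `^ p).
  apply: eq_Rintegral => z _; rewrite -!mulrA; congr (_ * _).
  by have := jmapM (u z) p1; rewrite /jmap -mulrA.
exact: half_sqrt_sub (spectral_form_ge0 _ _) (spectral_form_ge0 _ _) (etrans H I).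
Qed.

(** Three kinds of test functions: kernel elements give admissibility, single modes give the
    coefficients, and [u] itself gives the value of the form. Every weak solution thus becomes a
    competitor in the dual maximum problem. *)
Lemma weak_solution_dual u : weak_solution u ->
  [/\ admissible (dual_state u), forall i, lam i != 0 -> wcoef (dual_state u) i = lam i * coef u i &
    form (dual_state u) (dual_state u) = \int[mu2]_z (q z * `|u z| `^ p)].
Proof.
move=> [Eu weak].
have hu := E_space_Lr Eu; have hW := dual_state_Lr hu.
have lim v l : E_space v -> (fun n => \sum_(i <- band n) lam i * (coef u i * coef v i)) @ \oo --> l ->
    \int[mu2]_z (q z * `|u z| `^ (p - 2) * u z * v z) = l.
  move=> Ev hl; rewrite -(weak v Ev).
  exact: (cvg_unique _ (form_cvg Hbasis Eu Ev) hl).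
have wc i : lam i != 0 -> wcoef (dual_state u) i = lam i * coef u i.
  move=> li; have := lim (mode i) (lam i * coef u i) (mode_E_space li).
  rewrite dual_state_pairing => H.
  have -> : wcoef (dual_state u) i = \int[mu2]_z (mode i z * (dual_state u z * weight z)).
    by rewrite /wcoef /Defs.coef innerC.
  apply: H; have [N hN] := band_exhaust Hbasis li.
  apply/cvgrPdist_le => e e0; exists N => // n /= Nn.
  have iN : i \in band n := fsubsetP (band_mono Hbasis Nn) _ hN.
  have -> : \sum_(j <- band n) lam j * (coef u j * coef (mode i) j) = lam i * coef u i.
    rewrite (bigD1_seq i) ?fset_uniq //= big1 ?addr0.
      by rewrite /Defs.coef (mode_ortho Hbasis) eqxx mulr1.
    by move=> j ji; rewrite /Defs.coef (mode_ortho Hbasis) eq_sym (negbTE ji) !mulr0.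
  by rewrite subrr normr0 ltW.
split => //.
  split => // phi hphi; rewrite -dual_state_pairing; apply: lim; first exact: kernel_E_space.
  have -> : (fun n => \sum_(i <- band n) lam i * (coef u i * coef phi i)) = fun=> 0.
    by apply/funext => n; rewrite big_seq big1 // => i /(kernel_coef hphi) ->; rewrite !mulr0.
  exact: cvg_cst.
have -> : \int[mu2]_z (q z * `|u z| `^ p) = \int[mu2]_z (q z * `|u z| `^ (p - 2) * u z * u z).
  apply: eq_Rintegral => z _; rewrite -!mulrA; congr (_ * _).
  by have := jmapM (u z) p1; rewrite /jmap -mulrA.
apply: esym; apply: lim => //.
have := form_sum_cvg Hbasis p2 r1 pr weight_measurable weight_bound hW hW.
have -> // : (fun n => form_sum nu zeta weight n (dual_state u) (dual_state u)) =
  (fun n => \sum_(i <- band n) lam i * (coef u i * coef u i)).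
apply/funext => n; rewrite /form_sum big_seq [RHS]big_seq; apply: eq_bigr => i.
rewrite (bandP Hbasis) normr_gt0 => /andP[li _]; rewrite wc //; field.
exact: li.
Qed.

(** The bump is divided by the weight, which is bounded below on its support, so that
    [w * weight = v]. As an image under the wave operator [v] has no kernel coefficients, and the
    form becomes the positive pairing of [v] with [psi]. *)
Lemma admissible_positive : exists2 w, admissible w & 0 < form w w.
Proof.
have [v [psi [pv mv [B hB] vbox [psi2 vc vpos]]]] := bump_exists Hbasis c1 c2 h10 h1pi h20 h2pi.
have B0 : 0 <= B := le_trans (normr_ge0 _) (hB (0, 0)).
pose w z := v z * q z `^ (- p^-1).
have pn : - p^-1 != 0 by rewrite oppr_eq0 invr_eq0 gt_eqF.
have wv z : w z * weight z = v z.
  have [v0|v0] := eqVneq (v z) 0; first by rewrite /w v0 !mul0r.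
  have qz : 0 < q z := lt_le_trans c0 (qc (vbox z v0)).
  by rewrite /w /weight -mulrA -powRD ?addNr ?powRr0 ?mulr1 // (gt_eqF qz) implybT.
have mw : measurable_fun [set: T2] w.
  by apply: measurable_funM => //; exact: (measurableT_comp (measurable_powR _) mq).
have hw : Lr mu2 r w.
  apply: (bounded_Lr (C := B * c `^ (- p^-1))) => //; [exact: torus_measure_fin|exact: ltW|].
  move=> z; have [v0|v0] := eqVneq (v z) 0; first by rewrite /w v0 mul0r normr0 mulr_ge0 ?powR_ge0.
  have qz : c <= q z := qc (vbox z v0).
  rewrite /w normrM; apply: ler_pM => //; rewrite ger0_norm ?powR_ge0 //.
  have qz0 : 0 < q z := lt_le_trans c0 qz.
  rewrite !powRN lef_pV2 ?posrE ?powR_gt0 //; apply: ge0_ler_powR; rewrite ?nnegrE ?invr_ge0 // ltW //.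
have v2 : L2_torus v.
  apply/L2_torusP; split => //; apply: (bounded_Lr (C := B)) => //; exact: torus_measure_fin.
have [_ v2'] : torus_invariant v /\ Lr mu2 2 v by exact/L2_torusP.
have wcE i : wcoef w i = coef v i.
  by apply: eq_Rintegral => z _; rewrite wv.
exists w.
  split => // phi [hphi phi0 hp].
  have -> : \int[mu2]_z (phi z * (w z * weight z)) = inner mu2 phi v.
    by apply: eq_Rintegral => z _; rewrite wv.
  have [_ phi2] : torus_invariant phi /\ Lr mu2 2 phi by exact/L2_torusP.
  apply: (inner_eq0_coef (mode_L2 Hbasis) (mode_ortho Hbasis) (S := setT)) => //.
    by apply: (mode_span Hbasis hphi) => i /(_ I).
  move=> i _; have [li|li] := eqVneq (lam i) 0; last by left; exact: phi0.
  by right; have := vc i; rewrite li mul0r.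
have cv := band_parseval v2 psi2 (fun i (li : lam i = 0) => etrans (vc i) (etrans (congr1 (fun x => x * _) li) (mul0r _))).
have cv2 := form_sum_cvg Hbasis p2 r1 pr weight_measurable weight_bound hw hw.
have e : (fun n => form_sum nu zeta weight n w w) = (fun n => \sum_(i <- band n) coef v i * coef psi i).
  apply/funext => n; rewrite /form_sum big_seq [RHS]big_seq; apply: eq_bigr => i.
  rewrite (bandP Hbasis) normr_gt0 => /andP[li _]; rewrite !wcE {2}vc; field.
  exact: li.
rewrite e in cv2.
by have -> : form w w = inner mu2 v psi by exact: (cvg_unique _ cv2 cv).
Qed.

Lemma pointwise_ground_state : exists u, ground_state nu zeta p q u.
Proof.
have mk := weight_measurable; have kK := weight_bound.
have XL := @admissible_Lr R nu zeta p r weight.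
have XZ := admissibleZ p2 r1 pr mk kK (nu := nu) (zeta := zeta).
have XD := admissibleD p2 r1 pr mk kK (nu := nu) (zeta := zeta).
have Xc := admissible_closed p2 r1 pr mk kK (nu := nu) (zeta := zeta).
have [M M0 [QM Msup]] := form_sup Hbasis p2 r1 pr mk kK XL XZ admissible_positive.
have [w [Xw nw Qw]] := maximizer_exists Hbasis p2 r1 pr mk kK XL XZ XD Xc M0 QM Msup.
have EL := euler_lagrange Hbasis p2 r1 pr mk kK XL XZ XD M0 QM Xw nw Qw.
have r2 := conjugate_lt2 p2 r0 pr.
(* With [sg^(r - 2) = M] the factor [M] in the Euler-Lagrange equation is absorbed:
   [sg * M = sg^(r - 1)]. *)
pose sg : R := M `^ (r - 2)^-1.
have sg0 : 0 < sg by rewrite powR_gt0.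
have rn : r - 2 != 0 by rewrite subr_eq0 lt_eqF.
have sgM : sg `^ (r - 2) = M by rewrite /sg -powRrM mulVf // powRr1 // ltW.
have hw := XL _ Xw.
pose w1 z := sg * w z.
have Xw1 : admissible w1 by exact: XZ.
have hw1 := XL _ Xw1.
have EL1 h : admissible h -> form w1 h = \int[mu2]_z (jmap r (w1 z) * h z).
  move=> Xh; have hh := XL _ Xh.
  have hj : Lr mu2 p (fun z => jmap r (w z)) := Lr_jmap r1 p1 rp hw.
  rewrite (formZl Hbasis p2 r1 pr mk kK _ hw hh) EL //.
  have -> : \int[mu2]_z (jmap r (w1 z) * h z) = \int[mu2]_z (sg `^ (r - 1) * (jmap r (w z) * h z)).
    by apply: eq_Rintegral => z _; rewrite /w1 jmapZ // mulrA.
  rewrite int_Z; last exact: Lr_mul p1 r1 pr hj hh.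
  rewrite mulrA; congr (_ * _); rewrite -sgM -{1}(powRr1 (ltW sg0)) -powRD; last by rewrite (gt_eqF sg0) implybT.
  by congr (_ `^ _); ring.
have [g [g2 gp gc gb gl]] := green_exists Hbasis p2 r1 pr mk kK hw1.
have gform h : admissible h -> \int[mu2]_z (g z * (h z * weight z)) = form w1 h.
  move=> Xh; have hh := XL _ Xh.
  exact: (cvg_unique _ (gl _ hh) (form_sum_cvg Hbasis p2 r1 pr mk kK hw1 hh)).
have hj1 : Lr mu2 p (fun z => jmap r (w1 z)) := Lr_jmap r1 p1 rp hw1.
(* The residual of the dual equation annihilates all admissible functions, hence is [weight] times a
   kernel element [phi]; adding [phi] to [g] corrects the solution. *)
pose y z := jmap r (w1 z) - g z * weight z.
have hy : Lr mu2 p y := LrB (ltW p0) hj1 (weighted_Lr gp).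
have yX h : admissible h -> \int[mu2]_z (y z * h z) = 0.
  move=> Xh; have hh := XL _ Xh.
  have i1 := Lr_mul p1 r1 pr hj1 hh; have i2 := pair_intg p2 r1 pr mk kK gp hh.
  have -> : \int[mu2]_z (y z * h z) = \int[mu2]_z (jmap r (w1 z) * h z) - \int[mu2]_z (g z * (h z * weight z)).
    by rewrite -int_B //; apply: eq_Rintegral => z _; rewrite /y; ring.
  by rewrite gform // EL1 // subrr.
have [C hC] := kernel_weight_control.
have [phi hphi yphi] := kernel_bipolar Hbasis p2 r1 pr mk kK hC hy yX.
pose u := g \+ phi.
have g0 i : lam i = 0 -> coef g i = 0 by move=> li; rewrite gc li eqxx.
have Eu : E_space u.
  by apply/(E_spaceP Hbasis); exists g, phi; split => //; exact/E_zeroP.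
have up := E_space_Lr Eu.
have [phi2 phi0 phip] := hphi.
(* By construction [u * weight] equals [jmap r w1] almost everywhere, and the two duality maps are
   inverse to each other. *)
have dual : {ae mu2, forall z, dual_state u z = w1 z}.
  apply: (ae_imp (mu := mu2) yphi) => z /eqP; rewrite /y subr_eq => /eqP e.
  have e' : jmap r (w1 z) = u z * weight z by rewrite e /u /= mulrDl addrC.
  by rewrite -[RHS](jmapK _ p1 r1 pr) e'.
have mw1 := hw1.1; have hd := dual_state_Lr up.
have pairE v : Lr mu2 p v -> \int[mu2]_z (q z * `|u z| `^ (p - 2) * u z * v z) = \int[mu2]_z (v z * (w1 z * weight z)).
  move=> hv; rewrite dual_state_pairing; apply: int_ae_eq.
  - by apply: measurable_funM; [exact: hv.1|apply: measurable_funM => //; exact: hd.1].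
  - by apply: measurable_funM; [exact: hv.1|exact: measurable_funM].
  by apply: (ae_imp (mu := mu2) dual) => z ->.
have uc n i : i \in band n -> lam i * coef u i = wcoef w1 i.
  move=> ib; have := kernel_coef hphi ib; move: ib; rewrite (bandP Hbasis) normr_gt0 => /andP[li _] k0.
  have -> : coef u i = coef g i + coef phi i := coefD Hbasis i g2 phi2.
  by rewrite k0 addr0 gc (negbTE li) mulrC divfK.
have weak_u : weak_solution u.
  split => // v Ev; have hv := E_space_Lr Ev.
  have [g' [phi' [ev g2' gc' [B hB] /E_zeroP hphi']]] := (E_spaceP Hbasis p q v).1 Ev.
  apply: (cvg_unique _ (form_cvg Hbasis Eu Ev)) => //; rewrite pairE //.
  have [gp' gl'] := energy_pairing Hbasis p2 r1 pr g2' gc' hB.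
  have [phi2' _ phip'] := hphi'.
  have -> : \int[mu2]_z (v z * (w1 z * weight z)) = \int[mu2]_z (g' z * (w1 z * weight z)).
    rewrite -[RHS]addr0 -(Xw1.2 _ hphi') -int_D.
    - by apply: eq_Rintegral => z _; rewrite ev /= mulrDl.
    - exact: (pair_intg p2 r1 pr mk kK gp' hw1).
    - exact: (pair_intg p2 r1 pr mk kK phip' hw1).
  have := gl' _ (weight_Lr r1 mk kK hw1).
  have -> // : (fun n => \sum_(i <- band n) coef g' i * coef (fun z => w1 z * weight z) i) =
     (fun n => \sum_(i <- band n) lam i * (coef u i * coef v i)).
  apply/funext => n; rewrite big_seq [RHS]big_seq; apply: eq_bigr => i ib.
  have -> : coef v i = coef g' i + coef phi' i by rewrite ev; exact: (coefD Hbasis i g2' phi2').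
  by rewrite (kernel_coef hphi' ib) addr0 mulrA (uc n) // mulrC.
have nw1 : nr mu2 r w1 = sg by rewrite (nrZ _ r0 hw) nw mulr1 ger0_norm // ltW.
have Iu : \int[mu2]_z (q z * `|u z| `^ p) = sg `^ r.
  rewrite dual_state_int -nw1 -(int_nr _ _ r0); apply: int_ae_eq.
  - exact: measurable_normpowR hd.1.
  - exact: measurable_normpowR mw1.
  by apply: (ae_imp (mu := mu2) dual) => z ->.
exists u; split.
  split => // ae0.
  have : sg = 0; last by move=> e; rewrite e ltxx in sg0.
  rewrite -nw1; apply: nr_ae0 => //.
  by apply: (ae_imp2 (mu := mu2) dual ae0) => z <- uz; rewrite /dual_state uz mul0r jmap0.
move=> U [wU nU].
rewrite (weak_solution_energy weak_u) (weak_solution_energy wU) Iu.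
apply: ler_wpM2l; first by rewrite subr_ge0 lef_pV2 ?posrE // ltW.
have [aU cU fU] := weak_solution_dual wU.
have EU := wU.1; have hU := E_space_Lr EU.
have HQ := QM _ aU; rewrite fU in HQ.
rewrite dual_state_int int_nr // in HQ *.
set s := nr mu2 r (dual_state U) in HQ *.
have s0 : 0 <= s := nr_ge0 _ _ _.
(* If the dual state of [U] vanished, so would all coefficients of [U] off the kernel, and the
   kernel control would force [U = 0] almost everywhere. *)
have sn : s != 0.
  apply/eqP => s00; apply: nU.
  have W0 := nr_eq0 r0 (dual_state_Lr hU) s00.
  have [U2 _] := E_space_energy Hbasis EU.
  have wc0 i : wcoef (dual_state U) i = 0.
    rewrite /wcoef /Defs.coef /inner -[RHS](int_0 mu2); apply: int_ae_eq.
    - exact: intg_measurable (wcoef_intg Hbasis p2 r1 pr mk kK i (dual_state_Lr hU)).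
    - exact: measurable_cst.
    by apply: (ae_imp (mu := mu2) W0) => z ->; rewrite !mul0r.
  have kU : kernel_Lr U.
    split => // i li; have := cU i li; rewrite wc0 => /eqP; rewrite eq_sym mulf_eq0 (negbTE li) /=.
    by move/eqP.
  have := hC U kU.
  have -> : nr mu2 p (fun z => U z * weight z) = 0.
    apply: (nr_ae0 p0 (weighted_Lr hU).1).
    apply: (ae_imp (mu := mu2) W0) => z e.
    by rewrite -(jmapK (U z * weight z) r1 p1 rp) -/(dual_state U z) e jmap0.
  rewrite mulr0 => le0; apply: (nr_eq0 p0 hU); apply/eqP; rewrite eq_le le0; exact: nr_ge0.
have sp : 0 < s by rewrite lt_def sn.
(* [s^r <= M * s^2] reads [s^(r - 2) <= sg^(r - 2)]; as [r < 2] this means [sg <= s]. *)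
have : s `^ (r - 2) <= sg `^ (r - 2).
  rewrite sgM; have -> : s `^ (r - 2) = s `^ r / s ^+ 2.
    by rewrite -powR_mulrn // -powRN -powRD // sn implybT.
  by rewrite ler_pdivrMr // exprn_gt0.
have e21 : r - 2 = - (2 - r) by rewrite opprB.
rewrite e21 !powRN lef_pV2 ?posrE ?powR_gt0 // => H.
apply: (ge0_ler_powR (ltW r0)); rewrite ?nnegrE ?(ltW sg0) //.
rewrite leNgt; apply/negP => ssg.
have r20 : 0 < 2 - r by rewrite subr_gt0.
have := @gt0_ltr_powR _ _ r20 s sg; rewrite !nnegrE s0 (ltW sg0) => /(_ erefl erefl ssg).
by rewrite ltNge H.
Qed.

End GroundState.

(** * Changing the potential on a null set *)

Section PotentialTransfer.
Context {R : realType}.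
Variables (nu : nat -> R) (zeta : nat -> R -> R).
Hypothesis Hbasis : laplace_eigenbasis nu zeta.
Local Notation mu2 := (@torus_measure R).
Local Notation T1 := (measurableTypeR R).
Local Notation T2 := (T1 * T1)%type.
Variables (p : R) (q q' : R * R -> R).
Hypothesis mq : measurable_fun [set: T2] q.
Hypothesis mq' : measurable_fun [set: T2] q'.
Hypothesis qq' : {ae mu2, forall z, q z = q' z}.

Lemma L2_torus_measurable (u : R * R -> R) : L2_torus u -> measurable_fun [set: T2] u.
Proof. by move=> /L2_torusP[_ []]. Qed.

Lemma E_zero_ae : E_zero nu zeta p q = E_zero nu zeta p q'.
Proof.
apply/funext => u; apply/propext.
suff H : ker_LA nu zeta u ->
    (\int[mu2]_z (q z * `|u z| `^ p)%:E = \int[mu2]_z (q' z * `|u z| `^ p)%:E)%E.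
  by split=> -[ku fu]; split => //; [rewrite -H|rewrite H].
move=> [/L2_torus_measurable mu _ _].
have mp : measurable_fun [set: T2] (fun z => `|u z| `^ p) := measurable_normpowR p mu.
apply: ae_eq_integral => //.
- by apply/measurable_EFinP; apply: measurable_funM.
- by apply/measurable_EFinP; apply: measurable_funM.
by apply: (ae_imp (mu := mu2) qq') => z -> _.
Qed.

Lemma E_space_ae : E_space nu zeta p q = E_space nu zeta p q'.
Proof. by rewrite /E_space E_zero_ae. Qed.

Lemma E_space_measurable u : E_space nu zeta p q u -> measurable_fun [set: T2] u.
Proof. by move=> /(E_space_energy Hbasis)[/L2_torus_measurable]. Qed.

Lemma weak_solution_ae u : weak_solution nu zeta p q u <-> weak_solution nu zeta p q' u.
Proof.
rewrite /weak_solution -E_space_ae.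
suff H v : E_space nu zeta p q u -> E_space nu zeta p q v ->
    \int[mu2]_z (q z * `|u z| `^ (p - 2) * u z * v z) = \int[mu2]_z (q' z * `|u z| `^ (p - 2) * u z * v z).
  by split => -[Eu h]; split => // v Ev; rewrite h // H.
move=> /E_space_measurable mu /E_space_measurable mv.
have mp : measurable_fun [set: T2] (fun z => `|u z| `^ (p - 2)) := measurable_normpowR (p - 2) mu.
apply: int_ae_eq.
- by do 3 (apply: measurable_funM => //).
- by do 3 (apply: measurable_funM => //).
by apply: (ae_imp (mu := mu2) qq') => z ->.
Qed.

Lemma energy_ae u : E_space nu zeta p q u -> energy nu zeta p q u = energy nu zeta p q' u.
Proof.
move=> /E_space_measurable mu; rewrite /energy; congr (_ - _ * _).
have mp : measurable_fun [set: T2] (fun z => `|u z| `^ p) := measurable_normpowR p mu.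
apply: int_ae_eq; [exact: measurable_funM|exact: measurable_funM|].
by apply: (ae_imp (mu := mu2) qq') => z ->.
Qed.

Lemma ground_state_ae u : ground_state nu zeta p q u -> ground_state nu zeta p q' u.
Proof.
move=> [[wu nu0] min]; split; first by split => //; exact/weak_solution_ae.
move=> w [/weak_solution_ae ww nw]; rewrite -(energy_ae wu.1) -(energy_ae ww.1).
by apply: min; split.
Qed.

End PotentialTransfer.

(** * From the stated hypotheses to bounds at every point *)

Section Hypotheses.
Context {R : realType}.
Local Notation mu2 := (@torus_measure R).
Local Notation T1 := (measurableTypeR R).
Local Notation T2 := (T1 * T1)%type.

Lemma ess_inf_on_gt0 (Omega : set (R * R)) (q : R * R -> R) : (0 < ess_inf_on Omega q)%E ->
  exists2 c, 0 < c & {ae mu2, forall z, Omega z -> c <= q z}.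
Proof.
move=> H; have [c c0 cH] : exists2 c : R, 0 < c & (c%:E <= ess_inf_on Omega q)%E.
  case: (ess_inf_on Omega q) H => [c||] // c0; first by exists c.
  (* The essential infimum may be infinite, for instance when [Omega] is null; any positive constant
     then does. *)
  by exists 1 => //; exact: leey.
exists c => //; have /ess_infP := cH.
move=> h; apply: (ae_imp (mu := mu2) h) => z /[swap] Oz.
by rewrite /patch mem_set //= lee_fin.
Qed.

Lemma Linfty_bound (q : R * R -> R) : q \in Lfun mu2 +oo%E ->
  measurable_fun [set: T2] q /\ exists K, {ae mu2, forall z, q z <= K}.
Proof.
move=> h; split; first by have := sub_Lfun_mfun h; rewrite inE.
have := sub_Lfun_finLfun h; rewrite inE /= /finite_norm unlock /Lnorm.
have -> : (0 < mu2 setT)%E.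
  by rewrite [X in (_ < X)%E]torus_measure_setT lte_fin; have p0 := pi_gt0 R; rewrite !mulr_gt0.
move=> /ess_supr_bounded[K hK]; exists K; apply: (ae_imp (mu := mu2) hK) => z /=.
exact: le_trans (ler_norm _).
Qed.

Lemma torus_invariant_int (V : Type) (f : R * R -> V) (k l : int) (z : R * R) : torus_invariant f ->
  f (z.1 + k%:~R * (2 * pi), z.2 + l%:~R * (2 * pi)) = f z.
Proof.
move=> hf.
have H1 t : circle_invariant (fun x => f (x, t)) by move=> x; exact: (hf x t).1.
have H2 x : circle_invariant (fun t => f (x, t)) by move=> t; exact: (hf x t).2.
by case: z => x t /=; rewrite (circle_invariant_int k _ (H1 _)) (circle_invariant_int l _ (H2 _)).
Qed.

(** Half-sides are cut at [pi], because longer sides wrap around the circle. Their sum stays above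
    [pi]: a side that is cut contributes [pi] alone, and the other is positive. *)
Lemma cosbox_sub (Omega : set (R * R)) (a1 b1 a2 b2 : R) :
  torus_invariant Omega -> a1 < b1 -> a2 < b2 -> `[a1, b1] `*` `[a2, b2] `<=` Omega ->
  2 * pi < b1 + b2 - a1 - a2 ->
  exists c1 c2 h1 h2 : R, [/\ 0 < h1 <= pi, 0 < h2 <= pi, pi < h1 + h2 &
    forall z, cosbox c1 c2 h1 h2 z -> Omega z].
Proof.
move=> invO ab1 ab2 sub big; have p0 := pi_gt0 R.
have half (a b : R) : a < b -> exists2 h, 0 < h <= pi & h <= (b - a) / 2 /\ (h = pi \/ h = (b - a) / 2).
  move=> ab; have [le|lt] := leP ((b - a) / 2) pi.
    by exists ((b - a) / 2); [apply/andP; split; lra|split; [|right]].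
  by exists pi; [apply/andP; split; lra|split; [lra|left]].
have [h1 /andP[h10 h1p] [h1l h1e]] := half _ _ ab1.
have [h2 /andP[h20 h2p] [h2l h2e]] := half _ _ ab2.
exists ((a1 + b1) / 2), ((a2 + b2) / 2), h1, h2; split; [exact/andP|exact/andP| |].
  by case: h1e; case: h2e => ? ?; lra.
move=> z /andP[/(cos_ballP (ltW h10) h1p)[k hk] /(cos_ballP (ltW h20) h2p)[l hl]].
rewrite -(torus_invariant_int k l z invO); apply: sub; split => /=; rewrite in_itv /=.
  by move: hk; rewrite ler_norml => /andP[? ?]; apply/andP; split; lra.
by move: hl; rewrite ler_norml => /andP[? ?]; apply/andP; split; lra.
Qed.

Lemma rectangle_ground_state (nu : nat -> R) (zeta : nat -> R -> R) (p : R) (q : R * R -> R)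
    (Omega : set (R * R)) (a1 b1 a2 b2 : R) :
  laplace_eigenbasis nu zeta -> 2 < p -> torus_invariant q -> q \in Lfun mu2 +oo%E ->
  {ae mu2, forall z, 0 <= q z} -> torus_invariant Omega -> a1 < b1 -> a2 < b2 ->
  `[a1, b1] `*` `[a2, b2] `<=` Omega -> 2 * pi < b1 + b2 - a1 - a2 ->
  (0 < ess_inf_on Omega q)%E -> exists u, ground_state nu zeta p q u.
Proof.
move=> Hbasis p2 pq qoo q0 invO ab1 ab2 sub big /ess_inf_on_gt0[c c0 hc].
have [c1 [c2 [h1 [h2 [/andP[h10 h1p] /andP[h20 h2p] h12 boxO]]]]] := cosbox_sub invO ab1 ab2 sub big.
have [mq [K0 hK0]] := Linfty_bound qoo.
pose K := Num.max K0 c.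
pose ind := cosbox_ind c1 c2 h1 h2.
(* Truncation turns almost everywhere bounds into bounds at every point: [c * ind] forces
   nonnegativity and the lower bound [c] on the box, and [K >= c] keeps this compatible with the
   upper bound. *)
pose q' z := Num.min K (Num.max (q z) (c * ind z)).
have ind0 z : 0 <= ind z := cosbox_ind_ge0 c1 c2 h1 h2 z.
have cK : c <= K by rewrite /K le_max lexx orbT.
have mind : measurable_fun [set: T2] ind := cosbox_ind_measurable c1 c2 h1 h2.
have mq' : measurable_fun [set: T2] q'.
  apply: measurable_minr; first exact: measurable_cst.
  by apply: measurable_maxr => //; exact: measurable_funM.
have pq' : torus_invariant q'.
  move=> x t; have [e1 e2] := cosbox_ind_invariant c1 c2 h1 h2 x t.
  by rewrite /q' /ind e1 e2 (pq x t).1 (pq x t).2.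
have q'0 z : 0 <= q' z.
  by rewrite /q' le_min (le_trans (ltW c0) cK) le_max (mulr_ge0 (ltW c0) (ind0 z)) orbT.
have q'K z : q' z <= K by rewrite /q' ge_min lexx.
have q'c z : cosbox c1 c2 h1 h2 z -> c <= q' z.
  by move=> bz; rewrite /q' le_min cK le_max /ind /cosbox_ind bz mulr1 lexx orbT.
have qq : {ae mu2, forall z, q' z = q z}.
  have hq : {ae mu2, forall z, 0 <= q z <= K0}.
    by apply: (ae_imp2 (mu := mu2) q0 hK0) => z -> ->.
  apply: (ae_imp2 (mu := mu2) hq hc) => z /andP[qz qK] cz; rewrite /q'.
  have -> : Num.max (q z) (c * ind z) = q z.
    apply/max_idPl; rewrite /ind /cosbox_ind; case: (boolP (cosbox c1 c2 h1 h2 z)) => [bz|_] /=; last by rewrite mulr0.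
    by rewrite mulr1; apply: cz; exact: boxO.
  by apply/min_idPr; rewrite /K le_max qK.
pose r : R := p / (p - 1).
have p1 : 0 < p - 1 by lra.
have r1 : 1 < r by rewrite /r ltr_pdivlMr // mul1r; lra.
have pr : p^-1 + r^-1 = 1.
  by rewrite /r; field; apply/andP; split; rewrite gt_eqF //; lra.
have [u gu] := pointwise_ground_state Hbasis p2 r1 pr mq' pq' q'0 q'K c0 h10 h20 h1p h2p h12 q'c.
by exists u; exact: (ground_state_ae Hbasis mq' mq qq gu).
Qed.

Lemma open_itv_sub (omega : set R) : open omega -> omega !=set0 ->
  exists a b : R, a < b /\ `[a, b] `<=` omega.
Proof.
move=> oo [x ox]; have := open_nbhs_nbhs (conj oo ox).
move=> /nbhs_ballP[e /= e0 sub]; exists (x - e / 2), (x + e / 2); split; first by lra.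
move=> y /=; rewrite in_itv /= => /andP[y1 y2]; apply: sub.
by rewrite /ball /= ltr_norml; apply/andP; split; lra.
Qed.

End Hypotheses.

Theorem theorem1p3 (R : realType) (nu : nat -> R) (zeta : nat -> R -> R)
    (Hbasis : laplace_eigenbasis nu zeta)
    (p : R) (Hp : 2 < p)
    (q : R * R -> R) (q_torus : torus_invariant q)
    (q_Linfty : q \in Lfun (@torus_measure R) +oo%E)
    (q_ge0 : {ae @torus_measure R, forall z, 0 <= q z}) :
  (forall (Omega : set (R * R)) (a1 b1 a2 b2 : R),
     torus_invariant Omega ->
     a1 < b1 -> a2 < b2 ->
     `[a1, b1] `*` `[a2, b2] `<=` Omega ->
     2 * pi < b1 + b2 - a1 - a2 ->
     (0 < ess_inf_on Omega q)%E ->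
     exists u : R * R -> R, ground_state nu zeta p q u)
  /\
  (forall omega : set R,
     circle_invariant omega -> open omega -> omega !=set0 ->
     (0 < ess_inf_on (omega `*` setT) q)%E \/
     (0 < ess_inf_on (setT `*` omega) q)%E ->
     exists u : R * R -> R, ground_state nu zeta p q u).
Proof.
have p0 := pi_gt0 R.
split=> [D a1 b1 a2 b2|omega invo oo o0].
  exact: rectangle_ground_state.
(* One side is a short interval inside [omega], the other a full period, so the side lengths add up
   to more than [2 * pi]. *)
have [a [b [ab sub]]] := open_itv_sub oo o0.
have tp0 : 0 < 2 * pi :> R by lra.
case; [apply: (rectangle_ground_state (a1 := a) (b1 := b) (a2 := 0) (b2 := 2 * pi))
      |apply: (rectangle_ground_state (a1 := 0) (b1 := 2 * pi) (a2 := a) (b2 := b))] => //.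
- by move=> x t; split; rewrite /setX /= ?invo.
- by move=> z [/sub].
- by lra.
- by move=> x t; split; rewrite /setX /= ?invo.
- by move=> z [_ /sub].
by lra.
Qed.
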